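(* Let $1<p<2$ and let $\Omega\subseteq\mathbb{R}^2$ be open, simply connected and bounded with Lipschitz boundary. Then there exists a constant $C>0$ such that for every $\beta\in L^p(\Omega;\mathbb{R}^{2\times2})$ with $\operatorname{curl}\beta\in\mathcal{M}(\Omega;\mathbb{R}^2)$ there exists a rotation $R\in SO(2)$ with $$\int_\Omega|\beta-R|^2\wedge|\beta-R|^p\,dx\le C\left(\int_\Omega\operatorname{dist}(\beta,SO(2))^2\wedge\operatorname{dist}(\beta,SO(2))^p\,dx+|\operatorname{curl}\beta|(\Omega)^2\right).$$
   Context: $a\wedge b=\min\{a,b\}$; $|F|$ is the Euclidean (Frobenius) norm; $\operatorname{curl}\beta$ is the $\mathbb{R}^2$-valued distribution with $i$-th component $\partial_1\beta_{i2}-\partial_2\beta_{i1}$, assumed to be a bounded $\mathbb{R}^2$-valued Radon measure with total variation $|\operatorname{curl}\beta|(\Omega)$. *)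

(* Defs.v *)
From HB Require Import structures.
From mathcomp Require Import all_boot all_order all_algebra.
From mathcomp Require Import all_classical all_reals all_analysis.
Set Implicit Arguments. Unset Strict Implicit. Unset Printing Implicit Defensive.
Import Order.TTheory GRing.Theory Num.Theory numFieldNormedType.Exports.
Local Open Scope classical_set_scope.
Local Open Scope ring_scope.

(* Points of R^2 are pairs (x.1, x.2) : R * R (product topology = Euclidean
   topology).  Lebesgue measure on R^2 is the product of Lebesgue measures. *)

Section Defs.
Context {R : realType}.

Definition leb2 := ((@lebesgue_measure R) \x (@lebesgue_measure R))%E.

Definition enorm2 (x : R * R) : R := Num.sqrt (x.1 ^+ 2 + x.2 ^+ 2).

Definition fnorm (A : 'M[R]_2) : R := Num.sqrt (\sum_i \sum_j A i j ^+ 2).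

Definition SO2 : set 'M[R]_2 := [set Q | Q^T *m Q = 1%:M /\ \det Q = 1].

Definition distSO2 (A : 'M[R]_2) : R := inf [set fnorm (A - Q) | Q in SO2].

Definition mixed (a p : R) : R := Order.min (a ^+ 2) (a `^ p).

Definition unit_interval : set R := [set t | 0 <= t <= 1].

Definition bounded2 (O : set (R * R)) : Prop :=
  exists M : R, forall x, O x -> enorm2 x <= M.

Definition path_connected2 (O : set (R * R)) : Prop :=
  forall x y, O x -> O y -> exists g : R -> R * R,
    {within unit_interval, continuous g} /\ g 0 = x /\ g 1 = y /\
    g @` unit_interval `<=` O.

Definition simply_connected2 (O : set (R * R)) : Prop :=
  path_connected2 O /\
  forall g : R -> R * R, {within unit_interval, continuous g} -> g 0 = g 1 ->
    g @` unit_interval `<=` O ->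
    exists H : R * R -> R * R,
      {within unit_interval `*` unit_interval, continuous H} /\
      H @` (unit_interval `*` unit_interval) `<=` O /\
      (forall t, unit_interval t -> H (0, t) = g t /\ H (1, t) = g 0) /\
      (forall s, unit_interval s -> H (s, 0) = g 0 /\ H (s, 1) = g 0).

(* Lipschitz boundary: near every boundary point, in suitable rotated
   coordinates centred at the point, O is the strict epigraph of a Lipschitz
   function. *)
Definition lipschitz_boundary (O : set (R * R)) : Prop :=
  forall x0, (closure O `\` O) x0 ->
  exists r : R, 0 < r /\ exists a b : R, a ^+ 2 + b ^+ 2 = 1 /\
  exists g : R -> R, (exists L : R, forall s t, `|g s - g t| <= L * `|s - t|) /\
  forall x : R * R, enorm2 (x.1 - x0.1, x.2 - x0.2) < r ->
    (O x <-> g (a * (x.1 - x0.1) - b * (x.2 - x0.2))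
             < b * (x.1 - x0.1) + a * (x.2 - x0.2)).

Definition iterD (vs : seq (R * R)) (f : R * R -> R) : R * R -> R :=
  foldr (fun v g => fun x => derive g x v) f vs.

Definition smooth2 (f : R * R -> R) : Prop :=
  forall vs x, differentiable (iterD vs f) x.

Definition test_fun (O : set (R * R)) (f : R * R -> R) : Prop :=
  smooth2 f /\ exists K, compact K /\ K `<=` O /\ (forall x, ~ K x -> f x = 0).

Definition d1 (f : R * R -> R) x := derive f x (1, 0).
Definition d2 (f : R * R -> R) x := derive f x (0, 1).

Definition i1 : 'I_2 := ord0.
Definition i2 : 'I_2 := ord_max.

(* <curl beta, (phi1, phi2)>, where (curl beta)_i = d1 beta_i2 - d2 beta_i1 *)
Definition curl_pair (O : set (R * R)) (beta : R * R -> 'M[R]_2)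
  (phi1 phi2 : R * R -> R) : \bar R :=
  (\int[leb2]_(x in O)
     (beta x i1 i1 * d2 phi1 x - beta x i1 i2 * d1 phi1 x
      + beta x i2 i1 * d2 phi2 x - beta x i2 i2 * d1 phi2 x)%:E)%E.

Definition curlTV (O : set (R * R)) (beta : R * R -> 'M[R]_2) : \bar R :=
  ereal_sup [set r | exists phi1 phi2, test_fun O phi1 /\ test_fun O phi2 /\
     (forall x, phi1 x ^+ 2 + phi2 x ^+ 2 <= 1) /\ r = curl_pair O beta phi1 phi2].

Definition Lp2 (O : set (R * R)) (p : R) (beta : R * R -> 'M[R]_2) : Prop :=
  (forall i j, measurable_fun O (fun x => beta x i j)) /\
  (\int[leb2]_(x in O) ((fnorm (beta x)) `^ p)%:E < +oo)%E.

End Defs.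

(* Main.v *)
(* Writing [beta z = a z + b * conj z] with complex-valued [a], [b], the distance to SO(2) controls
   [| |a| - 1 |] and [|b|], a rotation is a unit constant [c], and the curl becomes
   [L(phi) = \int a Dbar phi - b D phi], bounded by [T * sup |phi|].  Only the growth
   [m1 t = min(t, t^2)] is needed: it suffices to bound [\int min(1, |a - c|)^2] by
   [D = \int m1(|b|) + m1(| |a| - 1 |) + T^2].

   Interior estimate, with [d^2 = D] on a large ball: with mollified Cauchy kernels and a cutoff [chi],
   [c0 a] is close to [F - S * (chi b) + M], where [F] is holomorphic, [S] is a truncated Beurling
   kernel, for which a weak type estimate on [min(1, |.|)^2] follows from an L2 bound and a dyadic
   decomposition, and [M x = L(chi * C(x - .))] is controlled by duality.  Since [|a|] is
   close to 1, [|F|] is nearly constant, so by the mean value property [F] is within [O(d)] of a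
   constant of modulus [c0].  The second order information [|a| = 1] gives
   [2 Re (conj c (a - c)) = -|a - c|^2 + error], and [\int chi^2 M^2] is small because [C] is itself a
   Dbar-derivative; together these bound [|M|^2] by [O(d^2)], the cubic error being absorbed.

   Global estimate: estimates on finitely many balls of bounded overlap add up, since nearly optimal
   test functions can be added.  Overlapping sets with an estimate can be glued, so by
   connectedness and compactness every compact subset of the domain is covered.  Near the boundary the
   layers at height [2^-k] are compared with higher ones by vertical translations, and the resulting
   geometric recursion on the masses of the layers is summed. *)
Require Import Defs.
From HB Require Import structures.
From mathcomp Require Import all_boot all_order all_algebra.
From mathcomp Require Import complex.
From mathcomp Require Import all_classical all_reals all_analysis.
From mathcomp Require Import measurable_realfun ring lra zify.
Set Implicit Arguments. Unset Strict Implicit. Unset Printing Implicit Defensive.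
Import Order.TTheory GRing.Theory Num.Theory numFieldNormedType.Exports.
Local Open Scope classical_set_scope.
Local Open Scope ring_scope.
Local Open Scope complex_scope.

Local Notation mfun := (measurable_fun setT).
Notation Re := complex.Re.
Notation Im := complex.Im.

(** The curl is only a measure, so the field it generates behaves like [1 / |x|], which just misses
    square integrability in the plane: a purely linear estimate loses a logarithm. This is why the
    second order information in [|a| = 1] is brought in. With [w = conj c M] it bounds [(Re w)^2] by
    small terms and a cubic one, duality bounds the integral of [w^2] without modulus, and
    [|w|^2 = 2 (Re w)^2 - Re (w^2)] combines the two. Likewise [m1] grows only linearly, so the
    Beurling transform of [b] is accessible through weak type bounds only, and deviations are
    measured by [min(1, .)]. No singular integral is ever formed: all kernels are mollified at a
    scale [e], hence bounded and C^{1,1}, with estimates uniform in [e]. The relations among them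
    are exact identities between radial profiles. The exponent [p] matters only in the passage
    between matrices and complex numbers. All terms scale like an area, so a defect exceeding the
    area makes an estimate trivial; this allows [d <= 1]. *)

HB.instance Definition _ (R : realType) := Measure.on (@leb2 R).

Lemma leb2_sigma_finite (R : realType) : sigma_finite setT (@leb2 R).
Proof.
have /sigma_finiteP[F [TF ndF Foo]] := sigma_finiteT (@lebesgue_measure R).
exists (fun n => F n `*` F n).
 rewrite -setXTT TF predeqE => -[x y]; split.
  move=> [/= [n _ Fnx] [k _ Gky]]; exists (maxn n k) => //; split.
  - by move: x Fnx; exact/subsetPset/ndF/leq_maxl.
  - by move: y Gky; exact/subsetPset/ndF/leq_maxr.
 by move=> [n _ []/= ? ?]; split; exists n.
move=> k; have [? ?] := Foo k.
split; first exact: measurableX.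
by rewrite /leb2 product_measure1E// lte_mul_pinfty// ge0_fin_numE.
Qed.

HB.instance Definition _ (R : realType) :=
 Measure_isSigmaFinite.Build _ _ _ (@leb2 R) (@leb2_sigma_finite R).

Lemma eq_ler (R : numDomainType) (x y : R) : x = y -> x <= y.
Proof. by move=> ->. Qed.

Lemma ler_sqr_norm (R : realDomainType) (x y : R) : `|x| <= y -> x ^+ 2 <= y ^+ 2.
Proof.
move=> h; rewrite -[x ^+ 2]real_normK ?num_real// ler_pXn2r ?nnegrE//.
exact: le_trans (normr_ge0 x) h.
Qed.

(** * Lebesgue measure and integrals on the plane *)

Section Integral2.
Context {R : realType}.
Implicit Types (f g : R * R -> R) (A : set (R * R)).

Definition L1 f := (@leb2 R).-integrable setT (EFin \o f).
Definition I2 f : R := Rintegral (@leb2 R) setT f.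

Lemma ball2E (x : R * R) (r : R) : ball x r = ball x.1 r `*` ball x.2 r.
Proof. by apply/seteqP; split=> y []. Qed.

Lemma mball2 (x : R * R) (r : R) : measurable (ball x r).
Proof. by rewrite ball2E; apply: measurableX; apply: open_measurable; exact: ball_open. Qed.

(** The sigma-algebra of the product is generated by rectangles, so an open set has to be written as
    a countable union; balls of the sup norm are squares, and those with rational centre and radius
    suffice. *)
Lemma open2_meas A : open A -> measurable A.
Proof.
move=> oA.
pose F (q1 q2 q : rat) : set (R * R) :=
 if `[< ball ((ratr q1, ratr q2) : R * R) (ratr q) `<=` A >]
 then ball ((ratr q1, ratr q2) : R * R) (ratr q) else set0.
suff -> : A = \bigcup_q1 \bigcup_q2 \bigcup_q F q1 q2 q.
 apply: bigcupT_measurable_rat => q1; apply: bigcupT_measurable_rat => q2.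
 apply: bigcupT_measurable_rat => q; rewrite /F; case: asboolP => // _.
 exact: mball2.
apply/seteqP; split=> x; last first.
 by move=> [q1 _ [q2 _ [q _]]]; rewrite /F; case: asboolP => // h; apply: h.
move=> Ax; have nA : nbhs x A by apply: open_nbhs_nbhs; split.
move/nbhs_ballP : nA => [e /= e0 eA].
have [q [qe1 qe2]] : exists q : rat, (0 : R) < ratr q /\ (ratr q : R) < e / 2.
 have e20 : 0 < e / 2 by rewrite divr_gt0.
 by have [q] := rat_in_itvoo e20; rewrite in_itv /= => /andP[? ?]; exists q.
have near (t : R) : exists p : rat, `|ratr p - t| < (ratr q : R).
 have lt_t : t - ratr q < t + ratr q by lra.
 have [p] := rat_in_itvoo lt_t; rewrite in_itv /= => /andP[? ?]; exists p; rewrite ltr_distlC; lra.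
have [q1 h1] := near x.1; have [q2 h2] := near x.2.
exists q1 => //; exists q2 => //; exists q => //; rewrite /F.
have bx : ball ((ratr q1, ratr q2) : R * R) (ratr q) x by split.
case: asboolP => // -[] y [/= y1 y2]; apply: eA; split => /=;
 [move: y1 h1|move: y2 h2]; rewrite /ball /= => a b.
- by rewrite -(subrKA (ratr q1)) (le_lt_trans (ler_normD _ _))//; rewrite distrC in b; lra.
- by rewrite -(subrKA (ratr q2)) (le_lt_trans (ler_normD _ _))//; rewrite distrC in b; lra.
Qed.
End Integral2.

(** * Behaviour of the measure under translations and dilations *)

Section Affine.
Context {R : realType}.
Local Notation lam := (@lebesgue_measure R).

Lemma measurable_affine1 (h r : R) : mfun (fun t : R => h + r * t)%R.
Proof. by apply: continuous_measurable_fun => t; apply: cvgD; [exact: cvg_cst|apply: cvgM; [exact: cvg_cst|exact: cvg_id]]. Qed.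

(** For negative [r] the half-open interval comes back closed at the other end; only its length is
    read off afterwards. *)
Lemma preimage_affine_oc (h r a b : R) : r != 0 ->
 (fun t => h + r * t) @^-1` `]a, b]%classic =
 if 0 < r then `](a - h) / r, (b - h) / r]%classic
 else `[(b - h) / r, (a - h) / r[%classic.
Proof.
move=> r0; apply/seteqP; split=> t; case: ltP => hr;
 rewrite /= !in_itv /= => /andP[h1 h2].
- by rewrite ltr_pdivrMr// ler_pdivlMr// ![t * r]mulrC; lra.
- have r1 : r < 0 by rewrite lt_neqAle r0.
 by rewrite ler_ndivrMr// ltr_ndivlMr// ![t * r]mulrC; lra.
- by move: h1 h2; rewrite ltr_pdivrMr// ler_pdivlMr// ![t * r]mulrC; lra.
- have r1 : r < 0 by rewrite lt_neqAle r0.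
 by move: h1 h2; rewrite ler_ndivrMr// ltr_ndivlMr// ![t * r]mulrC; lra.
Qed.

(** The scaled push-forward has the right value on half-open intervals, and these determine Lebesgue
    measure. *)
Lemma lebesgue_affine (h r : R) (A : set R) : r != 0 -> measurable A ->
 lam A = (`|r|%:E * lam ((fun t => h + r * t)%R @^-1` A))%E.
Proof.
move=> r0 mA.
pose m' := mscale (NngNum (normr_ge0 r))
 (@measure_function_pushforward__canonical__measure_function_Measure _ _
   (measurableTypeR R) (measurableTypeR R) R lam _ (measurable_affine1 h r)).
rewrite (@lebesgue_measure_unique R m')//= => _ [[a b]] _ <-.
rewrite -[RHS]/(`|r|%:E * lam ((fun t => h + r * t)%R @^-1` `]a, b]%classic))%E.
rewrite preimage_affine_oc//.
rewrite lebesgue_measure_itv/= lte_fin.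
case: (ltP 0 r) => hr; rewrite lebesgue_measure_itv/= lte_fin.
- rewrite ltr_pM2r ?invr_gt0// ltrD2r; case: ltP => // ab; last by rewrite mule0.
 by rewrite gtr0_norm// -!EFinB -EFinM; congr (_%:E); field.
- have r1 : r < 0 by rewrite lt_neqAle r0.
 rewrite ltr_nM2r ?invr_lt0// ltrD2r; case: ltP => // ab; last by rewrite mule0.
 by rewrite ltr0_norm// -!EFinB -EFinM; congr (_%:E); field.
Qed.

Lemma measurable_affine2 (h : R * R) (r : R) : mfun (fun x : R * R => h + r *: x).
Proof.
apply/measurable_fun_pairP; split; rewrite /comp /=.
- exact: (measurableT_comp (measurable_affine1 h.1 r) measurable_fst).
- exact: (measurableT_comp (measurable_affine1 h.2 r) measurable_snd).
Qed.

Lemma leb2_affine (h : R * R) (r : R) (A : set (R * R)) : r != 0 -> measurable A ->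
 leb2 A = ((r ^+ 2)%:E * leb2 ((fun x => h + r *: x)%R @^-1` A))%E.
Proof.
move=> r0 mA.
pose m' := mscale (NngNum (sqr_ge0 r))
 (@measure_function_pushforward__canonical__measure_function_Measure _ _
   (measurableTypeR R * measurableTypeR R)%type (measurableTypeR R * measurableTypeR R)%type R (@leb2 R) _ (measurable_affine2 h r)).
apply: (@product_measure_unique _ _ _ _ R lam lam m') => // B C mB mC.
rewrite -[LHS]/((r ^+ 2)%:E * leb2 ((fun x => h + r *: x)%R @^-1` (B `*` C)))%E.
have -> : (fun x => h + r *: x) @^-1` (B `*` C) =
 ((fun t => h.1 + r * t) @^-1` B) `*` ((fun t => h.2 + r * t) @^-1` C).
 by apply/seteqP; split => x.
rewrite /leb2 product_measure1E; last 2 first.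
- rewrite -[X in measurable X]setTI; exact: measurable_affine1.
- rewrite -[X in measurable X]setTI; exact: measurable_affine1.
have hB := @lebesgue_affine h.1 r B r0 mB.
have hC := @lebesgue_affine h.2 r C r0 mC.
transitivity ((`|r|%:E * lam ((fun t => h.1 + r * t)%R @^-1` B)) *
 (`|r|%:E * lam ((fun t => h.2 + r * t)%R @^-1` C)))%E; last first.
 congr (_ * _)%E; exact: esym.
by rewrite -real_normK ?num_real// expr2 EFinM muleACA.
Qed.

Lemma ge0_integral_affine2 (h : R * R) (r : R) (f : R * R -> R) : r != 0 ->
 mfun f -> (forall x, 0 <= f x) ->
 (\int[leb2]_x (f (h + r *: x)%R)%:E = (r ^- 2)%:E * \int[leb2]_x (f x)%:E)%E.
Proof.
move=> r0 mf f0.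
have r20 : 0 <= r ^- 2 by rewrite invr_ge0 sqr_ge0.
have mEf : mfun (EFin \o f) by exact/measurable_EFinP.
rewrite -[LHS]/(\int[leb2]_(x in (fun x => h + r *: x)%R @^-1` setT) ((EFin \o f) \o (fun x => h + r *: x)%R) x)%E.
rewrite -(@ge0_integral_pushforward _ _ (measurableTypeR R * measurableTypeR R)%type (measurableTypeR R * measurableTypeR R)%type R _ (measurable_affine2 h r) leb2 setT (EFin \o f))//; last first.
 by move=> y _; rewrite lee_fin.
rewrite -(@ge0_integral_mscale _ (measurableTypeR R * measurableTypeR R)%type R leb2 setT measurableT (NngNum r20) (EFin \o f))//; last first.
 by move=> y _; rewrite lee_fin.
apply: eq_measure_integral; first exact: measurable_affine2.
move=> ? A mA _; rewrite -[RHS]/((r ^- 2)%:E * leb2 A)%E.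
have -> := @leb2_affine h r A r0 mA.
by rewrite muleA -EFinM mulVf ?mul1e// expf_neq0.
Qed.
End Affine.

Section L1theory.
Context {R : realType}.
Implicit Types (f g h : R * R -> R) (A : set (R * R)).

Lemma L1_meas f : L1 f -> mfun f.
Proof. by move=> /integrableP[+ _] => /measurable_EFinP. Qed.

Lemma L1_dom f g : mfun f -> L1 g -> (forall x, `|f x| <= g x) -> L1 f.
Proof.
move=> mf Lg fg; apply: (le_integrable _ _ _ Lg) => //; first exact/measurable_EFinP.
by move=> x _ /=; rewrite lee_fin (le_trans (fg x))// ler_norm.
Qed.

Lemma L1D f g : L1 f -> L1 g -> L1 (fun x => f x + g x).
Proof. by move=> Lf Lg; apply: (integrableD measurableT Lf Lg). Qed.

Lemma L1N f : L1 f -> L1 (fun x => - f x).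
Proof. by move=> Lf; apply: (integrableN Lf). Qed.

Lemma L1B f g : L1 f -> L1 g -> L1 (fun x => f x - g x).
Proof. by move=> Lf Lg; apply: L1D => //; exact: L1N. Qed.

Lemma L1Z c f : L1 f -> L1 (fun x => c * f x).
Proof. by move=> Lf; apply: (integrableZl measurableT c Lf). Qed.

Lemma L1Zr c f : L1 f -> L1 (fun x => f x * c).
Proof. by move=> /(L1Z c); under eq_fun do rewrite mulrC. Qed.

Lemma L1_abs f : L1 f -> L1 (fun x => `|f x|).
Proof. by move=> Lf; apply: (integrable_norm Lf). Qed.

Lemma L1_0 : L1 (fun _ : R * R => 0 : R).
Proof. exact: integrable0. Qed.

Lemma L1_sum I (s : seq I) (F : I -> R * R -> R) : (forall i, L1 (F i)) ->
 L1 (fun x => \sum_(i <- s) F i x).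
Proof.
move=> LF; elim: s => [|i s ih]; first by under eq_fun do rewrite big_nil; exact: L1_0.
under eq_fun do rewrite big_cons; exact: L1D.
Qed.

Lemma I2_eq f g : f =1 g -> I2 f = I2 g.
Proof. by move=> /funext ->. Qed.

Lemma I2D f g : L1 f -> L1 g -> I2 (fun x => f x + g x) = I2 f + I2 g.
Proof. by move=> Lf Lg; rewrite /I2 RintegralD. Qed.

Lemma I2B f g : L1 f -> L1 g -> I2 (fun x => f x - g x) = I2 f - I2 g.
Proof. by move=> Lf Lg; rewrite /I2 RintegralB. Qed.

Lemma I2Z c f : L1 f -> I2 (fun x => c * f x) = c * I2 f.
Proof. by move=> Lf; rewrite /I2 RintegralZl. Qed.

Lemma I2Zr c f : L1 f -> I2 (fun x => f x * c) = I2 f * c.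
Proof. by move=> Lf; rewrite /I2 RintegralZr. Qed.

Lemma I2_0 : I2 (fun _ : R * R => 0 : R) = 0.
Proof. by rewrite /I2 Rintegral_cst// mul0r. Qed.

Lemma I2_ge0 f : (forall x, 0 <= f x) -> 0 <= I2 f.
Proof. by move=> f0; apply: Rintegral_ge0. Qed.

Lemma I2_le f g : L1 f -> L1 g -> (forall x, f x <= g x) -> I2 f <= I2 g.
Proof. by move=> Lf Lg fg; apply: le_Rintegral. Qed.

Lemma I2_le0 f g : mfun f -> L1 g ->
 (forall x, 0 <= f x <= g x) -> I2 f <= I2 g.
Proof.
move=> mf Lg fg; apply: I2_le => //; last by move=> x; case/andP: (fg x).
by apply: L1_dom Lg _ => // x; case/andP: (fg x) => f0 ?; rewrite ger0_norm.
Qed.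

Lemma I2_abs f : L1 f -> `|I2 f| <= I2 (fun x => `|f x|).
Proof. by move=> Lf; apply: le_normr_Rintegral. Qed.

Lemma I2_sum I (s : seq I) (F : I -> R * R -> R) : (forall i, L1 (F i)) ->
 I2 (fun x => \sum_(i <- s) F i x) = \sum_(i <- s) I2 (F i).
Proof.
move=> LF; elim: s => [|i s ih].
 by under eq_fun do rewrite big_nil; rewrite big_nil I2_0.
under eq_fun do rewrite big_cons; rewrite big_cons I2D ?ih//; exact: L1_sum.
Qed.

Lemma L1_bdM (M : R) h f : mfun h -> (forall x, `|h x| <= M) ->
 L1 f -> L1 (fun x => h x * f x).
Proof.
move=> mh hM Lf; apply: (@L1_dom _ (fun x => M * `|f x|)).
- apply: measurable_funM => //; exact: L1_meas.
- apply: L1Z; exact: L1_abs.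
- by move=> x; rewrite normrM ler_wpM2r.
Qed.

Lemma I2E f : L1 f -> (\int[leb2]_x (f x)%:E)%E = (I2 f)%:E.
Proof. by move=> Lf; rewrite /I2 /Rintegral fineK//; exact: integrable_fin_num. Qed.

Lemma L1_ge0P f : mfun f -> (forall x, 0 <= f x) ->
 (\int[leb2]_x (f x)%:E < +oo)%E -> L1 f.
Proof.
move=> mf f0 foo; apply/integrableP; split; first exact/measurable_EFinP.
by under eq_integral do rewrite gee0_abs ?lee_fin//.
Qed.

Lemma measurable_affine2f (h : R * R) (r : R) f : mfun f ->
 mfun (fun x : R * R => f (h + r *: x)).
Proof. by move=> mf; exact: (measurableT_comp mf (measurable_affine2 h r)). Qed.

Lemma L1_affine (h : R * R) (r : R) f : r != 0 -> L1 f -> L1 (fun x : R * R => f (h + r *: x)).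
Proof.
move=> r0 Lf; have mf := L1_meas Lf; apply/integrableP; split.
 apply/measurable_EFinP; exact: measurable_affine2f.
have := @ge0_integral_affine2 R h r (fun x => `|f x|) r0 (measurableT_comp _ mf) (fun x => normr_ge0 _).
rewrite /= => -> //; rewrite lte_mul_pinfty ?lee_fin ?invr_ge0 ?sqr_ge0//.
rewrite I2E ?ltry//; exact: L1_abs.
Qed.

Lemma I2_affine (h : R * R) (r : R) f : r != 0 -> L1 f ->
 I2 (fun x : R * R => f (h + r *: x)) = r ^- 2 * I2 f.
Proof.
move=> r0.
have pos g : L1 g -> (forall x, 0 <= g x) -> I2 (fun x => g (h + r *: x)) = r ^- 2 * I2 g.
 move=> Lg g0; apply: EFin_inj; rewrite -I2E ?ge0_integral_affine2//.
 - by rewrite I2E.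
 - exact: L1_meas.
 - exact: L1_affine.
move=> Lf.
(* A signed function is a difference of two nonnegative integrable ones. *)
have Lp : L1 (fun x => `|f x| + f x) by apply: L1D => //; exact: L1_abs.
have E x : f x = (`|f x| + f x) - `|f x| by rewrite addrC addKr.
rewrite (I2_eq E) I2B//; last exact: L1_abs.
rewrite mulrBr -!pos//; last 2 first.
- exact: L1_abs.
- by move=> x; rewrite -lerBlDr sub0r ler_normr lexx orbT.
rewrite -I2B; last 2 first.
- exact: (@L1_affine h r (fun x => `|f x| + f x)).
- exact: (@L1_affine h r (fun x => `|f x|)) (L1_abs Lf).
by apply: I2_eq => x; rewrite -E.
Qed.

Lemma mindic A : measurable A -> mfun (\1_A : R * R -> R).
Proof. by move=> mA; exact: measurable_indic. Qed.

Lemma meas_ball (x : R * R) (r : R) : mfun (\1_(ball x r) : R * R -> R).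
Proof. by apply: mindic; exact: mball2. Qed.

Lemma indE A x : (\1_A x : R) = if x \in A then 1 else 0.
Proof. by rewrite indicE; case: (x \in A). Qed.

Lemma ind_itv A x : 0 <= (\1_A x : R) <= 1.
Proof. by rewrite indE; case: ifP; rewrite ?lexx ?ler01. Qed.

Lemma ind_ge0 A x : 0 <= (\1_A x : R). Proof. by case/andP: (ind_itv A x). Qed.

Lemma norm_ind A x : `|\1_A x : R| <= 1.
Proof. by case/andP: (ind_itv A x) => ? ?; rewrite ger0_norm. Qed.

Lemma ind_in A x : A x -> \1_A x = 1 :> R.
Proof. by move=> Ax; rewrite indE mem_set. Qed.

Lemma ind_out A x : ~ A x -> \1_A x = 0 :> R.
Proof. by move=> Ax; rewrite indE memNset. Qed.

(** Balls are those of the sup norm, that is squares: this is the origin of the factors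
    [(2 * r) ^+ 2] below. *)
Lemma leb2_ball (c : R * R) (r : R) : 0 <= r -> leb2 (ball c r) = ((2 * r) ^+ 2)%:E.
Proof.
move=> r0; rewrite ball2E /leb2 product_measure1E; try by apply: open_measurable; exact: ball_open.
rewrite /= !lebesgue_measure_ball// -EFinM; congr (_%:E); ring.
Qed.

Lemma L1_ind A : measurable A -> (leb2 A < +oo)%E -> L1 (\1_A).
Proof.
move=> mA Aoo; apply: L1_ge0P; first exact: mindic.
- by move=> x; case/andP: (ind_itv A x).
- by rewrite integral_indic// setIT.
Qed.

Lemma L1_ball (c : R * R) (r : R) : L1 (\1_(ball c r)).
Proof.
have [r0|r0] := ltP r 0.
 have -> : ball c r = set0 by apply/seteqP; split => // x; rewrite ball2E => -[] /=; rewrite /ball /= => h; have := le_lt_trans (normr_ge0 _) h; lra.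
 by apply: L1_ind => //; rewrite measure0.
by apply: L1_ind; [exact: mball2|rewrite leb2_ball// ltry].
Qed.

Lemma I2_ball (c : R * R) (r : R) : 0 <= r -> I2 (\1_(ball c r)) = (2 * r) ^+ 2.
Proof.
move=> r0; apply: EFin_inj; rewrite -I2E; last exact: L1_ball.
rewrite integral_indic//; last exact: mball2.
rewrite setIT; exact: leb2_ball.
Qed.

Lemma L1_box (M r : R) f : mfun f -> (forall x, `|f x| <= M) ->
 (forall x, ~ ball 0 r x -> f x = 0) -> L1 f.
Proof.
move=> mf fM f0; apply: (@L1_dom _ (fun x => M * \1_(ball 0 r) x)) => //.
 exact/L1Z/L1_ball.
move=> x; have [xr|xr] := pselect (ball 0 r x); first by rewrite ind_in// mulr1.
by rewrite f0// normr0 ind_out// mulr0.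
Qed.

Lemma I2_box_le (M r : R) f : 0 <= r -> mfun f -> (forall x, `|f x| <= M) ->
 (forall x, ~ ball 0 r x -> f x = 0) -> I2 (fun x => `|f x|) <= M * (2 * r) ^+ 2.
Proof.
move=> r0 mf fM f0; rewrite -(I2_ball 0 r0) -I2Z; last exact: L1_ball.
apply: I2_le0; [exact: measurableT_comp|exact/L1Z/L1_ball|].
move=> x; rewrite normr_ge0 /=.
have [xr|xr] := pselect (ball 0 r x); first by rewrite ind_in// mulr1.
by rewrite f0// normr0 ind_out// mulr0.
Qed.
End L1theory.

Local Notation bdr f M := (forall x, `|f x| <= M).

(** * Convolutions *)

Section Fubini2.
Context {R : realType}.
Local Notation pt := (R * R)%type.
Implicit Types (f g h k : pt -> R) (F : pt * pt -> R).

Lemma meas_sub k : mfun k ->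
 mfun (fun z : pt * pt => k (z.1 - z.2)).
Proof.
move=> mk; apply: (measurableT_comp mk).
apply/measurable_fun_pairP; split; rewrite /comp /=.
- by apply: measurable_funB; apply: (measurableT_comp measurable_fst); [exact: measurable_fst|exact: measurable_snd].
- by apply: measurable_funB; apply: (measurableT_comp measurable_snd); [exact: measurable_fst|exact: measurable_snd].
Qed.

Lemma meas_fst f : mfun f -> mfun (fun z : pt * pt => f z.1).
Proof. by move=> mf; apply: (measurableT_comp mf); exact: measurable_fst. Qed.

Lemma meas_snd f : mfun f -> mfun (fun z : pt * pt => f z.2).
Proof. by move=> mf; apply: (measurableT_comp mf); exact: measurable_snd. Qed.

Lemma meas_swap F : mfun F -> mfun (fun z => F (z.2, z.1)).
Proof.
move=> mF; apply: (measurableT_comp mF).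
by apply/measurable_fun_pairP; split; [exact: measurable_snd|exact: measurable_fst].
Qed.

Lemma meas_sec F x : mfun F -> mfun (fun y => F (x, y)).
Proof. by move=> mF; apply: (measurableT_comp mF); exact: measurable_pair1. Qed.

(** Tonelli applies to the positive and negative parts separately, and [fine] is measurable, so
    sections with infinite integral do no harm. *)
Lemma meas_I2 F : mfun F ->
 mfun (fun x : pt => I2 (fun y => F (x, y))).
Proof.
move=> mF; have mEF : mfun (EFin \o F) by exact/measurable_EFinP.
have mfine : mfun (@fine R) by exact: fine_measurable.
apply: (measurableT_comp mfine).
pose Fp x := (\int[leb2]_y ((EFin \o F)^\+ (x, y)))%E.
pose Fm x := (\int[leb2]_y ((EFin \o F)^\- (x, y)))%E.
have mFp : mfun Fp.
 apply: (measurable_fun_fubini_tonelli_F (m2 := leb2)) => //; exact: measurable_funepos.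
have mFm : mfun Fm.
 apply: (measurable_fun_fubini_tonelli_F (m2 := leb2)) => //; exact: measurable_funeneg.
have := emeasurable_funB mFp mFm; congr (measurable_fun _ _).
apply/funext => x; rewrite [RHS]integralE; congr (_ - _)%E; apply: eq_integral => y _.
- by rewrite !funeposE.
- by rewrite !funenegE.
Qed.

Lemma L1_prodP F : mfun F -> (forall x, L1 (fun y => F (x, y))) ->
 L1 (fun x => I2 (fun y => `|F (x, y)|)) ->
 ((@leb2 R) \x (@leb2 R))%E.-integrable setT (EFin \o F).
Proof.
move=> mF Lx Ly; apply/(@integrable12ltyP _ _ _ _ R leb2 leb2 (EFin \o F)); first exact/measurable_EFinP.
under eq_integral.
 move=> x _; rewrite (_ : (fun y => _) = (fun y => (`|F (x, y)|)%:E))//.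
 rewrite I2E; last exact: L1_abs.
 over.
by rewrite I2E// ltry.
Qed.

Lemma fubini_I2 F : mfun F -> (forall x, L1 (fun y => F (x, y))) ->
 (forall y, L1 (fun x => F (x, y))) ->
 L1 (fun x => I2 (fun y => `|F (x, y)|)) ->
 I2 (fun x => I2 (fun y => F (x, y))) = I2 (fun y => I2 (fun x => F (x, y))).
Proof.
move=> mF Lx Ly LL; have iF := L1_prodP mF Lx LL.
rewrite /I2 {1 3}/Rintegral; congr fine.
under eq_integral do rewrite -/(I2 _) -I2E//.
under [RHS]eq_integral do rewrite -/(I2 _) -I2E//.
exact: (@Fubini _ _ _ _ R leb2 leb2 (EFin \o F) iF).
Qed.

Lemma L1_fubini F : mfun F -> (forall x, L1 (fun y => F (x, y))) ->
 (forall y, L1 (fun x => F (x, y))) ->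
 L1 (fun x => I2 (fun y => `|F (x, y)|)) ->
 L1 (fun y => I2 (fun x => F (x, y))).
Proof.
move=> mF Lx Ly LL; have iF := L1_prodP mF Lx LL.
have mFE : mfun (EFin \o F) by exact/measurable_EFinP.
have iF21 := (@integrable21ltyP _ _ _ _ R leb2 leb2 (EFin \o F) mFE).1 iF.
have mG : mfun (fun y => I2 (fun x => `|F (x, y)|)).
 apply: (@meas_I2 (fun z => `|F (z.2, z.1)|)); apply: measurableT_comp => //; exact: meas_swap.
have LG : L1 (fun y => I2 (fun x => `|F (x, y)|)).
 apply: L1_ge0P => //; first by move=> y; exact: I2_ge0.
 rewrite (_ : (fun y => _) = (fun y => \int[leb2]_x `|(EFin \o F) (x, y)|)%E)//.
 apply/funext => y; rewrite -I2E//; exact: L1_abs.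
apply: (L1_dom _ LG); last by move=> y; exact: I2_abs.
apply: (@meas_I2 (fun z => F (z.2, z.1))); exact: meas_swap.
Qed.

Definition rconv k g (x : pt) : R := I2 (fun y => k (x - y) * g y).

Lemma L1_conv_in k g (M : R) x : mfun k -> bdr k M -> L1 g ->
 L1 (fun y => k (x - y) * g y).
Proof.
move=> mk kM Lg; apply: (@L1_bdM _ M) => //.
by have := meas_sec x (meas_sub mk).
Qed.

Lemma meas_conv k g : mfun k -> mfun g ->
 mfun (rconv k g).
Proof.
move=> mk mg; apply: (@meas_I2 (fun z => k (z.1 - z.2) * g z.2)).
by apply: measurable_funM; [exact: meas_sub|exact: meas_snd].
Qed.

Lemma conv_bd k g (M : R) x : mfun k -> bdr k M -> L1 g ->
 `|rconv k g x| <= M * I2 (fun y => `|g y|).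
Proof.
move=> mk kM Lg; apply: (le_trans (I2_abs (L1_conv_in x mk kM Lg))).
rewrite -I2Z; last exact: L1_abs.
apply: I2_le; [exact/L1_abs/L1_conv_in/Lg|exact/L1Z/L1_abs|].
by move=> y; rewrite normrM ler_wpM2r.
Qed.

Lemma conv_swap k f g (M : R) : mfun k -> bdr k M ->
 L1 f -> L1 g ->
 I2 (fun x => f x * rconv k g x) = I2 (fun y => g y * I2 (fun x => k (x - y) * f x)).
Proof.
move=> mk kM Lf Lg.
pose F (z : pt * pt) := f z.1 * (k (z.1 - z.2) * g z.2).
have mF : mfun F.
 apply: measurable_funM; first exact: (meas_fst (L1_meas Lf)).
 by apply: measurable_funM; [exact: (meas_sub mk)|exact: (meas_snd (L1_meas Lg))].
have Lx x : L1 (fun y => F (x, y)) by rewrite /F /=; exact/L1Z/(L1_conv_in _ _ kM).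
have mky y : mfun (fun x : pt => k (x - y)).
 by have := meas_sec y (meas_swap (meas_sub mk)).
have Ly y : L1 (fun x => F (x, y)).
 have -> : (fun x => F (x, y)) = (fun x => (k (x - y) * g y) * f x).
  by apply/funext => x; rewrite /F /=; ring.
 apply: (@L1_bdM _ (M * `|g y|)) => //; first exact: measurable_funM.
 by move=> x; rewrite normrM ler_wpM2r.
have LL : L1 (fun x => I2 (fun y => `|F (x, y)|)).
 apply: (@L1_dom _ _ (fun x => (M * I2 (fun y => `|g y|)) * `|f x|)).
 - apply: (@meas_I2 (fun z => `|F z|)); exact: measurableT_comp.
 - exact/L1Z/L1_abs.
 - move=> x; rewrite ger0_norm; last by apply: I2_ge0 => y.
  rewrite -I2Z; last exact: L1_abs.
  rewrite -I2Zr; last exact/L1Z/L1_abs.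
  apply: I2_le; [exact/L1_abs/Lx|exact/L1Zr/L1Z/L1_abs|].
  move=> y; rewrite /F !normrM /= mulrC; apply: ler_wpM2r => //.
  exact: ler_wpM2r.
transitivity (I2 (fun x => I2 (fun y => F (x, y)))).
 apply: I2_eq => x; rewrite /F /= I2Z//; exact: (L1_conv_in _ _ kM).
rewrite fubini_I2//; apply: I2_eq => y.
rewrite -I2Z; last first.
 exact: (@L1_bdM _ M).
by apply: I2_eq => x; rewrite /F /=; ring.
Qed.

(* Integrating over [x] first bounds the mass of a convolution by the product of the masses. *)
Lemma I2_conv_le k g f (M B : R) : mfun k -> bdr k M ->
 (forall y, I2 (fun x => `|k (x - y) * f x|) <= B) ->
 L1 f -> L1 g ->
 I2 (fun x => `|f x| * rconv (fun z => `|k z|) (fun y => `|g y|) x) <= B * I2 (fun y => `|g y|).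
Proof.
move=> mk kM hB Lf Lg.
have mak : mfun (fun z => `|k z|) by exact: measurableT_comp.
have akM z : `| `|k z| | <= M by rewrite normr_id.
rewrite (conv_swap mak akM (L1_abs Lf) (L1_abs Lg)) -I2Z; last exact: L1_abs.
apply: I2_le0 => [||y].
- apply: measurable_funM; first exact: (L1_meas (L1_abs Lg)).
 apply: (@meas_I2 (fun z => `|k (z.2 - z.1)| * `|f z.2|)).
 apply: measurable_funM; last exact: (meas_snd (L1_meas (L1_abs Lf))).
 exact: (meas_swap (meas_sub mak)).
- exact/L1Z/L1_abs.
- rewrite mulrC; apply/andP; split.
  by rewrite mulr_ge0//; apply: I2_ge0 => x; rewrite mulr_ge0.
 apply: ler_wpM2r => //; apply: le_trans (hB y); apply: eq_ler.
 by apply: I2_eq => x; rewrite normrM.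
Qed.

End Fubini2.

(** * Complex-valued functions *)

Section Modulus.
Context {R : realType}.
Implicit Types (z w : R[i]) (x y : R).

Definition iC : R[i] := 0 +i* 1.
(** The norm of [R[i]] takes its values in [R[i]]; this is the modulus as a real number. *)
Definition nm z : R := Num.sqrt (Re z ^+ 2 + Im z ^+ 2).
Definition cj z : R[i] := Re z +i* (- Im z).

Lemma ReM z w : Re (z * w) = Re z * Re w - Im z * Im w. Proof. by case: z; case: w. Qed.
Lemma ImM z w : Im (z * w) = Re z * Im w + Im z * Re w. Proof. by case: z; case: w. Qed.
Lemma ReD z w : Re (z + w) = Re z + Re w. Proof. by case: z; case: w. Qed.
Lemma ImD z w : Im (z + w) = Im z + Im w. Proof. by case: z; case: w. Qed.
Lemma ReN z : Re (- z) = - Re z. Proof. by case: z. Qed.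
Lemma ImN z : Im (- z) = - Im z. Proof. by case: z. Qed.
Lemma ReB z w : Re (z - w) = Re z - Re w. Proof. by case: z; case: w. Qed.
Lemma ImB z w : Im (z - w) = Im z - Im w. Proof. by case: z; case: w. Qed.
Lemma ReC x : Re (x%:C) = x. Proof. by []. Qed.
Lemma ImC x : Im (x%:C) = 0. Proof. by []. Qed.
Lemma Rei : Re iC = 0. Proof. by []. Qed.
Lemma Imi : Im iC = 1. Proof. by []. Qed.
Lemma Re0 : Re (0 : R[i]) = 0. Proof. by []. Qed.
Lemma Im0 : Im (0 : R[i]) = 0. Proof. by []. Qed.
Lemma Re1 : Re (1 : R[i]) = 1. Proof. by []. Qed.
Lemma Im1 : Im (1 : R[i]) = 0. Proof. by []. Qed.
Lemma Recj z : Re (cj z) = Re z. Proof. by []. Qed.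
Lemma Imcj z : Im (cj z) = - Im z. Proof. by []. Qed.
Definition reim := (ReM, ImM, ReD, ImD, ReN, ImN, ReC, ImC, Rei, Imi, Re0, Im0, Re1, Im1, Recj, Imcj).

Lemma cplx_eq z w : Re z = Re w -> Im z = Im w -> z = w.
Proof. by case: z => a b; case: w => c d /= -> ->. Qed.

Lemma iC2 : iC * iC = -1. Proof. by apply: cplx_eq; rewrite !reim; ring. Qed.

Lemma nm_ge0 z : 0 <= nm z. Proof. exact: sqrtr_ge0. Qed.
Lemma sqr_nm z : nm z ^+ 2 = Re z ^+ 2 + Im z ^+ 2.
Proof. by rewrite sqr_sqrtr// addr_ge0// sqr_ge0. Qed.
Lemma nmM z w : nm (z * w) = nm z * nm w.
Proof.
apply/eqP; rewrite -(eqrXn2 (n := 2))// ?nm_ge0// ?mulr_ge0 ?nm_ge0//.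
by rewrite exprMn !sqr_nm !reim; apply/eqP; ring.
Qed.
Lemma nmN z : nm (- z) = nm z.
Proof. by rewrite /nm !reim !sqrrN. Qed.
Lemma nmcj z : nm (cj z) = nm z.
Proof. by rewrite /nm !reim !sqrrN. Qed.
Lemma nm0 : nm 0 = 0. Proof. by rewrite /nm !reim expr0n /= addr0 sqrtr0. Qed.
Lemma nm1 : nm 1 = 1. Proof. by rewrite /nm !reim expr0n expr1n /= addr0 sqrtr1. Qed.
Lemma nmi : nm iC = 1. Proof. by rewrite /nm !reim expr0n expr1n /= add0r sqrtr1. Qed.
Lemma nmR x : nm (x%:C) = `|x|.
Proof. by rewrite /nm !reim expr0n /= addr0 sqrtr_sqr. Qed.
Lemma nm_Re z : `|Re z| <= nm z.
Proof. by rewrite -sqrtr_sqr; apply: ler_wsqrtr; rewrite lerDl sqr_ge0. Qed.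
Lemma nm_Im z : `|Im z| <= nm z.
Proof. by rewrite -sqrtr_sqr; apply: ler_wsqrtr; rewrite lerDr sqr_ge0. Qed.
Lemma Re_le_nm z : Re z <= nm z.
Proof. exact: le_trans (ler_norm _) (nm_Re z). Qed.
Lemma nm_le z : nm z <= `|Re z| + `|Im z|.
Proof.
rewrite -(ler_pXn2r (n := 2))// ?nnegrE ?nm_ge0 ?addr_ge0//.
rewrite sqr_nm -[X in X + _]real_normK ?num_real// -[X in _ + X <= _]real_normK ?num_real//.
have : 0 <= `|Re z| * `|Im z| by rewrite mulr_ge0.
by nra.
Qed.
Lemma nmD z w : nm (z + w) <= nm z + nm w.
Proof.
rewrite -(ler_pXn2r (n := 2))// ?nnegrE ?nm_ge0 ?addr_ge0 ?nm_ge0//.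
have h : Re (cj z * w) <= nm z * nm w by rewrite -(nmcj z) -nmM Re_le_nm.
move: h; rewrite sqrrD !sqr_nm !reim; lra.
Qed.
Lemma nmB z w : nm (z - w) <= nm z + nm w.
Proof. by rewrite -(nmN w); exact: nmD. Qed.
Lemma nm_distC z w : nm (z - w) = nm (w - z).
Proof. by rewrite -nmN opprB. Qed.
Lemma nm_eq0 z : nm z = 0 -> z = 0.
Proof.
move=> z0; have := sqr_nm z; rewrite z0 expr0n /= => /esym/eqP.
rewrite paddr_eq0 ?sqr_ge0// !sqrf_eq0 => /andP[/eqP a /eqP b].
by apply: cplx_eq; rewrite ?a ?b.
Qed.
Lemma nmV z : nm z^-1 = (nm z)^-1.
Proof.
have [->|z0] := eqVneq z 0; first by rewrite invr0 nm0 invr0.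
have cz : nm z != 0 by apply: contra z0 => /eqP/nm_eq0/eqP.
by apply: (mulfI cz); rewrite -nmM !divff// nm1.
Qed.
Lemma nm_sub z w : `|nm z - nm w| <= nm (z - w).
Proof.
have h1 := nmD (z - w) w; have h2 := nmD (w - z) z.
move: h1 h2; rewrite !subrK (nm_distC w z) ler_distl; lra.
Qed.
Lemma mulcjE z : cj z * z = (nm z ^+ 2)%:C.
Proof. by rewrite sqr_nm; apply: cplx_eq; rewrite !reim; ring. Qed.

(** The bound [nm w <= 1] in place of equality lets [w = 0] serve for [z = 0]. *)
Lemma nm_phase z : exists w, [/\ nm w <= 1, w * z = (nm z)%:C & Re (w * z) = nm z].
Proof.
have [->|z0] := eqVneq z 0.
 exists 0; rewrite nm0 mulr0; split => //; exact: ler01.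
have cz : nm z != 0 by apply: contra z0 => /eqP/nm_eq0/eqP.
exists ((nm z)^-1%:C * cj z).
have E : (nm z)^-1%:C * cj z * z = (nm z)%:C.
 by rewrite -mulrA mulcjE -rmorphM /= expr2 mulrA mulVf// mul1r.
split=> //; last by rewrite E.
by rewrite nmM nmR nmcj ger0_norm ?invr_ge0 ?nm_ge0// mulVf.
Qed.
End Modulus.

Local Notation bdd f M := (forall x, nm (f x) <= M).

Ltac cplx_ring := apply: cplx_eq; rewrite !reim; ring.

Section ComplexIntegral.
Context {R : realType}.
Local Notation pt := (R * R)%type.
Implicit Types (f g h k : pt -> R[i]).

Definition cmeas f := mfun (fun x : pt => Re (f x)) /\ mfun (fun x : pt => Im (f x)).
Definition cL1 f := L1 (fun x => Re (f x)) /\ L1 (fun x => Im (f x)).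
Definition cI f : R[i] := I2 (fun x => Re (f x)) +i* I2 (fun x => Im (f x)).
Definition cnv k g (x : pt) : R[i] := cI (fun y => k (x - y) * g y).

Lemma cL1_meas f : cL1 f -> cmeas f.
Proof. by case=> /L1_meas ? /L1_meas ?. Qed.

Lemma cmeasM f g : cmeas f -> cmeas g -> cmeas (fun x => f x * g x).
Proof.
move=> [f1 f2] [g1 g2]; split.
- under eq_fun do rewrite ReM; apply: measurable_funB; exact: measurable_funM.
- under eq_fun do rewrite ImM; apply: measurable_funD; exact: measurable_funM.
Qed.

Lemma cmeasD f g : cmeas f -> cmeas g -> cmeas (fun x => f x + g x).
Proof.
move=> [f1 f2] [g1 g2]; split.
- under eq_fun do rewrite ReD; exact: measurable_funD.
- under eq_fun do rewrite ImD; exact: measurable_funD.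
Qed.

Lemma cmeasN f : cmeas f -> cmeas (fun x => - f x).
Proof.
move=> [f1 f2]; split.
- under eq_fun do rewrite ReN; exact: measurableT_comp.
- under eq_fun do rewrite ImN; exact: measurableT_comp.
Qed.

Lemma cmeasB f g : cmeas f -> cmeas g -> cmeas (fun x => f x - g x).
Proof. by move=> mf mg; apply: cmeasD => //; exact: cmeasN. Qed.

Lemma cmeas_cst (c : R[i]) : cmeas (fun _ => c).
Proof. by split; exact: measurable_cst. Qed.

Lemma cmeasR (f : pt -> R) : mfun f -> cmeas (fun x => (f x)%:C).
Proof. by move=> mf; split => //=; exact: measurable_cst. Qed.

Lemma cmeas_cj f : cmeas f -> cmeas (fun x => cj (f x)).
Proof. by move=> [f1 f2]; split => //=; exact: measurableT_comp. Qed.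

Lemma meas_nm f : cmeas f -> mfun (fun x => nm (f x)).
Proof.
move=> [f1 f2]; apply: measurableT_comp => //.
 exact: (continuous_measurable_fun (@sqrt_continuous R)).
apply: measurable_funD; exact: measurable_funX.
Qed.

Lemma L1_nm f : cL1 f -> L1 (fun x => nm (f x)).
Proof.
move=> Lf; apply: (@L1_dom _ _ (fun x => `|Re (f x)| + `|Im (f x)|)).
- exact: (meas_nm (cL1_meas Lf)).
- by apply: L1D; apply: L1_abs; case: Lf.
- by move=> x; rewrite ger0_norm ?nm_ge0 ?nm_le.
Qed.

Lemma cL1_dom f (g : pt -> R) : cmeas f -> L1 g -> (forall x, nm (f x) <= g x) -> cL1 f.
Proof.
move=> [f1 f2] Lg fg; split.
- apply: (L1_dom f1 Lg) => x; exact: le_trans (nm_Re _) (fg x).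
- apply: (L1_dom f2 Lg) => x; exact: le_trans (nm_Im _) (fg x).
Qed.

Lemma cL1D f g : cL1 f -> cL1 g -> cL1 (fun x => f x + g x).
Proof.
move=> [f1 f2] [g1 g2]; split.
- under eq_fun do rewrite ReD; exact: L1D.
- under eq_fun do rewrite ImD; exact: L1D.
Qed.

Lemma cL1N f : cL1 f -> cL1 (fun x => - f x).
Proof.
move=> [f1 f2]; split.
- under eq_fun do rewrite ReN; exact: L1N.
- under eq_fun do rewrite ImN; exact: L1N.
Qed.

Lemma cL1B f g : cL1 f -> cL1 g -> cL1 (fun x => f x - g x).
Proof. by move=> Lf Lg; apply: cL1D => //; exact: cL1N. Qed.

Lemma cL1Z c f : cL1 f -> cL1 (fun x => c * f x).
Proof.
move=> [f1 f2]; split.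
- under eq_fun do rewrite ReM; apply: L1B; exact: L1Z.
- under eq_fun do rewrite ImM; apply: L1D; exact: L1Z.
Qed.

Lemma cL1_bdM (M : R) h f : cmeas h -> bdd h M ->
 cL1 f -> cL1 (fun x => h x * f x).
Proof.
move=> mh hM Lf; apply: (@cL1_dom _ (fun x => M * nm (f x))).
- apply: cmeasM => //; exact: cL1_meas.
- exact: (L1Z _ (L1_nm _)).
- by move=> x; rewrite nmM; apply: ler_wpM2r; rewrite ?nm_ge0.
Qed.

Lemma cL1R (f : pt -> R) : L1 f -> cL1 (fun x => (f x)%:C).
Proof. by move=> Lf; split => //; exact: L1_0. Qed.

Lemma cL1_box (M r : R) f : cmeas f -> bdd f M ->
 (forall x, ~ ball 0 r x -> f x = 0) -> cL1 f.
Proof.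
move=> mf fM f0; apply: (@cL1_dom _ (fun x => M * \1_(ball 0 r) x)) => //.
 exact/L1Z/L1_ball.
move=> x; have [xr|xr] := pselect (ball 0 r x); first by rewrite ind_in// mulr1.
by rewrite f0// nm0 ind_out// mulr0.
Qed.

Lemma Re_cI f : Re (cI f) = I2 (fun x => Re (f x)). Proof. by []. Qed.
Lemma Im_cI f : Im (cI f) = I2 (fun x => Im (f x)). Proof. by []. Qed.

Lemma cI_eq f g : f =1 g -> cI f = cI g.
Proof. by move=> /funext ->. Qed.

Lemma cID f g : cL1 f -> cL1 g -> cI (fun x => f x + g x) = cI f + cI g.
Proof.
move=> [f1 f2] [g1 g2]; apply: cplx_eq; rewrite !reim ?(Re_cI, Im_cI).
- by rewrite -I2D//; apply: I2_eq => x; rewrite ReD.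
- by rewrite -I2D//; apply: I2_eq => x; rewrite ImD.
Qed.

Lemma cIZ c f : cL1 f -> cI (fun x => c * f x) = c * cI f.
Proof.
move=> [f1 f2]; apply: cplx_eq; rewrite !reim ?(Re_cI, Im_cI).
- by rewrite -!I2Z// -I2B; try exact: L1Z; apply: I2_eq => x; rewrite ReM.
- by rewrite -!I2Z// -I2D; try exact: L1Z; apply: I2_eq => x; rewrite ImM.
Qed.

Lemma cIZr c f : cL1 f -> cI (fun x => f x * c) = cI f * c.
Proof. by move=> Lf; rewrite mulrC -cIZ//; apply: cI_eq => x; rewrite mulrC. Qed.

Lemma cIN f : cL1 f -> cI (fun x => - f x) = - cI f.
Proof. by move=> Lf; rewrite -mulN1r -cIZ//; apply: cI_eq => x; rewrite mulN1r. Qed.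

Lemma cIB f g : cL1 f -> cL1 g -> cI (fun x => f x - g x) = cI f - cI g.
Proof. by move=> Lf Lg; rewrite cID ?cIN//; exact: cL1N. Qed.

Lemma cIR (f : pt -> R) : cI (fun x => (f x)%:C) = (I2 f)%:C.
Proof. by apply: cplx_eq; rewrite !reim ?(Re_cI, Im_cI)//= I2_0. Qed.

Lemma cI0 : cI (fun _ : pt => 0) = 0.
Proof. by apply: cplx_eq; rewrite !(Re_cI, Im_cI) /= I2_0. Qed.

(** Rotating by the phase of the integral reduces the complex triangle inequality to a bound of real
    parts. *)
Lemma cI_abs f : cL1 f -> nm (cI f) <= I2 (fun x => nm (f x)).
Proof.
move=> Lf; have [w [w1 _ <-]] := nm_phase (cI f).
rewrite -cIZ// Re_cI; apply: I2_le; [by case: (cL1Z w Lf)|exact: L1_nm|].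
move=> x; apply: (le_trans (Re_le_nm _)); rewrite nmM -[leRHS]mul1r.
by apply: ler_wpM2r; rewrite ?nm_ge0.
Qed.

Lemma cI_affine (h : pt) (r : R) f : r != 0 -> cL1 f ->
 cI (fun x : pt => f (h + r *: x)) = (r ^- 2)%:C * cI f.
Proof.
move=> r0 [f1 f2]; apply: cplx_eq; rewrite !reim ?(Re_cI, Im_cI) mul0r ?subr0 ?addr0.
- exact: (@I2_affine R h r (fun x => Re (f x))).
- exact: (@I2_affine R h r (fun x => Im (f x))).
Qed.

Lemma cL1_affine (h : pt) (r : R) f : r != 0 -> cL1 f -> cL1 (fun x : pt => f (h + r *: x)).
Proof.
by move=> r0 [f1 f2]; split; [exact: (L1_affine h r0 f1)|exact: (L1_affine h r0 f2)].
Qed.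

Lemma cmeas_sub k x : cmeas k -> cmeas (fun y => k (x - y)).
Proof.
move=> [k1 k2]; split.
- by have := meas_sec x (meas_sub k1).
- by have := meas_sec x (meas_sub k2).
Qed.

Lemma cmeas_subr k y : cmeas k -> cmeas (fun x => k (x - y)).
Proof.
move=> [k1 k2]; split.
- by have := meas_sec y (meas_swap (meas_sub k1)).
- by have := meas_sec y (meas_swap (meas_sub k2)).
Qed.

Lemma cL1_conv_in k g (M : R) x : cmeas k -> bdd k M -> cL1 g ->
 cL1 (fun y => k (x - y) * g y).
Proof. by move=> mk kM Lg; apply: (@cL1_bdM M) => //; exact: cmeas_sub. Qed.

Section ReIm.
Variables (k g : pt -> R[i]) (M : R).
Hypotheses (mk : cmeas k) (kM : forall z, nm (k z) <= M) (Lg : cL1 g).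
Let kr z := Re (k z).
Let ki z := Im (k z).
Let gr z := Re (g z).
Let gi z := Im (g z).
Let mkr : mfun kr. Proof. by case: mk. Qed.
Let mki : mfun ki. Proof. by case: mk. Qed.
Let krM z : `|kr z| <= M. Proof. exact: le_trans (nm_Re _) (kM z). Qed.
Let kiM z : `|ki z| <= M. Proof. exact: le_trans (nm_Im _) (kM z). Qed.
Let Lgr : L1 gr. Proof. by case: Lg. Qed.
Let Lgi : L1 gi. Proof. by case: Lg. Qed.

Lemma Re_cnv x : Re (cnv k g x) = rconv kr gr x - rconv ki gi x.
Proof.
rewrite /cnv Re_cI /rconv -I2B; last 2 first.
- exact: (L1_conv_in x mkr krM Lgr).
- exact: (L1_conv_in x mki kiM Lgi).
by apply: I2_eq => y; rewrite ReM.
Qed.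

Lemma Im_cnv x : Im (cnv k g x) = rconv kr gi x + rconv ki gr x.
Proof.
rewrite /cnv Im_cI /rconv -I2D; last 2 first.
- exact: (L1_conv_in x mkr krM Lgi).
- exact: (L1_conv_in x mki kiM Lgr).
by apply: I2_eq => y; rewrite ImM.
Qed.

Lemma cmeas_cnv : cmeas (cnv k g).
Proof.
split.
- rewrite (_ : (fun x => _) = (fun x => rconv kr gr x - rconv ki gi x)).
  apply: measurable_funB; apply: meas_conv => //; exact: L1_meas.
 apply/funext => x; exact: Re_cnv.
- rewrite (_ : (fun x => _) = (fun x => rconv kr gi x + rconv ki gr x)).
  apply: measurable_funD; apply: meas_conv => //; exact: L1_meas.
 apply/funext => x; exact: Im_cnv.
Qed.

Lemma cnv_bd x : nm (cnv k g x) <= M * I2 (fun y => nm (g y)).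
Proof.
apply: (le_trans (cI_abs (cL1_conv_in x mk kM Lg))); rewrite -I2Z; last exact: L1_nm.
apply: I2_le; [exact: (L1_nm (cL1_conv_in x mk kM Lg))|exact: (L1Z _ (L1_nm _))|].
by move=> y; rewrite nmM; apply: ler_wpM2r; rewrite ?nm_ge0.
Qed.
End ReIm.

Lemma I2_BBD (a b c d : pt -> R) : L1 a -> L1 b -> L1 c -> L1 d ->
 I2 (fun x => a x - b x - (c x + d x)) = I2 a - I2 b - (I2 c + I2 d).
Proof.
move=> La Lb Lc Ld; rewrite I2B; [|exact: L1B|exact: L1D].
by rewrite I2B// I2D.
Qed.

Lemma I2_DDB (a b c d : pt -> R) : L1 a -> L1 b -> L1 c -> L1 d ->
 I2 (fun x => a x + b x + (c x - d x)) = I2 a + I2 b + (I2 c - I2 d).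
Proof.
move=> La Lb Lc Ld; rewrite I2D; [|exact: L1D|exact: L1B].
by rewrite I2B// I2D.
Qed.

(** Real and imaginary parts expand into four real convolutions each, to which [conv_swap]
    applies. *)
Lemma cnv_swap k f g (M : R) : cmeas k -> bdd k M -> cL1 f -> cL1 g ->
 cI (fun x => f x * cnv k g x) = cI (fun y => g y * cI (fun x => k (x - y) * f x)).
Proof.
move=> mk kM Lf Lg.
pose kr z := Re (k z); pose ki z := Im (k z).
pose gr z := Re (g z); pose gi z := Im (g z).
pose fr z := Re (f z); pose fi z := Im (f z).
have [mkr mki] : mfun kr /\ mfun ki by case: mk.
have krM z : `|kr z| <= M by exact: le_trans (nm_Re _) (kM z).
have kiM z : `|ki z| <= M by exact: le_trans (nm_Im _) (kM z).
have [Lgr Lgi] : L1 gr /\ L1 gi by case: Lg.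
have [Lfr Lfi] : L1 fr /\ L1 fi by case: Lf.
pose tc (u v : pt -> R) y := I2 (fun x => u (x - y) * v x).
have mtc (u v : pt -> R) : mfun u -> L1 v -> mfun (tc u v).
 move=> mu Lv; apply: (@meas_I2 _ (fun z => u (z.2 - z.1) * v z.2)).
 apply: measurable_funM; last exact: (meas_snd (L1_meas Lv)).
 exact: (meas_swap (meas_sub mu)).
have Ltc_in (u v : pt -> R) (y : pt) : mfun u -> bdr u M -> L1 v ->
  L1 (fun x => u (x - y) * v x).
 move=> mu uM Lv; apply: (@L1_bdM _ M) => //.
 by have := meas_sec y (meas_swap (meas_sub mu)).
have Ltc (u v w : pt -> R) : mfun u -> bdr u M -> L1 v -> L1 w ->
  L1 (fun y => w y * tc u v y).
 move=> mu uM Lv Lw.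
 have -> : (fun y => w y * tc u v y) = (fun y => tc u v y * w y).
  by apply/funext => y; rewrite mulrC.
 apply: (@L1_bdM _ (M * I2 (fun y => `|v y|))) => //; first exact: mtc.
 move=> y; apply: (le_trans (I2_abs (Ltc_in _ _ y mu uM Lv))).
 rewrite -I2Z; last exact: L1_abs.
 apply: I2_le; [exact/L1_abs/Ltc_in|exact/L1Z/L1_abs|].
 by move=> x; rewrite normrM ler_wpM2r.
have Lcv (u v w : pt -> R) : mfun u -> bdr u M -> L1 v -> L1 w ->
  L1 (fun y => w y * rconv u v y).
 move=> mu uM Lv Lw.
 have -> : (fun y => w y * rconv u v y) = (fun y => rconv u v y * w y).
  by apply/funext => y; rewrite mulrC.
 apply: (@L1_bdM _ (M * I2 (fun y => `|v y|))) => //.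
  apply: meas_conv => //; exact: L1_meas.
 move=> y; exact: conv_bd.
have Rtc y : Re (cI (fun x => k (x - y) * f x)) = tc kr fr y - tc ki fi y.
 by rewrite Re_cI /tc -I2B; try exact: Ltc_in; apply: I2_eq => x; rewrite ReM.
have Itc y : Im (cI (fun x => k (x - y) * f x)) = tc kr fi y + tc ki fr y.
 by rewrite Im_cI /tc -I2D; try exact: Ltc_in; apply: I2_eq => x; rewrite ImM.
have sw (u v w : pt -> R) : mfun u -> bdr u M -> L1 v -> L1 w ->
  I2 (fun x => v x * rconv u w x) = I2 (fun y => w y * tc u v y).
 move=> mu uM Lv Lw; exact: (conv_swap mu uM).
apply: cplx_eq.
- rewrite -[LHS]/(I2 (fun x => Re (f x * cnv k g x))).
 rewrite -[RHS]/(I2 (fun y => Re (g y * cI (fun x => k (x - y) * f x)))).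
 transitivity ((I2 (fun x => fr x * rconv kr gr x) - I2 (fun x => fr x * rconv ki gi x)) -
  (I2 (fun x => fi x * rconv kr gi x) + I2 (fun x => fi x * rconv ki gr x))).
  rewrite -I2_BBD; try exact: Lcv.
  apply: I2_eq => x; rewrite ReM (Re_cnv mk kM Lg) (Im_cnv mk kM Lg) -/kr -/ki /fr /fi.
  by ring.
 rewrite !sw//.
 rewrite -I2_BBD; try exact: Ltc.
 by apply: I2_eq => y; rewrite ReM Rtc Itc -/kr -/ki /gr /gi; ring.
- rewrite -[LHS]/(I2 (fun x => Im (f x * cnv k g x))).
 rewrite -[RHS]/(I2 (fun y => Im (g y * cI (fun x => k (x - y) * f x)))).
 transitivity ((I2 (fun x => fr x * rconv kr gi x) + I2 (fun x => fr x * rconv ki gr x)) +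
  (I2 (fun x => fi x * rconv kr gr x) - I2 (fun x => fi x * rconv ki gi x))).
  rewrite -I2_DDB; try exact: Lcv.
  apply: I2_eq => x; rewrite ImM (Re_cnv mk kM Lg) (Im_cnv mk kM Lg) -/kr -/ki /fr /fi.
  by ring.
 rewrite !sw//.
 rewrite -I2_DDB; try exact: Ltc.
 by apply: I2_eq => y; rewrite ImM Rtc Itc -/kr -/ki /gr /gi; ring.
Qed.
End ComplexIntegral.

(** * Functions of class C^{1,1} *)

Section C11.
Context {R : realType}.
Local Notation pt := (R * R)%type.
Implicit Types (f g : pt -> R[i]) (z h : pt).

Lemma norm_fst (h : pt) : `|h.1| <= `|h|.
Proof. by rewrite prod_normE le_max lexx. Qed.
Lemma norm_snd (h : pt) : `|h.2| <= `|h|.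
Proof. by rewrite prod_normE le_max lexx orbT. Qed.
Lemma norm_ptP (h : pt) (r : R) : `|h| <= r <-> `|h.1| <= r /\ `|h.2| <= r.
Proof. by rewrite prod_normE ge_max; split=> [/andP[]|[-> ->]]. Qed.
Lemma norm_pt_ltP (h : pt) (r : R) : `|h| < r <-> `|h.1| < r /\ `|h.2| < r.
Proof. by rewrite prod_normE gt_max; split=> [/andP[]|[-> ->]]. Qed.
Lemma ball0E (r : R) (z : pt) : ball 0 r z <-> `|z| < r.
Proof. by rewrite -ball_normE /ball_ /= sub0r normrN. Qed.

Lemma nball0 (r : R) (z : pt) : ~ ball 0 r z -> r <= `|z|.
Proof. by rewrite leNgt => h; apply/negP => /ball0E. Qed.

Lemma le_nmD (x y : R[i]) (a b : R) : nm x <= a -> nm y <= b -> nm (x + y) <= a + b.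
Proof. by move=> xa yb; apply: (le_trans (nmD _ _)); exact: lerD. Qed.
Lemma le_nmM (x y : R[i]) (a b : R) : nm x <= a -> nm y <= b -> nm (x * y) <= a * b.
Proof. by move=> xa yb; rewrite nmM; apply: ler_pM => //; exact: nm_ge0. Qed.
Lemma le_nm_lin (x y : R[i]) (a b : R) (h : pt) : nm x <= a -> nm y <= b ->
 nm (x * h.1%:C + y * h.2%:C) <= (a + b) * `|h|.
Proof.
by move=> xa yb; rewrite mulrDl; apply: le_nmD; apply: le_nmM => //;
 rewrite nmR ?norm_fst ?norm_snd.
Qed.

(* [f] has partial derivatives [f1], [f2] that are Lipschitz on bounded sets, with the
  quadratic Taylor estimate. *)
Definition C11 f f1 f2 : Prop := forall r : R, exists C : R, 0 <= C /\
 forall z h, `|z| <= r -> `|z + h| <= r ->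
 [/\ nm (f (z + h) - f z - (f1 z * h.1%:C + f2 z * h.2%:C)) <= C * `|h| ^+ 2,
   nm (f1 (z + h) - f1 z) <= C * `|h| & nm (f2 (z + h) - f2 z) <= C * `|h|].

Definition supp (r : R) f := forall z, r <= `|z| -> f z = 0.
(** Test functions carry their partial derivatives as data, so that convolutions and products are
    differentiated by exhibiting formulas; [C11r_diff] later connects this with [derive]. *)
Definition TF (r : R) f f1 f2 := [/\ C11 f f1 f2, supp r f, supp r f1 & supp r f2].

Lemma C11_bound f f1 f2 (r : R) : C11 f f1 f2 -> exists M : R, 0 <= M /\
 forall z, `|z| <= r -> [/\ nm (f z) <= M, nm (f1 z) <= M & nm (f2 z) <= M].
Proof.
move=> Cf; have [r0|r0] := ltP r 0.
 by exists 0; split => // z zr; have := le_lt_trans (le_trans (normr_ge0 z) zr) r0; rewrite ltxx.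
have [C [C0 hC]] := Cf r.
pose A := nm (f 0) + nm (f1 0) + nm (f2 0).
have A0 : 0 <= A by rewrite !addr_ge0 ?nm_ge0.
have := (nm_ge0 (f 0), nm_ge0 (f1 0), nm_ge0 (f2 0)); case=> [[a0 a1] a2].
exists (A + C * r ^+ 2 + C * r + A * r); split; first by rewrite !addr_ge0// ?mulr_ge0// exprn_ge0.
have Cr : 0 <= C * r by rewrite mulr_ge0.
have Cr2 : 0 <= C * r ^+ 2 by rewrite mulr_ge0// exprn_ge0.
have Ar : 0 <= A * r by rewrite mulr_ge0.
move=> z zr; have [||] := hC 0 z; rewrite ?normr0 ?add0r// => h h1 h2.
have z2 : C * `|z| ^+ 2 <= C * r ^+ 2 by apply: ler_wpM2l => //; rewrite ler_pXn2r ?nnegrE.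
have z1 : C * `|z| <= C * r by apply: ler_wpM2l.
split.
- have -> : f z = f z - f 0 - (f1 0 * z.1%:C + f2 0 * z.2%:C) + (f 0 + (f1 0 * z.1%:C + f2 0 * z.2%:C)) by ring.
 have hl := le_nm_lin z (lexx (nm (f1 0))) (lexx (nm (f2 0))).
 have hl2 : (nm (f1 0) + nm (f2 0)) * `|z| <= A * r.
  by apply: ler_pM => //; rewrite ?addr_ge0// /A; lra.
 have hh := le_nmD h (le_nmD (lexx (nm (f 0))) (le_trans hl hl2)).
 by apply: (le_trans hh); rewrite /A in Ar *; lra.
- have -> : f1 z = f1 z - f1 0 + f1 0 by ring.
 by have := le_nmD h1 (lexx (nm (f1 0))); move=> hh; apply: (le_trans hh); rewrite /A in Ar *; lra.
- have -> : f2 z = f2 z - f2 0 + f2 0 by ring.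
 by have := le_nmD h2 (lexx (nm (f2 0))); move=> hh; apply: (le_trans hh); rewrite /A in Ar *; lra.
Qed.

Lemma C11_lip f f1 f2 (r : R) : C11 f f1 f2 -> exists L : R, 0 <= L /\
 forall z h, `|z| <= r -> `|z + h| <= r -> nm (f (z + h) - f z) <= L * `|h|.
Proof.
move=> Cf; have [M [M0 hM]] := C11_bound r Cf; have [C [C0 hC]] := Cf r.
have [r0|r0] := ltP r 0.
 by exists 0; split => // z h zr; have := le_lt_trans (le_trans (normr_ge0 z) zr) r0; rewrite ltxx.
exists (C * (r + r) + (M + M)); split; first by rewrite !addr_ge0// mulr_ge0// addr_ge0.
move=> z h zr hr; have [e _ _] := hC z h zr hr; have [_ b1 b2] := hM z zr.
have -> : f (z + h) - f z = f (z + h) - f z - (f1 z * h.1%:C + f2 z * h.2%:C) + (f1 z * h.1%:C + f2 z * h.2%:C) by ring.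
apply: (le_trans (le_nmD e (le_nm_lin h b1 b2))).
rewrite [leRHS]mulrDl lerD2r expr2 mulrA; apply: ler_wpM2r => //; apply: ler_wpM2l => //.
by have := ler_normB (z + h) z; rewrite addrC addKr => hh; apply: (le_trans hh); exact: lerD.
Qed.

Lemma C11_cst (c : R[i]) : C11 (fun _ => c) (fun _ => 0) (fun _ => 0).
Proof.
move=> r; exists 0; split => // z h _ _.
by rewrite !subrr !mul0r addr0 subr0 nm0.
Qed.

Lemma C11_x : C11 (fun z => z.1%:C) (fun _ => 1) (fun _ => 0).
Proof.
move=> r; exists 0; split => // z h _ _; rewrite !subrr nm0 !mul0r; split => //.
have -> : (z + h).1%:C - z.1%:C - (1 * h.1%:C + 0) = 0 :> R[i] by apply: cplx_eq; rewrite !reim /=; ring.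
by rewrite nm0.
Qed.

Lemma C11_y : C11 (fun z => z.2%:C) (fun _ => 0) (fun _ => 1).
Proof.
move=> r; exists 0; split => // z h _ _; rewrite !subrr !mul0r !nm0; split => //.
have -> : (z + h).2%:C - z.2%:C - (0 + 1 * h.2%:C) = 0 :> R[i] by apply: cplx_eq; rewrite !reim /=; ring.
by rewrite nm0.
Qed.

Lemma C11_eq f f1 f2 g g1 g2 : f =1 g -> f1 =1 g1 -> f2 =1 g2 -> C11 f f1 f2 -> C11 g g1 g2.
Proof. by move=> /funext -> /funext -> /funext ->. Qed.

Lemma C11_D f f1 f2 g g1 g2 : C11 f f1 f2 -> C11 g g1 g2 ->
 C11 (fun z => f z + g z) (fun z => f1 z + g1 z) (fun z => f2 z + g2 z).
Proof.
move=> Cf Cg r; have [C [C0 hC]] := Cf r; have [D [D0 hD]] := Cg r.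
exists (C + D); split; first exact: addr_ge0.
move=> z h zr hr; have [a a1 a2] := hC z h zr hr; have [b b1 b2] := hD z h zr hr.
rewrite !mulrDl; split.
- apply: le_trans (le_nmD a b); apply: eq_ler; congr nm; ring.
- apply: le_trans (le_nmD a1 b1); apply: eq_ler; congr nm; ring.
- apply: le_trans (le_nmD a2 b2); apply: eq_ler; congr nm; ring.
Qed.

Lemma C11_M f f1 f2 g g1 g2 : C11 f f1 f2 -> C11 g g1 g2 ->
 C11 (fun z => f z * g z) (fun z => f1 z * g z + f z * g1 z) (fun z => f2 z * g z + f z * g2 z).
Proof.
move=> Cf Cg r; have [C [C0 hC]] := Cf r; have [D [D0 hD]] := Cg r.
have [L [L0 hL]] := C11_lip r Cf; have [K [K0 hK]] := C11_lip r Cg.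
have [M [M0 hM]] := C11_bound r Cf; have [N [N0 hN]] := C11_bound r Cg.
exists (M * D + C * N + L * K + M * K + L * N); split.
 by rewrite !addr_ge0// mulr_ge0.
move=> z h zr hr; have [a a1 a2] := hC z h zr hr; have [b b1 b2] := hD z h zr hr.
have ll := hL z h zr hr; have kk := hK z h zr hr.
have [m m1 m2] := hM z zr; have [n n1 n2] := hN z zr.
have [m' _ _] := hM _ hr; have [n' n1' n2'] := hN _ hr.
have hp : 0 <= `|h| by [].
split.
- have -> : f (z + h) * g (z + h) - f z * g z -
  ((f1 z * g z + f z * g1 z) * h.1%:C + (f2 z * g z + f z * g2 z) * h.2%:C) =
  f z * (g (z + h) - g z - (g1 z * h.1%:C + g2 z * h.2%:C)) +
  (f (z + h) - f z - (f1 z * h.1%:C + f2 z * h.2%:C)) * g z +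
  (f (z + h) - f z) * (g (z + h) - g z) by ring.
 have := le_nmD (le_nmD (le_nmM m b) (le_nmM a n)) (le_nmM ll kk).
 move=> hh; apply: (le_trans hh).
 have := mulr_ge0 (mulr_ge0 M0 K0) (sqr_ge0 `|h|).
 have := mulr_ge0 (mulr_ge0 L0 N0) (sqr_ge0 `|h|).
 by rewrite !expr2; nra.
- have -> : f1 (z + h) * g (z + h) + f (z + h) * g1 (z + h) - (f1 z * g z + f z * g1 z) =
  f1 z * (g (z + h) - g z) + (f1 (z + h) - f1 z) * g (z + h) +
  ((f (z + h) - f z) * g1 (z + h) + f z * (g1 (z + h) - g1 z)) by ring.
 have := le_nmD (le_nmD (le_nmM m1 kk) (le_nmM a1 n')) (le_nmD (le_nmM ll n1') (le_nmM m b1)).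
 move=> hh; apply: (le_trans hh).
 have := mulr_ge0 (mulr_ge0 L0 K0) hp.
 by nra.
- have -> : f2 (z + h) * g (z + h) + f (z + h) * g2 (z + h) - (f2 z * g z + f z * g2 z) =
  f2 z * (g (z + h) - g z) + (f2 (z + h) - f2 z) * g (z + h) +
  ((f (z + h) - f z) * g2 (z + h) + f z * (g2 (z + h) - g2 z)) by ring.
 have := le_nmD (le_nmD (le_nmM m2 kk) (le_nmM a2 n')) (le_nmD (le_nmM ll n2') (le_nmM m b2)).
 move=> hh; apply: (le_trans hh).
 have := mulr_ge0 (mulr_ge0 L0 K0) hp.
 by nra.
Qed.

Lemma C11_Z (c : R[i]) f f1 f2 : C11 f f1 f2 ->
 C11 (fun z => c * f z) (fun z => c * f1 z) (fun z => c * f2 z).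
Proof.
move=> Cf; apply: C11_eq (C11_M (C11_cst c) Cf) => z //=; by rewrite mul0r add0r.
Qed.

Lemma C11_cj f f1 f2 : C11 f f1 f2 -> C11 (fun z => cj (f z)) (fun z => cj (f1 z)) (fun z => cj (f2 z)).
Proof.
move=> Cf r; have [C [C0 hC]] := Cf r; exists C; split => // z h zr hr.
have [a a1 a2] := hC z h zr hr; split; rewrite -nmcj.
- apply: le_trans a; apply: eq_ler; congr nm.
 by cplx_ring.
- apply: le_trans a1; apply: eq_ler; congr nm.
 by cplx_ring.
- apply: le_trans a2; apply: eq_ler; congr nm.
 by cplx_ring.
Qed.

Lemma C11_affine f f1 f2 (p : pt) (c : R) : C11 f f1 f2 ->
 C11 (fun z => f (p + c *: z)) (fun z => c%:C * f1 (p + c *: z)) (fun z => c%:C * f2 (p + c *: z)).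
Proof.
move=> Cf r; have [C [C0 hC]] := Cf (`|p| + `|c| * r).
exists (C * `|c| ^+ 2); split; first by rewrite mulr_ge0// exprn_ge0.
have inr z : `|z| <= r -> `|p + c *: z| <= `|p| + `|c| * r.
 move=> zr; apply: (le_trans (ler_normD _ _)); rewrite lerD2l normrZ.
 exact: ler_wpM2l.
move=> z h zr hr; have E : p + c *: (z + h) = (p + c *: z) + c *: h by rewrite scalerDr addrA.
have [|a a1 a2] := hC (p + c *: z) (c *: h) (inr _ zr); first by rewrite -E; exact: inr.
rewrite E; rewrite normrZ in a a1 a2; split.
- apply: le_trans (_ : C * (`|c| * `|h|) ^+ 2 <= _); last by rewrite exprMn mulrA.
 apply: le_trans a; apply: eq_ler; congr nm.
 by rewrite /= !rmorphM/=; ring.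
- rewrite -mulrBr nmM nmR; apply: (le_trans (ler_wpM2l (normr_ge0 c) a1)).
 by apply: eq_ler; ring.
- rewrite -mulrBr nmM nmR; apply: (le_trans (ler_wpM2l (normr_ge0 c) a2)).
 by apply: eq_ler; ring.
Qed.

Definition C11R (p p' : R -> R) : Prop := forall r : R, exists C : R, 0 <= C /\
 forall t u, `|t| <= r -> `|u| <= r ->
 `|p u - p t - p' t * (u - t)| <= C * (u - t) ^+ 2 /\ `|p' u - p' t| <= C * `|u - t|.

Lemma C11_comp (p p' : R -> R) (g g1 g2 : pt -> R) : C11R p p' ->
 C11 (fun z => (g z)%:C) (fun z => (g1 z)%:C) (fun z => (g2 z)%:C) ->
 C11 (fun z => (p (g z))%:C) (fun z => (p' (g z) * g1 z)%:C) (fun z => (p' (g z) * g2 z)%:C).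
Proof.
move=> Cp Cg r; have [D [D0 hD]] := Cg r; have [L [L0 hL]] := C11_lip r Cg.
have [N [N0 hN]] := C11_bound r Cg; have [C [C0 hC]] := Cp N.
pose M := `|p' 0| + C * N.
have hM t : `|t| <= N -> `|p' t| <= M.
 move=> tN; have [||_ h] := hC 0 t; rewrite ?normr0//.
 have -> : p' t = p' t - p' 0 + p' 0 by ring.
 apply: (le_trans (ler_normD _ _)); rewrite /M addrC lerD2l; apply: (le_trans h).
 by rewrite subr0 ler_wpM2l.
have M0 : 0 <= M by rewrite addr_ge0// mulr_ge0.
exists (C * L ^+ 2 + M * D + C * L * N); split.
 by rewrite !addr_ge0// !mulr_ge0// exprn_ge0.
move=> z h zr hr; have [b b1 b2] := hD z h zr hr.
have ll := hL z h zr hr; have [n n1 n2] := hN z zr; have [n' n1' n2'] := hN _ hr.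
rewrite -?rmorphB/= in ll b b1 b2; rewrite -?(rmorphM, rmorphB, rmorphD)/= in ll b b1 b2 n n1 n2 n' n1' n2' *.
rewrite !nmR in ll b b1 b2 n n1 n2 n' n1' n2' *.
have [c c'] := hC _ _ n n'; have mm := hM _ n.
have ll2 : (g (z + h) - g z) ^+ 2 <= L ^+ 2 * `|h| ^+ 2.
 by rewrite -exprMn -[X in X <= _]real_normK ?num_real// ler_pXn2r ?nnegrE// mulr_ge0.
have h2 := sqr_ge0 `|h|; have h1 := normr_ge0 h.
split.
- have -> : p (g (z + h)) - p (g z) - (p' (g z) * g1 z * h.1 + p' (g z) * g2 z * h.2) =
  (p (g (z + h)) - p (g z) - p' (g z) * (g (z + h) - g z)) +
  p' (g z) * (g (z + h) - g z - (g1 z * h.1 + g2 z * h.2)) by ring.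
 apply: (le_trans (ler_normD _ _)); rewrite normrM.
 have q1 := le_trans c (ler_wpM2l C0 ll2).
 have q2 : `|p' (g z)| * `|g (z + h) - g z - (g1 z * h.1 + g2 z * h.2)| <= M * (D * `|h| ^+ 2).
  exact: ler_pM.
 apply: (le_trans (lerD q1 q2)); have := mulr_ge0 (mulr_ge0 (mulr_ge0 C0 L0) N0) h2; clear; lra.
- have -> : p' (g (z + h)) * g1 (z + h) - p' (g z) * g1 z =
  (p' (g (z + h)) - p' (g z)) * g1 (z + h) + p' (g z) * (g1 (z + h) - g1 z) by ring.
 apply: (le_trans (ler_normD _ _)); rewrite !normrM.
 have q1 : `|p' (g (z + h)) - p' (g z)| * `|g1 (z + h)| <= C * (L * `|h|) * N.
  by apply: ler_pM => //; apply: (le_trans c'); apply: ler_wpM2l.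
 have q2 : `|p' (g z)| * `|g1 (z + h) - g1 z| <= M * (D * `|h|) by apply: ler_pM.
 apply: (le_trans (lerD q1 q2)); have := mulr_ge0 (mulr_ge0 C0 (sqr_ge0 L)) h1; clear; lra.
- have -> : p' (g (z + h)) * g2 (z + h) - p' (g z) * g2 z =
  (p' (g (z + h)) - p' (g z)) * g2 (z + h) + p' (g z) * (g2 (z + h) - g2 z) by ring.
 apply: (le_trans (ler_normD _ _)); rewrite !normrM.
 have q1 : `|p' (g (z + h)) - p' (g z)| * `|g2 (z + h)| <= C * (L * `|h|) * N.
  by apply: ler_pM => //; apply: (le_trans c'); apply: ler_wpM2l.
 have q2 : `|p' (g z)| * `|g2 (z + h) - g2 z| <= M * (D * `|h|) by apply: ler_pM.
 apply: (le_trans (lerD q1 q2)); have := mulr_ge0 (mulr_ge0 C0 (sqr_ge0 L)) h1; clear; lra.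
Qed.

Lemma lip_continuous (g : pt -> R) : (forall r, exists L : R, 0 <= L /\
  forall z h, `|z| <= r -> `|z + h| <= r -> `|g (z + h) - g z| <= L * `|h|) -> continuous g.
Proof.
move=> gl z; have [L [L0 hL]] := gl (`|z| + 1).
apply/cvgrPdist_lt => e e0.
have d0 : 0 < Num.min 1 (e / (L + 1)) by rewrite lt_min ltr01 divr_gt0// ltr_wpDl.
apply: filterS (nbhsx_ballx z (Num.min 1 (e / (L + 1))) d0) => y; rewrite -ball_normE /ball_ /= distrC lt_min => /andP[y1 y2].
have -> : y = z + (y - z) by rewrite addrC subrK.
rewrite distrC; apply: le_lt_trans (hL z (y - z) _ _) _; rewrite ?lerDl//.
 by apply: (le_trans (ler_normD _ _)); rewrite lerD2l ltW.
apply: (@le_lt_trans _ _ ((L + 1) * `|y - z|)); first by rewrite ler_wpM2r// lerDl.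
by rewrite mulrC -ltr_pdivlMr// ltr_wpDl.
Qed.

Lemma continuous2_measurable (g : pt -> R) : continuous g -> mfun g.
Proof.
move=> /continuousP cg; apply: (measurability _ (RGenOpens.measurableE R)).
move=> _ [_ [a [b ->] <-]]; rewrite setTI; apply: open2_meas.
exact/cg/interval_open.
Qed.

Lemma clip_cmeas f : (forall r, exists L : R, 0 <= L /\
  forall z h, `|z| <= r -> `|z + h| <= r -> nm (f (z + h) - f z) <= L * `|h|) -> cmeas f.
Proof.
move=> fl; split; apply: continuous2_measurable; apply: lip_continuous => r;
 have [L [L0 hL]] := fl r; exists L; split=> // z h zr hr; apply: le_trans (hL z h zr hr).
- by rewrite -ReB nm_Re.
- by rewrite -ImB nm_Im.
Qed.

Lemma C11_cmeas f f1 f2 : C11 f f1 f2 -> [/\ cmeas f, cmeas f1 & cmeas f2].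
Proof.
move=> Cf; split; apply: clip_cmeas => r.
- exact: C11_lip Cf.
- by have [C [C0 hC]] := Cf r; exists C; split => // z h zr hr; case: (hC z h zr hr).
- by have [C [C0 hC]] := Cf r; exists C; split => // z h zr hr; case: (hC z h zr hr).
Qed.

Lemma supp_ball (r : R) f : supp r f -> forall z, ~ ball 0 r z -> f z = 0.
Proof. by move=> sf z hz; apply: sf; exact: nball0. Qed.

Lemma suppM (r : R) f g : supp r f -> supp r (fun z => f z * g z).
Proof. by move=> sf z zr; rewrite sf// mul0r. Qed.
Lemma suppMr (r : R) f g : supp r f -> supp r (fun z => g z * f z).
Proof. by move=> sf z zr; rewrite sf// mulr0. Qed.
Lemma suppD (r : R) f g : supp r f -> supp r g -> supp r (fun z => f z + g z).
Proof. by move=> sf sg z zr; rewrite sf// sg// add0r. Qed.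
Lemma suppW (r s : R) f : r <= s -> supp r f -> supp s f.
Proof. by move=> rs sf z zr; apply: sf; exact: le_trans zr. Qed.

Lemma bd_supp_cL1 (M r : R) f : cmeas f -> (forall z, `|z| <= r -> nm (f z) <= M) -> supp r f -> cL1 f.
Proof.
move=> mf fM sf; apply: (@cL1_box _ (Num.max M 0) r) => //; last exact: supp_ball.
move=> z; rewrite le_max; have [zr|zr] := leP `|z| r; first by rewrite fM.
by rewrite sf ?nm0 ?lexx ?orbT// ltW.
Qed.

Lemma TF_cL1 r f f1 f2 : TF r f f1 f2 -> [/\ cL1 f, cL1 f1 & cL1 f2].
Proof.
move=> [Cf s s1 s2]; have [m m1 m2] := C11_cmeas Cf.
have [M [M0 hM]] := C11_bound r Cf.
by split; apply: (@bd_supp_cL1 M r) => // z zr; case: (hM z zr).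
Qed.

Lemma TF_M r f f1 f2 g g1 g2 : TF r f f1 f2 -> C11 g g1 g2 ->
 TF r (fun z => f z * g z) (fun z => f1 z * g z + f z * g1 z) (fun z => f2 z * g z + f z * g2 z).
Proof.
move=> [Cf s s1 s2] Cg; split; first exact: C11_M.
- exact: suppM.
- apply: suppD; exact: suppM.
- apply: suppD; exact: suppM.
Qed.

Lemma TF_W r s f f1 f2 : r <= s -> TF r f f1 f2 -> TF s f f1 f2.
Proof. by move=> rs [Cf a b c]; split => //; exact: suppW rs _. Qed.

Lemma eq0_small (x K : R) : 0 <= x -> (forall t, 0 < t <= 1 -> x <= K * t) -> x = 0.
Proof.
move=> x0 hx; apply/eqP; rewrite eq_le x0 andbT leNgt; apply/negP => xp.
have K1 : x <= K by have := hx 1; rewrite ltr01 lexx mulr1; apply.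
have Kp : 0 < K by exact: lt_le_trans xp K1.
have h1 : 0 < x / (2 * K) <= 1.
 rewrite divr_gt0//= ?mulr_gt0// ler_pdivrMr ?mulr_gt0// mul1r.
 by apply: (le_trans K1); lra.
have E : K * (x / (2 * K)) = x / 2 by field; rewrite gt_eqF.
have := hx _ h1; rewrite E; lra.
Qed.

(* By translation invariance, [0] is the integral of the difference quotients. *)
Lemma cI_partial r f f1 f2 (e : pt) : 0 <= r -> `|e| = 1 -> TF r f f1 f2 ->
 cI (fun z => f1 z * e.1%:C + f2 z * e.2%:C) = 0.
Proof.
move=> r0 e1 Tf; have [Cf s s1 s2] := Tf; have [L L1 L2] := TF_cL1 Tf.
have [C [C0 hC]] := Cf (r + 2).
have LD : cL1 (fun z => f1 z * e.1%:C + f2 z * e.2%:C).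
 apply: cL1D; under eq_fun do rewrite mulrC; exact: cL1Z.
apply: nm_eq0; apply: (@eq0_small _ (C * (2 * (r + 2)) ^+ 2)); first exact: nm_ge0.
move=> t /andP[t0 t1]; rewrite -(ler_pM2l t0).
have te : `|t *: e| = t by rewrite normrZ e1 mulr1 ger0_norm// ltW.
pose d z := f (t *: e + 1 *: z) - f z - t%:C * (f1 z * e.1%:C + f2 z * e.2%:C).
have LT : cL1 (fun z : pt => f (t *: e + 1 *: z)) by apply: cL1_affine.
have Ed : cI d = - (t%:C * cI (fun z => f1 z * e.1%:C + f2 z * e.2%:C)).
 rewrite /d cIB; [|exact: cL1B|exact: cL1Z].
 rewrite cIB// cI_affine// cIZ// expr1n invr1 mul1r subrr sub0r//.
have -> : t * nm (cI (fun z => f1 z * e.1%:C + f2 z * e.2%:C)) = nm (cI d).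
 by rewrite Ed nmN nmM nmR ger0_norm// ltW.
have Lcd : cL1 d by apply: cL1B; [exact: cL1B|exact: cL1Z].
apply: (le_trans (cI_abs Lcd)).
have -> : t * (C * (2 * (r + 2)) ^+ 2 * t) = (C * t ^+ 2) * (2 * (r + 2)) ^+ 2 by ring.
rewrite -(@I2_ball R 0 (r + 2)); last by rewrite addr_ge0.
rewrite -I2Z; last exact: L1_ball.
apply: I2_le; [exact: L1_nm|exact/L1Z/L1_ball|].
move=> z; have [zr|zr] := ltP `|z| (r + 1).
 rewrite ind_in; last by apply/ball0E; lra.
 rewrite mulr1.
 have zr2 : `|z| <= r + 2 by lra.
 have hr2 : `|z + t *: e| <= r + 2 by apply: (le_trans (ler_normD _ _)); lra.
 have [h _ _] := hC z (t *: e) zr2 hr2; rewrite te in h.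
 apply: le_trans h; apply: eq_ler; congr nm.
 by rewrite /d scale1r (addrC z) /= !rmorphM/=; ring.
have z1 : r <= `|z| by lra.
have z2 : r <= `|t *: e + z|.
 have := ler_normB (t *: e + z) (t *: e); rewrite addrAC subrr add0r te; lra.
rewrite /d scale1r s// s1// s2// s// !mul0r addr0 mulr0 !subr0 nm0.
by rewrite mulr_ge0// mulr_ge0// exprn_ge0// ltW.
Qed.

Lemma norm_e1 : `|((1, 0) : pt)| = 1.
Proof. by rewrite prod_normE /= normr1 normr0 max_l. Qed.
Lemma norm_e2 : `|((0, 1) : pt)| = 1.
Proof. by rewrite prod_normE /= normr1 normr0 max_r. Qed.

Lemma cI_d1 r f f1 f2 : 0 <= r -> TF r f f1 f2 -> cI f1 = 0.
Proof.
move=> r0 Tf; rewrite -[RHS](cI_partial r0 norm_e1 Tf); apply: cI_eq => z /=.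
by rewrite mulr1 mulr0 addr0.
Qed.
Lemma cI_d2 r f f1 f2 : 0 <= r -> TF r f f1 f2 -> cI f2 = 0.
Proof.
move=> r0 Tf; rewrite -[RHS](cI_partial r0 norm_e2 Tf); apply: cI_eq => z /=.
by rewrite mulr1 mulr0 add0r.
Qed.

(** All derivatives fall on the kernel, so [g] need only be integrable. Its bounded support confines
    [z - y] to the ball of radius [r + r0], where one constant for [k] is available. *)
Lemma C11_cnv k k1 k2 g (M r0 : R) : C11 k k1 k2 ->
 bdd k M -> bdd k1 M -> bdd k2 M ->
 cL1 g -> supp r0 g -> C11 (cnv k g) (cnv k1 g) (cnv k2 g).
Proof.
move=> Ck kM k1M k2M Lg sg r; have [m m1 m2] := C11_cmeas Ck.
have [C [C0 hC]] := Ck (r + r0).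
exists (C * I2 (fun y => nm (g y))); split.
 rewrite mulr_ge0//; apply: I2_ge0 => y; exact: nm_ge0.
have est (u : pt -> R[i]) (b : R) : cL1 (fun y => u y * g y) ->
  (forall y, `|y| < r0 -> nm (u y) <= b) -> 0 <= b ->
  nm (cI (fun y => u y * g y)) <= b * I2 (fun y => nm (g y)).
 move=> Lu ub b0; apply: (le_trans (cI_abs Lu)); rewrite -I2Z; last exact: L1_nm.
 apply: I2_le; [exact: L1_nm|exact: (L1Z _ (L1_nm Lg))|].
 move=> y; rewrite nmM; have [yr|yr] := ltP `|y| r0.
  by apply: ler_wpM2r; rewrite ?nm_ge0 ?ub.
 by rewrite sg// nm0 !mulr0.
have Lk x := cL1_conv_in x m kM Lg.
have Lk1 x := cL1_conv_in x m1 k1M Lg.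
have Lk2 x := cL1_conv_in x m2 k2M Lg.
move=> z h zr hr.
have inr (y : pt) (w : pt) : `|w| <= r -> `|y| < r0 -> `|w - y| <= r + r0.
 move=> wr yr; apply: (le_trans (ler_normB _ _)); apply: lerD => //; exact: ltW.
have E y : z + h - y = (z - y) + h by rewrite addrAC.
split.
- rewrite /cnv -cIB// -cIZr// -[X in _ - (_ + X)]cIZr// -cID; last 2 first.
 + by under eq_fun do rewrite mulrC; exact: cL1Z.
 + by under eq_fun do rewrite mulrC; exact: cL1Z.
 rewrite -cIB; last 2 first.
 + exact: cL1B.
 + by apply: cL1D; under eq_fun do rewrite mulrC; exact: cL1Z.
 have eqf : (fun y => k (z + h - y) * g y - k (z - y) * g y -
   (k1 (z - y) * g y * h.1%:C + k2 (z - y) * g y * h.2%:C)) =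
   (fun y => (k ((z - y) + h) - k (z - y) - (k1 (z - y) * h.1%:C + k2 (z - y) * h.2%:C)) * g y).
  by apply/funext => y; rewrite E; ring.
 rewrite eqf mulrAC; apply: est; last by rewrite mulr_ge0// exprn_ge0.
  rewrite -eqf; apply: cL1B; first exact: cL1B.
  apply: cL1D; under eq_fun do rewrite mulrC; exact: cL1Z.
 by move=> y yr; have [] := hC (z - y) h (inr _ _ zr yr) _; rewrite -?E; first exact: inr.
- rewrite /cnv -cIB//.
 have eqf : (fun y => k1 (z + h - y) * g y - k1 (z - y) * g y) =
   (fun y => (k1 ((z - y) + h) - k1 (z - y)) * g y).
  by apply/funext => y; rewrite E; ring.
 rewrite eqf mulrAC; apply: est; last by rewrite mulr_ge0.
  rewrite -eqf; exact: cL1B.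
 by move=> y yr; have [] := hC (z - y) h (inr _ _ zr yr) _; rewrite -?E; first exact: inr.
- rewrite /cnv -cIB//.
 have eqf : (fun y => k2 (z + h - y) * g y - k2 (z - y) * g y) =
   (fun y => (k2 ((z - y) + h) - k2 (z - y)) * g y).
  by apply/funext => y; rewrite E; ring.
 rewrite eqf mulrAC; apply: est; last by rewrite mulr_ge0.
  rewrite -eqf; exact: cL1B.
 by move=> y yr; have [] := hC (z - y) h (inr _ _ zr yr) _; rewrite -?E; first exact: inr.
Qed.
End C11.

(** * Mollified Cauchy and Beurling kernels *)

Section Kernels.
Context {R : realType}.
Local Notation pt := (R * R)%type.
Implicit Types (s t u : R) (z : pt).

Definition pw (A B : R -> R) s := if s < 1 then A s else B s.

(** Across the junction the expansion is made in two stages through the point 1, where values and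
    derivatives match; the cross term accounts for the larger constant. *)
Lemma C11R_glue (A A' B B' : R -> R) (C : R) : 0 <= C ->
 (forall t u, t <= 1 -> u <= 1 ->
   `|A u - A t - A' t * (u - t)| <= C * (u - t) ^+ 2 /\ `|A' u - A' t| <= C * `|u - t|) ->
 (forall t u, 1 <= t -> 1 <= u ->
   `|B u - B t - B' t * (u - t)| <= C * (u - t) ^+ 2 /\ `|B' u - B' t| <= C * `|u - t|) ->
 A 1 = B 1 -> A' 1 = B' 1 -> C11R (pw A B) (pw A' B').
Proof.
move=> C0 hA hB AB AB' r; exists (3 * C); split; first by rewrite mulr_ge0.
move=> t u _ _; rewrite /pw.
have lift (x y : R) : 0 <= y -> x <= C * y -> x <= 3 * C * y by move=> y0; nra.
have [t1|t1] := ltP t 1; have [u1|u1] := ltP u 1.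
- by have [h h'] := hA t u (ltW t1) (ltW u1); split; apply: lift; rewrite ?sqr_ge0.
- have [a a'] := hA t 1 (ltW t1) (lexx _); have [b b'] := hB 1 u (lexx _) u1.
 have d1 : 0 <= 1 - t by lra. have d2 : 0 <= u - 1 by lra.
 rewrite (ger0_norm d1) in a'; rewrite (ger0_norm d2) in b'.
 have -> : `|u - t| = u - t by rewrite ger0_norm; lra.
 split; last first.
  rewrite (_ : _ - _ = (B' u - B' 1) + (A' 1 - A' t)); last by rewrite AB'; ring.
  by apply: (le_trans (ler_normD _ _)); nra.
 rewrite (_ : _ - _ - _ = (B u - B 1 - B' 1 * (u - 1)) + (A 1 - A t - A' t * (1 - t)) + (A' 1 - A' t) * (u - 1)); last first.
  by rewrite AB AB'; ring.
 apply: (le_trans (ler_normD _ _)); rewrite normrM (ger0_norm d2).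
 apply: (@le_trans _ _ (C * (u - 1) ^+ 2 + C * (1 - t) ^+ 2 + C * (1 - t) * (u - 1))).
  apply: lerD; first by apply: (le_trans (ler_normD _ _)); exact: lerD.
  exact: ler_wpM2r.
 have : 0 <= C * ((u - 1) * (1 - t)) by rewrite mulr_ge0// mulr_ge0.
 have : 0 <= C * (u - t) ^+ 2 by rewrite mulr_ge0// sqr_ge0.
 by rewrite !expr2; nra.
- have [a a'] := hA 1 u (lexx _) (ltW u1); have [b b'] := hB t 1 t1 (lexx _).
 have d1 : 0 <= 1 - u by lra. have d2 : 0 <= t - 1 by lra.
 have e1 : `|u - 1| = 1 - u by rewrite distrC ger0_norm.
 have e2 : `|1 - t| = t - 1 by rewrite distrC ger0_norm.
 rewrite e1 in a'; rewrite e2 in b'.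
 have -> : `|u - t| = t - u by rewrite distrC ger0_norm; lra.
 split; last first.
  rewrite (_ : _ - _ = (A' u - A' 1) + (B' 1 - B' t)); last by rewrite AB'; ring.
  by apply: (le_trans (ler_normD _ _)); nra.
 rewrite (_ : _ - _ - _ = (A u - A 1 - A' 1 * (u - 1)) + (B 1 - B t - B' t * (1 - t)) + (B' 1 - B' t) * (u - 1)); last first.
  by rewrite AB AB'; ring.
 apply: (le_trans (ler_normD _ _)); rewrite normrM e1.
 apply: (@le_trans _ _ (C * (u - 1) ^+ 2 + C * (1 - t) ^+ 2 + C * (t - 1) * (1 - u))).
  apply: lerD; first by apply: (le_trans (ler_normD _ _)); exact: lerD.
  exact: ler_wpM2r.
 have : 0 <= C * ((1 - u) * (t - 1)) by rewrite mulr_ge0// mulr_ge0.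
 have : 0 <= C * (u - t) ^+ 2 by rewrite mulr_ge0// sqr_ge0.
 by rewrite !expr2; nra.
- by have [h h'] := hB t u t1 u1; split; apply: lift; rewrite ?sqr_ge0.
Qed.

(** Radial profiles in [s = |z|^2], glued at [s = 1] with matching derivatives. Outside, [mP] is
    [1 / s], so that conj z times it is [1 / z]; inside, [s * mP s = 1 - (1 - s) ^+ 3]. The others
    are tied to it by [m = 2 n + s n'] and [r = 2 m + 2 s m']. The term [1 / (4 s^2)] in [nP], which
    contributes a multiple of the holomorphic [1 / z^2], is what makes its two branches match. *)
Definition nP := pw (fun s => 3 / 2 - s + s ^+ 2 / 4) (fun s => s^-1 - (s^-1) ^+ 2 / 4).
Definition nP' := pw (fun s => - 1 + s / 2) (fun s => - (s^-1) ^+ 2 + (s^-1) ^+ 3 / 2).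
Definition mP := pw (fun s => 3 - 3 * s + s ^+ 2) (fun s => s^-1).
Definition mP' := pw (fun s => 2 * s - 3) (fun s => - (s^-1) ^+ 2).
Definition mP'' := pw (fun s => 2) (fun s => 2 * (s^-1) ^+ 3).
Definition rP := pw (fun s => 6 * (1 - s) ^+ 2) (fun s => 0).
Definition rP' := pw (fun s => - 12 * (1 - s)) (fun s => 0).

Lemma inv01 s : 1 <= s -> 0 <= s^-1 <= 1.
Proof. by move=> s1; rewrite invr_ge0 invf_le1 ?s1 ?andbT; lra. Qed.

Lemma abs_sqM (d f b : R) : `|f| <= b -> `|d ^+ 2 * f| <= b * d ^+ 2.
Proof. by move=> fb; rewrite normrM ger0_norm ?sqr_ge0// mulrC ler_wpM2r// sqr_ge0. Qed.
Lemma abs_M (d f b : R) : `|f| <= b -> `|d * f| <= b * `|d|.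
Proof. by move=> fb; rewrite normrM mulrC ler_wpM2r. Qed.

Lemma inv_rem t u : 1 <= t -> 1 <= u -> exists f : R,
 [/\ u^-1 - t^-1 - (- (t^-1) ^+ 2) * (u - t) = (u - t) ^+ 2 * f, 0 <= f & f <= 1].
Proof.
move=> t1 u1; exists ((t^-1) ^+ 2 * u^-1).
have /andP[a0 a1] := inv01 t1; have /andP[b0 b1] := inv01 u1.
split; [by field; lra|by rewrite mulr_ge0// sqr_ge0|].
by apply: mulr_ile1 => //; [exact: sqr_ge0|exact: exprn_ile1].
Qed.

Lemma inv2_dif t u : 1 <= t -> 1 <= u -> exists f : R,
 [/\ (u^-1) ^+ 2 - (t^-1) ^+ 2 = (u - t) * (- f), 0 <= f & f <= 2].
Proof.
move=> t1 u1; exists (t^-1 * (u^-1) ^+ 2 + (t^-1) ^+ 2 * u^-1).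
have /andP[a0 a1] := inv01 t1; have /andP[b0 b1] := inv01 u1.
have h1 : t^-1 * (u^-1) ^+ 2 <= 1 by apply: mulr_ile1; rewrite ?sqr_ge0 ?exprn_ile1.
have h2 : (t^-1) ^+ 2 * u^-1 <= 1 by apply: mulr_ile1; rewrite ?sqr_ge0 ?exprn_ile1.
split; [by field; lra|by rewrite addr_ge0// mulr_ge0// sqr_ge0|lra].
Qed.

Lemma inv2_rem t u : 1 <= t -> 1 <= u -> exists f : R,
 [/\ (u^-1) ^+ 2 - (t^-1) ^+ 2 - (- 2 * (t^-1) ^+ 3) * (u - t) = (u - t) ^+ 2 * f, 0 <= f & f <= 3].
Proof.
move=> t1 u1; exists (2 * ((t^-1) ^+ 3 * u^-1) + (t^-1) ^+ 2 * (u^-1) ^+ 2).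
have /andP[a0 a1] := inv01 t1; have /andP[b0 b1] := inv01 u1.
have h1 : (t^-1) ^+ 3 * u^-1 <= 1 by apply: mulr_ile1; rewrite ?exprn_ge0 ?exprn_ile1.
have h2 : (t^-1) ^+ 2 * (u^-1) ^+ 2 <= 1 by apply: mulr_ile1; rewrite ?sqr_ge0 ?exprn_ile1.
have g1 : 0 <= (t^-1) ^+ 3 * u^-1 by rewrite mulr_ge0// exprn_ge0.
have g2 : 0 <= (t^-1) ^+ 2 * (u^-1) ^+ 2 by rewrite mulr_ge0// exprn_ge0.
split; [by field; lra|lra|lra].
Qed.

Lemma inv3_dif t u : 1 <= t -> 1 <= u -> exists f : R,
 [/\ (u^-1) ^+ 3 - (t^-1) ^+ 3 = (u - t) * (- f), 0 <= f & f <= 3].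
Proof.
move=> t1 u1; exists (t^-1 * (u^-1) ^+ 3 + (t^-1) ^+ 2 * (u^-1) ^+ 2 + (t^-1) ^+ 3 * u^-1).
have /andP[a0 a1] := inv01 t1; have /andP[b0 b1] := inv01 u1.
have h1 : t^-1 * (u^-1) ^+ 3 <= 1 by apply: mulr_ile1; rewrite ?exprn_ge0 ?exprn_ile1.
have h2 : (t^-1) ^+ 2 * (u^-1) ^+ 2 <= 1 by apply: mulr_ile1; rewrite ?sqr_ge0 ?exprn_ile1.
have h3 : (t^-1) ^+ 3 * u^-1 <= 1 by apply: mulr_ile1; rewrite ?exprn_ge0 ?exprn_ile1.
split; [by field; lra|by rewrite !addr_ge0// mulr_ge0// exprn_ge0|lra].
Qed.

Lemma C11R_nP : C11R nP nP'.
Proof.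
apply: (@C11R_glue _ _ _ _ 6) => //.
- move=> t u _ _; split.
  rewrite (_ : _ - _ - _ = (u - t) ^+ 2 * (1 / 4)); last by field.
  by apply: abs_sqM; rewrite ger0_norm; lra.
 rewrite (_ : _ - _ = (u - t) * (1 / 2)); last by field.
 by apply: abs_M; rewrite ger0_norm; lra.
- move=> t u t1 u1; have [f [fE f0 f1]] := inv_rem t1 u1; have [g [gE g0 g1]] := inv2_rem t1 u1.
 have [f' [fE' f0' f1']] := inv2_dif t1 u1; have [g' [gE' g0' g1']] := inv3_dif t1 u1.
 split.
  rewrite (_ : _ - _ - _ = (u - t) ^+ 2 * (f - g / 4)).
   by apply: abs_sqM; rewrite ler_norml; lra.
  have -> : (u - t) ^+ 2 * (f - g / 4) = (u - t) ^+ 2 * f - (u - t) ^+ 2 * g / 4 by ring.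
  by rewrite -fE -gE; field; lra.
 rewrite (_ : _ - _ = (u - t) * (f' - g' / 2)).
  by apply: abs_M; rewrite ler_norml; lra.
 have -> : (u - t) * (f' - g' / 2) = - ((u - t) * - f') + ((u - t) * - g') / 2 by ring.
 by rewrite -fE' -gE'; ring.
- by rewrite invr1; field.
- by rewrite invr1; field.
Qed.

Lemma C11R_mP : C11R mP mP'.
Proof.
apply: (@C11R_glue _ _ _ _ 6) => //.
- move=> t u _ _; split.
  rewrite (_ : _ - _ - _ = (u - t) ^+ 2 * 1); last by ring.
  by apply: abs_sqM; rewrite ger0_norm; lra.
 rewrite (_ : _ - _ = (u - t) * 2); last by ring.
 by apply: abs_M; rewrite ger0_norm; lra.
- move=> t u t1 u1; have [f [fE f0 f1]] := inv_rem t1 u1.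
 have [f' [fE' f0' f1']] := inv2_dif t1 u1.
 split; first by rewrite fE; apply: abs_sqM; rewrite ler_norml; lra.
 rewrite (_ : _ - _ = (u - t) * f').
  by apply: abs_M; rewrite ler_norml; lra.
 have -> : (u - t) * f' = - ((u - t) * - f') by ring.
 by rewrite -fE'; ring.
- by rewrite invr1; ring.
- by rewrite invr1; ring.
Qed.

Lemma C11R_mP' : C11R mP' mP''.
Proof.
apply: (@C11R_glue _ _ _ _ 6) => //.
- move=> t u _ _; split.
  rewrite (_ : _ - _ - _ = (u - t) ^+ 2 * 0); last by ring.
  by apply: abs_sqM; rewrite ger0_norm; lra.
 rewrite subrr normr0 mulr_ge0//.
- move=> t u t1 u1; have [g [gE g0 g1]] := inv2_rem t1 u1.
 have [g' [gE' g0' g1']] := inv3_dif t1 u1.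
 split.
  rewrite (_ : _ - _ - _ = (u - t) ^+ 2 * (- g)).
   by apply: abs_sqM; rewrite ler_norml; lra.
  by rewrite mulrN -gE; ring.
 rewrite (_ : _ - _ = (u - t) * (- 2 * g')).
  by apply: abs_M; rewrite ler_norml; lra.
 by rewrite -mulrBr gE'; ring.
- by rewrite invr1; ring.
- by rewrite invr1; ring.
Qed.

Lemma C11R_rP : C11R rP rP'.
Proof.
apply: (@C11R_glue _ _ _ _ 12) => //.
- move=> t u _ _; split.
  rewrite (_ : _ - _ - _ = (u - t) ^+ 2 * 6); last by ring.
  by apply: abs_sqM; rewrite ger0_norm; lra.
 rewrite (_ : _ - _ = (u - t) * 12); last by ring.
 by apply: abs_M; rewrite ger0_norm; lra.
- move=> t u _ _; rewrite !subrr mul0r subr0 normr0; split; rewrite mulr_ge0// sqr_ge0//.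
- by rewrite subrr expr0n /= mulr0.
- by rewrite subrr mulr0.
Qed.

Definition sq z : R := z.1 ^+ 2 + z.2 ^+ 2.
(** With the point [z] read as the complex number [z.1 + i z.2], this is its conjugate. *)
Definition cz z : R[i] := z.1%:C - iC * z.2%:C.

Lemma sq_ge0 z : 0 <= sq z. Proof. by rewrite addr_ge0// sqr_ge0. Qed.
Lemma nm_cz z : nm (cz z) ^+ 2 = sq z.
Proof. by rewrite sqr_nm /cz !reim /sq /=; ring. Qed.
Lemma norm_sq z : `|z| ^+ 2 <= sq z.
Proof.
have h1 := sqr_ge0 z.1; have h2 := sqr_ge0 z.2.
rewrite prod_normE /sq /=; case: (leP `|z.1| `|z.2|) => _;
 rewrite real_normK ?num_real//; lra.
Qed.
Lemma sq_norm z : sq z <= 2 * `|z| ^+ 2.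
Proof.
have h1 := norm_fst z; have h2 := norm_snd z.
have g1 : z.1 ^+ 2 <= `|z| ^+ 2 by rewrite ler_sqr_norm.
have g2 : z.2 ^+ 2 <= `|z| ^+ 2 by rewrite ler_sqr_norm.
by rewrite /sq; lra.
Qed.
Lemma norm_cz z : `|z| <= nm (cz z).
Proof. by rewrite -(ler_pXn2r (n := 2))// ?nnegrE ?nm_ge0// nm_cz norm_sq. Qed.

Lemma C11_cz : C11 cz (fun _ => 1) (fun _ => - iC).
Proof.
apply: C11_eq (C11_D (@C11_x R) (C11_Z (- iC) (@C11_y R))) => z /=.
- by rewrite /cz mulNr.
- by rewrite mulr0 addr0.
- by rewrite mulr1 add0r.
Qed.

Lemma C11_sq : C11 (fun z => (sq z)%:C) (fun z => (2 * z.1)%:C) (fun z => (2 * z.2)%:C).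
Proof.
apply: C11_eq (C11_D (C11_M (@C11_x R) (@C11_x R)) (C11_M (@C11_y R) (@C11_y R))) => z /=;
 by apply: cplx_eq; rewrite !reim /sq; ring.
Qed.

(** Where [1 <= sq z], [C0] is [1 / z], [S0] is [- 2 / z^2], a multiple of the Beurling kernel, and
    [r0] vanishes; [K0] is a bounded primitive of [C0] for Dbar. Each kernel comes with the explicit
    partial derivatives that [C11] requires. *)
Definition K0 z : R[i] := cz z ^+ 2 * (nP (sq z) / 2)%:C.
Definition K01 z : R[i] := 2 * cz z * (nP (sq z) / 2)%:C + cz z ^+ 2 * (nP' (sq z) * z.1)%:C.
Definition K02 z : R[i] := - 2 * iC * cz z * (nP (sq z) / 2)%:C + cz z ^+ 2 * (nP' (sq z) * z.2)%:C.
Definition C0 z : R[i] := cz z * (mP (sq z))%:C.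
Definition C01 z : R[i] := (mP (sq z))%:C + cz z * (mP' (sq z) * (2 * z.1))%:C.
Definition C02 z : R[i] := - iC * (mP (sq z))%:C + cz z * (mP' (sq z) * (2 * z.2))%:C.
Definition S0 z : R[i] := cz z ^+ 2 * (2 * mP' (sq z))%:C.
Definition S01 z : R[i] := 2 * cz z * (2 * mP' (sq z))%:C + cz z ^+ 2 * (2 * mP'' (sq z) * (2 * z.1))%:C.
Definition S02 z : R[i] := - 2 * iC * cz z * (2 * mP' (sq z))%:C + cz z ^+ 2 * (2 * mP'' (sq z) * (2 * z.2))%:C.
Definition r0 z : R[i] := (rP (sq z))%:C.
Definition r01 z : R[i] := (rP' (sq z) * (2 * z.1))%:C.
Definition r02 z : R[i] := (rP' (sq z) * (2 * z.2))%:C.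

Lemma C11_K0 : C11 K0 K01 K02.
Proof.
have H := C11_M (C11_M C11_cz C11_cz) (C11_Z (2^-1)%:C (C11_comp C11R_nP C11_sq)).
apply: C11_eq H => z; rewrite /K0 /K01 /K02 /=.
- by rewrite -expr2 -rmorphM/=; congr (_ * _%:C); field.
- by rewrite -!rmorphM/=; rewrite (_ : nP (sq z) / 2 = 2^-1 * nP (sq z)); [rewrite (_ : nP' (sq z) * z.1 = 2^-1 * (nP' (sq z) * (2 * z.1))); [ring|field]|field].
- by rewrite -!rmorphM/=; rewrite (_ : nP (sq z) / 2 = 2^-1 * nP (sq z)); [rewrite (_ : nP' (sq z) * z.2 = 2^-1 * (nP' (sq z) * (2 * z.2))); [ring|field]|field].
Qed.

Lemma C11_C0 : C11 C0 C01 C02.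
Proof.
have H := C11_M C11_cz (C11_comp C11R_mP C11_sq).
by apply: C11_eq H => z; rewrite /C0 /C01 /C02 /= ?mul1r.
Qed.

Lemma C11_S0 : C11 S0 S01 S02.
Proof.
have H := C11_M (C11_M C11_cz C11_cz) (C11_Z 2%:C (C11_comp C11R_mP' C11_sq)).
apply: C11_eq H => z; rewrite /S0 /S01 /S02 /=.
- by rewrite -expr2 -rmorphM.
- by rewrite -!rmorphM/= mulrA; ring.
- by rewrite -!rmorphM/= mulrA; ring.
Qed.

Lemma C11_r0 : C11 r0 r01 r02.
Proof. exact: (C11_comp C11R_rP C11_sq). Qed.

Lemma czN z : cz (- z) = - cz z.
Proof. by rewrite /cz /=; cplx_ring. Qed.
Lemma sqN z : sq (- z) = sq z.
Proof. by rewrite /sq /= !sqrrN. Qed.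

Lemma C0N z : C0 (- z) = - C0 z. Proof. by rewrite /C0 czN sqN mulNr. Qed.
Lemma S0N z : S0 (- z) = S0 z. Proof. by rewrite /S0 czN sqN sqrrN. Qed.
Lemma r0N z : r0 (- z) = r0 z. Proof. by rewrite /r0 sqN. Qed.

Lemma two_cplx : (2 : R[i]) = 2%:C. Proof. by rewrite rmorph_nat. Qed.

(** For a profile [u] of [s = |z|^2], Dbar of [(conj z)^k u] is [(conj z)^(k-1) (2 k u + 2 s u')].
    This identity and those for Dbar of [C0] and [S0] thus reduce to relations between profiles,
    checked on each branch. *)
Lemma DbarK0 z : K01 z + iC * K02 z = C0 z.
Proof.
rewrite /K01 /K02 /C0.
have -> : mP (sq z) = 2 * nP (sq z) + sq z * nP' (sq z).
 rewrite /mP /nP /nP' /pw; case: ltP => s1; first by field.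
 by field; lra.
rewrite (_ : - 2 * iC * cz z * (nP (sq z) / 2)%:C = - iC * (2 * cz z * (nP (sq z) / 2)%:C)); last by ring.
rewrite two_cplx /cz; move: (nP (sq z)) (nP' (sq z)) => u v; rewrite /sq; move: z.1 z.2 => x y.
by apply: cplx_eq; rewrite !reim; field.
Qed.

Lemma DbarC0 z : C01 z + iC * C02 z = r0 z.
Proof.
rewrite /C01 /C02 /r0.
have -> : rP (sq z) = 2 * mP (sq z) + 2 * sq z * mP' (sq z).
 rewrite /rP /mP /mP' /pw; case: ltP => s1; first by ring.
 by field; lra.
by apply: cplx_eq; rewrite /cz /sq !(expr2, reim); ring.
Qed.

Lemma DC0 z : C01 z - iC * C02 z = S0 z.
Proof. by rewrite /C01 /C02 /S0; apply: cplx_eq; rewrite /cz !(expr2, reim); ring. Qed.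

Lemma DbarS0 z : S01 z + iC * S02 z = r01 z - iC * r02 z.
Proof.
rewrite /S01 /S02 /r01 /r02.
have -> : rP' (sq z) = 4 * mP' (sq z) + 2 * sq z * mP'' (sq z).
 rewrite /rP' /mP' /mP'' /pw; case: ltP => s1; first by ring.
 by field; lra.
rewrite two_cplx /cz; move: (mP' (sq z)) (mP'' (sq z)) => u v; rewrite /sq; move: z.1 z.2 => x y.
by apply: cplx_eq; rewrite !(expr2, reim); ring.
Qed.

Lemma sq_lt1 z : sq z < 1 -> `|z| < 1.
Proof. by move=> h; rewrite -(ltr_pXn2r (n := 2))// ?nnegrE// expr1n (le_lt_trans (norm_sq z)). Qed.
Lemma sq_ge1 z : 1 <= `|z| -> 1 <= sq z.
Proof. by move=> h; rewrite leNgt; apply/negP => /sq_lt1; rewrite ltNge h. Qed.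

Lemma K0_le1 z : nm (K0 z) <= 1.
Proof.
rewrite /K0 nmM expr2 nmM -expr2 nm_cz nmR /nP /pw; have s0 := sq_ge0 z.
case: ltP => s1.
 rewrite ger0_norm; last by have := sqr_ge0 (sq z); lra.
 have := mulr_ge0 s0 s0; have := mulr_ge0 (mulr_ge0 s0 s0) s0.
 have : sq z * sq z <= 1 by apply: mulr_ile1; lra.
 by rewrite expr2; nra.
have /andP[i0 i1] := inv01 s1; rewrite ger0_norm; last by rewrite expr2; nra.
have si : sq z * (sq z)^-1 = 1 by rewrite divff; lra.
by rewrite expr2; nra.
Qed.

Lemma mP_bd s : 0 <= s -> [/\ 0 <= mP s, s * mP s <= 1 & mP s <= 3].
Proof.
move=> s0; rewrite /mP /pw; case: ltP => s1.
 split; [by have := sqr_ge0 s; nra| |by rewrite expr2; nra].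
 have -> : s * (3 - 3 * s + s ^+ 2) = 1 - (1 - s) ^+ 3 by ring.
 by rewrite gerBl exprn_ge0; lra.
by have /andP[i0 i1] := inv01 s1; split=> //; [rewrite divff; lra|lra].
Qed.

Lemma C0_bd z : nm (C0 z) <= 3 /\ nm (C0 z) * nm (cz z) <= 1.
Proof.
have s0 := sq_ge0 z; have [m0 m1 m3] := mP_bd s0.
have q0 := nm_ge0 (cz z); have q2 := nm_cz z.
rewrite /C0 nmM nmR ger0_norm//; split; last by rewrite mulrAC -expr2 q2.
have [q1|q1] := leP (nm (cz z)) 1; first by nra.
by move: m1; rewrite -q2 expr2; nra.
Qed.

Lemma mP'_bd s : 0 <= s -> [/\ `|mP' s| <= 3, s ^+ 2 * `|mP' s| <= 3, `|mP'' s| <= 2 & s ^+ 3 * `|mP'' s| <= 2].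
Proof.
move=> s0; rewrite /mP' /mP'' /pw; case: ltP => s1.
 have h : `|2 * s - 3| <= 3 by rewrite ler_norml; lra.
 have s2 : s ^+ 2 <= 1 by apply: exprn_ile1 => //; lra.
 have s3 : s ^+ 3 <= 1 by apply: exprn_ile1 => //; lra.
 have e2 : `|2| = 2 :> R by rewrite ger0_norm.
 rewrite e2; split=> //.
  by rewrite -[leRHS]mul1r; apply: ler_pM; rewrite ?sqr_ge0.
 by rewrite -[leRHS]mul1r; apply: ler_pM; rewrite ?exprn_ge0.
have /andP[i0 i1] := inv01 s1.
have j2 : (s^-1) ^+ 2 <= 1 by exact: exprn_ile1.
have j3 : (s^-1) ^+ 3 <= 1 by exact: exprn_ile1.
have k3 : 0 <= (s^-1) ^+ 3 by exact: exprn_ge0.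
rewrite normrN [`|s^-1 ^+ 2|]ger0_norm ?sqr_ge0// [`|2 * _|]ger0_norm ?mulr_ge0//.
split; [lra| |lra| ].
 by rewrite -exprMn divff ?expr1n; lra.
by rewrite mulrCA -exprMn divff ?expr1n; lra.
Qed.

Lemma S0_bd z : nm (S0 z) <= 6.
Proof.
have s0 := sq_ge0 z; have [m1 m2 _ _] := mP'_bd s0.
rewrite /S0 nmM expr2 nmM -expr2 nm_cz nmR normrM (ger0_norm (ler0n _ _)).
have a0 := normr_ge0 (mP' (sq z)).
have [q1|q1] := leP (sq z) 1; first by nra.
by move: m2; rewrite expr2; nra.
Qed.

(** Decay of order three is integrable at infinity in the plane; the cancellation estimate for
    oscillating pieces rests on it. *)
Lemma gradS0_bd z : [/\ nm (S01 z) <= 30, nm (S02 z) <= 30,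
 nm (S01 z) * `|z| ^+ 3 <= 30 & nm (S02 z) * `|z| ^+ 3 <= 30].
Proof.
have s0 := sq_ge0 z; have [m1 m2 m3 m4] := mP'_bd s0.
have q0 := nm_ge0 (cz z); have q2 := nm_cz z.
set q := nm (cz z) in q0 q2; rewrite -q2 in m1 m2 m3 m4.
have [z1 z2] := (norm_fst z, norm_snd z); have zq : `|z| <= q := norm_cz z.
pose B := 4 * q * `|mP' (q ^+ 2)| + 4 * q ^+ 3 * `|mP'' (q ^+ 2)|.
have est (w : R[i]) (x : R) : nm w <= 1 -> `|x| <= q ->
  nm (2 * w * cz z * (2 * mP' (sq z))%:C + cz z ^+ 2 * (2 * mP'' (sq z) * (2 * x))%:C) <= B.
 move=> w1 xq; apply: le_nmD.
  rewrite two_cplx !nmM !nmR !normrM (ger0_norm (ler0n _ _)) -q2 -/q.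
  have -> : 4 * q * `|mP' (q ^+ 2)| = 2 * 1 * q * (2 * `|mP' (q ^+ 2)|) by ring.
  by rewrite ler_wpM2r ?mulr_ge0// ler_wpM2r// ler_wpM2l.
 rewrite expr2 !nmM nmR !normrM (ger0_norm (ler0n _ _)) -q2 -/q.
 have -> : 4 * q ^+ 3 * `|mP'' (q ^+ 2)| = q * q * (2 * `|mP'' (q ^+ 2)| * (2 * q)) by ring.
 by rewrite ler_wpM2l ?mulr_ge0// ler_wpM2l ?mulr_ge0// ler_wpM2l.
have a1 : nm (S01 z) <= B.
 rewrite /S01 (_ : 2 * cz z = 2 * 1 * cz z); last by rewrite mulr1.
 apply: est; rewrite ?nm1//; exact: le_trans z1 zq.
have a2 : nm (S02 z) <= B.
 rewrite /S02 (_ : - 2 * iC = 2 * - iC); last by ring.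
 apply: est; rewrite ?nmN ?nmi//; exact: le_trans z2 zq.
have A0 := normr_ge0 (mP' (q ^+ 2)); have D0 := normr_ge0 (mP'' (q ^+ 2)).
have Bq : B * q ^+ 3 <= 30.
 rewrite /B; have -> : (4 * q * `|mP' (q ^+ 2)| + 4 * q ^+ 3 * `|mP'' (q ^+ 2)|) * q ^+ 3 =
  4 * ((q ^+ 2) ^+ 2 * `|mP' (q ^+ 2)|) + 4 * ((q ^+ 2) ^+ 3 * `|mP'' (q ^+ 2)|) by ring.
 lra.
have B30 : B <= 30.
 have [q1|q1] := leP q 1.
  have q3 : q ^+ 3 <= 1 by exact: exprn_ile1.
  have q30 : 0 <= q ^+ 3 by exact: exprn_ge0.
  rewrite /B; nra.
 have q3 : 1 <= q ^+ 3 by apply: exprn_ege1; exact: ltW.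
 have B0 : 0 <= B by rewrite /B addr_ge0// !mulr_ge0// exprn_ge0.
 by nra.
have zq3 : `|z| ^+ 3 <= q ^+ 3 by rewrite ler_pXn2r ?nnegrE.
have z30 : 0 <= `|z| ^+ 3 by exact: exprn_ge0.
have B0 : 0 <= B by rewrite /B addr_ge0// !mulr_ge0// exprn_ge0.
split; [exact: le_trans a1 B30|exact: le_trans a2 B30| |];
 apply: le_trans Bq; apply: ler_pM => //; exact: nm_ge0.
Qed.

Lemma rP_ge0 s : 0 <= s -> 0 <= rP s <= 6.
Proof.
move=> s0; rewrite /rP /pw; case: ltP => s1; last by rewrite lexx ler0n.
by rewrite mulr_ge0 ?sqr_ge0//=; rewrite expr2; nra.
Qed.

Lemma r0_out z : 1 <= `|z| -> [/\ r0 z = 0, r01 z = 0 & r02 z = 0].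
Proof.
move=> /sq_ge1 s1; rewrite /r0 /r01 /r02 /rP /rP' /pw ltNge s1 /=.
by rewrite !mul0r.
Qed.

Lemma r0_grad_bd z : nm (r01 z) <= 24 /\ nm (r02 z) <= 24.
Proof.
have s0 := sq_ge0 z.
have [z1|z1] := ltP `|z| 1; last by have [_ -> ->] := r0_out z1; rewrite nm0.
have h : `|rP' (sq z)| <= 12.
 rewrite /rP' /pw; case: ltP => s1; last by rewrite normr0.
 by rewrite ler_norml; lra.
have n1 := norm_fst z; have n2 := norm_snd z.
have a0 := normr_ge0 (rP' (sq z)).
rewrite /r01 /r02 !nmR !normrM (ger0_norm (ler0n _ _)).
have := normr_ge0 z.1; have := normr_ge0 z.2.
by split; nra.
Qed.

Lemma C0_out z : 1 <= `|z| -> C0 z = cz z * ((sq z)^-1)%:C.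
Proof. by move=> /sq_ge1 s1; rewrite /C0 /mP /pw ltNge s1. Qed.

Lemma C0_grad_bd z : nm (C01 z) <= 6 /\ nm (C02 z) <= 6.
Proof.
have e1 : C01 z = (2^-1)%:C * (r0 z + S0 z).
 by rewrite -DbarC0 -DC0; move: (C01 z) (C02 z) => u v; apply: cplx_eq; rewrite !reim; field.
have e2 : C02 z = - iC * (2^-1)%:C * (r0 z - S0 z).
 by rewrite -DbarC0 -DC0; move: (C01 z) (C02 z) => u v; apply: cplx_eq; rewrite !reim; field.
have rb : nm (r0 z) <= 6 by rewrite /r0 nmR; have /andP[? ?] := rP_ge0 (sq_ge0 z); rewrite ger0_norm.
have sb := S0_bd z.
have h : `|2^-1 : R| = 2^-1 by rewrite ger0_norm.
have hD : nm (r0 z + S0 z) <= 12 by apply: (le_trans (nmD _ _)); lra.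
have hB : nm (r0 z - S0 z) <= 12 by apply: (le_trans (nmB _ _)); lra.
split.
- by rewrite e1 (nmM (2^-1)%:C) nmR h; lra.
- by rewrite e2 (nmM (- iC * (2^-1)%:C)) (nmM (- iC)) nmN nmi nmR h; lra.
Qed.
End Kernels.

(** * Cauchy-Schwarz by weights, and integrals over dyadic annuli *)

Section Aux.
Context {R : realType}.
Local Notation pt := (R * R)%type.

(** The weight [l = X / A] is optimal; in this form Cauchy-Schwarz for integrals follows from a
    pointwise Young inequality. *)
Lemma amgm_sq (X A B : R) : 0 <= X -> 0 <= A -> 0 <= B ->
 (forall l, 0 < l -> 2 * X <= l * A + B / l) -> X ^+ 2 <= A * B.
Proof.
rewrite le_eqVlt => /predU1P[<-|X0] A0 B0 H; first by rewrite expr0n mulr_ge0.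
move: A0; rewrite le_eqVlt => /predU1P[A0|A0].
 (* If [A] vanishes, this large weight makes the right-hand side at most [X], which contradicts
    [0 < X]. *)
 have l0 : 0 < (B + 1) / X by rewrite divr_gt0// ltr_wpDl.
 have := H _ l0; rewrite -A0 mulr0 add0r invf_div mulrCA.
 have : B / (B + 1) <= 1 by rewrite ler_pdivrMr ?ltr_wpDl// mul1r lerDl.
 by move=> h; have := ler_wpM2l (ltW X0) h; lra.
have l0 : 0 < X / A by rewrite divr_gt0.
have := H _ l0; rewrite mulfVK ?gt_eqF// invf_div => h.
have : X * X <= X * (B * (A / X)) by rewrite ler_pM2l//; lra.
have -> : X * (B * (A / X)) = A * B by field; rewrite gt_eqF.
by rewrite expr2.
Qed.

Lemma le_pow2 (x y K : R) : (forall n : nat, x <= y + K / 2 ^+ n) -> x <= y.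
Proof.
move=> H; rewrite leNgt; apply/negP => yx.
have [n hn] : exists n : nat, K < (x - y) * 2 ^+ n.
 have [m hm] : exists m : nat, K / (x - y) < m%:R.
  by exists (Num.bound `|K / (x - y)|); apply: le_lt_trans (ler_norm _) (archi_boundP (normr_ge0 _)).
 exists m; rewrite mulrC -ltr_pdivrMr ?subr_gt0//; apply: (lt_le_trans hm).
 by rewrite -natrX ler_nat ltnW// ltn_expl.
have p0 : (0 : R) < 2 ^+ n by rewrite exprn_gt0.
by have := H n; rewrite -lerBlDl ler_pdivlMr// leNgt hn.
Qed.

Lemma I2_shift (f : pt -> R) (y : pt) : L1 f -> L1 (fun x => f (x - y)) /\ I2 (fun x => f (x - y)) = I2 f.
Proof.
move=> Lf; have E : (fun x => f (x - y)) = (fun x : pt => f (- y + 1 *: x)).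
 by apply/funext => x; rewrite scale1r addrC.
rewrite E; split; first by apply: L1_affine.
by rewrite I2_affine// expr1n invr1 mul1r.
Qed.

Lemma I2_reflect (f : pt -> R) (x : pt) : L1 f -> L1 (fun y => f (x - y)) /\ I2 (fun y => f (x - y)) = I2 f.
Proof.
have n1 : -1 != 0 :> R by rewrite oppr_eq0 oner_eq0.
move=> Lf; have E : (fun y => f (x - y)) = (fun y : pt => f (x + (-1) *: y)).
 by apply/funext => y; rewrite scaleN1r.
rewrite E; split; first by apply: L1_affine.
by rewrite I2_affine// sqrrN expr1n invr1 mul1r.
Qed.

Lemma L1_ind_bd (u : pt -> R) (A : set pt) (M r : R) : mfun u -> measurable A ->
 (forall z, A z -> `|u z| <= M) -> A `<=` ball 0 r -> L1 (fun z => u z * \1_A z).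
Proof.
move=> mu mA uM Ar.
have mf : mfun (fun z => u z * \1_A z) by apply: measurable_funM => //; exact: mindic.
apply: (@L1_box _ (Num.max M 0) r) => //.
 move=> z; rewrite le_max; have [Az|Az] := pselect (A z).
  by rewrite ind_in// mulr1 uM.
 by rewrite ind_out// mulr0 normr0 lexx orbT.
by move=> z zr; rewrite ind_out ?mulr0// => /Ar.
Qed.

(* Integrals of [1/|z|] over dyadic annuli shrinking to the origin. *)
Lemma I2_inv_ball (u : pt -> R) (B r : R) : mfun u -> (forall z, 0 <= u z <= B) ->
 (forall z, u z * `|z| <= 1) -> 0 < r -> I2 (fun z => u z * \1_(ball 0 r) z) <= 16 * r.
Proof.
move=> mu uB uz r0; have B0 : 0 <= B by have /andP[a b] := uB 0; exact: le_trans b.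
have ub z : `|u z| <= B by have /andP[a b] := uB z; rewrite ger0_norm.
have Lb s : L1 (fun z => u z * \1_(ball 0 s) z).
 apply: (@L1_ind_bd _ _ B s) => //; exact: mball2.
(* On the shell between [s / 2] and [s] the integrand is at most [2 / s], which over a square of
   area [(2 * s) ^+ 2] gives [8 * s]; the geometric sum of the shells is [16 * r]. *)
have step s : 0 < s -> I2 (fun z => u z * \1_(ball 0 s) z) <= 8 * s + I2 (fun z => u z * \1_(ball 0 (s / 2)) z).
 move=> s0; have -> : 8 * s = (2 / s) * (2 * s) ^+ 2 by field; rewrite gt_eqF.
 rewrite -(@I2_ball R 0 s (ltW s0)) -I2Z; last exact: L1_ball.
 rewrite -I2D => //; last exact: (L1Z _ (L1_ball _ _)).
 apply: I2_le => //; first by apply: L1D => //; exact: (L1Z _ (L1_ball _ _)).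
 move=> z; have /andP[u0 _] := uB z.
 have s20 : 0 <= 2 / s by rewrite divr_ge0// ltW.
 have [zs|zs] := pselect (ball 0 s z); last first.
  by rewrite !ind_out// ?mulr0 ?add0r// => /ball0E hh; apply: zs; apply/ball0E; lra.
 have [zs2|zs2] := pselect (ball 0 (s / 2) z).
  by rewrite !ind_in//; lra.
 rewrite (ind_in zs) (ind_out zs2) !mulr1 mulr0 addr0.
 have z2 : s / 2 <= `|z| by exact: nball0.
 rewrite ler_pdivlMr//; have := uz z; nra.
have iter n : I2 (fun z => u z * \1_(ball 0 r) z) <= 16 * r * (1 - (2 ^+ n)^-1) + I2 (fun z => u z * \1_(ball 0 (r / 2 ^+ n)) z).
 elim: n => [|n ih]; first by rewrite expr0 invr1 subrr mulr0 add0r mulr1.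
 apply: (le_trans ih); have rn : 0 < r / 2 ^+ n by rewrite divr_gt0// exprn_gt0.
 have E : r / 2 ^+ n.+1 = r / 2 ^+ n / 2 by rewrite exprSr invfM mulrA.
 rewrite E; apply: (le_trans (lerD (lexx _) (step _ rn))); rewrite addrA; apply: lerD => //.
 have -> : (2 ^+ n.+1)^-1 = (2 ^+ n)^-1 / 2 :> R by rewrite exprSr invfM.
 by lra.
apply: (@le_pow2 _ _ (B * 4 * r ^+ 2)) => n; apply: (le_trans (iter n)).
have p1 : (1 : R) <= 2 ^+ n by apply: exprn_ege1; rewrite ler1n.
have p0 : (0 : R) < 2 ^+ n by exact: lt_le_trans p1.
have i0 : 0 <= (2 ^+ n)^-1 :> R by rewrite invr_ge0 ltW.
have i1 : (2 ^+ n)^-1 <= 1 :> R by rewrite invf_le1.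
apply: lerD; first by have := mulr_ge0 (ltW r0) i0; lra.
apply: (@le_trans _ _ (B * (2 * (r / 2 ^+ n)) ^+ 2)).
 rewrite -(@I2_ball R 0 (r / 2 ^+ n)); last by rewrite divr_ge0// ltW.
 rewrite -I2Z; last exact: L1_ball.
 apply: I2_le => //; first exact: (L1Z _ (L1_ball _ _)).
 by move=> z; have /andP[? ?] := uB z; have /andP[? ?] := ind_itv (ball 0 (r / 2 ^+ n)) z; rewrite ler_wpM2r.
have -> : B * (2 * (r / 2 ^+ n)) ^+ 2 = (B * 4 * r ^+ 2) * ((2 ^+ n)^-1 * (2 ^+ n)^-1) by rewrite expr2; ring.
rewrite ler_wpM2l// ?mulr_ge0// ?exprn_ge0// ?(ltW r0)//.
by rewrite -[leRHS]mulr1 ler_wpM2l.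
Qed.

Definition annulus (l s : R) : set pt := [set z | l <= `|z| < s].

Lemma annulusE (l s : R) : annulus l s = ball 0 s `\` ball 0 l.
Proof.
apply/seteqP; split => z.
- by move=> /andP[a b]; split; [exact/ball0E|move/ball0E; rewrite ltNge a].
- by move=> [/ball0E a b]; apply/andP; split=> //; rewrite leNgt; apply/negP => h; apply: b; exact/ball0E.
Qed.

Lemma measurable_annulus (l s : R) : measurable (annulus l s).
Proof. by rewrite annulusE; apply: measurableD; exact: mball2. Qed.

(** The shell between [s] and [2 * s] contributes at most [16 * A / s], and these sum to
    [32 * A / l] independently of the outer radius. *)
Lemma I2_inv3_annulus (u : pt -> R) (A l : R) (n : nat) : mfun u -> 0 < l ->
 (forall z, 0 <= u z) -> (forall z, l <= `|z| -> u z * `|z| ^+ 3 <= A) ->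
 L1 (fun z => u z * \1_(annulus l (2 ^+ n * l)) z) /\
 I2 (fun z => u z * \1_(annulus l (2 ^+ n * l)) z) <= 32 * A / l.
Proof.
move=> mu l0 u0 uz.
have A0 : 0 <= A.
 apply: le_trans (uz (l, 0) _); first by rewrite mulr_ge0// exprn_ge0.
 by apply: le_trans (norm_fst _); rewrite /= ler_norm.
have Lb s : L1 (fun z => u z * \1_(annulus l s) z).
 apply: (@L1_ind_bd _ _ (A / l ^+ 3) s) => //; first exact: measurable_annulus.
  move=> z /andP[lz _]; rewrite ger0_norm// ler_pdivlMr ?exprn_gt0//.
  apply: le_trans (uz z lz); rewrite ler_wpM2l//.
  by rewrite ler_pXn2r ?nnegrE// ltW.
 by move=> z /andP[_ ?]; exact/ball0E.
split => //; apply: (@le_trans _ _ (32 * A / l * (1 - (2 ^+ n)^-1))); last first.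
 rewrite -[leRHS]mulr1 ler_wpM2l ?divr_ge0 ?mulr_ge0 ?(ltW l0)// gerBl.
elim: n => [|n ih].
 rewrite (_ : (fun z => _) = (fun _ => 0)); last first.
  apply/funext => z; rewrite ind_out ?mulr0//.
  by rewrite /annulus /= expr0 mul1r => /andP[a b]; move: (le_lt_trans a b); rewrite ltxx.
 by rewrite I2_0 expr0 invr1 subrr mulr0.
set s := 2 ^+ n * l in ih *; have p0 : (0 : R) < 2 ^+ n by rewrite exprn_gt0.
have p1 : (1 : R) <= 2 ^+ n by apply: exprn_ege1; rewrite ler1n.
have s0 : 0 < s by rewrite mulr_gt0.
have ls : l <= s by rewrite ler_peMl// ltW.
have -> : 2 ^+ n.+1 * l = 2 * s by rewrite exprS mulrA.
have E : 32 * A / l * (1 - (2 ^+ n.+1)^-1) = 32 * A / l * (1 - (2 ^+ n)^-1) + A / s ^+ 3 * (2 * (2 * s)) ^+ 2.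
 by rewrite /s exprS; field; rewrite !gt_eqF.
rewrite E -(@I2_ball R 0 (2 * s)); last by rewrite mulr_ge0// ltW.
rewrite -I2Z; last exact: L1_ball.
apply: (@le_trans _ _ (I2 (fun z => u z * \1_(annulus l s) z) + I2 (fun z => A / s ^+ 3 * \1_(ball 0 (2 * s)) z))); last by rewrite lerD2r.
rewrite -I2D => //; last exact: (L1Z _ (L1_ball _ _)).
apply: I2_le => //; first by apply: L1D => //; exact: (L1Z _ (L1_ball _ _)).
have c0 : 0 <= A / s ^+ 3 by rewrite divr_ge0// exprn_ge0// ltW.
move=> z; have [zs|zs] := pselect (annulus l (2 * s) z); last first.
 rewrite (ind_out zs) mulr0 addr_ge0// mulr_ge0//.
have /andP[z1 z2] := zs; rewrite (ind_in zs) [X in _ + _ * X]ind_in; last exact/ball0E.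
have [zl|zl] := ltP `|z| s.
 by rewrite ind_in ?/annulus /= ?z1//; lra.
rewrite ind_out; last by rewrite /annulus /= => /andP[_]; rewrite ltNge zl.
rewrite mulr0 add0r !mulr1 ler_pdivlMr ?exprn_gt0//.
apply: le_trans (uz z z1); rewrite ler_wpM2l//.
by rewrite ler_pXn2r ?nnegrE// ltW.
Qed.
End Aux.

(** * The kernels at scale [e] *)

Section Scaled.
Context {R : realType}.
Local Notation pt := (R * R)%type.
Implicit Types (z x y : pt) (e d : R).

(** The prefactors [1], [e^-1], [e^-2] keep the relations Dbar K = C, Dbar C = r, D C = S exact at
    every scale, and make [Ce e] equal to [1 / z] for [e <= |z|], whatever [e]; [re e] is an
    approximate identity of mass [c0]. *)
Definition Ke e z : R[i] := K0 (e^-1 *: z).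
Definition Ke1 e z : R[i] := (e^-1)%:C * K01 (e^-1 *: z).
Definition Ke2 e z : R[i] := (e^-1)%:C * K02 (e^-1 *: z).
Definition Ce e z : R[i] := (e^-1)%:C * C0 (e^-1 *: z).
Definition Ce1 e z : R[i] := (e^-1)%:C * ((e^-1)%:C * C01 (e^-1 *: z)).
Definition Ce2 e z : R[i] := (e^-1)%:C * ((e^-1)%:C * C02 (e^-1 *: z)).
Definition Se e z : R[i] := (e^-1 ^+ 2)%:C * S0 (e^-1 *: z).
Definition Se1 e z : R[i] := (e^-1 ^+ 2)%:C * ((e^-1)%:C * S01 (e^-1 *: z)).
Definition Se2 e z : R[i] := (e^-1 ^+ 2)%:C * ((e^-1)%:C * S02 (e^-1 *: z)).
Definition re e z : R[i] := (e^-1 ^+ 2)%:C * r0 (e^-1 *: z).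
Definition re1 e z : R[i] := (e^-1 ^+ 2)%:C * ((e^-1)%:C * r01 (e^-1 *: z)).
Definition re2 e z : R[i] := (e^-1 ^+ 2)%:C * ((e^-1)%:C * r02 (e^-1 *: z)).
Definition rr e z : R := e^-1 ^+ 2 * rP (sq (e^-1 *: z)).

Lemma C11_scale (f f1 f2 : pt -> R[i]) (c : R[i]) e : C11 f f1 f2 ->
 C11 (fun z => c * f (e^-1 *: z)) (fun z => c * ((e^-1)%:C * f1 (e^-1 *: z)))
  (fun z => c * ((e^-1)%:C * f2 (e^-1 *: z))).
Proof.
move=> Cf; apply: C11_eq (C11_Z c (C11_affine 0 e^-1 Cf)) => z; by rewrite add0r.
Qed.

Lemma C11_Ke e : C11 (Ke e) (Ke1 e) (Ke2 e).
Proof. by apply: C11_eq (C11_scale 1 e (@C11_K0 R)) => z; rewrite mul1r. Qed.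
Lemma C11_Ce e : C11 (Ce e) (Ce1 e) (Ce2 e).
Proof. exact: C11_scale (@C11_C0 R). Qed.
Lemma C11_Se e : C11 (Se e) (Se1 e) (Se2 e).
Proof. exact: C11_scale (@C11_S0 R). Qed.
Lemma C11_re e : C11 (re e) (re1 e) (re2 e).
Proof. exact: C11_scale (@C11_r0 R). Qed.

Lemma DbarKe e z : Ke1 e z + iC * Ke2 e z = Ce e z.
Proof. by rewrite /Ke1 /Ke2 /Ce -DbarK0; ring. Qed.
Lemma DbarCe e z : Ce1 e z + iC * Ce2 e z = re e z.
Proof. by rewrite /Ce1 /Ce2 /re -DbarC0 rmorphXn/=; ring. Qed.
Lemma DCe e z : Ce1 e z - iC * Ce2 e z = Se e z.
Proof. by rewrite /Ce1 /Ce2 /Se -DC0 rmorphXn/=; ring. Qed.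
Lemma DbarSe e z : Se1 e z + iC * Se2 e z = re1 e z - iC * re2 e z.
Proof.
rewrite /Se1 /Se2 /re1 /re2.
have := DbarS0 (e^-1 *: z); set a := S01 _; set b := S02 _; set c := r01 _; set d := r02 _ => h.
transitivity ((e^-1 ^+ 2)%:C * (e^-1)%:C * (a + iC * b)); first by ring.
by rewrite h; ring.
Qed.

Lemma CeN e z : Ce e (- z) = - Ce e z.
Proof. by rewrite /Ce scalerN C0N mulrN. Qed.
Lemma SeN e z : Se e (- z) = Se e z.
Proof. by rewrite /Se scalerN S0N. Qed.
Lemma reN e z : re e (- z) = re e z.
Proof. by rewrite /re scalerN r0N. Qed.
Lemma reE e z : re e z = (rr e z)%:C.
Proof. by rewrite /re /rr /r0 -rmorphM. Qed.
Lemma Ce_sym e x y : Ce e (x - y) = - Ce e (y - x).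
Proof. by rewrite -CeN opprB. Qed.
Lemma Se_sym e x y : Se e (x - y) = Se e (y - x).
Proof. by rewrite -SeN opprB. Qed.
Lemma re_sym e x y : re e (x - y) = re e (y - x).
Proof. by rewrite -reN opprB. Qed.

Lemma nm_pR (c : R) (w : R[i]) : 0 <= c -> nm (c%:C * w) = c * nm w.
Proof. by move=> c0; rewrite nmM nmR ger0_norm. Qed.

Lemma Ke_bd e z : nm (Ke e z) <= 1. Proof. exact: K0_le1. Qed.

Lemma Ce_bd e z : 0 < e -> nm (Ce e z) <= 3 / e /\ nm (Ce e z) * `|z| <= 1.
Proof.
move=> e0; have i0 : 0 <= e^-1 by rewrite invr_ge0 ltW.
have [a b] := C0_bd (e^-1 *: z); rewrite /Ce nm_pR//; split.
 by rewrite mulrC ler_wpM2r.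
apply: le_trans b; rewrite mulrAC mulrC; apply: ler_wpM2l; first exact: nm_ge0.
apply: le_trans (norm_cz _); by rewrite normrZ ger0_norm.
Qed.

Lemma Ce_grad_bd e z : 0 < e -> nm (Ce1 e z) <= 6 / e ^+ 2 /\ nm (Ce2 e z) <= 6 / e ^+ 2.
Proof.
move=> e0; have i0 : 0 <= e^-1 by rewrite invr_ge0 ltW.
have [a b] := C0_grad_bd (e^-1 *: z); rewrite /Ce1 /Ce2 !nm_pR// -exprVn expr2.
by split; rewrite mulrA mulrC ler_wpM2r// mulr_ge0.
Qed.

Lemma Se_bd e z : 0 < e -> nm (Se e z) <= 6 / e ^+ 2.
Proof.
move=> e0; rewrite /Se nm_pR ?sqr_ge0// -exprVn mulrC ler_wpM2r ?sqr_ge0//.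
exact: S0_bd.
Qed.

Lemma Se_grad_bd e z : 0 < e ->
 [/\ nm (Se1 e z) <= 30 / e ^+ 3, nm (Se2 e z) <= 30 / e ^+ 3,
   nm (Se1 e z) * `|z| ^+ 3 <= 30 & nm (Se2 e z) * `|z| ^+ 3 <= 30].
Proof.
move=> e0; have i0 : 0 <= e^-1 by rewrite invr_ge0 ltW.
have i3 : 0 <= e^-1 ^+ 3 by rewrite exprn_ge0.
have [a b c d] := gradS0_bd (e^-1 *: z).
rewrite normrZ (ger0_norm i0) in c d.
have E (w : R[i]) : nm ((e^-1 ^+ 2)%:C * ((e^-1)%:C * w)) = e^-1 ^+ 3 * nm w.
 by rewrite !nm_pR ?sqr_ge0//; ring.
rewrite /Se1 /Se2 !E -exprVn; split.
- by rewrite mulrC ler_wpM2r.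
- by rewrite mulrC ler_wpM2r.
- by apply: le_trans c; rewrite exprMn; apply: eq_ler; ring.
- by apply: le_trans d; rewrite exprMn; apply: eq_ler; ring.
Qed.

Lemma re_out e z : 0 < e -> e <= `|z| -> [/\ re e z = 0, re1 e z = 0 & re2 e z = 0].
Proof.
move=> e0 ez; have h : 1 <= `|e^-1 *: z|.
 by rewrite normrZ ger0_norm ?invr_ge0 ?(ltW e0)// mulrC ler_pdivlMr// mul1r.
by have [a b c] := r0_out h; rewrite /re /re1 /re2 a b c !mulr0.
Qed.

Lemma rr_bd e z : 0 <= rr e z <= 6 / e ^+ 2.
Proof.
have /andP[a b] := rP_ge0 (sq_ge0 (e^-1 *: z)).
rewrite /rr mulr_ge0 ?sqr_ge0//= -exprVn mulrC.
by rewrite ler_wpM2r// sqr_ge0.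
Qed.

Lemma re_bd e z : nm (re e z) <= 6 / e ^+ 2.
Proof. by rewrite reE nmR; have /andP[a b] := rr_bd e z; rewrite ger0_norm. Qed.

Lemma re_grad_bd e z : 0 < e -> nm (re1 e z) <= 24 / e ^+ 3 /\ nm (re2 e z) <= 24 / e ^+ 3.
Proof.
move=> e0; have i0 : 0 <= e^-1 by rewrite invr_ge0 ltW.
have i3 : 0 <= e^-1 ^+ 3 by rewrite exprn_ge0.
have [a b] := r0_grad_bd (e^-1 *: z).
have E (w : R[i]) : nm ((e^-1 ^+ 2)%:C * ((e^-1)%:C * w)) = e^-1 ^+ 3 * nm w.
 by rewrite !nm_pR ?sqr_ge0//; ring.
by rewrite /re1 /re2 !E -exprVn; split; rewrite mulrC ler_wpM2r.
Qed.

Lemma Ce_out e z : 0 < e -> e <= `|z| -> Ce e z = cz z * ((sq z)^-1)%:C.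
Proof.
move=> e0 ez; have h : 1 <= `|e^-1 *: z|.
 by rewrite normrZ ger0_norm ?invr_ge0 ?(ltW e0)// mulrC ler_pdivlMr// mul1r.
rewrite /Ce C0_out//.
have -> : cz (e^-1 *: z) = (e^-1)%:C * cz z.
 rewrite /cz -[(e^-1 *: z).1]/(e^-1 * z.1) -[(e^-1 *: z).2]/(e^-1 * z.2).
 by rewrite !rmorphM/=; ring.
have -> : sq (e^-1 *: z) = (e^-1) ^+ 2 * sq z.
 by rewrite /sq -[(e^-1 *: z).1]/(e^-1 * z.1) -[(e^-1 *: z).2]/(e^-1 * z.2); ring.
have e1 : e^-1 * e^-1 * ((e^-1) ^+ 2 * sq z)^-1 = (sq z)^-1.
 by rewrite -expr2 invfM mulrA divff ?mul1r// expf_neq0// invr_eq0 gt_eqF.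
rewrite -{}e1 !rmorphM/=; ring.
Qed.

Lemma Ce_same e d z : 0 < e -> 0 < d -> e <= `|z| -> d <= `|z| -> Ce e z = Ce d z.
Proof. by move=> e0 d0 ez dz; rewrite !Ce_out. Qed.

Lemma Ce_meas e : [/\ cmeas (Ce e), cmeas (Ce1 e) & cmeas (Ce2 e)].
Proof. exact: C11_cmeas (C11_Ce e). Qed.
Lemma Se_meas e : cmeas (Se e). Proof. by have [] := C11_cmeas (C11_Se e). Qed.
Lemma re_meas e : cmeas (re e). Proof. by have [] := C11_cmeas (C11_re e). Qed.
Lemma Ke_meas e : cmeas (Ke e). Proof. by have [] := C11_cmeas (C11_Ke e). Qed.
Lemma rr_meas e : mfun (rr e).
Proof. by case: (re_meas e) => [h _]; rewrite (_ : rr e = fun z => Re (re e z))//; apply/funext => z; rewrite reE. Qed.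

Lemma I2_Ce_ball e (r : R) : 0 < e -> 0 < r -> I2 (fun z => nm (Ce e z) * \1_(ball 0 r) z) <= 16 * r.
Proof.
move=> e0 r0; apply: (@I2_inv_ball _ _ (3 / e)) => //.
- by apply: meas_nm; have [] := Ce_meas e.
- by move=> z; rewrite nm_ge0; have [] := Ce_bd z e0.
- by move=> z; have [] := Ce_bd z e0.
Qed.

Lemma L1_Ce_ball e (r : R) : 0 < e -> L1 (fun z => nm (Ce e z) * \1_(ball 0 r) z).
Proof.
move=> e0; apply: (@L1_ind_bd _ _ _ (3 / e) r) => //.
- by apply: meas_nm; have [] := Ce_meas e.
- exact: mball2.
- by move=> z _; rewrite ger0_norm ?nm_ge0//; have [] := Ce_bd z e0.
Qed.

Lemma L1_rr e : 0 < e -> L1 (rr e).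
Proof.
move=> e0; apply: (@L1_box _ (6 / e ^+ 2) e); first exact: rr_meas.
- by move=> z; have /andP[a b] := rr_bd e z; rewrite ger0_norm.
- move=> z hz; have ez : e <= `|z| by exact: nball0.
 by have [] := re_out e0 ez; rewrite reE => /(congr1 (@Re R)).
Qed.

(** The mass of the mollifier, in fact [2 * pi]. It stands where 1 would stand in the reproducing
    formulas, and the crude bounds [1 <= c0 <= 24] suffice. *)
Definition c0 : R := I2 (rr 1).

Lemma I2_rr e : 0 < e -> I2 (rr e) = c0.
Proof.
move=> e0; have -> : rr e = (fun z => e^-1 ^+ 2 * rr 1 (0 + e^-1 *: z)).
 by apply/funext => z; rewrite add0r /rr invr1 expr1n mul1r scale1r.
have en : e^-1 != 0 by rewrite invr_eq0 gt_eqF.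
rewrite I2Z; last exact: (L1_affine 0 en (L1_rr ltr01)).
rewrite (I2_affine 0 en (L1_rr ltr01)) mulrA -exprVn invrK exprVn mulVf ?mul1r//.
by rewrite expf_neq0// gt_eqF.
Qed.

Lemma c0_bd : 1 <= c0 <= 24.
Proof.
apply/andP; split.
 have h : 0 <= 1 / 2 :> R by lra.
 apply: (@le_trans _ _ (3 / 2 * (2 * (1 / 2)) ^+ 2)); first by rewrite expr2; lra.
 rewrite -(@I2_ball R 0 (1 / 2) h) -I2Z; last exact: L1_ball.
 apply: I2_le; [exact: (L1Z _ (L1_ball _ _))|exact: L1_rr|].
 move=> z; have [zb|zb] := pselect (ball 0 (1 / 2) z); last first.
  by rewrite ind_out// mulr0; have /andP[] := rr_bd 1 z.
 rewrite ind_in// mulr1 /rr invr1 expr1n mul1r scale1r /rP /pw.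
 have s2 : sq z <= 1 / 2.
  apply: (le_trans (sq_norm z)); move/ball0E: zb => zb; have := normr_ge0 z; rewrite expr2; nra.
 have s0 := sq_ge0 z.
 case: ltP => s1; last lra.
 by rewrite expr2; nra.
apply: (@le_trans _ _ (6 * (2 * 1) ^+ 2)); last by rewrite expr2; lra.
rewrite -(@I2_ball R 0 1 ler01) -I2Z; last exact: L1_ball.
apply: I2_le; [exact: L1_rr|exact: (L1Z _ (L1_ball _ _))|].
move=> z; have /andP[a b] := rr_bd 1 z; rewrite expr1n divr1 in b.
have [zb|zb] := pselect (ball 0 1 z); first by rewrite ind_in// mulr1.
have ez : 1 <= `|z| by exact: nball0.
have [+ _ _] := re_out ltr01 ez; rewrite reE => /(congr1 (@Re R)) /= ->.
by rewrite ind_out// mulr0.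
Qed.

(** The two kernels agree beyond the larger scale, so their difference is integrable with norm of
    the order of that scale: changing the scale of the Cauchy kernel is cheap. *)
Lemma I2_Ce_diff e d : 0 < e -> 0 < d ->
 let k z := Ce e z - Ce d z in
 [/\ cL1 k, I2 (fun z => nm (k z)) <= 32 * Num.max e d & forall z, nm (k z) <= 3 / e + 3 / d].
Proof.
move=> e0 d0 k; set m := Num.max e d.
have m0 : 0 < m by rewrite lt_max e0.
have mk : cmeas k by apply: cmeasB; [have [] := Ce_meas e|have [] := Ce_meas d].
have kb z : nm (k z) <= 3 / e + 3 / d.
 by apply: (le_trans (nmB _ _)); apply: lerD; [have [] := Ce_bd z e0|have [] := Ce_bd z d0].
have k0 z : m <= `|z| -> k z = 0.
 by rewrite ge_max => /andP[ez dz]; rewrite /k (Ce_same e0 d0)// subrr.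
have Lk : cL1 k by apply: (@bd_supp_cL1 _ (3 / e + 3 / d) m).
split => //; apply: (@le_trans _ _ (16 * m + 16 * m)); last lra.
apply: le_trans (lerD (I2_Ce_ball e0 m0) (I2_Ce_ball d0 m0)).
rewrite -I2D; try exact: L1_Ce_ball.
apply: I2_le; [exact: L1_nm|by apply: L1D; exact: L1_Ce_ball|].
move=> z; have [zm|zm] := pselect (ball 0 m z).
 rewrite !ind_in// !mulr1; exact: nmB.
rewrite k0 ?nm0 ?ind_out ?mulr0 ?addr0//; exact: nball0.
Qed.

(* Splitting the Cauchy kernel at distance [t]. *)
Lemma Ce_sup e (psi : pt -> R[i]) (B t : R) y : 0 < e -> 0 < t -> cL1 psi -> bdd psi B ->
 nm (cI (fun x => Ce e (x - y) * psi x)) <= 16 * B * t + I2 (fun x => nm (psi x)) / t.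
Proof.
move=> e0 t0 Lp pB; have [mC _ _] := Ce_meas e.
have B0 : 0 <= B by exact: le_trans (nm_ge0 _) (pB 0).
have LC : cL1 (fun x => Ce e (x - y) * psi x).
 by apply: (@cL1_bdM _ (3 / e)) => // [|x]; [exact: cmeas_subr|have [] := Ce_bd (x - y) e0].
apply: (le_trans (cI_abs LC)).
have [Ls Es] := I2_shift y (L1_Ce_ball t e0).
apply: (@le_trans _ _ (B * I2 (fun x => nm (Ce e (x - y)) * \1_(ball 0 t) (x - y)) + I2 (fun x => nm (psi x) / t))); last first.
 rewrite Es I2Zr; last exact: L1_nm.
 by rewrite lerD2r; have := ler_wpM2l B0 (I2_Ce_ball e0 t0); lra.
have Lpt : L1 (fun x => nm (psi x) / t) by apply: L1Zr; exact: L1_nm.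
rewrite -I2Z// -I2D//; last exact: L1Z.
apply: I2_le; [exact: L1_nm|by apply: L1D => //; exact: L1Z|].
move=> x; rewrite nmM; have c0 := nm_ge0 (Ce e (x - y)); have p0 := nm_ge0 (psi x).
have [zb|zb] := pselect (ball 0 t (x - y)).
 rewrite ind_in// mulr1; apply: ler_wpDr; first by rewrite divr_ge0// ltW.
 by rewrite mulrC ler_wpM2r.
rewrite ind_out// !mulr0 add0r mulrC ler_wpM2l// -[leRHS]mul1r ler_pdivlMr//.
have tz : t <= `|x - y| by exact: nball0.
by have [_] := Ce_bd (x - y) e0; apply: le_trans; rewrite ler_wpM2l.
Qed.
End Scaled.

(** * Cutoff functions *)

Section Cutoff.
Context {R : realType}.
Local Notation pt := (R * R)%type.

Definition C11r (f f1 f2 : pt -> R) :=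
 C11 (fun z => (f z)%:C) (fun z => (f1 z)%:C) (fun z => (f2 z)%:C).

Lemma C11_Re (F F1 F2 : pt -> R[i]) : C11 F F1 F2 ->
 C11r (fun z => Re (F z)) (fun z => Re (F1 z)) (fun z => Re (F2 z)).
Proof.
move=> C; have E w : (2^-1)%:C * (w + cj w) = (Re w)%:C :> R[i] by apply: cplx_eq; rewrite !reim; field.
by apply: C11_eq (C11_Z (2^-1)%:C (C11_D C (C11_cj C))) => z; rewrite E.
Qed.

(* The cutoff is the mollification at scale [1/2] of the indicator of [ball 0 (a + 1/2)]. *)
Lemma cutoff_exists (a : R) : 0 <= a -> exists x x1 x2 : pt -> R, [/\
 TF (a + 1) (fun z => (x z)%:C) (fun z => (x1 z)%:C) (fun z => (x2 z)%:C),
 forall z, 0 <= x z <= 1,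
 forall z, `|z| <= a -> [/\ x z = 1, x1 z = 0 & x2 z = 0] &
 exists G : R, 0 <= G /\ forall z, `|x1 z| <= G /\ `|x2 z| <= G].
Proof.
move=> a0; pose e : R := 2^-1; have e0 : 0 < e by rewrite invr_gt0.
have ee : e + e = 1 by rewrite /e; lra.
have /andP[c1 _] := @c0_bd R; have cp : 0 < (c0 : R) by lra.
have [M [M0 hM]] := C11_bound e (C11_re e).
have Tr : TF e (re e) (re1 e) (re2 e) by split; [exact: C11_re| | |] => z /(re_out e0)[].
have [_ s0 s1 s2] := Tr; have [m0 m1 m2] := C11_cmeas (C11_re e); have [L0 L1' L2'] := TF_cL1 Tr.
have bd z : [/\ nm (re e z) <= M, nm (re1 e z) <= M & nm (re2 e z) <= M].
 have [ze|/ltW ez] := leP `|z| e; first exact: hM.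
 by rewrite s0// s1// s2// nm0.
have b0 z : nm (re e z) <= M by case: (bd z).
have b1 z : nm (re1 e z) <= M by case: (bd z).
have b2 z : nm (re2 e z) <= M by case: (bd z).
pose g : pt -> R := \1_(ball 0 (a + e)); pose gc z : R[i] := (g z)%:C.
have Lg : cL1 gc := cL1R (L1_ball 0 (a + e)).
have sg : supp (a + e) gc by move=> z ze; rewrite /gc /g ind_out// => /ball0E; rewrite ltNge ze.
have CX := C11_cnv (C11_re e) b0 b1 b2 Lg sg.
pose X k z := c0^-1 * Re (cnv k gc z).
have out k : supp e k -> forall z, a + 1 <= `|z| -> X k z = 0.
 move=> sk z za; rewrite /X /cnv (@cI_eq _ _ (fun _ => 0)) ?cI0 ?Re0 ?mulr0// => y.
 have [ye|ey] := leP e `|z - y|; first by rewrite sk// mul0r.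
 by rewrite sg ?mulr0//; have := ler_normD (z - y) y; rewrite subrK; lra.
have val k z : supp e k -> cL1 k -> `|z| <= a -> X k z = c0^-1 * Re (cI k).
 move=> sk Lk za; rewrite /X /cnv (@cI_eq _ _ (fun y => k (z - y))); last first.
  move=> y; have [ye|ey] := leP e `|z - y|; first by rewrite sk// mul0r.
  rewrite /gc /g ind_in ?mulr1//; apply/ball0E.
  by have := ler_normB z (z - y); rewrite subKr; lra.
 by rewrite !Re_cI (I2_reflect z Lk.1).2.
have gr k z : cmeas k -> bdd k M -> `|X k z| <= c0^-1 * (M * I2 (fun y => nm (gc y))).
 move=> mk kM; rewrite normrM gtr0_norm ?invr_gt0// ler_pM2l ?invr_gt0//.
 exact: le_trans (nm_Re _) (cnv_bd mk kM Lg z).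
exists (X (re e)), (X (re1 e)), (X (re2 e)); split.
- split; try by move=> z za; rewrite out.
 by apply: C11_eq (C11_Z (c0^-1)%:C (C11_Re CX)) => z; rewrite -rmorphM.
- move=> z; have Lr := I2_reflect z (L1_rr e0).
 have i01 y := ind_itv (ball 0 (a + e)) y; have r0 y : 0 <= rr e y by case/andP: (rr_bd e y).
 have XE : X (re e) z = c0^-1 * I2 (fun y => rr e (z - y) * g y).
  by rewrite /X /cnv Re_cI; congr (_ * _); apply: I2_eq => y; rewrite reE -rmorphM.
 rewrite XE mulr_ge0 ?invr_ge0 ?(ltW cp) ?I2_ge0//=; last first.
  by move=> y; rewrite mulr_ge0//; case/andP: (i01 y).
 rewrite ler_pdivrMl// mulr1 -(I2_rr e0) -Lr.2; apply: I2_le0; [|exact: Lr.1|].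
  by apply: measurable_funM; [exact: L1_meas Lr.1|exact: meas_ball].
 by move=> y; have /andP[h0 h1] := i01 y; rewrite mulr_ge0//= ler_piMr.
- move=> z za; rewrite !val// (cI_d1 (ltW e0) Tr) (cI_d2 (ltW e0) Tr) Re0 mulr0; split=> //.
 rewrite Re_cI (@I2_eq _ _ (rr e)) ?I2_rr// ?mulVf ?gt_eqF// => y; by rewrite reE.
- exists (c0^-1 * (M * I2 (fun y => nm (gc y)))); split; last by move=> z; split; exact: gr.
 rewrite !mulr_ge0 ?invr_ge0 ?(ltW cp)// I2_ge0// => y; exact: nm_ge0.
Qed.
End Cutoff.

(** * L2 and weak type bounds for the truncated Beurling kernel *)

Section L2bound.
Context {R : realType}.
Local Notation pt := (R * R)%type.
Implicit Types (k f g psi : pt -> R[i]).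

Lemma L1_sqball f (M s : R) : cmeas f -> bdd f M ->
 L1 (fun x => nm (f x) ^+ 2 * \1_(ball 0 s) x).
Proof.
move=> mf fM; apply: (@L1_ind_bd _ _ _ (M ^+ 2) s) => //.
- apply: measurable_funX; exact: meas_nm.
- exact: mball2.
- move=> z _; rewrite ger0_norm ?sqr_ge0// ler_pXn2r ?nnegrE ?nm_ge0//.
 exact: le_trans (nm_ge0 _) (fM z).
Qed.

Lemma young_L2 k psi (M s : R) : cmeas k -> bdd k M -> cL1 k ->
 cL1 psi -> L1 (fun x => nm (psi x) ^+ 2) ->
 I2 (fun x => nm (cnv k psi x) ^+ 2 * \1_(ball 0 s) x)
 <= I2 (fun z => nm (k z)) ^+ 2 * I2 (fun x => nm (psi x) ^+ 2).
Proof.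
move=> mk kM Lk Lp Lp2; pose N := I2 (fun z => nm (k z)).
have N0 : 0 <= N by apply: I2_ge0 => z; exact: nm_ge0.
have mak := meas_nm mk; have akM z : `|nm (k z)| <= M by rewrite ger0_norm ?nm_ge0.
pose w x := rconv (fun z => `|nm (k z)|) (fun y => `|nm (psi y) ^+ 2|) x.
have wx x : nm (cnv k psi x) ^+ 2 <= N * w x.
 have L (g : pt -> R) : L1 g -> L1 (fun y => nm (k (x - y)) * g y).
  exact: (L1_conv_in x mak akM).
 have Lky := (I2_reflect x (L1_nm Lk)).1.
 apply: (@le_trans _ _ (I2 (fun y => nm (k (x - y)) * nm (psi y)) ^+ 2)).
  rewrite ler_pXn2r ?nnegrE ?nm_ge0//; last by apply: I2_ge0 => y; rewrite mulr_ge0 ?nm_ge0.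
  apply: (le_trans (cI_abs (cL1_conv_in x mk kM Lp))).
  by under eq_fun do rewrite nmM.
 rewrite /N -(I2_reflect x (L1_nm Lk)).2 /w /rconv.
 apply: amgm_sq; try by apply: I2_ge0 => y; rewrite ?mulr_ge0 ?nm_ge0.
 move=> l l0.
 have La := L _ (L1_nm Lp); have Lb := L _ Lp2.
 rewrite -I2Z// -I2Z; last exact: Lky.
 have -> : (fun y => `|nm (k (x - y))| * `|nm (psi y) ^+ 2|) = (fun y => nm (k (x - y)) * nm (psi y) ^+ 2).
  by apply/funext => y; rewrite !ger0_norm ?sqr_ge0 ?nm_ge0.
 rewrite -I2Zr// -I2D; [|exact: L1Z|exact: L1Zr].
 apply: I2_le; [exact: L1Z|by apply: L1D; [exact: L1Z|exact: L1Zr]|].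
 move=> y; set a := nm _; set b := nm (psi y).
 have a0 : 0 <= a by exact: nm_ge0.
 have h : 2 * b <= l + b ^+ 2 / l.
  have -> : l + b ^+ 2 / l = (l ^+ 2 + b ^+ 2) / l by field; rewrite gt_eqF.
  by rewrite ler_pdivlMr//; have := sqr_ge0 (l - b); lra.
 by have := ler_wpM2l a0 h; lra.
have mw : mfun w.
 apply: meas_conv; first by apply: measurableT_comp.
 apply: measurableT_comp => //; exact: L1_meas Lp2.
have wM x : `|w x| <= M * I2 (fun x => nm (psi x) ^+ 2).
 rewrite /w; apply: le_trans (conv_bd x _ _ _) _.
 - exact: measurableT_comp.
 - move=> z; rewrite normr_id; exact: akM.
 - exact: L1_abs.
 - rewrite (_ : (fun y => _) = (fun x => nm (psi x) ^+ 2))//.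
  by apply/funext => y; rewrite normr_id ger0_norm ?sqr_ge0.
have Lb := L1_ball 0 s.
have Lw : L1 (fun x => w x * \1_(ball 0 s) x) by apply: L1_bdM mw wM Lb.
apply: (@le_trans _ _ (I2 (fun x => N * (w x * \1_(ball 0 s) x)))).
 apply: I2_le; [|exact: L1Z|].
  apply: (@L1_sqball _ (M * I2 (fun y => nm (psi y)))); first exact: (cmeas_cnv mk kM Lp).
  move=> x; exact: (cnv_bd mk kM Lp).
 move=> x; rewrite mulrA ler_wpM2r//; by case/andP: (ind_itv (ball 0 s) x).
rewrite I2Z// expr2 -mulrA ler_wpM2l//.
have h := @I2_conv_le _ (fun z => nm (k z)) (fun x => nm (psi x) ^+ 2) (\1_(ball 0 s)) M N mak akM _ Lb Lp2.
apply: (le_trans _ (le_trans (h _) _)).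
- apply/eq_ler/I2_eq => x.
 by rewrite mulrC ger0_norm//; case/andP: (ind_itv (ball 0 s) x).
- move=> y; have [L1s I2s] := I2_shift y (L1_nm Lk).
 rewrite /N -I2s; apply: I2_le0 => //.
  apply: measurableT_comp => //; apply: measurable_funM; first exact: L1_meas L1s.
  exact: meas_ball.
 move=> x; rewrite normr_ge0 normrM ger0_norm ?nm_ge0//=.
 by rewrite ler_piMr ?nm_ge0// norm_ind.
- rewrite ler_wpM2l//; apply/eq_ler/I2_eq => x.
 by rewrite ger0_norm ?sqr_ge0.
Qed.

(** The Cauchy kernel is not integrable at infinity. With [psi] living in the ball of radius [r] and
    the result read on that of radius [s], only the part of the kernel in the ball of radius [s + r]
    is seen. *)
Lemma young_L2_local k psi (M s r B A : R) : cmeas k -> bdd k M ->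
 cmeas psi -> bdd psi B -> supp r psi ->
 I2 (fun z => nm (k z) * \1_(ball 0 (s + r)) z) <= A ->
 I2 (fun x => nm (cnv k psi x) ^+ 2 * \1_(ball 0 s) x)
 <= A ^+ 2 * I2 (fun x => nm (psi x) ^+ 2).
Proof.
move=> mk kM mp pB sp kA.
have Lp : cL1 psi by exact: cL1_box mp pB (supp_ball sp).
have Lp2 : L1 (fun x => nm (psi x) ^+ 2).
 apply: (@L1_box _ (B ^+ 2) r).
 - apply: measurable_funX; exact: meas_nm.
 - move=> x; rewrite ger0_norm ?sqr_ge0// ler_pXn2r ?nnegrE ?nm_ge0//.
  exact: le_trans (nm_ge0 _) (pB x).
 - by move=> x /(supp_ball sp) ->; rewrite nm0 expr0n.
pose k' z := k z * (\1_(ball 0 (s + r)) z)%:C.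
have mb : mfun (\1_(ball 0 (s + r)) : pt -> R).
 exact: meas_ball.
have mk' : cmeas k' by apply: cmeasM => //; exact: cmeasR.
have ak' z : nm (k' z) = nm (k z) * \1_(ball 0 (s + r)) z.
 by rewrite /k' nmM nmR ger0_norm//; case/andP: (ind_itv (ball 0 (s + r)) z).
have k'M z : nm (k' z) <= M.
 by rewrite ak' (le_trans _ (kM z))// ler_piMr ?nm_ge0//; case/andP: (ind_itv (ball 0 (s + r)) z).
have Lk' : cL1 k'.
 apply: (@cL1_box _ M (s + r)) => // x xb; by rewrite /k' ind_out ?mulr0.
have A0 : 0 <= I2 (fun z => nm (k' z)) by apply: I2_ge0 => z; exact: nm_ge0.
have -> : (fun x => nm (cnv k psi x) ^+ 2 * \1_(ball 0 s) x) =
  (fun x => nm (cnv k' psi x) ^+ 2 * \1_(ball 0 s) x).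
 apply/funext => x; have [xb|xb] := pselect (ball 0 s x); last by rewrite !(ind_out xb) !mulr0.
 congr (nm _ ^+ 2 * _); apply: cI_eq => y.
 have [/sp ->|yr] := leP r `|y|; first by rewrite !mulr0.
 rewrite /k' ind_in ?mulr1//; apply/ball0E.
 by rewrite (le_lt_trans (ler_normB _ _))// ltrD//; exact/ball0E.
apply: (le_trans (young_L2 s mk' k'M Lk' Lp Lp2)).
have e : I2 (fun z => nm (k' z)) <= A.
 by apply: le_trans kA; apply/eq_ler/I2_eq.
rewrite ler_wpM2r ?I2_ge0// => [x|]; first exact: sqr_ge0.
by rewrite ler_pXn2r ?nnegrE// (le_trans A0).
Qed.

Lemma Ce1E e (z : pt) : Ce1 e z = 2^-1 * (re e z + Se e z).
Proof. by rewrite -DbarCe -DCe; field. Qed.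

Lemma Ce2E e (z : pt) : Ce2 e z = (- iC / 2) * (re e z - Se e z).
Proof.
rewrite -DbarCe -DCe; transitivity (- (iC * iC) * Ce2 e z); first by rewrite iC2; ring.
by field.
Qed.

Lemma C11_Ce1 e : C11 (Ce1 e : pt -> R[i]) (fun z => 2^-1 * (re1 e z + Se1 e z))
 (fun z => 2^-1 * (re2 e z + Se2 e z)).
Proof.
by apply: C11_eq (C11_Z 2^-1 (C11_D (C11_re e) (C11_Se e))) => // z; rewrite Ce1E.
Qed.

(** [DbarSe] gives both mixed second derivatives the same expression [2^-1 * (re2 e + Se2 e)], the
    symmetry on which the integration by parts in [caccioppoli] rests. *)
Lemma C11_Ce2 e : C11 (Ce2 e : pt -> R[i]) (fun z => 2^-1 * (re2 e z + Se2 e z))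
 (fun z => (- iC / 2) * (re2 e z - Se2 e z)).
Proof.
have H := C11_Z (- iC / 2) (C11_D (C11_re e) (C11_Z (-1) (C11_Se e))).
apply: C11_eq H => z; rewrite ?mulN1r ?Ce2E//.
have h : iC * Se2 e z = re1 e z - iC * re2 e z - Se1 e z by rewrite -DbarSe; ring.
have -> : Se2 e z = - iC * (re1 e z - iC * re2 e z - Se1 e z).
 by rewrite -h mulrA mulNr iC2; ring.
transitivity (2^-1 * ((1 + iC * iC) * re2 e z - iC * (re1 e z - Se1 e z))).
 by rewrite iC2; field.
by congr (_ * _); ring.
Qed.

Lemma nm_mul_i (z : R[i]) : nm (iC * z) = nm z.
Proof. by rewrite nmM nmi mul1r. Qed.

Lemma L1_sq_C11 f f1 f2 (s : R) : C11 f f1 f2 ->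
 L1 (fun x => nm (f x) ^+ 2 * \1_(ball 0 s) x).
Proof.
move=> Cf; have [M [M0 hM]] := C11_bound s Cf; have [mf _ _] := C11_cmeas Cf.
apply: (@L1_ind_bd _ _ _ (M ^+ 2) s) => //.
- apply: measurable_funX; exact: meas_nm.
- exact: mball2.
- move=> z /ball0E/ltW/hM[h _ _].
 by rewrite ger0_norm ?sqr_ge0// ler_pXn2r ?nnegrE ?nm_ge0.
Qed.

(* [|DP|^2 - |Dbar P|^2] is a null Lagrangian, so it integrates to zero up
  to cutoff terms. *)
Lemma caccioppoli (P P1 P2 P11 P12 P22 : pt -> R[i]) (th th1 th2 : pt -> R) (s G : R) :
 0 < s -> C11 P P1 P2 -> C11 P1 P11 P12 -> C11 P2 P12 P22 ->
 TF (s + 1) (fun z => (th z)%:C) (fun z => (th1 z)%:C) (fun z => (th2 z)%:C) ->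
 (forall z, 0 <= th z <= 1) ->
 (forall z : pt, `|z| <= s -> [/\ th z = 1, th1 z = 0 & th2 z = 0]) ->
 0 <= G -> (forall z, `|th1 z| <= G /\ `|th2 z| <= G) ->
 2^-1 * I2 (fun x => nm (P1 x - iC * P2 x) ^+ 2 * \1_(ball 0 s) x) <=
 3 / 2 * I2 (fun x => nm (P1 x + iC * P2 x) ^+ 2 * \1_(ball 0 (s + 1)) x)
 + 16 * G ^+ 2 * I2 (fun x => nm (P x) ^+ 2 * \1_(ball 0 (s + 1)) x).
Proof.
move=> s0 CP CP1 CP2 Tt th01 thin G0 Gth.
have s10 : 0 <= s + 1 by lra.
pose t z := (th z)%:C; pose t1 z := (th1 z)%:C; pose t2 z := (th2 z)%:C.
have Ct : C11 t t1 t2 by case: Tt.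
(* The first of [th^2 P conj(d2 P)], [th^2 P conj(d1 P)] is differentiated by d1, the second by d2.
   In the difference the second derivatives of [P] cancel, and the imaginary part is [th^2 / 2]
   times [|Dbar P|^2 - |D P|^2], plus cutoff terms. *)
have TF1 := TF_M (TF_M Tt Ct) (C11_M CP (C11_cj CP2)).
have TF2 := TF_M (TF_M Tt Ct) (C11_M CP (C11_cj CP1)).
pose F1 z := (t1 z * t z + t z * t1 z) * (P z * cj (P2 z)) + t z * t z * (P1 z * cj (P2 z) + P z * cj (P12 z)).
pose F2 z := (t2 z * t z + t z * t2 z) * (P z * cj (P1 z)) + t z * t z * (P2 z * cj (P1 z) + P z * cj (P12 z)).
have L1F : cL1 F1 by have [_ + _] := TF_cL1 TF1.
have L2F : cL1 F2 by have [_ _ +] := TF_cL1 TF2.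
have I1 : cI F1 = 0 by exact: (cI_d1 s10 TF1).
have I2' : cI F2 = 0 by exact: (cI_d2 s10 TF2).
have IJ : I2 (fun z => Im (F1 z - F2 z)) = 0.
 transitivity (Im (cI (fun z => F1 z - F2 z))) => //.
 by rewrite cIB// I1 I2' subrr.
have LJ : L1 (fun z => Im (F1 z - F2 z)) by case: (cL1B L1F L2F).
have LS : L1 (fun x => nm (P1 x - iC * P2 x) ^+ 2 * \1_(ball 0 s) x).
 have H := C11_D CP1 (C11_Z (- iC) CP2).
 by apply: (L1_sq_C11 s (C11_eq _ _ _ H)) => // z; rewrite mulNr.
have LQ := L1_sq_C11 (s + 1) (C11_D CP1 (C11_Z iC CP2)).
have LP := L1_sq_C11 (s + 1) CP.
have key x : 2^-1 * (nm (P1 x - iC * P2 x) ^+ 2 * \1_(ball 0 s) x) <=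
  3 / 2 * (nm (P1 x + iC * P2 x) ^+ 2 * \1_(ball 0 (s + 1)) x)
  + 16 * G ^+ 2 * (nm (P x) ^+ 2 * \1_(ball 0 (s + 1)) x) + (- 2) * Im (F1 x - F2 x).
 have [xs|xs] := pselect (ball 0 (s + 1) x); last first.
  have x1 : s + 1 <= `|x| by exact: nball0.
  have xs' : ~ ball 0 s x by move=> /ball0E h; apply: xs; apply/ball0E; lra.
  have [_ S0 S1 S2] := Tt; rewrite (ind_out xs) (ind_out xs').
  rewrite /F1 /F2 /t /t1 /t2 (S0 _ x1) (S1 _ x1) (S2 _ x1).
  by rewrite !(mul0r, mulr0, addr0) subr0 Im0 !mulr0.
 rewrite (ind_in xs) !mulr1.
 have a01 := th01 x; have [Ga Gb] := Gth x.
 set cS := nm (P1 x - _) ^+ 2; set cQ := nm (P1 x + _) ^+ 2.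
 have le1 : cS * \1_(ball 0 s) x <= th x ^+ 2 * cS.
  have [xb|xb] := pselect (ball 0 s x); last by rewrite ind_out// mulr0 mulr_ge0 ?sqr_ge0.
  have [-> _ _] : [/\ th x = 1, th1 x = 0 & th2 x = 0] by apply: thin; apply: ltW; exact/ball0E.
  by rewrite ind_in// mulr1 expr1n mul1r.
 have le2 : th x ^+ 2 * cQ <= cQ.
  by rewrite ler_piMl ?sqr_ge0//; case/andP: a01 => u v; rewrite exprn_ile1.
 have Gs (u : R) : `|u| <= G -> u ^+ 2 <= G ^+ 2.
  by move=> h; rewrite ler_sqr_norm.
 have {Ga}Ga := Gs _ Ga; have {Gb}Gb := Gs _ Gb.
 have -> : Im (F1 x - F2 x) = th x ^+ 2 * (2 * (Im (P1 x) * Re (P2 x) - Re (P1 x) * Im (P2 x)))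
   + 2 * th x * (Re (P x) * (- th1 x * Im (P2 x) + th2 x * Im (P1 x)) + Im (P x) * (th1 x * Re (P2 x) - th2 x * Re (P1 x))).
  by rewrite /F1 /F2 /t /t1 /t2; move: (P x) (P1 x) (P2 x) (th x) (th1 x) (th2 x) => *; rewrite !reim; ring.
 have q1 : th x ^+ 2 * cS = th x ^+ 2 * ((Re (P1 x) + Im (P2 x)) ^+ 2 + (Im (P1 x) - Re (P2 x)) ^+ 2).
  by rewrite /cS sqr_nm !reim; ring.
 have q2 : th x ^+ 2 * cQ = th x ^+ 2 * ((Re (P1 x) - Im (P2 x)) ^+ 2 + (Im (P1 x) + Re (P2 x)) ^+ 2).
  by rewrite /cQ sqr_nm !reim; ring.
 have q3 : G ^+ 2 * nm (P x) ^+ 2 = G ^+ 2 * Re (P x) ^+ 2 + G ^+ 2 * Im (P x) ^+ 2.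
  by rewrite sqr_nm mulrDr.
 rewrite q1 in le1; rewrite q2 in le2; move: le1 le2; rewrite -(mulrA 16) q3.
 set cSi := cS * _; move: cSi cQ {q1 q2 q3} => cSi cQ.
 move: (th x) (th1 x) (th2 x) (Re (P x)) (Im (P x)) (Re (P1 x)) (Im (P1 x)) (Re (P2 x)) (Im (P2 x)) Ga Gb {a01}.
 move=> tt a b p q c d f g Ga Gb le1 le2.
 (* What is left to show is that [th^2 |grad P|^2], plus cutoff terms linear in grad P, plus
    [16 G^2 |P|^2], is nonnegative; these four squares absorb the linear terms. *)
 have k1 := sqr_ge0 (tt * g + 2 * p * a); have k2 := sqr_ge0 (tt * d - 2 * p * b).
 have k3 := sqr_ge0 (tt * f - 2 * q * a); have k4 := sqr_ge0 (tt * c + 2 * q * b).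
 have m1 := ler_wpM2l (sqr_ge0 p) Ga; have m2 := ler_wpM2l (sqr_ge0 p) Gb.
 have m3 := ler_wpM2l (sqr_ge0 q) Ga; have m4 := ler_wpM2l (sqr_ge0 q) Gb.
 have n1 : 0 <= G ^+ 2 * p ^+ 2 by rewrite mulr_ge0 ?sqr_ge0.
 have n2 : 0 <= G ^+ 2 * q ^+ 2 by rewrite mulr_ge0 ?sqr_ge0.
 lra.
have E (a b : R) : a * I2 (fun x => nm (P1 x + iC * P2 x) ^+ 2 * \1_(ball 0 (s + 1)) x)
  + b * I2 (fun x => nm (P x) ^+ 2 * \1_(ball 0 (s + 1)) x)
 = I2 (fun x => a * (nm (P1 x + iC * P2 x) ^+ 2 * \1_(ball 0 (s + 1)) x)
  + b * (nm (P x) ^+ 2 * \1_(ball 0 (s + 1)) x) + (- 2) * Im (F1 x - F2 x)).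
 rewrite I2D; [|by apply: L1D; exact: L1Z|exact: L1Z].
 rewrite (I2Z (- 2) LJ) IJ mulr0 addr0 I2D; [|exact: L1Z|exact: L1Z].
 by rewrite !I2Z.
rewrite E -I2Z//; apply: I2_le => //; first exact: L1Z.
by apply: L1D; [apply: L1D; exact: L1Z|exact: L1Z].
Qed.

(** For [P] the convolution of [Ce e] with [psi], D P is that of [Se e] and Dbar P that of [re e].
    Both terms on the right of [caccioppoli] thus involve kernels whose mass on the relevant ball is
    bounded whatever [e], by 24 and by [16 * (s1 + r)]. *)
Lemma Se_L2 (s r : R) : 0 < s -> 0 < r -> exists A : R, 0 <= A /\
 forall e : R, 0 < e <= 1 -> forall psi (B : R), cmeas psi ->
 bdd psi B -> supp r psi ->
 I2 (fun x => nm (cnv (Se e) psi x) ^+ 2 * \1_(ball 0 s) x)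
 <= A * I2 (fun x => nm (psi x) ^+ 2).
Proof.
move=> s0 r0; have [th [th1 [th2 [Tth th01 thin [G [G0 Gth]]]]]] := cutoff_exists (ltW s0).
pose s1 := s + 1; have s10 : 0 < s1 by rewrite /s1; lra.
pose A := 3 * 24 ^+ 2 + 32 * G ^+ 2 * (16 * (s1 + r)) ^+ 2.
have A0 : 0 <= A by rewrite /A addr_ge0// mulr_ge0// ?sqr_ge0// mulr_ge0// sqr_ge0.
exists A; split => // e /andP[e0 e1] psi B mp pB sp.
have Lp : cL1 psi by exact: cL1_box mp pB (supp_ball sp).
have [Cm C1m C2m] := Ce_meas e.
have Ceb z := (Ce_bd z e0).1.
have C1b z := (Ce_grad_bd z e0).1; have C2b z := (Ce_grad_bd z e0).2.
have CP : C11 (cnv (Ce e) psi) (cnv (Ce1 e) psi) (cnv (Ce2 e) psi).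
 apply: (C11_cnv (C11_Ce e) (M := Num.max (3 / e) (6 / e ^+ 2)) _ _ _ Lp sp) => z;
  rewrite le_max; apply/orP; [left; exact: Ceb|right; exact: C1b|right; exact: C2b].
pose M := 24 / e ^+ 3 + 30 / e ^+ 3.
have hM (x y : R[i]) : nm x <= 24 / e ^+ 3 -> nm y <= 30 / e ^+ 3 ->
  nm (2^-1 * (x + y)) <= M /\ nm ((- iC / 2) * (x - y)) <= M.
 move=> hx hy.
 have h2 : nm (2^-1 : R[i]) = 2^-1 by rewrite nmV two_cplx nmR ger0_norm.
 rewrite !nmM nmN nmi h2 mul1r; have H := lerD hx hy.
 have a1 := le_trans (nmD x y) H; have a2 := le_trans (nmB x y) H.
 have b1 := nm_ge0 (x + y); have b2 := nm_ge0 (x - y); rewrite -/M in a1 a2; lra.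
have g1 z : nm (re1 e z) <= 24 / e ^+ 3 by have [] := re_grad_bd z e0.
have g2 z : nm (re2 e z) <= 24 / e ^+ 3 by have [] := re_grad_bd z e0.
have h1 z : nm (Se1 e z) <= 30 / e ^+ 3 by have [] := Se_grad_bd z e0.
have h2 z : nm (Se2 e z) <= 30 / e ^+ 3 by have [] := Se_grad_bd z e0.
have CP1 : C11 (cnv (Ce1 e) psi) (cnv (fun z => 2^-1 * (re1 e z + Se1 e z)) psi)
  (cnv (fun z => 2^-1 * (re2 e z + Se2 e z)) psi).
 apply: (C11_cnv (M := Num.max (6 / e ^+ 2) M) (C11_Ce1 e) _ _ _ Lp sp) => z.
 - rewrite le_max; apply/orP; left; exact: C1b.
 - rewrite le_max; apply/orP; right; exact: (hM _ _ (g1 z) (h1 z)).1.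
 - rewrite le_max; apply/orP; right; exact: (hM _ _ (g2 z) (h2 z)).1.
have CP2 : C11 (cnv (Ce2 e) psi) (cnv (fun z => 2^-1 * (re2 e z + Se2 e z)) psi)
  (cnv (fun z => (- iC / 2) * (re2 e z - Se2 e z)) psi).
 apply: (C11_cnv (M := Num.max (6 / e ^+ 2) M) (C11_Ce2 e) _ _ _ Lp sp) => z.
 - rewrite le_max; apply/orP; left; exact: C2b.
 - rewrite le_max; apply/orP; right; exact: (hM _ _ (g2 z) (h2 z)).1.
 - rewrite le_max; apply/orP; right; exact: (hM _ _ (g2 z) (h2 z)).2.
have H := caccioppoli s0 CP CP1 CP2 Tth th01 thin G0 Gth.
have Lc k (m : R) x : cmeas k -> bdd k m -> cL1 (fun y => k (x - y) * psi y).
 move=> mk km; exact: cL1_conv_in mk km Lp.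
have SE x : cnv (Ce1 e) psi x - iC * cnv (Ce2 e) psi x = cnv (Se e) psi x.
 rewrite /cnv -cIZ; last exact: Lc C2b.
 rewrite -cIB; [|exact: Lc C1b|by apply: cL1Z; exact: Lc C2b].
 by apply: cI_eq => y; rewrite -DCe mulrBl mulrA.
have QE x : cnv (Ce1 e) psi x + iC * cnv (Ce2 e) psi x = cnv (re e) psi x.
 rewrite /cnv -cIZ; last exact: Lc C2b.
 rewrite -cID; [|exact: Lc C1b|by apply: cL1Z; exact: Lc C2b].
 by apply: cI_eq => y; rewrite -DbarCe mulrDl mulrA.
rewrite (@I2_eq _ _ (fun x => nm (cnv (Se e) psi x) ^+ 2 * \1_(ball 0 s) x)) in H; last by move=> x; rewrite SE.
rewrite (@I2_eq _ (fun x => nm (_ + _) ^+ 2 * _) (fun x => nm (cnv (re e) psi x) ^+ 2 * \1_(ball 0 (s + 1)) x)) in H; last by move=> x; rewrite QE.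
have hQ : I2 (fun x => nm (cnv (re e) psi x) ^+ 2 * \1_(ball 0 (s + 1)) x) <= 24 ^+ 2 * I2 (fun x => nm (psi x) ^+ 2).
 apply: (young_L2_local (re_meas e) (re_bd e) mp pB sp).
 have [_ c24] := andP (@c0_bd R); apply: le_trans c24; rewrite -(I2_rr e0).
 apply: I2_le0; [|exact: L1_rr|].
  apply: measurable_funM; first by apply: meas_nm; exact: re_meas.
  exact: meas_ball.
 move=> z; have /andP[r0' _] := rr_bd e z; have /andP[i0 i1] := ind_itv (ball 0 (s + 1 + r)) z.
 by rewrite reE nmR ger0_norm// mulr_ge0//= ler_piMr.
have hP : I2 (fun x => nm (cnv (Ce e) psi x) ^+ 2 * \1_(ball 0 (s + 1)) x) <= (16 * (s1 + r)) ^+ 2 * I2 (fun x => nm (psi x) ^+ 2).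
 apply: (young_L2_local Cm Ceb mp pB sp).
 by apply: I2_Ce_ball => //; rewrite addr_gt0.
have := ler_wpM2l (mulr_ge0 (ler0n _ 16) (sqr_ge0 G)) hP.
rewrite /A; move: (I2 _) (I2 _) (I2 _) (I2 _) H hQ; clear => *; lra.
Qed.
End L2bound.

(** * Calderon-Zygmund decomposition and the truncated square bound *)

Section WeakType.
Context {R : realType}.
Local Notation pt := (R * R)%type.
Implicit Types (f g b S : pt -> R[i]).

Definition tr (t : R) : R := Num.min 1 t.

Lemma tr_ge0 t : 0 <= t -> 0 <= tr t.
Proof. by move=> t0; rewrite /tr le_min ler01. Qed.

Lemma tr_le1 t : tr t <= 1.
Proof. by rewrite /tr ge_min lexx. Qed.

Lemma tr_le t : tr t <= t.
Proof. by rewrite /tr ge_min lexx orbT. Qed.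

Lemma tr_mono s t : s <= t -> tr s <= tr t.
Proof. by move=> st; rewrite /tr le_min !ge_min lexx st orbT. Qed.

Lemma trD s t : 0 <= s -> 0 <= t -> tr (s + t) <= tr s + tr t.
Proof. by rewrite /tr => s0 t0; case: (leP 1 s); case: (leP 1 t); case: (leP 1 (s + t)); lra. Qed.

Lemma tr_nmD (x y : R[i]) : tr (nm (x + y)) <= tr (nm x) + tr (nm y).
Proof. by apply: le_trans (trD (nm_ge0 _) (nm_ge0 _)); apply: tr_mono; exact: nmD. Qed.

Lemma tr_sq3 (x y z : R[i]) : tr (nm (x + y + z)) ^+ 2 <=
 3 * nm x ^+ 2 + 3 * nm y ^+ 2 + 3 * tr (nm z).
Proof.
have h := tr_nmD (x + y) z; have h' := tr_nmD x y.
have [tx ty] := (tr_le (nm x), tr_le (nm y)).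
have [x0 y0] := (nm_ge0 x, nm_ge0 y).
have [tz1 tz0] := (tr_le1 (nm z), tr_ge0 (nm_ge0 z)).
have t0 := tr_ge0 (nm_ge0 (x + y + z)).
move: (tr _) (tr (nm (x + y))) (tr (nm x)) (tr (nm y)) (tr (nm z)) (nm x) (nm y) h h' tx ty x0 y0 tz1 tz0 t0.
move=> u v p q w a c *.
have h1 : u <= a + c + w by lra.
have h2 : u ^+ 2 <= (a + c + w) ^+ 2 by rewrite ler_pXn2r ?nnegrE//; lra.
have h3 := sqr_ge0 (a - c); have h4 := sqr_ge0 (a - w); have h5 := sqr_ge0 (c - w).
have h6 : w ^+ 2 <= w by rewrite expr2; nra.
lra.
Qed.

Lemma meas_tr (f : pt -> R) : mfun f -> mfun (fun x : pt => tr (f x)).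
Proof. by move=> mf; apply: measurable_minr => //; exact: measurable_cst. Qed.

(** A mean value inequality by subdivision: the segment is cut into [2 ^+ n] pieces, the Taylor
    errors add up to [C * |h|^2 / 2 ^+ n], and [n] is arbitrary. *)
Lemma C11_seg f f1 f2 (z h : pt) (B : R) : C11 f f1 f2 -> 0 <= B ->
 (forall t : R, 0 <= t <= 1 -> nm (f1 (z + t *: h)) <= B /\ nm (f2 (z + t *: h)) <= B) ->
 nm (f (z + h) - f z) <= 2 * B * `|h|.
Proof.
move=> Cf B0 hB; have [C [C0 hC]] := Cf (`|z| + `|h|).
apply: (@le_pow2 _ _ _ (C * `|h| ^+ 2)) => n.
pose N : R := 2 ^+ n; have N0 : 0 < N by rewrite exprn_gt0.
have inN (k : nat) : (k <= 2 ^ n)%N -> 0 <= k%:R / N <= 1.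
 move=> kn; rewrite divr_ge0 ?(ltW N0)//= ler_pdivrMr// mul1r /N -natrX ler_nat//.
have nb (t : R) : 0 <= t <= 1 -> `|z + t *: h| <= `|z| + `|h|.
 move=> /andP[t0 t1]; apply: (le_trans (ler_normD _ _)).
 by rewrite lerD2l normrZ ger0_norm// ler_piMl.
have H (k : nat) : (k <= 2 ^ n)%N -> nm (f (z + (k%:R / N) *: h) - f z) <=
  k%:R * (2 * B * `|h| / N + C * `|h| ^+ 2 / N ^+ 2).
 elim: k => [_|k IH kn]; first by rewrite mul0r scale0r addr0 subrr nm0 mul0r.
 have {}IH := IH (ltnW kn).
 have Ek : z + (k.+1%:R / N) *: h = (z + (k%:R / N) *: h) + N^-1 *: h.
  by rewrite -natr1 mulrDl scalerDl mul1r addrA.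
 rewrite Ek; set p := z + (k%:R / N) *: h in IH *.
 rewrite (_ : _ - f z = (f (p + N^-1 *: h) - f p) + (f p - f z)); last by ring.
 apply: (le_trans (nmD _ _)); rewrite -natr1 mulrDl mul1r addrC; apply: lerD => //.
 have pr : `|p| <= `|z| + `|h| by apply: nb; apply: inN; exact: ltnW.
 have pr' : `|p + N^-1 *: h| <= `|z| + `|h| by rewrite -Ek; apply: nb; exact: inN.
 have [c1 _ _] := hC p (N^-1 *: h) pr pr'.
 have [b1 b2] := hB _ (inN k (ltnW kn)).
 set X := f1 p * _ + _ in c1.
 have hX : nm X <= (B + B) * `|N^-1 *: h| by exact: le_nm_lin.
 rewrite normrZ (ger0_norm (_ : 0 <= N^-1)) ?invr_ge0 ?(ltW N0)// in c1 hX.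
 rewrite (_ : f _ - f p = X + (f (p + N^-1 *: h) - f p - X)); last by ring.
 have -> : 2 * B * `|h| / N + C * `|h| ^+ 2 / N ^+ 2 = (B + B) * (N^-1 * `|h|) + C * (N^-1 * `|h|) ^+ 2.
  by rewrite exprMn exprVn; ring.
 exact: le_nmD.
have := H (2 ^ n)%N (leqnn _).
have -> : (2 ^ n)%:R = N by rewrite natrX.
rewrite divff ?gt_eqF// scale1r.
have -> // : N * (2 * B * `|h| / N + C * `|h| ^+ 2 / N ^+ 2) = 2 * B * `|h| + C * `|h| ^+ 2 / 2 ^+ n.
by rewrite -/N; field; rewrite gt_eqF.
Qed.

Lemma Se_lip (e : R) (z h : pt) : 0 < e -> nm (Se e (z + h) - Se e z) <= 60 / e ^+ 3 * `|h|.
Proof.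
move=> e0; have -> : 60 / e ^+ 3 = 2 * (30 / e ^+ 3) by rewrite mulrA; congr (_ / _); ring.
apply: (C11_seg (C11_Se e)); first by rewrite divr_ge0// exprn_ge0// ltW.
by move=> t _; have [] := Se_grad_bd (z + t *: h) e0.
Qed.

(** Along the segment the modulus stays at least half that of [z], so the cubic decay of the
    gradient loses a factor 8: [480 = 2 * 8 * 30]. *)
Lemma Se_hormander (e : R) (z h : pt) : 0 < e -> 0 < `|z| -> 2 * `|h| <= `|z| ->
 nm (Se e (z + h) - Se e z) * `|z| ^+ 3 <= 480 * `|h|.
Proof.
move=> e0 z0 hz; have z3 : 0 < `|z| ^+ 3 by rewrite exprn_gt0.
rewrite -ler_pdivlMr//.
have -> : 480 * `|h| / `|z| ^+ 3 = 2 * (240 / `|z| ^+ 3) * `|h| by rewrite -!mulrA; ring.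
apply: (C11_seg (C11_Se e)); first by rewrite divr_ge0 ?ler0n// ltW.
move=> t /andP[t0 t1]; set p := z + _.
have pz : `|z| / 2 <= `|p|.
 have : `|z| <= `|p| + `|t *: h|.
  by rewrite (_ : `|z| = `|p - t *: h|) ?ler_normB// /p addrK.
 rewrite normrZ ger0_norm// => h1.
 have : t * `|h| <= `|h| by rewrite ler_piMl.
 lra.
have p3 : `|z| ^+ 3 <= 8 * `|p| ^+ 3.
 have -> : 8 * `|p| ^+ 3 = (2 * `|p|) ^+ 3 by rewrite exprMn; congr (_ * _); rewrite -natrX.
 by rewrite ler_pXn2r ?nnegrE ?normr_ge0 ?mulr_ge0//; lra.
have [_ _ a c] := Se_grad_bd p e0.
by split; rewrite ler_pdivlMr//; (apply: (le_trans (ler_wpM2l (nm_ge0 _) p3))); rewrite mulrCA; lra.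
Qed.

(** Half-open squares, so that the four halves partition their parent exactly, without null sets to
    discard. *)
Definition sqc (c : pt) (l : R) (z : pt) : R :=
 ((c.1 <= z.1 < c.1 + l) && (c.2 <= z.2 < c.2 + l))%:R.

Lemma sqcE c l : sqc c l = \1_(`[c.1, c.1 + l[%classic `*` `[c.2, c.2 + l[%classic).
Proof.
apply/funext => z; rewrite /sqc indE; case: ifPn => h.
 move: h => /set_mem[/= h1 h2]; rewrite !in_itv /= in h1 h2.
 by rewrite h1 h2.
case: andP => // -[h1 h2]; exfalso; move/negP: h; apply.
by apply/mem_set; split => /=; rewrite in_itv.
Qed.

Lemma sqc01 c l z : sqc c l z = 0 \/ sqc c l z = 1.
Proof. by rewrite /sqc; case: (_ && _); [right|left]. Qed.

Lemma sqc_itv c l z : 0 <= sqc c l z <= 1.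
Proof. by case: (sqc01 c l z) => ->; rewrite lexx ler01. Qed.

Lemma measurable_sqc c l : mfun (sqc c l).
Proof. by rewrite sqcE; apply: mindic; apply: measurableX; exact: measurable_itv. Qed.

Lemma sqc_near c l (z : pt) : sqc c l z <> 0 -> `|z - c| <= l.
Proof.
rewrite /sqc; case: andP => // -[/andP[a a'] /andP[d d']] _.
by apply/norm_ptP => /=; rewrite !ger0_norm ?subr_ge0//; split; lra.
Qed.

Lemma L1_sqc c l : L1 (sqc c l).
Proof.
apply: (@L1_box _ 1 (`|c| + `|l| + 1)); first exact: measurable_sqc.
- by move=> x; rewrite ger0_norm; case/andP: (sqc_itv c l x).
- move=> x xb; case: (sqc01 c l x) => // h1; exfalso; apply: xb; apply/ball0E.
 have h : `|x - c| <= l by apply: sqc_near; rewrite h1; exact/eqP/oner_neq0.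
 have := ler_normD (x - c) c; rewrite subrK => h2; apply: (le_lt_trans h2).
 by have := ler_norm l; lra.
Qed.

Lemma I2_sqc c l : 0 <= l -> I2 (sqc c l) = l ^+ 2.
Proof.
move=> l0; apply: EFin_inj; rewrite -I2E; last exact: L1_sqc.
have H : leb2 (`[c.1, c.1 + l[%classic `*` `[c.2, c.2 + l[%classic) = (l ^+ 2)%:E.
 rewrite /leb2 product_measure1E; try exact: measurable_itv.
 rewrite /= !lebesgue_measure_itv/= !lte_fin !ltrDl.
 have [->|ln0] := eqVneq l 0; first by rewrite ltxx mul0e expr0n.
 by rewrite lt_neqAle eq_sym ln0 l0 /= -!EFinD -EFinM; congr (_%:E); ring.
rewrite sqcE integral_indic//; last by apply: measurableX; exact: measurable_itv.
rewrite setIT; exact: H.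
Qed.

Definition half (c : pt) (l : R) (i j : bool) : pt := (c.1 + i%:R * (l / 2), c.2 + j%:R * (l / 2)).

Lemma sqc_split c l z : 0 < l -> sqc c l z =
 sqc (half c l false false) (l / 2) z + sqc (half c l false true) (l / 2) z +
 (sqc (half c l true false) (l / 2) z + sqc (half c l true true) (l / 2) z).
Proof.
move=> l0; rewrite /sqc /half /= !mul0r !mul1r !addr0.
have E (a t : R) : (a <= t < a + l) = (a <= t < a + l / 2) || (a + l / 2 <= t < a + l / 2 + l / 2).
 apply/idP/idP; last by move=> /orP[]/andP[p q]; apply/andP; split; lra.
 move=> /andP[p q]; case: (ltP t (a + l / 2)) => h; apply/orP; [left|right]; apply/andP; split; lra.
have D (a t : R) : (a <= t < a + l / 2) && (a + l / 2 <= t < a + l / 2 + l / 2) = false.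
 by apply/negP => /andP[/andP[p q] /andP[u v]]; lra.
rewrite !E; move: (D c.1 z.1) (D c.2 z.2).
move: (c.1 <= z.1 < c.1 + l / 2) (c.1 + l / 2 <= z.1 < c.1 + l / 2 + l / 2).
move: (c.2 <= z.2 < c.2 + l / 2) (c.2 + l / 2 <= z.2 < c.2 + l / 2 + l / 2).
by move=> [] [] [] [] //= _ _; rewrite ?addr0 ?add0r.
Qed.

Definition osc b c l (z : pt) : R[i] :=
 b z * (sqc c l z)%:C - (cI (fun y => b y * (sqc c l y)%:C) / (l ^+ 2)%:C) * (sqc c l z)%:C.
Definition avg b c l (z : pt) : R[i] :=
 (cI (fun y => b y * (sqc c l y)%:C) / (l ^+ 2)%:C) * (sqc c l z)%:C.
Definition mass b c l : R := I2 (fun z => nm (b z) * sqc c l z).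

Lemma mass_ge0 b c l : 0 <= mass b c l.
Proof. by apply: I2_ge0 => z; rewrite mulr_ge0 ?nm_ge0//; case/andP: (sqc_itv c l z). Qed.

Lemma cL1_sq b c l : cL1 b -> cL1 (fun y => b y * (sqc c l y)%:C).
Proof.
move=> Lb; have H : cL1 (fun y => (sqc c l y)%:C * b y).
 apply: (@cL1_bdM _ 1) => //; first by apply: cmeasR; exact: measurable_sqc.
 by move=> z; rewrite nmR; case: (sqc01 c l z) => ->; rewrite ?normr0 ?normr1.
by rewrite (_ : (fun y => _) = (fun y => (sqc c l y)%:C * b y))//; apply/funext => y; rewrite mulrC.
Qed.

Lemma L1_mass b c l : cL1 b -> L1 (fun z => nm (b z) * sqc c l z).
Proof.
move=> Lb; have H := L1_nm (cL1_sq c l Lb).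
rewrite (_ : (fun z => _) = (fun z => nm (b z * (sqc c l z)%:C)))//; apply/funext => z.
by rewrite nmM nmR ger0_norm//; case/andP: (sqc_itv c l z).
Qed.

Lemma avg_bd b c l z : 0 < l -> cL1 b -> nm (avg b c l z) <= mass b c l / l ^+ 2 * sqc c l z.
Proof.
move=> l0 Lb; have [s0 s1] := andP (sqc_itv c l z); have l2 : 0 < l ^+ 2 by rewrite exprn_gt0.
rewrite /avg !nmM nmV !nmR (ger0_norm s0) (ger0_norm (ltW l2)).
rewrite ler_wpM2r// ler_wpM2r ?invr_ge0 ?(ltW l2)//.
apply: (le_trans (cI_abs (cL1_sq c l Lb))); apply/eq_ler/I2_eq => y.
by rewrite nmM nmR ger0_norm//; case/andP: (sqc_itv c l y).
Qed.

Lemma cL1_avg b c l : cL1 (avg b c l).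
Proof. by apply: cL1Z; apply: cL1R; exact: L1_sqc. Qed.

Lemma I2_avg b c l : 0 < l -> cL1 b -> I2 (fun z => nm (avg b c l z)) <= mass b c l.
Proof.
move=> l0 Lb; have l2 : 0 < l ^+ 2 by rewrite exprn_gt0.
apply: (@le_trans _ _ (I2 (fun z => mass b c l / l ^+ 2 * sqc c l z))).
 apply: I2_le; [by apply: L1_nm; exact: cL1_avg|by apply: L1Z; exact: L1_sqc|].
 move=> z; exact: avg_bd.
rewrite I2Z ?I2_sqc ?(ltW l0)//; last exact: L1_sqc.
by rewrite divfK// gt_eqF.
Qed.

Lemma oscE b c l z : osc b c l z = b z * (sqc c l z)%:C - avg b c l z.
Proof. by []. Qed.

Lemma cL1_osc b c l : cL1 b -> cL1 (osc b c l).
Proof. by move=> Lb; apply: cL1B; [exact: cL1_sq|exact: cL1_avg]. Qed.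

Lemma cI_osc b c l : 0 < l -> cL1 b -> cI (osc b c l) = 0.
Proof.
move=> l0 Lb; rewrite (cIB (cL1_sq c l Lb) (cL1_avg b c l)).
rewrite [X in _ - X]cIZ; last by apply: cL1R; exact: L1_sqc.
rewrite cIR I2_sqc ?(ltW l0)// divfK ?subrr//.
by rewrite -(rmorph0 (real_complex R)) (inj_eq (@complexI R)) gt_eqF// exprn_gt0.
Qed.

Lemma I2_osc b c l : 0 < l -> cL1 b -> I2 (fun z => nm (osc b c l z)) <= 2 * mass b c l.
Proof.
move=> l0 Lb; have La := cL1_avg b c l.
apply: (@le_trans _ _ (I2 (fun z => nm (b z) * sqc c l z + nm (avg b c l z)))).
 apply: I2_le; [by apply: L1_nm; exact: cL1_osc|by apply: L1D; [exact: L1_mass|exact: L1_nm]|].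
 move=> z; apply: (le_trans (nmB _ _)); rewrite lerD2r nmM nmR ger0_norm//.
rewrite I2D; [|exact: L1_mass|exact: L1_nm].
by have := I2_avg c l0 Lb; rewrite -/(mass b c l); lra.
Qed.

Lemma osc_out b c l z : sqc c l z = 0 -> osc b c l z = 0.
Proof. by move=> h; rewrite oscE /avg h !mulr0 subr0. Qed.

(** As the oscillating part has mean zero, [S (x - c)] may be subtracted from the kernel; only the
    variation of [S] over the square is left. *)
Lemma cnv_osc S b c l (M D : R) (x : pt) : 0 < l -> cL1 b -> cmeas S -> bdd S M ->
 0 <= D -> (forall y, sqc c l y <> 0 -> nm (S (x - y) - S (x - c)) <= D) ->
 nm (cnv S (osc b c l) x) <= D * (2 * mass b c l).
Proof.
move=> l0 Lb mS SM D0 SD; have Lo := cL1_osc c l Lb.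
have L1' := cL1_conv_in x mS SM Lo.
have -> : cnv S (osc b c l) x = cI (fun y => S (x - y) * osc b c l y - S (x - c) * osc b c l y).
 rewrite cIB// ?cIZ ?cI_osc ?mulr0 ?subr0//; exact: cL1Z.
apply: (le_trans (cI_abs (cL1B L1' (cL1Z (S (x - c)) Lo)))).
apply: (@le_trans _ _ (I2 (fun y => D * nm (osc b c l y)))); last first.
 rewrite I2Z ?ler_wpM2l ?I2_osc//; exact: L1_nm.
apply: I2_le; [by apply: L1_nm; apply: cL1B => //; exact: cL1Z|by apply: L1Z; exact: L1_nm|].
move=> y; rewrite -mulrBl nmM.
have [h|h] := eqVneq (sqc c l y) 0; first by rewrite osc_out// nm0 !mulr0.
by rewrite ler_wpM2r ?nm_ge0// SD//; exact/eqP.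
Qed.

Lemma le_sum4 (x : bool -> bool -> R) i j : (forall i j, 0 <= x i j) ->
 x i j <= x false false + x false true + (x true false + x true true).
Proof.
move=> h; move: (h false false) (h false true) (h true false) (h true true).
by case: i; case: j; lra.
Qed.

Section Decomposition.
Variables (S : pt -> R[i]) (M L H s : R) (b : pt -> R[i]).
Hypotheses (mS : cmeas S) (SM : forall z, nm (S z) <= M) (L0 : 0 <= L) (H0 : 0 <= H)
 (SL : forall z h : pt, nm (S (z + h) - S z) <= L * `|h|)
 (SH : forall z h : pt, 0 < `|z| -> 2 * `|h| <= `|z| ->
  nm (S (z + h) - S z) * `|z| ^+ 3 <= H * `|h|)
 (s0 : 0 < s) (Lb : cL1 b).

Let T f (x : pt) : R := tr (nm (cnv S f x)) * \1_(ball 0 s) x.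

Lemma L1_T f : cL1 f -> L1 (T f).
Proof.
move=> Lf; apply: (@L1_ind_bd _ _ _ 1 s) => //; last 1 first.
- by move=> z _; rewrite ger0_norm ?tr_le1// tr_ge0// nm_ge0.
- apply: meas_tr; apply: meas_nm; exact: cmeas_cnv mS SM Lf.
- exact: mball2.
Qed.

(** For tiny squares the Lipschitz bound is enough. Its constant [L] degenerates with the scale of
    the kernel, but the side [l] can be made as small as desired. *)
Lemma I2_T_tiny c l : 0 < l -> I2 (T (osc b c l)) <= 8 * s ^+ 2 * L * l * mass b c l.
Proof.
move=> l0; have L1b := L1_ball 0 s; have Lo := cL1_osc c l Lb.
apply: (@le_trans _ _ (I2 (fun x => (L * l * (2 * mass b c l)) * \1_(ball 0 s) x))).
 apply: I2_le; [exact: L1_T|exact: L1Z|].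
 move=> x; rewrite ler_wpM2r//.
 apply: (le_trans (tr_le _)); apply: (cnv_osc l0 Lb mS SM); first by rewrite mulr_ge0// ltW.
 move=> y /sqc_near yc; have := SL (x - c) (c - y).
 rewrite (_ : x - c + (c - y) = x - y); last by rewrite addrA subrK.
 move=> h; apply: (le_trans h); rewrite ler_wpM2l//; by rewrite distrC.
rewrite I2Z// I2_ball ?(ltW s0)//; apply: eq_ler; ring.
Qed.

(** On a square of large average, the ball of radius [2 * l] has area [16 * l ^+ 2], at most 16
    times the mass, and there [tr <= 1] suffices; outside, the regularity of the kernel gives
    integrable cubic decay. *)
Lemma I2_T_bad c l : 0 < l -> l ^+ 2 <= mass b c l -> I2 (T (osc b c l)) <= (16 + 32 * H) * mass b c l.
Proof.
move=> l0 lm; have Lo := cL1_osc c l Lb; have mm := mass_ge0 b c l.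
pose u (z : pt) := nm (cnv S (osc b c l) (z + c)).
have mc : cmeas (cnv S (osc b c l)) by exact: cmeas_cnv mS SM Lo.
have mu : mfun u.
 have := meas_nm (cmeas_subr (- c) mc); rewrite (_ : (fun x => _) = u)//.
 by apply/funext => z; rewrite opprK.
have l20 : 0 < 2 * l by rewrite mulr_gt0.
have uH z : 2 * l <= `|z| -> u z * `|z| ^+ 3 <= 2 * H * l * mass b c l.
 move=> lz; have z0 : 0 < `|z| by exact: lt_le_trans lz.
 have z3 : 0 < `|z| ^+ 3 by rewrite exprn_gt0.
 rewrite -ler_pdivlMr//.
 have -> : 2 * H * l * mass b c l / `|z| ^+ 3 = H * l / `|z| ^+ 3 * (2 * mass b c l) by ring.
 apply: (cnv_osc l0 Lb mS SM); first by rewrite divr_ge0 ?mulr_ge0// ltW.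
 move=> y /sqc_near yc; rewrite addrK ler_pdivlMr//.
 have := SH z0 (h := c - y).
 rewrite (_ : z + (c - y) = z + c - y); last by rewrite addrA.
 have yc' : `|c - y| <= l by rewrite distrC.
 move=> h; apply: (le_trans (h _)); first by lra.
 by rewrite ler_wpM2l.
have [n hn] : exists n : nat, s + `|c| <= 2 ^+ n * (2 * l).
 have h0 : 0 <= (s + `|c|) / (2 * l) by rewrite divr_ge0 ?(ltW l20)// addr_ge0// ltW.
 exists (Num.bound ((s + `|c|) / (2 * l))); rewrite -ler_pdivrMr//.
 by apply: (le_trans (ltW (archi_boundP h0))); rewrite -natrX ler_nat ltnW// ltn_expl.
have [La Ia] := I2_inv3_annulus n mu l20 (fun z => nm_ge0 _) uH.
have [La' Ia'] := I2_shift c La.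
have Lball := L1_ball c (2 * l).
apply: (@le_trans _ _ (I2 (fun x => \1_(ball c (2 * l)) x + u (x - c) * \1_(annulus (2 * l) (2 ^+ n * (2 * l))) (x - c)))).
 apply: I2_le; [exact: L1_T|exact: L1D|].
 move=> x; have [xs|xs] := pselect (ball 0 s x); last first.
  rewrite /T (ind_out xs) mulr0 addr_ge0 ?mulr_ge0 ?nm_ge0//.
 rewrite /T (ind_in xs) mulr1; have [xc|xc] := ltP `|x - c| (2 * l).
  rewrite (@ind_in _ (ball c (2 * l))); last first.
   have /ball0E : `|x - c| < 2 * l by [].
   by rewrite !ball2E /= /ball /= !sub0r !normrN => -[h1 h2]; split => /=; rewrite distrC.
  have h0 : 0 <= u (x - c) * \1_(annulus (2 * l) (2 ^+ n * (2 * l))) (x - c).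
   by rewrite mulr_ge0 ?nm_ge0//; case/andP: (ind_itv (annulus (2 * l) (2 ^+ n * (2 * l))) (x - c)).
  by have := tr_le1 (nm (cnv S (osc b c l) x)); lra.
 rewrite (@ind_in _ (annulus _ _)); last first.
  rewrite /annulus /= xc /=; apply: lt_le_trans hn.
  by apply: (le_lt_trans (ler_normB _ _)); rewrite ltrD2r; exact/ball0E.
 rewrite mulr1 /u subrK; apply: (le_trans (tr_le _)); rewrite lerDr.
 by case/andP: (ind_itv (ball c (2 * l)) x).
rewrite I2D// Ia' I2_ball ?mulr_ge0 ?(ltW l0)//.
have -> : (16 + 32 * H) * mass b c l = 16 * mass b c l + 32 * H * mass b c l by ring.
apply: lerD; first by rewrite !exprMn; lra.
apply: (le_trans Ia); apply: eq_ler.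
by field; rewrite gt_eqF.
Qed.

Lemma T_add f g x : cL1 f -> cL1 g -> T (fun z => f z + g z) x <= T f x + T g x.
Proof.
move=> Lf Lg; rewrite /T -mulrDl ler_wpM2r//.
apply: le_trans (tr_nmD _ _); rewrite /cnv -cID; [|exact: cL1_conv_in mS SM Lf|exact: cL1_conv_in mS SM Lg].
apply: eq_ler; congr (tr (nm _)); apply: cI_eq => y.
by rewrite mulrDr.
Qed.

Lemma I2_T_add f g : cL1 f -> cL1 g -> I2 (T (fun z => f z + g z)) <= I2 (T f) + I2 (T g).
Proof.
move=> Lf Lg; rewrite -I2D; [|exact: L1_T|exact: L1_T].
apply: I2_le; [by apply: L1_T; exact: cL1D|by apply: L1D; exact: L1_T|].
move=> x; exact: T_add.
Qed.

Definition good_part (K : R) c l g := [/\ cL1 g, forall z, nm (g z) <= 4 * sqc c l z,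
 I2 (fun z => nm (g z)) <= mass b c l &
 I2 (T (fun z => b z * (sqc c l z)%:C - g z)) <= K * mass b c l].

Lemma good_part_avg K c l : 0 < l -> mass b c l <= 4 * l ^+ 2 ->
 I2 (T (osc b c l)) <= K * mass b c l -> good_part K c l (avg b c l).
Proof.
move=> l0 lm hT; split => //; [exact: cL1_avg| |exact: I2_avg].
move=> z; apply: (le_trans (avg_bd c z l0 Lb)); rewrite ler_wpM2r//.
by rewrite ler_pdivrMr// exprn_gt0.
Qed.

(** The stopping-time selection at height 1, truncated at depth [N]. A square is replaced by its
    average as soon as this exceeds 1, and in any case at depth [0], where [I2_T_tiny] applies. The
    truncation error carries the factor [1 / 2 ^+ N]. *)
Lemma dyadic_decomposition (N : nat) c l : 0 < l -> mass b c l <= l ^+ 2 ->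
 exists g, good_part (16 + 32 * H + 8 * s ^+ 2 * L * l / 2 ^+ N) c l g.
Proof.
elim: N c l => [|N IH] c l l0 lm.
 exists (avg b c l); apply: good_part_avg => //.
  by have := sqr_ge0 l; lra.
 apply: (le_trans (I2_T_tiny c l0)); rewrite ler_wpM2r ?mass_ge0//.
 by rewrite expr0 divr1 lerDr addr_ge0// mulr_ge0.
set K := 16 + _ + _; have l20 : 0 < l / 2 by rewrite divr_gt0.
have EK : K = 16 + 32 * H + 8 * s ^+ 2 * L * (l / 2) / 2 ^+ N.
 rewrite /K (exprS _ N); have : (2 ^+ N : R) != 0 by rewrite expf_neq0.
 by move: (2 ^+ N) => X X0; congr (_ + _); field.
have msplit : mass b c l = mass b (half c l false false) (l / 2) + mass b (half c l false true) (l / 2)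
  + (mass b (half c l true false) (l / 2) + mass b (half c l true true) (l / 2)).
 rewrite /mass -!I2D; try by [exact: L1_mass|apply: L1D; exact: L1_mass].
 by apply: I2_eq => z; rewrite (sqc_split c z l0) !mulrDr.
have ml (i j : bool) : mass b (half c l i j) (l / 2) <= mass b c l.
 have h i' j' := mass_ge0 b (half c l i' j') (l / 2).
 rewrite msplit; exact: (@le_sum4 (fun i' j' => mass b (half c l i' j') (l / 2))).
have child (i j : bool) : exists g, good_part K (half c l i j) (l / 2) g.
 have [h|h] := leP (mass b (half c l i j) (l / 2)) ((l / 2) ^+ 2).
  rewrite EK; exact: IH.
 (* The selection stops at this child: its average exceeds 1, but is at most 4 because that of its
    parent is at most 1. *)
 exists (avg b (half c l i j) (l / 2)); apply: good_part_avg => //.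
  apply: (le_trans (ml i j)); apply: (le_trans lm); rewrite expr_div_n; lra.
 apply: (le_trans (I2_T_bad l20 (ltW h))); rewrite ler_wpM2r ?mass_ge0//.
 by rewrite /K lerDl divr_ge0 ?exprn_ge0// mulr_ge0 ?(ltW l0)// mulr_ge0// mulr_ge0// sqr_ge0.
have [ga [a1 a2 a3 a4]] := child false false; have [gb [b1 b2 b3 b4]] := child false true.
have [gc [c1 c2 c3 c4]] := child true false; have [gd [d1' d2' d3 d4]] := child true true.
have sE z := sqc_split c z l0; have LS i j := cL1_sq (half c l i j) (l / 2) Lb.
move: a2 b2 c2 d2' a3 b3 c3 d3 a4 b4 c4 d4; rewrite /=.
set qa := half c l false false; set qb := half c l false true.
set qc := half c l true false; set qd := half c l true true => a2 b2 c2 d2' a3 b3 c3 d3 a4 b4 c4 d4.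
exists (fun z => ga z + gb z + (gc z + gd z)); split.
- apply: cL1D; exact: cL1D.
- move=> z; rewrite sE !mulrDr; apply: le_nmD; exact: le_nmD.
- apply: (@le_trans _ _ (I2 (fun z => nm (ga z) + nm (gb z) + (nm (gc z) + nm (gd z))))).
  apply: I2_le; [by apply: L1_nm; apply: cL1D; exact: cL1D|by do ?apply: L1D; exact: L1_nm|].
  move=> z; apply: le_nmD; exact: nmD.
 rewrite !I2D; try by [exact: L1_nm|apply: L1D; exact: L1_nm].
 rewrite msplit; apply: lerD; exact: lerD.
- pose f q (g : pt -> R[i]) z := b z * (sqc q (l / 2) z)%:C - g z.
 have Lf i j g : cL1 g -> cL1 (f (half c l i j) g) by move=> Lg; exact: cL1B.
 have -> : (fun z => b z * (sqc c l z)%:C - (ga z + gb z + (gc z + gd z))) =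
   (fun z => f qa ga z + f qb gb z + (f qc gc z + f qd gd z)).
  by apply/funext => z; rewrite sE !rmorphD /f /=; ring.
 apply: (le_trans (I2_T_add (cL1D (Lf _ _ _ a1) (Lf _ _ _ b1)) (cL1D (Lf _ _ _ c1) (Lf _ _ _ d1')))).
 apply: (le_trans (lerD (I2_T_add (Lf _ _ _ a1) (Lf _ _ _ b1)) (I2_T_add (Lf _ _ _ c1) (Lf _ _ _ d1')))).
 rewrite msplit !mulrDr; apply: lerD; exact: lerD.
Qed.

End Decomposition.

Lemma I2_le3 (c : R) (F U V W : pt -> R) : L1 F -> L1 U -> L1 V -> L1 W ->
 (forall x, F x <= c * U x + c * V x + c * W x) -> I2 F <= c * I2 U + c * I2 V + c * I2 W.
Proof.
move=> LF LU LV LW h; rewrite -!I2Z// -!I2D; try by [exact: L1Z|apply: L1D; exact: L1Z].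
apply: I2_le => //; do ?apply: L1D; exact: L1Z.
Qed.

(** [b] is cut at height 1. The bounded part and the good part of the rest have squares with
    integrals of order [d^2], so [Se_L2] applies; the remainder is left to the decomposition. *)
Lemma Se_weak (s r : R) : 0 < s -> 1 <= r -> exists A : R, 0 <= A /\
 forall e : R, 0 < e <= 1 -> forall b (d : R), cL1 b -> supp r b -> 0 < d <= 1 ->
 I2 (fun x => Num.min (nm (b x)) (nm (b x) ^+ 2)) <= d ^+ 2 ->
 I2 (fun x => tr (nm (cnv (Se e) b x)) ^+ 2 * \1_(ball 0 s) x) <= A * d ^+ 2.
Proof.
move=> s0 r1; have r0 : 0 < r by lra.
have r20 : 0 < 2 * r by lra.
have [A1 [A10 hA1]] := @Se_L2 R s (4 * r) s0 (mulr_gt0 (ltr0n _ 4) r0).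
have [H [H0 hH]] : exists H : R, 0 <= H /\ forall (e : R) (z h : pt), 0 < e -> 0 < `|z| ->
  2 * `|h| <= `|z| -> nm (Se e (z + h) - Se e z) * `|z| ^+ 3 <= H * `|h|.
 by exists 480; split; [exact: ler0n|move=> e z h; exact: Se_hormander].
pose A2 := 16 + 32 * H.
have A20 : 0 <= A2 by rewrite /A2 addr_ge0// mulr_ge0.
exists (15 * A1 + 3 * A2); split; first by rewrite addr_ge0// mulr_ge0.
move=> e e01 b d Lb sb /andP[d0 d1] hb; have /andP[e0 e1] := e01.
pose m x := Num.min (nm (b x)) (nm (b x) ^+ 2).
have mcb := meas_nm (cL1_meas Lb).
have m0 x : 0 <= m x by rewrite /m le_min nm_ge0 sqr_ge0.
have Lm : L1 m.
 apply: (@L1_dom _ m (fun x => nm (b x))); last first.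
 - by move=> x; rewrite ger0_norm// /m ge_min lexx.
 - exact: L1_nm.
 - apply: measurable_minr => //; exact: measurable_funX.
pose A : set pt := [set x | nm (b x) <= 1].
have mA : measurable A.
 rewrite (_ : A = setT `&` [set x | nm (b x) <= 1]); last by rewrite setTI.
 exact: measurable_fun_le.
pose b1 x := (\1_A x)%:C * b x; pose b2 x := b x - b1 x.
have Lb1 : cL1 b1.
 apply: (@cL1_bdM _ 1) => //; first by apply: cmeasR; exact: mindic.
 by move=> x; rewrite nmR norm_ind.
have Lb2 : cL1 b2 by exact: cL1B.
have b1E x : A x -> b1 x = b x by move=> Ax; rewrite /b1 ind_in// mul1r.
have b1E' x : ~ A x -> b1 x = 0 by move=> Ax; rewrite /b1 ind_out// mul0r.
have b1m x : nm (b1 x) <= 1 /\ nm (b1 x) ^+ 2 <= m x.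
 have [Ax|Ax] := pselect (A x); last by rewrite b1E'// nm0 expr0n.
 rewrite b1E//; split => //; rewrite /m le_min lexx andbT expr2 ler_piMl ?nm_ge0//.
have b2m x : nm (b2 x) <= m x.
 rewrite /b2; have [Ax|Ax] := pselect (A x); first by rewrite b1E// subrr nm0.
 rewrite b1E'// subr0 /m le_min lexx /= expr2 ler_peMl ?nm_ge0// ltW// ltNge.
 exact/negP.
pose c : pt := (- r, - r).
have sq1 x : `|x| < r -> sqc c (2 * r) x = 1.
 move=> /norm_pt_ltP[]; rewrite !ltr_norml /sqc /= => /andP[p q] /andP[u v].
 have -> // : (- r <= x.1 < - r + 2 * r) && (- r <= x.2 < - r + 2 * r).
 by move: p q u v; clear => *; apply/andP; split; apply/andP; split; lra.
have sb2 : supp r b2 by move=> x xr; rewrite /b2 /b1 sb// mulr0 subr0.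
have b2sq x : b2 x * (sqc c (2 * r) x)%:C = b2 x.
 by have [/sb2 ->|/sq1 ->] := leP r `|x|; rewrite ?mul0r ?mulr1.
have Im : I2 (fun x => nm (b2 x)) <= d ^+ 2.
 apply: le_trans hb; apply: I2_le => //; exact: L1_nm.
have mass2 : mass b2 c (2 * r) <= d ^+ 2.
 apply: le_trans Im; apply: I2_le; [exact: L1_mass|exact: L1_nm|].
 by move=> z; rewrite ler_piMr ?nm_ge0//; case/andP: (sqc_itv c (2 * r) z).
have SM z := Se_bd z e0.
have mS := Se_meas (R := R) e.
have e3 : 0 < e ^+ 3 by rewrite exprn_gt0.
have Sl0 : 0 <= 60 / e ^+ 3 by rewrite divr_ge0// ltW.
have LT f : cL1 f -> L1 (fun x => tr (nm (cnv (Se e) f x)) * \1_(ball 0 s) x).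
 move=> Lf; exact: L1_T mS SM f Lf.
have LTs f : cL1 f -> L1 (fun x => tr (nm (cnv (Se e) f x)) ^+ 2 * \1_(ball 0 s) x).
 move=> Lf; have mf : mfun (fun x : pt => tr (nm (cnv (Se e) f x))).
  apply: meas_tr; apply: meas_nm; exact: cmeas_cnv mS SM Lf.
 apply: (@L1_ind_bd _ _ _ 1 s) => //; first exact: measurable_funX.
  exact: mball2.
 by move=> z _; rewrite ger0_norm ?sqr_ge0// exprn_ile1 ?tr_le1// tr_ge0// nm_ge0.
have LSs f : cL1 f -> L1 (fun x => nm (cnv (Se e) f x) ^+ 2 * \1_(ball 0 s) x).
 move=> Lf; exact: (L1_sqball s (cmeas_cnv mS SM Lf) (cnv_bd mS SM Lf)).
(* The depth [N] is arbitrary, so the truncation error disappears in the limit although its constant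
   depends on [e]. *)
apply: (@le_pow2 _ _ _ (3 * (8 * s ^+ 2 * (60 / e ^+ 3) * (2 * r)) * d ^+ 2)) => N.
have [||g [Lg g4 gm gT]] := @dyadic_decomposition _ _ _ H s b2 mS SM Sl0 H0
 (fun z h => Se_lip z h e0) (fun z h => @hH e z h e0) s0 Lb2 N c (2 * r) => //.
 apply: (le_trans mass2); rewrite ler_pXn2r ?nnegrE ?(ltW r20) ?(ltW d0)//; lra.
have sg : supp (4 * r) g.
 move=> x xr; apply: nm_eq0; apply/eqP; rewrite eq_le nm_ge0 andbT.
 apply: (le_trans (g4 x)); have [->|/eqP/sqc_near] := eqVneq (sqc c (2 * r) x) 0; first by rewrite mulr0.
 move=> h; exfalso; have c1 : `|c| <= r by apply/norm_ptP; rewrite /c /= !normrN ger0_norm// ltW.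
 by have := ler_normD (x - c) c; rewrite subrK; lra.
have sb1 : supp (4 * r) b1 by move=> x xr; rewrite /b1 sb ?mulr0//; lra.
have Lt : cL1 (fun x => b2 x - g x) by exact: cL1B.
have cS x : cnv (Se e) b x = cnv (Se e) b1 x + cnv (Se e) g x + cnv (Se e) (fun x => b2 x - g x) x.
 rewrite /cnv -!cID; try by [exact: cL1_conv_in mS SM _|apply: cL1D; exact: cL1_conv_in mS SM _].
 by apply: cI_eq => y; rewrite /b2; ring.
have E : (fun z => b2 z * (sqc c (2 * r) z)%:C - g z) = (fun z => b2 z - g z).
 by apply/funext => z; rewrite b2sq.
rewrite E in gT.
have h1 := hA1 e e01 b1 1 (cL1_meas Lb1) (fun x => (b1m x).1) sb1.
have gb z : nm (g z) <= 4.
 by apply: (le_trans (g4 z)); case: (sqc01 c (2 * r) z) => ->; rewrite ?mulr0// mulr1.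
have h2 := hA1 e e01 g 4 (cL1_meas Lg) gb sg.
have n1 : I2 (fun x => nm (b1 x) ^+ 2) <= d ^+ 2.
 apply: le_trans hb; apply: I2_le0 => //; last by move=> x; rewrite sqr_ge0; exact: (b1m x).2.
 apply: measurable_funX; apply: meas_nm; exact: cL1_meas.
have n2 : I2 (fun x => nm (g x) ^+ 2) <= 4 * d ^+ 2.
 apply: (@le_trans _ _ (I2 (fun x => 4 * nm (g x)))); last first.
  by rewrite I2Z ?ler_wpM2l//; [exact: le_trans gm mass2|exact: L1_nm].
 apply: I2_le0; [by apply: measurable_funX; apply: meas_nm; exact: cL1_meas|by apply: L1Z; exact: L1_nm|].
 by move=> x; rewrite sqr_ge0 /= expr2 ler_wpM2r ?nm_ge0.
have H1 := le_trans h1 (ler_wpM2l A10 n1); have H2 := le_trans h2 (ler_wpM2l A10 n2).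
have Q0 : 0 <= 8 * s ^+ 2 * (60 / e ^+ 3) * (2 * r) / 2 ^+ N.
 apply: divr_ge0; last exact: exprn_ge0.
 by apply: mulr_ge0; [apply: mulr_ge0 => //; rewrite mulr_ge0// sqr_ge0|exact: ltW].
move: gT Q0; rewrite -/A2; set q := _ / 2 ^+ N => gT Q0.
have H3 := le_trans gT (ler_wpM2l (addr_ge0 A20 Q0) mass2).
have -> : 3 * (8 * s ^+ 2 * (60 / e ^+ 3) * (2 * r)) * d ^+ 2 / 2 ^+ N = 3 * q * d ^+ 2 by rewrite /q; ring.
move: A2 q A20 Q0 H3 {gT} => A2 q A20 Q0 H3.
apply: (@le_trans _ _ (3 * I2 (fun x => nm (cnv (Se e) b1 x) ^+ 2 * \1_(ball 0 s) x) +
 3 * I2 (fun x => nm (cnv (Se e) g x) ^+ 2 * \1_(ball 0 s) x) +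
 3 * I2 (fun x => tr (nm (cnv (Se e) (fun x => b2 x - g x) x)) * \1_(ball 0 s) x))).
 apply: I2_le3; [exact: LTs|exact: LSs|exact: LSs|exact: LT|].
 move=> x; have i0 := ind_ge0 (ball 0 s) x.
 rewrite (cS x); apply: (le_trans (ler_wpM2r i0 (tr_sq3 _ _ _))).
 by apply: eq_ler; ring.
have -> : (15 * A1 + 3 * A2) * d ^+ 2 + 3 * q * d ^+ 2 =
 3 * (A1 * d ^+ 2) + 3 * (A1 * (4 * d ^+ 2)) + 3 * ((A2 + q) * d ^+ 2) by ring.
by apply: lerD; [apply: lerD|]; apply: ler_wpM2l.
Qed.
End WeakType.

(** * Mollification in L1 *)

Section Translation.
Import HBSimple.
Context {R : realType}.
Local Notation pt := (R * R)%type.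
Local Notation lam := (@lebesgue_measure R).
Implicit Types (f g : pt -> R).

Definition tr_cont f := L1 f /\ forall eta : R, 0 < eta -> exists rho : R, 0 < rho /\
 forall h : pt, `|h| < rho -> I2 (fun x => `|f (x - h) - f x|) <= eta.

Lemma tr_cont_close f : L1 f ->
 (forall eta : R, 0 < eta -> exists g, tr_cont g /\ I2 (fun x => `|f x - g x|) <= eta) -> tr_cont f.
Proof.
move=> Lf H; split => // eta eta0; have e3 : 0 < eta / 3 by rewrite divr_gt0.
have [g [[Lg /(_ _ e3)[rho [rho0 hrho]]] fg]] := H _ e3.
exists rho; split => // h hh.
have Ld : L1 (fun x => `|f x - g x|) by apply: L1_abs; exact: L1B.
have [Lds Ids] := I2_shift h Ld.
have [Lgs _] := I2_shift h Lg; have [Lfs _] := I2_shift h Lf.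
have Lg' : L1 (fun x => `|g (x - h) - g x|) by apply: L1_abs; exact: L1B.
apply: (@le_trans _ _ (I2 (fun x => `|f (x - h) - g (x - h)| + `|g (x - h) - g x| + `|f x - g x|))).
 apply: I2_le; [by apply: L1_abs; exact: L1B|by do ?apply: L1D|].
 move=> x; rewrite (_ : f (x - h) - f x = (f (x - h) - g (x - h)) + (g (x - h) - g x) - (f x - g x)); last by ring.
 apply: (le_trans (ler_normB _ _)); rewrite lerD2r; exact: ler_normD.
rewrite I2D ?I2D//; last exact: L1D.
have := hrho h hh; move: Ids fg => ->; move: (I2 _) (I2 _) => *; lra.
Qed.

Lemma tr_contD f g : tr_cont f -> tr_cont g -> tr_cont (fun x => f x + g x).
Proof.
move=> [Lf Hf] [Lg Hg]; split; first exact: L1D.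
move=> eta eta0; have e2 : 0 < eta / 2 by rewrite divr_gt0.
have [r1 [r10 h1]] := Hf _ e2; have [r2 [r20 h2]] := Hg _ e2.
exists (Num.min r1 r2); rewrite lt_min r10 r20; split => // h; rewrite lt_min => /andP[a b].
have [Lgs _] := I2_shift h Lg; have [Lfs _] := I2_shift h Lf.
have La : L1 (fun x => `|f (x - h) - f x|) by apply: L1_abs; exact: L1B.
have Lb : L1 (fun x => `|g (x - h) - g x|) by apply: L1_abs; exact: L1B.
apply: (@le_trans _ _ (I2 (fun x => `|f (x - h) - f x| + `|g (x - h) - g x|))).
 apply: I2_le; [by apply: L1_abs; apply: L1B; exact: L1D|exact: L1D|].
 move=> x; rewrite (_ : _ - _ = (f (x - h) - f x) + (g (x - h) - g x)) ?ler_normD//.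
 by ring.
by rewrite I2D//; have := h1 h a; have := h2 h b; move: (I2 _) (I2 _) => *; lra.
Qed.

Lemma tr_contZ (c : R) f : tr_cont f -> tr_cont (fun x => c * f x).
Proof.
move=> [Lf Hf]; split; first exact: L1Z.
move=> eta eta0; have c1 : 0 < `|c| + 1 by rewrite ltr_wpDl.
have e2 : 0 < eta / (`|c| + 1) by rewrite divr_gt0.
have [r1 [r10 h1]] := Hf _ e2; exists r1; split => // h hh.
have [Lfs _] := I2_shift h Lf.
have La : L1 (fun x => `|f (x - h) - f x|) by apply: L1_abs; exact: L1B.
rewrite (@I2_eq _ _ (fun x => `|c| * `|f (x - h) - f x|)); last by move=> x; rewrite -mulrBr normrM.
rewrite I2Z//; have := h1 h hh; rewrite ler_pdivlMr// => k; apply: le_trans k.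
by rewrite mulrC ler_wpM2l ?lerDl// I2_ge0.
Qed.

Lemma tr_cont0 : tr_cont (fun=> 0).
Proof.
split; first exact: L1_0.
move=> eta eta0; exists 1; split => // h _.
by rewrite (@I2_eq _ _ (fun=> 0)) ?I2_0 ?ltW// => x; rewrite subrr normr0.
Qed.

Lemma compact_shift (K U : set R) : compact K -> open U -> K `<=` U ->
 exists rho : R, 0 < rho /\ forall t h, K t -> `|h| < rho -> U (t + h).
Proof.
move=> cK oU KU.
have /compact_near_coveringP H := cK.
have : \forall h \near nbhs (0 : R), K `<=` (fun t => U (t + h)).
 apply: H => t Kt.
 have /nbhs_ballP[r /= r0 hr] : nbhs t U by apply: open_nbhs_nbhs; split => //; exact: KU.
 exists (ball t (r / 2), ball 0 (r / 2)) => /=.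
  by split; apply: nbhsx_ballx; rewrite divr_gt0.
 move=> [u v] /= []; rewrite /ball /= sub0r normrN => h1 h2; apply: hr; rewrite /ball /=.
 rewrite (_ : t - (u + v) = (t - u) - v); last by ring.
 by apply: (le_lt_trans (ler_normB _ _)); lra.
move=> /nbhs_ballP[rho rho0 hb]; exists rho; split => // t h Kt hr.
by apply: (hb h) => //; rewrite /ball /= sub0r normrN.
Qed.

(* [g] is the indicator of a small open-minus-compact set squeezing [A]. *)
Lemma shift_ind (A : set R) (eps : R) : measurable A -> (lam A < +oo)%E -> 0 < eps ->
 exists (G : set R) (rho : R), [/\ measurable G, (lam G <= eps%:E)%E, 0 < rho &
 forall t h, `|h| < rho -> `|\1_A (t - h) - \1_A t| <= \1_G (t - h) + \1_G t :> R].
Proof.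
move=> mA Aoo e0; have e2 : 0 < eps / 2 by rewrite divr_gt0.
have [U [oU AU hU]] := lebesgue_regularity_outer mA Aoo e2.
have [K [cK KA hK]] := lebesgue_regularity_inner mA Aoo e2.
have mU : measurable U by exact: open_measurable.
have mK : measurable K by apply: closed_measurable; apply: compact_closed => //; exact: Rhausdorff.
have [rho [rho0 hr]] := compact_shift cK oU (subset_trans KA AU).
exists (U `\` K), rho; split => //; first exact: measurableD.
 have -> : U `\` K = (U `\` A) `|` (A `\` K).
  apply/seteqP; split => x /=.
   by move=> [Ux Kx]; have [Ax|Ax] := pselect (A x); [right|left].
  by move=> [[Ux Ax]|[Ax Kx]]; split => //; [move=> /KA|exact: AU].
 apply: (le_trans (measureU2 _ _ _)); try exact: measurableD.
 rewrite (_ : eps = eps / 2 + eps / 2); last by lra.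
 by rewrite EFinD leeD// ltW.
move=> t h hh; have g0 x : 0 <= (\1_(U `\` K) x : R) by rewrite indicE ler0n.
have gin x : U x -> ~ K x -> \1_(U `\` K) x = 1 :> R.
 by move=> Ux Kx; rewrite indicE mem_set.
have a1 x : A x -> \1_A x = 1 :> R by move=> Ax; rewrite indicE mem_set.
have a0 x : ~ A x -> \1_A x = 0 :> R by move=> Ax; rewrite indicE memNset.
have [At|At] := pselect (A t); have [Ah|Ah] := pselect (A (t - h)).
- by rewrite !a1// subrr normr0 addr_ge0.
- rewrite (a1 t)// (a0 (t - h))// sub0r normrN normr1.
 have [Kt|Kt] := pselect (K t); last by rewrite (gin t) ?lerDr//; exact: AU.
 rewrite (gin (t - h)) ?lerDl//; last by move=> /KA.
 by apply: hr => //; rewrite normrN.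
- rewrite (a0 t)// (a1 (t - h))// subr0 normr1.
 have [Kt|Kt] := pselect (K (t - h)); last by rewrite (gin (t - h)) ?lerDl//; exact: AU.
 rewrite (gin t) ?lerDr//; last by move=> /KA.
 rewrite -(subrK h t); exact: hr.
- by rewrite !a0// subrr normr0 addr_ge0.
Qed.

Lemma I2_prod_ind (A B : set R) : measurable A -> measurable B -> (lam A < +oo)%E -> (lam B < +oo)%E ->
 L1 (fun x : pt => \1_A x.1 * \1_B x.2) /\
 ((I2 (fun x : pt => \1_A x.1 * \1_B x.2))%:E = lam A * lam B)%E.
Proof.
move=> mA mB Aoo Boo.
have E : (fun x : pt => \1_A x.1 * \1_B x.2) = \1_(A `*` B) :> (pt -> R).
 apply/funext => x; rewrite !indicE; case: (boolP (x \in A `*` B)) => [/set_mem[a b]|].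
  by rewrite !mem_set// mulr1.
 move=> /negP h; case: (boolP (x.1 \in A)) => [/set_mem a|]; last by rewrite mul0r.
 case: (boolP (x.2 \in B)) => [/set_mem b|]; last by rewrite mulr0.
 by exfalso; apply: h; rewrite mem_set.
have m2 : leb2 (A `*` B) = (lam A * lam B)%E by rewrite /leb2 product_measure1E.
have LL : L1 (\1_(A `*` B) : pt -> R).
 apply: L1_ind; first exact: measurableX.
 by rewrite m2 lte_mul_pinfty// ge0_fin_numE.
rewrite E; split => //; rewrite -I2E// integral_indic//; last exact: measurableX.
rewrite setIT; exact: m2.
Qed.

(** A product of indicators changes only where one factor does. By [shift_ind] this happens on a set
    of length at most [eps], while the other factor stays in the interval [W], so the area is
    small. *)
Lemma tr_cont_rect (A B : set R) (r : R) : measurable A -> measurable B -> 0 < r ->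
 A `<=` ball 0 r -> B `<=` ball 0 r -> tr_cont (fun x : pt => \1_A x.1 * \1_B x.2).
Proof.
move=> mA mB r0 Ar Br.
have mball (s : R) : measurable (ball (0 : R) s) by apply: open_measurable; exact: ball_open.
have fin (D : set R) (s : R) : measurable D -> 0 < s -> D `<=` ball 0 s -> (lam D <= (2 * s)%:E)%E.
 move=> mD s0 Ds; apply: (@le_trans _ _ (lam (ball (0 : R) s))).
  apply: le_measure; rewrite ?inE//; exact: mball.
 by rewrite lebesgue_measure_ball ?(ltW s0)// lee_fin mulr_natl.
have Aoo := le_lt_trans (fin _ _ mA r0 Ar) (ltry _).
have Boo := le_lt_trans (fin _ _ mB r0 Br) (ltry _).
split; first by have [] := I2_prod_ind mA mB Aoo Boo.
move=> eta eta0; have r10 : 0 < r + 1 by lra.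
pose eps := eta / (8 * (r + 1)); have eps0 : 0 < eps by rewrite divr_gt0// mulr_gt0.
have [GA [ra [mGA hGA ra0 kA]]] := shift_ind mA Aoo eps0.
have [GB [rb [mGB hGB rb0 kB]]] := shift_ind mB Boo eps0.
pose W := ball (0 : R) (r + 1); have mW : measurable W by exact: mball.
have Woo : (lam W <= (2 * (r + 1))%:E)%E by exact: fin.
have Wfin := le_lt_trans Woo (ltry _).
have [LA EA] := I2_prod_ind mGA mW (le_lt_trans hGA (ltry _)) Wfin.
have [LB EB] := I2_prod_ind mW mGB Wfin (le_lt_trans hGB (ltry _)).
pose FA (x : pt) : R := \1_GA x.1 * \1_W x.2; pose FB (x : pt) : R := \1_W x.1 * \1_GB x.2.
have IA : I2 FA <= eta / 4.
 rewrite -lee_fin EA; apply: (@le_trans _ _ (eps%:E * (2 * (r + 1))%:E)%E); first exact: lee_pmul.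
 by rewrite -EFinM lee_fin /eps; apply: eq_ler; field; rewrite gt_eqF.
have IB : I2 FB <= eta / 4.
 rewrite -lee_fin EB; apply: (@le_trans _ _ ((2 * (r + 1))%:E * eps%:E)%E); first exact: lee_pmul.
 by rewrite -EFinM lee_fin /eps; apply: eq_ler; field; rewrite gt_eqF.
exists (Num.min 1 (Num.min ra rb)); rewrite !lt_min ltr01 ra0 rb0; split => // h.
rewrite !lt_min => /and3P[h1 ha hb].
have [LAs IAs] := I2_shift h LA; have [LBs IBs] := I2_shift h LB.
have [L0 _] := I2_prod_ind mA mB Aoo Boo; have [L0s _] := I2_shift h L0.
apply: (@le_trans _ _ (I2 (fun x => FA (x - h) + FA x + (FB (x - h) + FB x)))); last first.
 rewrite I2D ?I2D//; try exact: L1D.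
 by rewrite IAs IBs -/FA -/FB; lra.
apply: I2_le; [by apply: L1_abs; exact: L1B|by do ?apply: L1D|].
move=> x; have i01 (D : set R) t : 0 <= (\1_D t : R) <= 1 by rewrite indicE; case: (_ \in _); rewrite ?ler01 ?lexx.
have iW (D : set R) t u : D `<=` ball 0 r -> `|u - t| < 1 -> \1_D t <= \1_W u :> R.
 move=> Dr ut; rewrite !indicE; case: (boolP (t \in D)) => [/set_mem/Dr|_]; last by rewrite ler0n.
 rewrite /ball /= sub0r normrN => tr'; rewrite mem_set//= /W /ball /= sub0r normrN.
 by rewrite -(subrK t u); apply: (le_lt_trans (ler_normD _ _)); lra.
have s0 (t : R) : `|t - t| < 1 by rewrite subrr normr0.
have s1 : `|x.1 - (x - h).1| < 1 by rewrite /= subKr (le_lt_trans (norm_fst h)).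
have s2 : `|x.2 - (x - h).2| < 1 by rewrite /= subKr (le_lt_trans (norm_snd h)).
have s1' : `|(x - h).1 - x.1| < 1 by rewrite distrC.
have s2' : `|(x - h).2 - x.2| < 1 by rewrite distrC.
have := kA x.1 h.1 (le_lt_trans (norm_fst h) ha); have := kB x.2 h.2 (le_lt_trans (norm_snd h) hb).
rewrite /FA /FB -[x.1 - h.1]/((x - h).1) -[x.2 - h.2]/((x - h).2).
have := iW _ _ _ Br (s0 (x - h).2); have := iW _ _ _ Br s2.
have := iW _ _ _ Ar s1'; have := iW _ _ _ Ar (s0 x.1).
have := i01 A x.1; have := i01 B (x - h).2; have := i01 GA x.1; have := i01 GA (x - h).1.
have := i01 GB x.2; have := i01 GB (x - h).2.
move: (\1_A x.1) (\1_A (x - h).1) (\1_B x.2) (\1_B (x - h).2) (\1_GA x.1) (\1_GA (x - h).1) (\1_GB x.2) (\1_GB (x - h).2).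
move: (\1_W x.1) (\1_W (x - h).1) (\1_W x.2) (\1_W (x - h).2).
move=> w1 w1' w2 w2' a a' b b' p p' q q' /andP[q'0 _] /andP[q0 _] /andP[p'0 _] /andP[p0 _] /andP[b'0 b'1] /andP[a0 a1] aw1 aw1' bw bw' hB hA.
rewrite (_ : a' * b' - a * b = (a' - a) * b' + a * (b' - b)); last by ring.
apply: (le_trans (ler_normD _ _)); rewrite !normrM (ger0_norm b'0) (ger0_norm a0).
apply: lerD.
- apply: (le_trans (ler_wpM2r b'0 hA)); rewrite mulrDl; apply: lerD; exact: ler_wpM2l.
- apply: (le_trans (ler_wpM2l a0 hB)); rewrite mulrDr; apply: lerD; exact: ler_wpM2r.
Qed.

(** A pi-lambda argument: rectangles are stable under intersection, and continuity of translations
    passes to proper differences by linearity and to increasing unions by approximation in L1. *)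
Lemma tr_cont_set (A : set pt) (r : R) : 0 < r -> measurable A -> tr_cont (\1_(A `&` ball 0 r)).
Proof.
move=> r0; pose H := [set A : set pt | measurable A /\ tr_cont (\1_(A `&` ball 0 r))].
have mB := @mball2 R 0 r.
suff: measurable `<=` H by move=> h /h[].
rewrite measurable_prod_measurableType.
set C := [set A1 `*` A2 | A1 in measurable & A2 in measurable].
have CI : setI_closed C.
 move=> X Y [X1 mX1 [X2 mX2 <-{X}]] [Y1 mY1 [Y2 mY2 <-{Y}]].
 exists (X1 `&` Y1); first exact: measurableI.
 by exists (X2 `&` Y2); [exact: measurableI|rewrite setXI].
have CT : C setT by exists setT => //; exists setT => //; rewrite setXTT.
have CB : C `<=` H.
 move=> X [X1 mX1 [X2 mX2 <-{X}]]; split; first exact: measurableX.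
 have mb : measurable (ball (0 : R) r) by apply: open_measurable; exact: ball_open.
 have := @tr_cont_rect (X1 `&` ball 0 r) (X2 `&` ball 0 r) r (measurableI _ _ mX1 mb) (measurableI _ _ mX2 mb) r0
  (@subIsetr _ _ _) (@subIsetr _ _ _).
 congr tr_cont; apply/funext => x; rewrite ball2E -setXI !indicE.
 case: (boolP (x \in (X1 `&` ball 0 r) `*` (X2 `&` ball 0 r))) => [/set_mem[a b]|].
  by rewrite !mem_set// mulr1.
 move=> /negP h; case: (boolP (x.1 \in X1 `&` ball 0 r)) => [/set_mem a|]; last by rewrite mul0r.
 case: (boolP (x.2 \in X2 `&` ball 0 r)) => [/set_mem b|]; last by rewrite mulr0.
 by exfalso; apply: h; rewrite mem_set.
suff lsystem : lambda_system setT H by exact: lambda_system_subset.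
have Lb (D : set pt) : measurable D -> L1 (\1_(D `&` ball 0 r) : pt -> R).
 move=> mD; apply: (@L1_dom _ _ (\1_(ball 0 r))); [by apply: mindic; exact: measurableI|exact: L1_ball|].
 move=> x; rewrite ger0_norm; last by case/andP: (ind_itv (D `&` ball 0 r) x).
 have [xb|xb] := pselect (ball 0 r x); first by rewrite (ind_in xb); case/andP: (ind_itv (D `&` ball 0 r) x).
 by rewrite (ind_out xb) ind_out// => -[].
split => //; first exact: CB.
- move=> X Y YX [mX tX] [mY tY]; split; first exact: measurableD.
 have := tr_contD tX (tr_contZ (-1) tY); congr tr_cont; apply/funext => x.
 have [xb|xb] := pselect (ball 0 r x); last by rewrite !ind_out ?mulr0 ?addr0// => -[].
 have [Yx|Yx] := pselect (Y x).
  rewrite (@ind_in _ (X `&` _)); last by split => //; exact: YX.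
  by rewrite (@ind_in _ (Y `&` _))// mulr1 subrr ind_out// => -[[]].
 rewrite (@ind_out _ (Y `&` _)) ?mulr0 ?addr0; last by case.
 have [Xx|Xx] := pselect (X x); first by rewrite !ind_in.
 by rewrite !ind_out//; [move=> [[]]|case].
- move=> F ndF HF; have mF i : measurable (F i) by case: (HF i).
 have mU : measurable (\bigcup_i F i) by exact: bigcupT_measurable.
 split => //; apply: tr_cont_close; first exact: Lb.
 move=> eta eta0; pose G i := F i `&` ball 0 r.
 have UG : \bigcup_i F i `&` ball 0 r = \bigcup_i G i by rewrite setI_bigcupl.
 have ndG : nondecreasing_seq G.
  by move=> i j ij; apply/subsetPset => x [Fx bx]; split => //; move: x Fx {bx}; exact/subsetPset/ndF.
 have E (D : set pt) : measurable D -> leb2 (D `&` ball 0 r) = (I2 (\1_(D `&` ball 0 r) : pt -> R))%:E.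
  by move=> mD; rewrite -I2E ?integral_indic ?setIT//; [exact: measurableI|exact: Lb].
 have cv := @nondecreasing_cvg_mu _ _ _ (@leb2 R) G (fun i => measurableI _ _ (mF i) mB) _ ndG.
 rewrite -UG in cv; have {}cv := cv (measurableI _ _ mU mB).
 rewrite [X in _ --> X]E// in cv.
 move/fine_cvgP: cv => [_ /cvgrPdist_le/(_ _ eta0)[n _ hn]].
 exists (\1_(G n)); split; first by case: (HF n).
 have := hn n (leqnn n); rewrite /= (E _ (mF n)) /=.
 have sub x : (\1_(G n) x : R) <= \1_(\bigcup_i F i `&` ball 0 r) x.
  have [Gx|Gx] := pselect (G n x); last by rewrite (ind_out Gx); case/andP: (ind_itv (\bigcup_i F i `&` ball 0 r) x).
  by rewrite (ind_in Gx) ind_in//; case: Gx => Fx bx; split => //; exists n.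
 rewrite -I2B; [|exact: Lb|exact: Lb].
 rewrite (@I2_eq _ (fun x => `|_|) (fun x => \1_(\bigcup_i F i `&` ball 0 r) x - \1_(F n `&` ball 0 r) x)).
  rewrite ger0_norm// I2_ge0// => x; rewrite subr_ge0; exact: sub.
 move=> x; rewrite ger0_norm// subr_ge0; exact: sub.
Qed.

Lemma tr_cont_sum I (s : seq I) (F : I -> pt -> R) : (forall i, tr_cont (F i)) ->
 tr_cont (fun x => \sum_(i <- s) F i x).
Proof.
move=> HF; elim: s => [|i s IH].
 by have := tr_cont0; congr tr_cont; apply/funext => x; rewrite big_nil.
by have := tr_contD (HF i) IH; congr tr_cont; apply/funext => x; rewrite big_cons.
Qed.

Lemma tr_cont_L1 f (r : R) : 0 < r -> L1 f -> (forall x, ~ ball 0 r x -> f x = 0) -> tr_cont f.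
Proof.
move=> r0 Lf f0; apply: tr_cont_close => // eta eta0.
have [g [Lg _ cv]] := approximation_sfun_integrable measurableT Lf.
move/fine_cvgP: cv => [cv0 /cvgrPdist_le/(_ _ eta0) cv1].
have [n _ hn] := cv1.
have Lgn : L1 (fun x => g n x) by exact: Lg.
pose h x := g n x * \1_(ball 0 r) x.
have th : tr_cont h.
 have [sq sqE] : exists sq : seq R, forall x, g n x = \sum_(y <- sq) (y * \1_(g n @^-1` [set y]) x).
  by exists (finmap.enum_fset (fset_set (range (g n)))) => x; rewrite fimfunE fsbig_finite.
 have : tr_cont (fun x => \sum_(y <- sq) (y * \1_((g n @^-1` [set y]) `&` ball 0 r) x)).
  apply: tr_cont_sum => i; apply: tr_contZ; apply: tr_cont_set => //.
  rewrite -[X in measurable X]setTI; exact: (measurable_funP (g n)).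
 congr tr_cont; apply/funext => x; rewrite /h sqE mulr_suml; apply: eq_bigr => i _.
 by rewrite -mulrA indicI.
exists h; split => //.
have Ld : L1 (fun x => `|f x - g n x|) by apply: L1_abs; exact: L1B.
apply: (@le_trans _ _ (I2 (fun x => `|f x - g n x|))).
 case: th => Lh _; apply: I2_le => //; first by apply: L1_abs; exact: L1B.
 move=> x; rewrite /h; have [xb|xb] := pselect (ball 0 r x); first by rewrite (ind_in xb) mulr1.
 by rewrite (ind_out xb) mulr0 f0// subrr normr0.
have := hn n (leqnn n); rewrite /= sub0r normrN.
have -> : (\int[leb2]_z `|(f z)%:E - (g n z)%:E| = (I2 (fun x => `|f x - g n x|))%:E)%E by rewrite -I2E.
by rewrite /= ger0_norm// I2_ge0.
Qed.

(** Minkowski's inequality by Fubini: the L1 distance to [c0 * g] is at most the integral over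
    [|z| < e], with weight [rr e], of the L1 distance between [g] and its translate by [z]. *)
Lemma rconv_mollify g (r s : R) : 0 < r -> L1 g -> (forall x, ~ ball 0 r x -> g x = 0) ->
 forall eta : R, 0 < eta -> exists e0 : R, 0 < e0 /\ forall e : R, 0 < e <= e0 ->
 I2 (fun x => `|rconv (rr e) g x - c0 * g x| * \1_(ball 0 s) x) <= eta.
Proof.
move=> r0 Lg g0 eta eta0; have [_ tc] := tr_cont_L1 r0 Lg g0.
have /andP[c1 _] := @c0_bd R; have c00 : 0 < (c0 : R) by lra.
have e1 : 0 < eta / c0 by rewrite divr_gt0.
have [rho [rho0 hrho]] := tc _ e1; exists rho; split => // e /andP[e0 er].
have rr0 z : 0 <= rr e z by case/andP: (rr_bd e z).
pose M := 6 / e ^+ 2.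
have rM z : `|rr e z| <= M by rewrite ger0_norm//; case/andP: (rr_bd e z).
have mr := rr_meas (R := R) e; have Lr := L1_rr e0; have mg := L1_meas Lg.
have Lz x : L1 (fun z => rr e z * g (x - z)) by apply: L1_bdM mr rM (I2_reflect x Lg).1.
have E x : rconv (rr e) g x - c0 * g x = I2 (fun z => rr e z * (g (x - z) - g x)).
 transitivity (I2 (fun z => rr e z * g (x - z)) - I2 (fun z => rr e z * g x)).
  have -> : I2 (fun z => rr e z * g x) = c0 * g x by rewrite (I2Zr (g x) Lr) (I2_rr e0).
  have -> // : rconv (rr e) g x = I2 (fun z => rr e z * g (x - z)).
  by rewrite -(I2_reflect x (Lz x)).2; apply: I2_eq => y; rewrite subKr.
 rewrite -I2B//; last exact: L1Zr.
 by apply: I2_eq => z; rewrite mulrBr.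
pose F (w : pt * pt) : R := rr e w.2 * `|g (w.1 - w.2) - g w.1| * \1_(ball 0 s) w.1.
have F0 w : 0 <= F w.
 have i0 := ind_ge0 (ball 0 s) w.1.
 rewrite /F; apply: mulr_ge0 => //; exact: mulr_ge0.
have mi : mfun (\1_(ball 0 s) : pt -> R) by exact: meas_ball.
have mF : mfun F.
 apply: measurable_funM; last exact: (meas_fst mi).
 apply: measurable_funM; first exact: (meas_snd mr).
 apply: measurableT_comp => //; apply: measurable_funB; [exact: meas_sub|exact: meas_fst].
have Ld x : L1 (fun z => rr e z * `|g (x - z) - g x|).
 apply: (@L1_dom _ _ (fun z => `|rr e z * g (x - z)| + rr e z * `|g x|)).
 - apply: measurable_funM => //; apply: measurableT_comp => //; apply: measurable_funB; last exact: measurable_cst.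
  apply: L1_meas; exact: (I2_reflect x Lg).1.
 - by apply: L1D; [exact: L1_abs|exact: L1Zr].
 - move=> z; rewrite normrM normr_id (ger0_norm (rr0 z)) normrM (ger0_norm (rr0 z)) -mulrDr.
  by rewrite ler_wpM2l// ler_normB.
have LF1 x : L1 (fun z => F (x, z)) by exact: (L1Zr (\1_(ball 0 s) x) (Ld x)).
have Lx z : L1 (fun x => `|g (x - z) - g x|).
 apply: L1_abs; apply: L1B => //; exact: (I2_shift z Lg).1.
have LF2 z : L1 (fun x => F (x, z)).
 rewrite (_ : (fun x => _) = (fun x => \1_(ball 0 s) x * (rr e z * `|g (x - z) - g x|))).
  by apply: (@L1_bdM _ 1) => //; [exact: norm_ind|exact: L1Z].
 by apply/funext => x; rewrite /F /= mulrC.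
have N0 : 0 <= I2 (fun z => `|g z|) by exact: I2_ge0.
have LI : L1 (fun x => I2 (fun z => `|F (x, z)|)).
 apply: (@L1_dom _ _ (fun x => (M * I2 (fun z => `|g z|)) * \1_(ball 0 s) x + c0 * `|g x|)).
 - apply: (@meas_I2 _ (fun w => `|F w|)); exact: measurableT_comp.
 - by apply: L1D; [apply: L1Z; exact: L1_ball|apply: L1Z; exact: L1_abs].
 - move=> x; rewrite ger0_norm; last exact: I2_ge0.
  have /andP[i0 i1] := ind_itv (ball 0 s) x.
  have La : L1 (fun z => `|rr e z * g (x - z)|) by exact: L1_abs.
  apply: (@le_trans _ _ (I2 (fun z => (\1_(ball 0 s) x * M) * `|g (x - z)| + rr e z * `|g x|))).
   apply: I2_le; [exact: L1_abs|by apply: L1D; [apply: L1Z; apply: L1_abs; exact: (I2_reflect x Lg).1|exact: L1Zr]|].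
   move=> z; rewrite ger0_norm// /F /=.
   have h1 := ler_normB (g (x - z)) (g x); have h2 := rM z; rewrite ger0_norm// in h2.
   apply: (@le_trans _ _ (rr e z * (`|g (x - z)| + `|g x|) * \1_(ball 0 s) x)).
    by rewrite ler_wpM2r// ler_wpM2l.
   rewrite mulrDr mulrDl; apply: lerD; last by rewrite ler_piMr// mulr_ge0.
   by rewrite mulrC -mulrA ler_wpM2l// ler_wpM2r.
  rewrite I2D; [|by apply: L1Z; apply: L1_abs; exact: (I2_reflect x Lg).1|exact: L1Zr].
  rewrite (I2Zr _ Lr) (I2_rr e0) I2Z; last by apply: L1_abs; exact: (I2_reflect x Lg).1.
  rewrite (I2_reflect x (L1_abs Lg)).2; apply: eq_ler; ring.
apply: (@le_trans _ _ (I2 (fun x => I2 (fun z => F (x, z))))).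
 have LI' : L1 (fun x => I2 (fun z => F (x, z))).
  move: LI; congr L1; apply/funext => x; apply: I2_eq => z; exact: ger0_norm.
 apply: I2_le0 => //.
  apply: measurable_funM => //; apply: measurableT_comp => //; apply: measurable_funB.
   exact: meas_conv.
  exact: measurable_funM.
 move=> x; have /andP[i0 i1] := ind_itv (ball 0 s) x; rewrite mulr_ge0//=.
 rewrite /F /= I2Zr// ler_wpM2r// E; apply: (le_trans (I2_abs _)).
  rewrite (_ : (fun z => _) = (fun z => rr e z * g (x - z) - rr e z * g x)); last by apply/funext => z; rewrite mulrBr.
  by apply: L1B; [|exact: L1Zr].
 apply: eq_ler; apply: I2_eq => z.
 by rewrite normrM ger0_norm.
rewrite (fubini_I2 mF LF1 LF2 LI).
have LI2 := L1_fubini mF LF1 LF2 LI.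
apply: (@le_trans _ _ (I2 (fun z => rr e z * (eta / c0)))); last first.
 by rewrite (I2Zr _ Lr) (I2_rr e0) mulrC divfK// gt_eqF.
apply: I2_le => //; first exact: L1Zr.
move=> z; have [ze|ze] := leP e `|z|.
 have rz : rr e z = 0.
  by have [/(congr1 (@complex.Re R)) + _ _] := re_out e0 ze; rewrite reE.
 by rewrite rz mul0r (@I2_eq _ _ (fun=> 0)) ?I2_0// => x; rewrite /F /= rz !mul0r.
apply: (@le_trans _ _ (I2 (fun x => rr e z * `|g (x - z) - g x|))).
 apply: I2_le => //; first exact: L1Z.
 move=> x; have /andP[_ i1] := ind_itv (ball 0 s) x.
 rewrite /F /=; apply: ler_piMr => //; exact: mulr_ge0.
rewrite I2Z// ler_wpM2l//; apply: hrho; exact: lt_le_trans er.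
Qed.

Lemma mollify_L1 (f : pt -> R[i]) (r s : R) : 0 < r -> cL1 f -> (forall x, ~ ball 0 r x -> f x = 0) ->
 forall eta : R, 0 < eta -> exists e0 : R, 0 < e0 /\ forall e : R, 0 < e <= e0 ->
 I2 (fun x => nm (cnv (re e) f x - c0%:C * f x) * \1_(ball 0 s) x) <= eta.
Proof.
move=> r0 [L1f L2f] f0 eta eta0; have e2 : 0 < eta / 2 by rewrite divr_gt0.
have [|e1 [e10 h1]] := rconv_mollify s r0 L1f _ e2; first by move=> x /f0 ->.
have [|e2' [e20 h2]] := rconv_mollify s r0 L2f _ e2; first by move=> x /f0 ->.
exists (Num.min e1 e2'); rewrite lt_min e10 e20; split => // e; rewrite le_min => /and3P[e0 ee1 ee2].
have {}h1 := h1 e (introT andP (conj e0 ee1)); have {}h2 := h2 e (introT andP (conj e0 ee2)).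
have rM z : `|rr e z| <= 6 / e ^+ 2 by have /andP[a b] := rr_bd e z; rewrite ger0_norm.
have LM (g : pt -> R) : L1 g -> L1 (fun x => `|rconv (rr e) g x - c0 * g x| * \1_(ball 0 s) x).
 move=> Lg; have mr := rr_meas (R := R) e.
 apply: (@L1_dom _ _ (fun x => (6 / e ^+ 2 * I2 (fun y => `|g y|)) * \1_(ball 0 s) x + `|c0 * g x|)).
 - apply: measurable_funM; last exact: meas_ball.
  apply: measurableT_comp => //; apply: measurable_funB; first by apply: meas_conv => //; exact: L1_meas.
  apply: measurable_funM => //; exact: L1_meas.
 - by apply: L1D; [apply: L1Z; exact: L1_ball|apply: L1_abs; exact: L1Z].
 - move=> x; have /andP[i0 i1] := ind_itv (ball 0 s) x.
  rewrite normrM normr_id (ger0_norm i0).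
  apply: (le_trans (ler_wpM2r i0 (ler_normB _ _))); rewrite mulrDl lerD ?ler_piMr//.
  by rewrite ler_wpM2r// (conv_bd x mr rM Lg).
have La := LM _ L1f; have Lb := LM _ L2f.
apply: (@le_trans _ _ (I2 (fun x => `|rconv (rr e) (fun x => Re (f x)) x - c0 * Re (f x)| * \1_(ball 0 s) x +
  `|rconv (rr e) (fun x => Im (f x)) x - c0 * Im (f x)| * \1_(ball 0 s) x))); last by rewrite I2D//; lra.
apply: I2_le0; [|exact: L1D|].
- apply: measurable_funM; last exact: meas_ball.
 have Lf : cL1 f by [].
 apply: meas_nm; apply: cmeasB; first exact: (cmeas_cnv (re_meas e) (re_bd e) Lf).
 by apply: cmeasM; [exact: cmeas_cst|exact: cL1_meas].
- move=> x; have /andP[i0 i1] := ind_itv (ball 0 s) x; rewrite mulr_ge0 ?nm_ge0//= -mulrDl ler_wpM2r//.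
 apply: (le_trans (nm_le _)).
 have -> (z w : R[i]) (c : R) : Re (z - c%:C * w) = Re z - c * Re w by rewrite !reim mul0r subr0.
 have -> (z w : R[i]) (c : R) : Im (z - c%:C * w) = Im z - c * Im w by rewrite !reim mul0r addr0.
 have -> : Re (cnv (re e) f x) = rconv (rr e) (fun x => Re (f x)) x.
  by apply: I2_eq => y; rewrite reE reim ReC ImC mul0r subr0.
 have -> // : Im (cnv (re e) f x) = rconv (rr e) (fun x => Im (f x)) x.
 by apply: I2_eq => y; rewrite reE reim ReC ImC mul0r addr0.
Qed.

End Translation.

(** * The curl functional and its duality with kernels *)

Section Duality.
Context {R : realType}.
Local Notation pt := (R * R)%type.
Implicit Types (f g psi kp : pt -> R[i]).

Lemma dual_L1 (N : pt -> R[i]) (B K s : R) : cmeas N -> bdd N B ->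
 (forall psi, cmeas psi -> bdd psi 1 -> supp s psi ->
  nm (cI (fun x => N x * psi x)) <= K) ->
 I2 (fun x => nm (N x) * \1_(ball 0 s) x) <= K.
Proof.
move=> mN NB HK; have mi : mfun (\1_(ball 0 s) : pt -> R) by exact: meas_ball.
have maN := meas_nm mN.
(* The conjugate phase of [N]. The inverse modulus is written as a power because powers are
   measurable; where [N] vanishes, so does the product. *)
pose psi x := cj (N x) * (powR (nm (N x)) (-1) * \1_(ball 0 s) x)%:C.
have E x : N x * psi x = (nm (N x) * \1_(ball 0 s) x)%:C.
 rewrite /psi powR_inv1 ?nm_ge0// mulrA (mulrC (N x)) mulcjE -rmorphM; congr (_%:C).
 have [->|n0] := eqVneq (nm (N x)) 0; first by rewrite expr0n /= !mul0r.
 by rewrite mulrA expr2 mulfK.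
have := HK psi; rewrite (_ : (fun x => N x * psi x) = (fun x => (nm (N x) * \1_(ball 0 s) x)%:C)); last exact/funext.
rewrite cIR nmR => H; apply: (le_trans (ler_norm _)); apply: H.
- apply: cmeasM; first exact: cmeas_cj.
 apply: cmeasR; apply: measurable_funM => //; exact: (measurableT_comp (measurable_powR (-1)) maN).
- move=> x; have /andP[i0 i1] := ind_itv (ball 0 s) x.
 rewrite /psi nmM nmcj nmR powR_inv1 ?nm_ge0// ger0_norm; last by rewrite mulr_ge0 ?invr_ge0 ?nm_ge0.
 rewrite mulrA; have [->|n0] := eqVneq (nm (N x)) 0; first by rewrite !mul0r.
 by rewrite divff// mul1r.
- move=> x xs; rewrite /psi ind_out ?mulr0//.
 by move=> /ball0E; rewrite ltNge xs.
Qed.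

(** The curl of the field [z |-> a z + b conj z], tested against a complex function with partial
    derivatives [f1] and [f2]; [curl_pairing] relates it to the real pairing. *)
Definition Lf (a b f1 f2 : pt -> R[i]) : R[i] :=
 cI (fun x => a x * (f1 x + iC * f2 x) - b x * (f1 x - iC * f2 x)).

Definition Lbd (r : R) (a b : pt -> R[i]) (T : R) := forall f f1 f2 (M : R), TF r f f1 f2 ->
 bdd f M -> nm (Lf a b f1 f2) <= T * M.

Definition kern (kp kp1 kp2 : pt -> R[i]) (M : R) :=
 C11 kp kp1 kp2 /\ forall z, [/\ nm (kp z) <= M, nm (kp1 z) <= M & nm (kp2 z) <= M].

Lemma kern_meas kp kp1 kp2 (M : R) : kern kp kp1 kp2 M ->
 [/\ cmeas (fun z => kp1 z + iC * kp2 z), cmeas (fun z => kp1 z - iC * kp2 z),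
  forall z, nm (kp1 z + iC * kp2 z) <= M + M & forall z, nm (kp1 z - iC * kp2 z) <= M + M].
Proof.
move=> [Ck kM]; have [m0 m1 m2] := C11_cmeas Ck.
have mi : cmeas (fun z => iC * kp2 z) by apply: cmeasM => //; exact: cmeas_cst.
have ib z : nm (iC * kp2 z) <= M by rewrite nm_mul_i; case: (kM z).
split; [exact: cmeasD|exact: cmeasB| |] => z; have [_ h1 _] := kM z.
 exact: le_nmD.
by rewrite -[- _]opprK opprK; apply: le_nmD => //; rewrite nmN.
Qed.

Section Kernel.
Variables (a b : pt -> R[i]) (chi chi1 chi2 : pt -> R) (r T G : R).
Hypotheses (La : cL1 a) (Lb : cL1 b) (r0 : 0 <= r)
 (Tchi : TF r (fun z => (chi z)%:C) (fun z => (chi1 z)%:C) (fun z => (chi2 z)%:C))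
 (chi01 : forall z, 0 <= chi z <= 1) (G0 : 0 <= G) (chiG : forall z, `|chi1 z| <= G /\ `|chi2 z| <= G)
 (HL : Lbd r a b T) (T0 : 0 <= T).

Definition ax x := a x * (chi x)%:C.
Definition bx x := b x * (chi x)%:C.
Definition kk x := a x * ((chi1 x)%:C + iC * (chi2 x)%:C) - b x * ((chi1 x)%:C - iC * (chi2 x)%:C).
(** [MkE] identifies this with [Lf] evaluated at [chi * kp (x - .)]. The product rule expands it
    into convolutions, with [kk] collecting the derivatives of the cutoff. *)
Definition Mk (kp kp1 kp2 : pt -> R[i]) (x : pt) : R[i] :=
 cnv kp kk x - cnv (fun z => kp1 z + iC * kp2 z) ax x + cnv (fun z => kp1 z - iC * kp2 z) bx x.

Lemma chi_meas : [/\ cmeas (fun z => (chi z)%:C), cmeas (fun z => (chi1 z)%:C) & cmeas (fun z => (chi2 z)%:C)].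
Proof. by case: Tchi => /C11_cmeas. Qed.

Lemma cL1_mulr f g (M : R) : cL1 f -> cmeas g -> bdd g M -> cL1 (fun x => f x * g x).
Proof.
move=> Lf0 mg gM; have := cL1_bdM mg gM Lf0; congr cL1; apply/funext => x; exact: mulrC.
Qed.

Lemma ax_L1 : cL1 ax.
Proof.
have [m _ _] := chi_meas; apply: (@cL1_mulr _ _ 1) => // x.
by rewrite nmR ger0_norm; case/andP: (chi01 x).
Qed.

Lemma bx_L1 : cL1 bx.
Proof.
have [m _ _] := chi_meas; apply: (@cL1_mulr _ _ 1) => // x.
by rewrite nmR ger0_norm; case/andP: (chi01 x).
Qed.

Lemma chi_grad x : nm ((chi1 x)%:C + iC * (chi2 x)%:C) <= 2 * G /\ nm ((chi1 x)%:C - iC * (chi2 x)%:C) <= 2 * G.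
Proof.
have [g1 g2] := chiG x; have h1 : nm (chi1 x)%:C <= G by rewrite nmR.
have h2 : nm (iC * (chi2 x)%:C) <= G by rewrite nm_mul_i nmR.
rewrite (_ : 2 * G = G + G); last by ring.
by split; [exact: le_nmD|apply: le_nmD => //; rewrite nmN].
Qed.

Lemma kk_L1 : cL1 kk.
Proof.
have [_ m1 m2] := chi_meas; have mi : cmeas (fun x => iC * (chi2 x)%:C) by apply: cmeasM => //; exact: cmeas_cst.
apply: cL1B; apply: (@cL1_mulr _ _ (2 * G)) => //; try by [exact: cmeasD|exact: cmeasB];
 by move=> x; case: (chi_grad x).
Qed.

Lemma kk_bd x : nm (kk x) <= 2 * G * (nm (a x) + nm (b x)).
Proof.
have [g1 g2] := chi_grad x; rewrite mulrDr; apply: le_nmD.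
 by rewrite nmM mulrC ler_wpM2r ?nm_ge0.
by rewrite nmN nmM mulrC ler_wpM2r ?nm_ge0.
Qed.

Lemma Mk_terms kp kp1 kp2 (M : R) x : kern kp kp1 kp2 M ->
 [/\ cL1 (fun y => kp (x - y) * kk y), cL1 (fun y => (kp1 (x - y) + iC * kp2 (x - y)) * ax y) &
  cL1 (fun y => (kp1 (x - y) - iC * kp2 (x - y)) * bx y)].
Proof.
move=> Hk; have [Ck kM] := Hk; have [m0 _ _] := C11_cmeas Ck.
have [ma mb hab hbb] := kern_meas Hk.
have hk0 z : nm (kp z) <= M by case: (kM z).
by split; [exact: (cL1_conv_in x m0 hk0 kk_L1)|exact: (cL1_conv_in x ma hab ax_L1)|exact: (cL1_conv_in x mb hbb bx_L1)].
Qed.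

Lemma MkE kp kp1 kp2 (M : R) x : kern kp kp1 kp2 M ->
 Mk kp kp1 kp2 x = Lf a b (fun y => (chi1 y)%:C * kp (x - y) - (chi y)%:C * kp1 (x - y))
  (fun y => (chi2 y)%:C * kp (x - y) - (chi y)%:C * kp2 (x - y)).
Proof.
move=> Hk; have [t1 t2 t3] := Mk_terms x Hk.
rewrite /Mk /cnv -cIB// -cID//; last exact: cL1B.
by apply: cI_eq => y; rewrite /kk /ax /bx; ring.
Qed.

Lemma Mk_bd kp kp1 kp2 (M M0 : R) x : kern kp kp1 kp2 M -> bdd kp M0 ->
 nm (Mk kp kp1 kp2 x) <= T * M0.
Proof.
move=> Hk kM0; rewrite (MkE x Hk); have [Ck _] := Hk.
have C1 : C11 (fun y => kp (x - y)) (fun y => - kp1 (x - y)) (fun y => - kp2 (x - y)).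
 by apply: C11_eq (C11_affine x (-1) Ck) => y; rewrite scaleN1r// rmorphN1 mulN1r.
have TT := TF_M Tchi C1.
apply: (HL (f := fun y => (chi y)%:C * kp (x - y))).
 case: TT => c p q s; split => //.
 - by apply: C11_eq c => // y; rewrite mulrN.
 - by move=> y /q <-; rewrite mulrN.
 - by move=> y /s <-; rewrite mulrN.
move=> y; rewrite nmM nmR; have /andP[c0' c1] := chi01 y; rewrite ger0_norm//.
by apply: le_trans (kM0 (x - y)); rewrite ler_piMl ?nm_ge0.
Qed.

(** By Fubini, pairing with [psi] amounts to evaluating [Lf] at [chi] times the convolution of [kp]
    with [psi], up to the parity [sg] of the kernel. The bound thus involves the sup of that
    convolution, which stays finite as the scale of the kernel shrinks, instead of the sup of
    [kp]. *)
Lemma Mk_dual kp kp1 kp2 (M B s : R) (sg : R[i]) psi : kern kp kp1 kp2 M ->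
 (forall x y, kp (x - y) = sg * kp (y - x)) ->
 (forall x y, kp1 (x - y) = - sg * kp1 (y - x)) ->
 (forall x y, kp2 (x - y) = - sg * kp2 (y - x)) ->
 nm sg <= 1 -> cL1 psi -> supp s psi -> (forall x, nm (cnv kp psi x) <= B) ->
 nm (cI (fun x => Mk kp kp1 kp2 x * psi x)) <= T * B.
Proof.
move=> Hk s0 s1 s2 sg1 Lp sp PB; have [Ck kM] := Hk; have [m0 m1 m2] := C11_cmeas Ck.
have [ma mb hab hbb] := kern_meas Hk.
have hk0 z : nm (kp z) <= M by case: (kM z).
have hk1 z : nm (kp1 z) <= M by case: (kM z).
have hk2 z : nm (kp2 z) <= M by case: (kM z).
pose P := cnv kp psi; pose P1 := cnv kp1 psi; pose P2 := cnv kp2 psi.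
have CP : C11 P P1 P2 by exact: C11_cnv Ck hk0 hk1 hk2 Lp sp.
have TT := TF_M Tchi CP.
have main : cI (fun x => Mk kp kp1 kp2 x * psi x) = sg * Lf a b
  (fun y => (chi1 y)%:C * P y + (chi y)%:C * P1 y) (fun y => (chi2 y)%:C * P y + (chi y)%:C * P2 y).
 have Lcv k g (m : R) : cmeas k -> bdd k m -> cL1 g -> cL1 (fun x => psi x * cnv k g x).
  by move=> mk km Lg; apply: (cL1_mulr Lp (cmeas_cnv mk km Lg) (cnv_bd mk km Lg)).
 have A1 := Lcv _ _ _ m0 hk0 kk_L1; have A2 := Lcv _ _ _ ma hab ax_L1; have A3 := Lcv _ _ _ mb hbb bx_L1.
 have E : cI (fun x => Mk kp kp1 kp2 x * psi x) = cI (fun x => psi x * cnv kp kk x)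
  - cI (fun x => psi x * cnv (fun z => kp1 z + iC * kp2 z) ax x)
  + cI (fun x => psi x * cnv (fun z => kp1 z - iC * kp2 z) bx x).
  rewrite -cIB// -cID//; last exact: cL1B.
  by apply: cI_eq => x; rewrite /Mk; ring.
 rewrite E (cnv_swap m0 hk0 Lp kk_L1) (cnv_swap ma hab Lp ax_L1) (cnv_swap mb hbb Lp bx_L1).
 have L0 y := cL1_conv_in y m0 hk0 Lp; have L1' y := cL1_conv_in y m1 hk1 Lp.
 have L2' y := cL1_conv_in y m2 hk2 Lp.
 have e0 y : cI (fun x => kp (x - y) * psi x) = sg * P y.
  by rewrite /P /cnv -cIZ//; apply: cI_eq => x; rewrite (s0 x y) mulrA.
 have ea y : cI (fun x => (kp1 (x - y) + iC * kp2 (x - y)) * psi x) = - sg * (P1 y + iC * P2 y).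
  rewrite /P1 /P2 /cnv -(cIZ iC (L2' y)) -cID//; last exact: cL1Z.
  rewrite -cIZ; last by apply: cL1D => //; exact: cL1Z.
  by apply: cI_eq => x; rewrite (s1 x y) (s2 x y); ring.
 have eb y : cI (fun x => (kp1 (x - y) - iC * kp2 (x - y)) * psi x) = - sg * (P1 y - iC * P2 y).
  rewrite /P1 /P2 /cnv -(cIZ iC (L2' y)) -cIB//; last exact: cL1Z.
  rewrite -cIZ; last by apply: cL1B => //; exact: cL1Z.
  by apply: cI_eq => x; rewrite (s1 x y) (s2 x y); ring.
 have PM := cnv_bd m0 hk0 Lp; have PM1 := cnv_bd m1 hk1 Lp; have PM2 := cnv_bd m2 hk2 Lp.
 set I := I2 _ in PM PM1 PM2.
 have bdi (z w : R[i]) : nm z <= M * I -> nm w <= M * I -> nm (z + iC * w) <= M * I + M * I /\ nm (z - iC * w) <= M * I + M * I.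
  move=> hz hw; have h : nm (iC * w) <= M * I by rewrite nm_mul_i.
  by split; [exact: le_nmD|apply: le_nmD => //; rewrite nmN].
 have [mP mP1 mP2] := C11_cmeas CP.
 have miP : cmeas (fun y => iC * P2 y) by apply: cmeasM => //; exact: cmeas_cst.
 have B1 : cL1 (fun y => kk y * P y) by exact: cL1_mulr kk_L1 mP PM.
 have B2 : cL1 (fun y => ax y * (P1 y + iC * P2 y)).
  apply: (cL1_mulr ax_L1 (cmeasD mP1 miP)) => y; exact: (bdi _ _ (PM1 y) (PM2 y)).1.
 have B3 : cL1 (fun y => bx y * (P1 y - iC * P2 y)).
  apply: (cL1_mulr bx_L1 (cmeasB mP1 miP)) => y; exact: (bdi _ _ (PM1 y) (PM2 y)).2.
 transitivity (sg * (cI (fun y => kk y * P y) + cI (fun y => ax y * (P1 y + iC * P2 y)) - cI (fun y => bx y * (P1 y - iC * P2 y)))).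
  rewrite mulrBr mulrDr -(cIZ sg B1) -(cIZ sg B2) -(cIZ sg B3).
  have -> : cI (fun y => kk y * cI (fun x => kp (x - y) * psi x)) = cI (fun y => sg * (kk y * P y)).
   by apply: cI_eq => y; rewrite e0; ring.
  have -> : cI (fun y => ax y * cI (fun x => (kp1 (x - y) + iC * kp2 (x - y)) * psi x)) = - cI (fun y => sg * (ax y * (P1 y + iC * P2 y))).
   by rewrite -cIN; [apply: cI_eq => y; rewrite ea; ring|exact: cL1Z].
  have -> : cI (fun y => bx y * cI (fun x => (kp1 (x - y) - iC * kp2 (x - y)) * psi x)) = - cI (fun y => sg * (bx y * (P1 y - iC * P2 y))).
   by rewrite -cIN; [apply: cI_eq => y; rewrite eb; ring|exact: cL1Z].
  by rewrite opprK.
 congr (_ * _); rewrite -cID// -cIB//; last exact: cL1D.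
 by apply: cI_eq => y; rewrite /kk /ax /bx; ring.
rewrite main nmM; apply: (@le_trans _ _ (1 * (T * B))); last by rewrite mul1r.
apply: ler_pM; rewrite ?nm_ge0//; apply: (HL TT) => x.
rewrite nmM nmR; have /andP[c0' c1] := chi01 x; rewrite ger0_norm//.
by apply: le_trans (PB x); rewrite ler_piMl ?nm_ge0.
Qed.

Lemma Mk_cmeas kp kp1 kp2 (M : R) : kern kp kp1 kp2 M -> cmeas (Mk kp kp1 kp2).
Proof.
move=> Hk; have [Ck kM] := Hk; have [m0 _ _] := C11_cmeas Ck.
have [ma mb hab hbb] := kern_meas Hk.
have hk0 z : nm (kp z) <= M by case: (kM z).
apply: cmeasD; last exact: (cmeas_cnv mb hbb bx_L1).
by apply: cmeasB; [exact: (cmeas_cnv m0 hk0 kk_L1)|exact: (cmeas_cnv ma hab ax_L1)].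
Qed.

Lemma Mk_L1 kp kp1 kp2 (M B s : R) (sg : R[i]) : kern kp kp1 kp2 M ->
 (forall x y, kp (x - y) = sg * kp (y - x)) ->
 (forall x y, kp1 (x - y) = - sg * kp1 (y - x)) ->
 (forall x y, kp2 (x - y) = - sg * kp2 (y - x)) ->
 nm sg <= 1 ->
 (forall psi, cL1 psi -> bdd psi 1 -> supp s psi ->
  forall x, nm (cnv kp psi x) <= B) ->
 I2 (fun x => nm (Mk kp kp1 kp2 x) * \1_(ball 0 s) x) <= T * B.
Proof.
move=> Hk s0 s1 s2 sg1 HB; apply: (@dual_L1 _ (T * M)).
- exact: Mk_cmeas Hk.
- by move=> x; apply: (Mk_bd x Hk); case: Hk => _ kM z; case: (kM z).
- move=> psi mp p1 sp; have Lp : cL1 psi by exact: cL1_box mp p1 (supp_ball sp).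
 exact: (Mk_dual Hk s0 s1 s2 sg1 Lp sp (HB psi Lp p1 sp)).
Qed.

End Kernel.
End Duality.

(** * Rigidity of holomorphic functions of almost constant modulus *)

Section Holomorphic.
Context {R : realType}.
Local Notation pt := (R * R)%type.

Lemma Se_out (e : R) (z : pt) : 0 < e -> e <= `|z| ->
 Se e z = cz z ^+ 2 * (- 2 * ((sq z)^-1) ^+ 2)%:C.
Proof.
move=> e0 ez; have e0' : e != 0 by rewrite gt_eqF.
have z0 : 0 < `|z| by exact: lt_le_trans ez.
have s0 : 0 < sq z by apply: lt_le_trans (norm_sq z); rewrite exprn_gt0.
have sE : sq (e^-1 *: z) = e^-1 ^+ 2 * sq z.
 by rewrite /sq -[(e^-1 *: z).1]/(e^-1 * z.1) -[(e^-1 *: z).2]/(e^-1 * z.2); ring.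
have cE : cz (e^-1 *: z) = (e^-1)%:C * cz z.
 rewrite /cz -[(e^-1 *: z).1]/(e^-1 * z.1) -[(e^-1 *: z).2]/(e^-1 * z.2) !rmorphM /=; ring.
have s1 : 1 <= sq (e^-1 *: z).
 apply: sq_ge1; rewrite normrZ ger0_norm ?invr_ge0 ?(ltW e0)// ler_pdivlMl// mulr1//.
rewrite /Se /S0 /mP' /pw ltNge s1 /= cE sE exprMn.
have -> : (2 * - ((e^-1 ^+ 2 * sq z)^-1) ^+ 2) = (e ^+ 2) ^+ 2 * (- 2 * ((sq z)^-1) ^+ 2).
 by rewrite invfM -exprVn invrK exprMn; ring.
move: (cz z ^+ 2) (- 2 * ((sq z)^-1) ^+ 2) => W Y.
have E : e^-1 ^+ 2 * (e^-1 * e^-1) * ((e ^+ 2) ^+ 2) = 1 by field.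
rewrite expr2 [in RHS](_ : Y = e^-1 ^+ 2 * (e^-1 * e^-1) * ((e ^+ 2) ^+ 2) * Y); last by rewrite E mul1r.
by cplx_ring.
Qed.

Lemma Ce_diff_out (e d : R) (z : pt) : 0 < e <= d -> d <= `|z| ->
 [/\ Ce d z - Ce e z = 0, Ce1 d z - Ce1 e z = 0 & Ce2 d z - Ce2 e z = 0].
Proof.
move=> /andP[e0 ed] dz; have d0 : 0 < d by lra.
have ez : e <= `|z| by lra.
have [r1 _ _] := re_out d0 dz; have [r2 _ _] := re_out e0 ez.
have S : Se d z = Se e z by rewrite !Se_out.
by rewrite (Ce_same d0 e0)// !Ce1E !Ce2E r1 r2 S !subrr.
Qed.

Lemma C11_reflect f f1 f2 (x : pt) : C11 f f1 f2 ->
 C11 (fun y : pt => f (x - y)) (fun y => - f1 (x - y)) (fun y => - f2 (x - y)).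
Proof.
by move=> Cf; apply: C11_eq (C11_affine x (-1) Cf) => y; rewrite scaleN1r// rmorphN1 mulN1r.
Qed.

Lemma Re_scalM (r : R) (w z : R[i]) : Re (w * (r%:C * z)) = r * Re (w * z).
Proof. by rewrite !reim; ring. Qed.

Section MeanValue.
Variables (F F1 F2 : pt -> R[i]) (s : R).
Hypotheses (s0 : 0 < s) (CF : C11 F F1 F2)
 (hol : forall x : pt, `|x| <= s -> F1 x + iC * F2 x = 0).

Definition Fb (x : pt) : R[i] := F x * (\1_(ball 0 s) x)%:C.

Lemma cL1_Fb : cL1 Fb.
Proof.
have [M [M0 hM]] := C11_bound s CF; have [mF _ _] := C11_cmeas CF.
apply: (@cL1_box _ M s).
- apply: cmeasM => //; apply: cmeasR; exact: meas_ball.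
- move=> x; rewrite /Fb; have [xb|xb] := pselect (ball 0 s x); last by rewrite ind_out// mulr0 nm0.
 by rewrite ind_in// mulr1; have [] := hM x (ltW ((ball0E s x).1 xb)).
- by move=> x xb; rewrite /Fb ind_out// mulr0.
Qed.

(** The kernel [Ce d - Ce e] is supported in the ball of radius [d] and has Dbar equal to
    [re d - re e]; integrated by parts against a function with vanishing Dbar, it gives zero. *)
Lemma mean_value_indep (e d : R) (x : pt) : 0 < e <= d -> `|x| + d <= s ->
 cnv (re d) Fb x = cnv (re e) Fb x.
Proof.
move=> ed xd; have /andP[e0 ed'] := ed; have d0 : 0 < d by lra.
have Ck := C11_reflect x (C11_D (C11_Ce d) (C11_Z (-1) (C11_Ce e))).
have out (y : pt) : s <= `|y| -> d <= `|x - y|.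
 by move=> ys; have := ler_normB x (x - y); rewrite subKr; lra.
have T1 : TF s (fun y => Ce d (x - y) + -1 * Ce e (x - y))
 (fun y => - (Ce1 d (x - y) + -1 * Ce1 e (x - y))) (fun y => - (Ce2 d (x - y) + -1 * Ce2 e (x - y))).
 by split => // y ys; have [h0 h1 h2] := Ce_diff_out ed (out y ys); rewrite !mulN1r ?h0 ?h1 ?h2 ?oppr0.
have TT := TF_M T1 CF; have I1 := cI_d1 (ltW s0) TT; have I2' := cI_d2 (ltW s0) TT.
have [_ L1' L2'] := TF_cL1 TT.
have Lr r : cL1 (fun y => re r (x - y) * Fb y) := cL1_conv_in x (re_meas r) (re_bd r) cL1_Fb.
apply/eqP; rewrite -subr_eq0; apply/eqP; rewrite /cnv -cIB//.
transitivity (- (cI (fun y => - (Ce1 d (x - y) + -1 * Ce1 e (x - y)) * F y + (Ce d (x - y) + -1 * Ce e (x - y)) * F1 y)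
  + iC * cI (fun y => - (Ce2 d (x - y) + -1 * Ce2 e (x - y)) * F y + (Ce d (x - y) + -1 * Ce e (x - y)) * F2 y))); last first.
 by rewrite I1 I2' mulr0 addr0 oppr0.
rewrite -cIZ// -cID//; last exact: cL1Z.
rewrite -cIN; last by apply: cL1D => //; exact: cL1Z.
apply: cI_eq => y; have [ys|ys] := ltP `|y| s; last first.
 have yb : ~ ball 0 s y by move=> /ball0E; rewrite ltNge ys.
 have [h0 h1 h2] := Ce_diff_out ed (out y ys).
 by rewrite /Fb ind_out// !mulN1r h0 h1 h2 oppr0 !(mul0r, mulr0, addr0, subrr, oppr0).
have h := hol (ltW ys); rewrite /Fb ind_in ?mulr1; last exact/ball0E.
rewrite -(DbarCe d) -(DbarCe e); set k := Ce d _ + _.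
transitivity (((Ce1 d (x - y) + iC * Ce2 d (x - y)) - (Ce1 e (x - y) + iC * Ce2 e (x - y))) * F y - k * (F1 y + iC * F2 y)).
 by rewrite h mulr0 subr0 mulrBl.
by ring.
Qed.

(** The scale may be sent to [0], where the Lipschitz bound makes the mollification converge to
    [c0 * F x]. *)
Lemma mean_value (d : R) (x : pt) : 0 < d -> `|x| + d <= s -> cnv (re d) Fb x = c0%:C * F x.
Proof.
move=> d0 xd; have [L [L0 hL]] := C11_lip s CF.
have /andP[c1 _] := @c0_bd R; have c00 : 0 <= (c0 : R) by lra.
suff: nm (cnv (re d) Fb x - c0%:C * F x) = 0 by move/nm_eq0/eqP; rewrite subr_eq0 => /eqP.
apply: (@eq0_small _ _ (c0 * L * d)); first exact: nm_ge0.
move=> t /andP[t0 t1]; pose e := t * d.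
have e0 : 0 < e by rewrite mulr_gt0.
have ed : e <= d by rewrite /e ler_piMl// ltW.
rewrite (@mean_value_indep e d)//; last by rewrite e0.
have xs : `|x| <= s by lra.
have mr := rr_meas (R := R) e; have Lr := L1_rr e0.
have Lx : L1 (fun y => rr e (x - y)) := (I2_reflect x Lr).1.
have E : c0%:C * F x = cI (fun y => (rr e (x - y))%:C * F x).
 rewrite cIZr ?cIR ?(I2_reflect x Lr).2 ?I2_rr//; exact: cL1R.
have LFx : cL1 (fun y => (rr e (x - y))%:C * F x).
 by have := cL1Z (F x) (cL1R Lx); congr cL1; apply/funext => y; exact: mulrC.
have Lc := cL1_conv_in x (re_meas e) (re_bd e) cL1_Fb.
rewrite E /cnv -cIB//; apply: (le_trans (cI_abs (cL1B Lc LFx))).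
have -> : c0 * L * d * t = I2 (fun y => rr e (x - y) * (L * e)).
 by rewrite I2Zr// (I2_reflect x Lr).2 (I2_rr e0) /e; ring.
apply: I2_le; [by apply: L1_nm; exact: cL1B|exact: L1Zr|].
move=> y; have /andP[r0' _] := rr_bd e (x - y).
rewrite reE -mulrBr nm_pR//.
have [ey|ey] := leP e `|x - y|.
 have [/(congr1 (@complex.Re R)) + _ _] := re_out e0 ey; rewrite reE /= => ->.
 by rewrite !mul0r.
apply: ler_wpM2l => //.
have ys : `|y| < s by have := ler_normB x (x - y); rewrite subKr; lra.
rewrite /Fb ind_in ?mulr1; last exact/ball0E.
have := hL x (y - x) xs; rewrite addrC subrK => h; apply: (le_trans (h (ltW ys))).
by rewrite ler_wpM2l// distrC ltW.
Qed.

Lemma mean_value_Re (d : R) (x : pt) (w : R[i]) : 0 < d -> `|x| + d <= s ->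
 L1 (fun z => rr d (x - z) * Re (w * Fb z)) /\
 I2 (fun z => rr d (x - z) * Re (w * Fb z)) = c0 * Re (w * F x).
Proof.
move=> d0 xd; have Lc := cL1_conv_in x (re_meas d) (re_bd d) cL1_Fb; split.
 by have [+ _] := cL1Z w Lc; congr L1; apply/funext => z; rewrite reE Re_scalM.
transitivity (Re (w * cnv (re d) Fb x)); last by rewrite mean_value// Re_scalM.
by rewrite /cnv -cIZ// Re_cI; apply: I2_eq => z; rewrite reE Re_scalM.
Qed.

End MeanValue.

Lemma le_dyad (x y C : R) : (forall t : R, 0 < t <= 1 -> x <= y + C * t) -> x <= y.
Proof.
move=> H; apply: (@le_pow2 _ _ _ C) => n; apply: H.
have p0 : 0 < (2 : R) ^+ n by rewrite exprn_gt0.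
by rewrite invr_gt0 p0 /= invf_le1// exprn_ege1// ler1n.
Qed.

(** Difference quotients turn the Lipschitz bound into one on derivatives; at a boundary point of
    the closed ball the increment has to point inwards, hence the sign [sg]. *)
Lemma Re_grad_le f f1 f2 (w : R[i]) (s L : R) (x : pt) : C11 f f1 f2 -> 0 < s -> `|x| <= s ->
 (forall y z : pt, `|y| <= s -> `|z| <= s -> `|Re (w * f y) - Re (w * f z)| <= L * `|y - z|) ->
 `|Re (w * f1 x)| <= L /\ `|Re (w * f2 x)| <= L.
Proof.
move=> Cf s0 xs lip; have [C [C0 hC]] := C11_Z w Cf s.
have dir (e : pt) : `|e| = 1 -> (exists sg : R, `|sg| = 1 /\ forall t, 0 < t <= 1 -> `|x + (sg * (t * s)) *: e| <= s) ->
  `|Re ((w * f1 x) * e.1%:C + (w * f2 x) * e.2%:C)| <= L.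
 move=> e1 [sg [sg1 hsg]]; apply: (@le_dyad _ _ (C * s)) => t t01; have xt := hsg t t01.
 have /andP[t0 t1] := t01; pose h := (sg * (t * s)) *: e.
 have ts0 : 0 < t * s by rewrite mulr_gt0.
 have nh : `|h| = t * s by rewrite /h normrZ e1 mulr1 normrM sg1 mul1r gtr0_norm.
 have [hh _ _] := hC x h xs xt; have := lip (x + h) x xt xs.
 rewrite [x + h - x]addrAC subrr add0r nh => hl.
 set D := _ * _ + _ in hh; have DE : Re D = (sg * (t * s)) * Re ((w * f1 x) * e.1%:C + (w * f2 x) * e.2%:C).
  by rewrite /D -[h.1]/((sg * (t * s)) * e.1) -[h.2]/((sg * (t * s)) * e.2) !reim; ring.
 have : `|Re D| <= L * (t * s) + C * (t * s) ^+ 2.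
  have -> : Re D = (Re (w * f (x + h)) - Re (w * f x)) - Re (w * f (x + h) - w * f x - D) by rewrite !reim; ring.
  apply: (le_trans (ler_normB _ _)); apply: lerD => //.
  by apply: (le_trans (nm_Re _)); rewrite -nh.
 rewrite DE normrM normrM sg1 mul1r gtr0_norm// => H.
 rewrite -(ler_pM2l ts0); apply: (le_trans H).
 by apply: eq_ler; ring.
have sgn (u v : R) (t : R) : 0 < t <= 1 -> `|u| <= s -> exists sg : R, `|sg| = 1 /\ forall t, 0 < t <= 1 -> `|u + sg * (t * s)| <= s.
 move=> _ us; have [u0|u0] := leP u 0.
  exists 1; rewrite normr1; split => // t' /andP[a b]; rewrite mul1r ler_norml.
  rewrite ler_norml in us; have h1 : t' * s <= s by rewrite ler_piMl// ltW.
  have h2 : 0 < t' * s by rewrite mulr_gt0.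
  by case/andP: us => us1 us2; apply/andP; split; lra.
 exists (-1); rewrite normrN1; split => // t' /andP[a b]; rewrite mulN1r ler_norml.
 rewrite ler_norml in us; have h1 : t' * s <= s by rewrite ler_piMl// ltW.
 have h2 : 0 < t' * s by rewrite mulr_gt0.
 by case/andP: us => us1 us2; apply/andP; split; lra.
have /norm_ptP[x1 x2] := xs.
split.
- have := dir (1, 0) norm_e1; rewrite /= !(mulr1, mulr0, addr0); apply.
 have [sg [sg1 hs]] := sgn x.1 0 1 (introT andP (conj ltr01 (lexx 1))) x1.
 exists sg; split => // t t01; apply/norm_ptP; split.
  rewrite -[(_ + _).1]/(x.1 + sg * (t * s) * 1) mulr1; exact: hs.
 by rewrite -[(_ + _).2]/(x.2 + sg * (t * s) * 0) mulr0 addr0.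
- have := dir (0, 1) norm_e2; rewrite /= !(mulr1, mulr0, add0r); apply.
 have [sg [sg1 hs]] := sgn x.2 0 1 (introT andP (conj ltr01 (lexx 1))) x2.
 exists sg; split => // t t01; apply/norm_ptP; split.
  by rewrite -[(_ + _).1]/(x.1 + sg * (t * s) * 0) mulr0 addr0.
 rewrite -[(_ + _).2]/(x.2 + sg * (t * s) * 1) mulr1; exact: hs.
Qed.

(** If [Re w >= c / 2], the identity [(|w| - Re w)(|w| + Re w) = (Im w)^2] makes the difference
    quadratic; otherwise [|w - c| >= c / 2], and a linear bound is as good as a quadratic one. *)
Lemma nm_Re_sub (w : R[i]) (c : R) : 1 <= c -> nm w - Re w <= 12 * nm (w - c%:C) ^+ 2.
Proof.
move=> c1; have w0 := nm_ge0 w; have h1 := Re_le_nm w.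
have h2 := nmD (w - c%:C) c%:C; rewrite subrK nmR ger0_norm in h2; last by lra.
have d0 := nm_ge0 (w - c%:C).
have d2 : nm (w - c%:C) ^+ 2 = (Re w - c) ^+ 2 + Im w ^+ 2.
 by rewrite sqr_nm !reim subr0.
have s2 := sqr_nm w.
have [r|r] := leP (c / 2) (Re w).
- have : (nm w - Re w) * (nm w + Re w) = Im w ^+ 2 by rewrite -[RHS](addKr (Re w ^+ 2)) -s2; ring.
 have x0 : 0 <= nm w - Re w by lra.
 have x1 : 1 <= nm w + Re w by lra.
 have := ler_wpM2l x0 x1; have := sqr_ge0 (Re w - c); have := sqr_ge0 (Im w); lra.
- have : c / 2 <= nm (w - c%:C).
  have := nm_Re (w - c%:C); rewrite !reim => h; apply: le_trans h.
  by rewrite distrC ger0_norm; lra.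
 have := nm_Re w; have := ler_norm (- Re w); rewrite normrN.
 have half : c / 2 <= nm (w - c%:C) -> 2^-1 <= nm (w - c%:C) by lra.
 move=> k1 k2 k3; have := ler_wpM2l d0 (half k3); rewrite expr2; lra.
Qed.

Lemma re_lip (e : R) (z h : pt) : 0 < e -> `|rr e (z + h) - rr e z| <= 48 / e ^+ 3 * `|h|.
Proof.
move=> e0; have -> : `|rr e (z + h) - rr e z| = nm (re e (z + h) - re e z).
 by rewrite !reE -rmorphB nmR.
have -> : 48 / e ^+ 3 = 2 * (24 / e ^+ 3) by rewrite mulrA; congr (_ / _); ring.
apply: (C11_seg (C11_re e)); first by rewrite divr_ge0// exprn_ge0// ltW.
move=> t _; exact: re_grad_bd.
Qed.

Lemma rr6_lower : exists w0 : R, 0 < w0 /\ forall z : pt, `|z| <= 4 -> w0 <= rr 6 z.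
Proof.
exists (6^-1 ^+ 2 * (6 * 9^-1 ^+ 2)); split; first by rewrite mulr_gt0// ?mulr_gt0// exprn_gt0// invr_gt0.
move=> z z4; rewrite /rr ler_wpM2l ?sqr_ge0//.
have n : `|6^-1 *: z| <= 2 / 3 by rewrite normrZ ger0_norm ?invr_ge0//; lra.
have s8 : sq (6^-1 *: z) <= 8 / 9.
 apply: (le_trans (sq_norm _)).
 have : `|6^-1 *: z| ^+ 2 <= (2 / 3) ^+ 2 by rewrite ler_pXn2r ?nnegrE// divr_ge0.
 by rewrite !expr2; lra.
have s1 : sq (6^-1 *: z) < 1 by lra.
rewrite /rP /pw s1 ler_wpM2l// ler_pXn2r ?nnegrE ?invr_ge0//; lra.
Qed.

Lemma Re_iM (z : R[i]) : Re (iC * z) = - Im z.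
Proof. by rewrite !reim; ring. Qed.

Lemma Re_cjM (z : R[i]) : Re (cj z * z) = nm z ^+ 2.
Proof. by rewrite sqr_nm !reim; ring. Qed.

(* Mean values turn the first-order bound on [|F| - c0] into a bound on the
  variance of [F], hence on [Re F - c0]; Cauchy-Riemann then controls [Im F]. *)
Lemma holomorphic_rigidity (B D : R) : 0 <= B -> 0 < D -> exists K : R, 0 <= K /\
 forall (F F1 F2 : pt -> R[i]) (d : R), C11 F F1 F2 ->
 (forall x : pt, `|x| <= 7 -> F1 x + iC * F2 x = 0) ->
 0 < d <= 1 -> (forall x : pt, `|x| <= 7 -> nm (F x) <= B) ->
 I2 (fun x => `|nm (F x) - c0| * \1_(ball 0 7) x) <= D * d ->
 exists c : R[i], nm c = 1 /\ forall x : pt, `|x| <= 2 -> nm (F x - c0%:C * c) <= K * d.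
Proof.
move=> B0 D0.
have /andP[c1 _] := @c0_bd R; have c00 : 0 <= (c0 : R) by lra.
have [w0 [w00 hw0]] := rr6_lower.
have [W [W0 hW]] : exists W : R, 0 <= W /\ forall z : pt, 0 <= rr 6 z <= W.
 by exists (6 / 6 ^+ 2); split; [rewrite divr_ge0// sqr_ge0|exact: rr_bd].
have h20 : 0 < (2^-1 : R) by rewrite invr_gt0.
have [Lr [Lr0 hLr]] : exists Lr : R, 0 <= Lr /\ forall z h : pt, `|rr 2^-1 (z + h) - rr 2^-1 z| <= Lr * `|h|.
 exists (48 / 2^-1 ^+ 3); split; last by move=> z h; exact: re_lip.
 by apply: divr_ge0; [exact: ler0n|rewrite exprn_ge0// ltW].
have BD0 : 0 <= B + c0 by exact: addr_ge0.
pose V := (W + c0) * ((B + c0) * D) / w0.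
have V0 : 0 <= V.
 by apply: divr_ge0; [apply: mulr_ge0; [exact: addr_ge0|apply: mulr_ge0; [exact: BD0|exact: ltW]]|exact: ltW].
pose U := D + 12 * (2 * V + 2 * (D ^+ 2 * (2 * 3) ^+ 2)).
have U0 : 0 <= U.
 by rewrite /U addr_ge0 ?(ltW D0)// mulr_ge0// addr_ge0// mulr_ge0// mulr_ge0// sqr_ge0.
pose K := D + 12 * (Lr * U) + (B + c0) * D.
have K1 : 0 <= 12 * (Lr * U) by rewrite mulr_ge0// mulr_ge0.
have K2 : 0 <= (B + c0) * D by rewrite mulr_ge0// ltW.
exists K; split; first by rewrite /K !addr_ge0// ltW.
move=> F F1 F2 d CF hol /andP[d0 d1] FB HI.
have KD : (B + c0) * D * d <= K * d by rewrite ler_wpM2r ?(ltW d0)// /K; lra.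
have KD' : (D + 12 * (Lr * U)) * d <= K * d by rewrite ler_wpM2r ?(ltW d0)// /K; lra.
(* When [d] is not small, the crude bound [B + c0] is itself of order [d]. *)
have [Dd|Dd] := leP 1 (D * d).
 exists 1; rewrite nm1; split => // x x2; apply: le_trans KD.
 rewrite mulr1; apply: (le_trans (nmB _ _)); rewrite nmR (ger0_norm c00).
 apply: (@le_trans _ _ (B + c0)); first by rewrite lerD2r FB//; lra.
 by rewrite -mulrA ler_peMr.
have [mF _ _] := C11_cmeas CF; have maF := meas_nm mF.
have s70 : 0 < (7 : R) by [].
have s30 : 0 < (3 : R) by [].
have mb (s : R) : mfun (\1_(ball 0 s) : pt -> R).
 exact: meas_ball.
pose p (z : pt) : R := `|nm (F z) - c0| * \1_(ball 0 7) z.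
have p0 z : 0 <= p z by rewrite mulr_ge0//; case/andP: (ind_itv (ball 0 7) z).
have Lp : L1 p.
 apply: (@L1_ind_bd _ _ _ (B + c0) 7) => //; last 1 first.
 - move=> z zb; rewrite normr_id; apply: (le_trans (ler_normB _ _)).
  by rewrite !ger0_norm ?nm_ge0// lerD2r FB// ltW//; exact/ball0E.
 - by apply: measurableT_comp => //; apply: measurable_funB.
 - exact: mball2.
have pin (z : pt) : `|z| < 7 -> p z = `|nm (F z) - c0|.
 by move=> z7; rewrite /p ind_in ?mulr1//; exact/ball0E.
(* The unit ball has area 4, so some point of it does no worse than the integral. The mollifier of
   scale 6 around it stays in the ball of radius 7 and is bounded below on the ball of radius 3,
   whose points are at distance at most 4. *)
have [x0 [x01 hx0]] : exists x0 : pt, `|x0| < 1 /\ `|nm (F x0) - c0| <= D * d.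
 apply/not_existsP => nx.
 have : I2 (fun x => D * d * \1_(ball 0 1) x) <= D * d.
  apply: le_trans HI; apply: I2_le => //; first by apply: L1Z; exact: L1_ball.
  move=> x; have [xb|xb] := pselect (ball 0 1 x); last first.
   rewrite (ind_out xb) mulr0; exact: p0.
  rewrite (ind_in xb) mulr1 ind_in ?mulr1; last by apply/ball0E; move/ball0E: xb; clear; lra.
  have [//|h] := leP (D * d) `|nm (F x) - c0|.
  by exfalso; apply: (nx x); split; [exact/ball0E|exact: ltW].
 rewrite I2Z; last exact: L1_ball.
 rewrite I2_ball// mulr1 => h; have : 0 < D * d by rewrite mulr_gt0.
 by move: h; rewrite expr2; clear; lra.
set F0 := F x0 in hx0.
have F0c : 0 < nm F0.
 by move: hx0; rewrite distrC => /(le_trans (ler_norm _)); move: Dd c1; clear; lra.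
pose G := Fb F 7.

have x07 : `|x0| + 6 <= 7 by move: x01; clear; lra.
have [Lq Iq] := mean_value_Re s70 CF hol (cj F0) (ltr0n _ 6) x07; rewrite -/F0 Re_cjM -/G in Lq Iq.
have L6 := L1_rr (ltr0n R 6); have Lx := (I2_reflect x0 L6).1.
have Ix : I2 (fun z => rr 6 (x0 - z)) = c0 by rewrite (I2_reflect x0 L6).2 I2_rr.
(* When [|F - F0|^2] is expanded, the mean value property evaluates the cross term as a multiple of
   [|F0|^2]; what remains is the weighted mean of [|F|^2 - |F0|^2], of first order in [d]. *)
have HV : I2 (fun z => nm (F z - F0) ^+ 2 * \1_(ball 0 3) z) <= V * d.
 rewrite /V mulrAC ler_pdivlMr// mulrC -I2Z; last first.
  have H := C11_D CF (C11_cst (- F0)); exact: (L1_sq_C11 3 H).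
 have L1r : L1 (fun z => rr 6 (x0 - z) * (c0 ^+ 2 + nm F0 ^+ 2) + W * (B + c0) * p z
   - 2 * (rr 6 (x0 - z) * Re (cj F0 * G z))).
  by apply: L1B; [apply: L1D; [exact: L1Zr|exact: L1Z]|exact: L1Z].
 apply: (@le_trans _ _ (I2 (fun z => rr 6 (x0 - z) * (c0 ^+ 2 + nm F0 ^+ 2) + W * (B + c0) * p z
   - 2 * (rr 6 (x0 - z) * Re (cj F0 * G z))))).
  apply: I2_le => //; first by apply: L1Z; exact: (L1_sq_C11 3 (C11_D CF (C11_cst (- F0)))).
  move=> z; have /andP[r0 rW] := hW (x0 - z).
  have [z7|z7] := ltP `|z| 7; last first.
   rewrite (@ind_out _ (ball 0 3)) ?mulr0; last by move=> /ball0E; move: z7; clear; lra.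
   have z6 : 6 <= `|x0 - z| by have := ler_normB x0 (x0 - z); rewrite subKr; move: z7 x01; clear; lra.
   have [/(congr1 (@complex.Re R)) + _ _] := re_out (ltr0n _ 6) z6; rewrite reE /= => ->.
   by rewrite !mul0r add0r mulr0 subr0 mulr_ge0// mulr_ge0.
  have GE : G z = F z by rewrite /G /Fb ind_in ?mulr1//; exact/ball0E.
  have le1 : w0 * (nm (F z - F0) ^+ 2 * \1_(ball 0 3) z) <= rr 6 (x0 - z) * nm (F z - F0) ^+ 2.
   have [zb|zb] := pselect (ball 0 3 z); last by rewrite ind_out// !mulr0 mulr_ge0// sqr_ge0.
   rewrite ind_in// mulr1 ler_wpM2r ?sqr_ge0// hw0//.
   by have := ler_normB x0 z; move/ball0E: zb; move: x01; clear; lra.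
  apply: (le_trans le1); rewrite GE pin//.
  have -> : nm (F z - F0) ^+ 2 = nm (F z) ^+ 2 + nm F0 ^+ 2 - 2 * Re (cj F0 * F z).
   by rewrite !sqr_nm !reim; ring.
  have h1 : nm (F z) ^+ 2 - c0 ^+ 2 <= (B + c0) * `|nm (F z) - c0|.
   rewrite subr_sqr mulrC; apply: (@le_trans _ _ ((nm (F z) + c0) * `|nm (F z) - c0|)).
    by rewrite ler_wpM2l ?ler_norm// addr_ge0 ?nm_ge0.
   by rewrite ler_wpM2r// lerD2r FB// ltW.
  have h2 := ler_wpM2l r0 h1.
  have h3 : rr 6 (x0 - z) * ((B + c0) * `|nm (F z) - c0|) <= W * ((B + c0) * `|nm (F z) - c0|).
   by rewrite ler_wpM2r// mulr_ge0.
  by move: h2 h3; move: (rr 6 _) (nm (F z) ^+ 2) (Re _) `|_|; clear; move=> *; lra.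
 rewrite I2B; [|by apply: L1D; [exact: L1Zr|exact: L1Z]|exact: L1Z].
 rewrite I2D; [|exact: L1Zr|exact: L1Z].
 rewrite (I2Zr _ Lx) Ix (I2Z _ Lp) (I2Z _ Lq) Iq.
 have h : c0 * (c0 ^+ 2 - nm F0 ^+ 2) <= c0 * ((B + c0) * (D * d)).
  rewrite ler_wpM2l// subr_sqr mulrC.
  have dn : c0 - nm F0 <= D * d by apply: le_trans (ler_norm _) _; rewrite distrC.
  apply: (@le_trans _ _ ((c0 + nm F0) * (D * d))).
   by rewrite ler_wpM2l// addr_ge0// ltW.
  rewrite ler_wpM2r ?mulr_ge0 ?(ltW D0) ?(ltW d0)// addrC lerD2r FB//; move: x01; clear; lra.
 have h' : W * (B + c0) * I2 p <= W * (B + c0) * (D * d) by rewrite ler_wpM2l// mulr_ge0.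
 rewrite -/p in h'; move: h h'; clear; lra.
pose c : R[i] := ((nm F0)^-1)%:C * F0.
have cc1 : nm c = 1 by rewrite /c nmM nmR ger0_norm ?invr_ge0 ?nm_ge0// mulVf// gt_eqF.
have F0E : F0 = (nm F0)%:C * c by rewrite /c mulrA -rmorphM divff ?gt_eqF// mul1r.
have dF0 : nm (F0 - c0%:C * c) <= D * d.
 by rewrite {1}F0E -mulrBl -rmorphB nmM nmR cc1 mulr1.
have cjc z : nm (cj c * z) = nm z by rewrite nmM nmcj cc1 mul1r.
have cc z : nm (cj c * F z - c0%:C) = nm (F z - c0%:C * c).
 by rewrite -[RHS]cjc mulrBr mulrCA mulcjE cc1 expr1n mulr1.
pose u z := Re (cj c * F z) - c0.
have [Cc _ _] := C11_cmeas (C11_Z (cj c) CF).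
have Lu : L1 (fun z => u z * \1_(ball 0 3) z).
 apply: (@L1_ind_bd _ _ _ (B + c0) 3) => //; last 1 first.
 - move=> z /ball0E z3; apply: (le_trans (ler_normB _ _)); rewrite (ger0_norm c00) lerD2r.
  by apply: (le_trans (nm_Re _)); rewrite cjc FB//; move: z3; clear; lra.
 - by apply: measurable_funB => //; case: Cc.
 - exact: mball2.
(* [|F|] and [Re (conj c F)] differ by a quantity quadratic in [F - c0 c], which the variance bound
   controls. *)
have Hu : I2 (fun z => `|u z * \1_(ball 0 3) z|) <= U * d.
 have LV : L1 (fun z => nm (F z - F0) ^+ 2 * \1_(ball 0 3) z) := L1_sq_C11 3 (C11_D CF (C11_cst (- F0))).
 have LB := L1_ball (0 : pt) 3.
 apply: (@le_trans _ _ (I2 (fun z => p z + 12 * (2 * (nm (F z - F0) ^+ 2 * \1_(ball 0 3) z) + 2 * ((D * d) ^+ 2 * \1_(ball 0 3) z))))).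
  apply: I2_le; [exact: L1_abs|by apply: L1D => //; apply: L1Z; apply: L1D; apply: L1Z => //; exact: L1Z|].
  move=> z; have [zb|zb] := pselect (ball 0 3 z); last by rewrite (ind_out zb) !mulr0 addr0 normr0 mulr0 addr0.
  have z3 : `|z| < 3 by exact/ball0E.
  rewrite (ind_in zb) !mulr1 pin; last by move: z3; clear; lra.
  have h1 := nm_Re_sub (cj c * F z) c1; rewrite cjc cc in h1.
  have h2 := Re_le_nm (cj c * F z); rewrite cjc in h2.
  have h3 : nm (F z - c0%:C * c) <= nm (F z - F0) + D * d.
   rewrite (_ : F z - c0%:C * c = (F z - F0) + (F0 - c0%:C * c)); last by ring.
   by apply: (le_trans (nmD _ _)); rewrite lerD2l.
  have h4 : nm (F z - c0%:C * c) ^+ 2 <= (nm (F z - F0) + D * d) ^+ 2.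
   by rewrite ler_pXn2r ?nnegrE ?nm_ge0// (le_trans (nm_ge0 _) h3).
  have h5 := sqr_ge0 (nm (F z - F0) - D * d).
  rewrite /u (_ : _ - c0 = (nm (F z) - c0) - (nm (F z) - Re (cj c * F z))); last by ring.
  apply: (le_trans (ler_normB _ _)); rewrite lerD2l ger0_norm ?subr_ge0//.
  move: h1 h4 h5; rewrite !sqrrD; clear; lra.
 rewrite I2D//; last by apply: L1Z; apply: L1D; apply: L1Z => //; exact: L1Z.
 rewrite I2Z; last by apply: L1D; apply: L1Z => //; exact: L1Z.
 rewrite I2D; [|exact: L1Z|by apply: L1Z; exact: L1Z].
 rewrite !I2Z//; last exact: L1Z.
 rewrite I2_ball//.
 have hp : I2 p <= D * d by [].
 have dd : (D * d) ^+ 2 <= D ^+ 2 * d.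
  by rewrite exprMn ler_wpM2l ?sqr_ge0// expr2 ler_piMl ?(ltW d0).
 have := ler_wpM2r (sqr_ge0 (2 * 3 : R)) dd; rewrite /U; move: HV hp; move: (I2 _) (I2 _); clear; move=> *; lra.
clear Ix Lx Lq Iq HV HI pin p0 Lp KD L6 hW W0 hw0 w00; clearbody U V K.
have hol3 (x : pt) : `|x| <= 3 -> F1 x + iC * F2 x = 0 by move=> x3; apply: hol; move: x3; clear; lra.
have Lh := L1_rr h20.
(* The mollifier of scale [1/2] reproduces [u], so its L1 bound becomes a Lipschitz bound on the
   smaller ball of radius [5 / 2]. *)
have repr (x : pt) : `|x| <= 5 / 2 -> c0 * u x = I2 (fun z => rr 2^-1 (x - z) * (u z * \1_(ball 0 3) z)).
 move=> x5; have x3 : `|x| + 2^-1 <= 3 by move: x5; clear; lra.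
 have [Lq3 Iq3] := mean_value_Re s30 CF hol3 (cj c) h20 x3; have Lxr := (I2_reflect x Lh).1.
 have Ic3 : I2 (fun z => rr 2^-1 (x - z) * c0) = c0 * c0.
  by rewrite (I2Zr _ Lxr) (I2_reflect x Lh).2 (I2_rr h20).
 rewrite /u mulrBr -Iq3 -Ic3 -I2B//; last exact: L1Zr.
 apply: I2_eq => z; have [z3|z3] := ltP `|z| 3.
  by rewrite /Fb ind_in ?mulr1 -?mulrBr//; exact/ball0E.
 have z2 : 2^-1 <= `|x - z| by have := ler_normB x (x - z); rewrite subKr; move: z3 x5; clear; lra.
 have [/(congr1 (@complex.Re R)) + _ _] := re_out h20 z2; rewrite reE /= => ->.
 by rewrite !mul0r subrr.
have lip (x y : pt) : `|x| <= 5 / 2 -> `|y| <= 5 / 2 -> `|Re (cj c * F x) - Re (cj c * F y)| <= Lr * U * d * `|x - y|.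
 move=> x5 y5.
 have -> : Re (cj c * F x) - Re (cj c * F y) = u x - u y by rewrite /u; ring.
 apply: (@le_trans _ _ (c0 * `|u x - u y|)); first by rewrite ler_peMl.
 rewrite -(ger0_norm c00) -normrM mulrBr !repr//.
 have LL (w : pt) : L1 (fun z => rr 2^-1 (w - z) * (u z * \1_(ball 0 3) z)).
  apply: (@L1_bdM _ (6 / 2^-1 ^+ 2)) => //.
   apply: L1_meas; exact: (I2_reflect w Lh).1.
  by move=> z; have /andP[a b] := rr_bd 2^-1 (w - z); rewrite ger0_norm.
 rewrite -I2B//; apply: (le_trans (I2_abs (L1B (LL x) (LL y)))).
 apply: (@le_trans _ _ (I2 (fun z => Lr * `|x - y| * `|u z * \1_(ball 0 3) z|))).
  apply: I2_le; [by apply: L1_abs; exact: L1B|by apply: L1Z; exact: L1_abs|].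
  move=> z; rewrite -mulrBl normrM ler_wpM2r//.
  have := hLr (y - z) (x - y); rewrite (_ : y - z + (x - y) = x - z)//.
  by rewrite addrC addrA subrK.
 rewrite I2Z; last exact: L1_abs.
 have := ler_wpM2l (mulr_ge0 Lr0 (normr_ge0 (x - y))) Hu; clear; lra.
have s5 : 0 < 5 / 2 :> R by clear; lra.
have grad (x : pt) : `|x| <= 2 -> nm (F1 x) <= 2 * (Lr * U * d) /\ nm (F2 x) <= 2 * (Lr * U * d).
 move=> x2; have x5 : `|x| <= 5 / 2 by move: x2; clear; lra.
 have [h1 h2] := Re_grad_le CF s5 x5 lip.
 have F2E : F2 x = iC * F1 x.
  have x7 : `|x| <= 7 by move: x2; clear; lra.
  have h : F1 x = - (iC * F2 x) by apply/eqP; rewrite -addr_eq0; apply/eqP; exact: hol.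
  by rewrite h mulrN mulrA iC2 mulN1r opprK.
 have e2 : nm (F2 x) = nm (F1 x) by rewrite F2E nm_mul_i.
 rewrite e2; suff h : nm (F1 x) <= 2 * (Lr * U * d) by [].
 have h3 : `|Im (cj c * F1 x)| <= Lr * U * d.
  by move: h2; rewrite F2E mulrCA (_ : Re _ = - Im (cj c * F1 x)) ?normrN// Re_iM.
 by rewrite -(cjc (F1 x)); apply: (le_trans (nm_le _)); move: h1 h3; clear; lra.
exists c; split => // x x2; apply: le_trans KD'.
have seg : nm (F (x0 + (x - x0)) - F x0) <= 2 * (2 * (Lr * U * d)) * `|x - x0|.
 apply: (C11_seg CF); first by rewrite mulr_ge0// mulr_ge0 ?(ltW d0)// mulr_ge0.
 move=> t /andP[t0 t1]; apply: grad.
 rewrite (_ : x0 + t *: (x - x0) = (1 - t) *: x0 + t *: x); last first.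
  by rewrite scalerBr scalerBl scale1r; ring.
 apply: (le_trans (ler_normD _ _)); rewrite !normrZ (ger0_norm t0) (@ger0_norm _ (1 - t)) ?subr_ge0//.
 have a1 : (1 - t) * `|x0| <= (1 - t) * 1 by rewrite ler_wpM2l ?subr_ge0// ltW.
 have a2 : t * `|x| <= t * 2 by rewrite ler_wpM2l.
 by move: a1 a2 t1; clear; lra.
rewrite (addrC x0) subrK in seg.
have x3 : `|x - x0| <= 3 by apply: (le_trans (ler_normB _ _)); move: x2 x01; clear; lra.
have L' : 0 <= 2 * (2 * (Lr * U * d)) by rewrite mulr_ge0// mulr_ge0// mulr_ge0 ?(ltW d0)// mulr_ge0.
have := ler_wpM2l L' x3.
rewrite (_ : F x - c0%:C * c = (F x - F x0) + (F0 - c0%:C * c)); last by rewrite /F0; ring.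
by have := nmD (F x - F x0) (F0 - c0%:C * c); rewrite -/F0 in seg *; move: seg dF0; clear; lra.
Qed.
End Holomorphic.

(** * Interior estimate *)

Section IntCore.
Context {R : realType}.
Local Notation pt := (R * R)%type.
Implicit Types (f g psi : pt -> R[i]).

Definition m1 (t : R) : R := Num.min t (t ^+ 2).

Lemma m1_ge0 t : 0 <= t -> 0 <= m1 t.
Proof. by move=> t0; rewrite /m1 le_min t0 sqr_ge0. Qed.

Lemma m1_le t : m1 t <= t.
Proof. by rewrite /m1 ge_min lexx. Qed.

Lemma m1_mono s t : 0 <= s -> s <= t -> m1 s <= m1 t.
Proof.
move=> s0 st; have t0 : 0 <= t by lra.
have h : s ^+ 2 <= t ^+ 2 by rewrite ler_pXn2r ?nnegrE.
by rewrite /m1 le_min !ge_min st h orbT.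
Qed.

Lemma tr_sq_m1 t : 0 <= t -> tr t ^+ 2 <= m1 t.
Proof.
move=> t0; have h1 := tr_le1 t; have h2 := tr_le t; have h0 := tr_ge0 t0.
rewrite /m1 le_min; apply/andP; split; last by rewrite ler_pXn2r ?nnegrE.
by apply: le_trans h2; rewrite expr2 ler_piMl.
Qed.

Lemma le_1m1 t : 0 <= t -> t <= 1 + m1 t.
Proof.
move=> t0; have h := sqr_ge0 (t - 2^-1); rewrite expr2 in h.
by rewrite /m1; case: (leP t (t ^+ 2)) => k; rewrite ?expr2; lra.
Qed.

Lemma meas_m1 (f : pt -> R) : mfun f -> mfun (fun x : pt => m1 (f x)).
Proof. by move=> mf; apply: measurable_minr => //; exact: measurable_funX. Qed.

Lemma tr_half (d t : R) : 0 < d -> 0 <= t -> tr t <= 2^-1 * (d + tr t ^+ 2 / d).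
Proof.
move=> d0 t0; have h := sqr_ge0 (tr t - d).
have -> : 2^-1 * (d + tr t ^+ 2 / d) = (2^-1 * (d ^+ 2 + tr t ^+ 2)) / d by field; rewrite gt_eqF.
by rewrite ler_pdivlMr//; move: h; rewrite sqrrB; lra.
Qed.

(** The exponents match the bounds at hand in [N_small]: [x] and [z] are small in L1, [y] after
    truncation and squaring, [w] pointwise. *)
Lemma tr_sq4 (x y z w : R[i]) : tr (nm (x + y + z + w)) ^+ 2 <=
 4 * nm x + 4 * tr (nm y) ^+ 2 + 4 * nm z + 4 * nm w ^+ 2.
Proof.
have h1 := tr_nmD (x + y + z) w; have h2 := tr_nmD (x + y) z; have h3 := tr_nmD x y.
have t0 := tr_ge0 (nm_ge0 (x + y + z + w)).
have [x0 x1 xx] := And3 (tr_ge0 (nm_ge0 x)) (tr_le1 (nm x)) (tr_le (nm x)).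
have y0 := tr_ge0 (nm_ge0 y).
have [z0 z1 zz] := And3 (tr_ge0 (nm_ge0 z)) (tr_le1 (nm z)) (tr_le (nm z)).
have w0 := tr_ge0 (nm_ge0 w); have ww := tr_le (nm w).
have w2 : tr (nm w) ^+ 2 <= nm w ^+ 2 by rewrite ler_pXn2r ?nnegrE ?nm_ge0.
move: (nm x) (nm z) (nm w) (tr (nm (x + y + z + w))) (tr (nm (x + y + z))) (tr (nm (x + y))) (tr (nm x)) (tr (nm y)) (tr (nm z)) (tr (nm w))
 h1 h2 h3 t0 x0 x1 xx y0 z0 z1 zz w0 ww w2.
move=> cx cz' cw t u v p q r s h1 h2 h3 t0 p0 p1 pc q0 r0 r1 rc s0 sc s2.
have h : t ^+ 2 <= (p + q + r + s) ^+ 2 by rewrite ler_pXn2r ?nnegrE//; lra.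
have e1 := sqr_ge0 (p - q); have e2 := sqr_ge0 (p - r); have e3 := sqr_ge0 (p - s).
have e4 := sqr_ge0 (q - r); have e5 := sqr_ge0 (q - s); have e6 := sqr_ge0 (r - s).
have pp : p ^+ 2 <= p by rewrite expr2 ler_piMl.
have rr' : r ^+ 2 <= r by rewrite expr2 ler_piMl.
by clear h1 h2 h3; lra.
Qed.

Lemma L1_trsq f (s : R) : cmeas f -> L1 (fun x => tr (nm (f x)) ^+ 2 * \1_(ball 0 s) x).
Proof.
move=> mf; apply: (@L1_ind_bd _ _ _ 1 s) => //.
- apply: measurable_funX; apply: meas_tr; exact: meas_nm.
- exact: mball2.
- by move=> z _; rewrite ger0_norm ?sqr_ge0// exprn_ile1 ?tr_le1// tr_ge0// nm_ge0.
Qed.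

Lemma re1N (e : R) (x y : pt) : re1 e (x - y) = - re1 e (y - x) /\ re2 e (x - y) = - re2 e (y - x).
Proof.
rewrite -(opprB y x); set w := y - x.
rewrite /re1 /re2 /r01 /r02 !scalerN !sqN -[(- _).1]/(- (e^-1 *: w).1) -[(- _).2]/(- (e^-1 *: w).2).
by rewrite !mulrN !rmorphN !mulrN.
Qed.

Lemma Ce_meas0 (e : R) : cmeas (Ce e : pt -> R[i]).
Proof. by case: (Ce_meas e). Qed.

Lemma growth_bd (al be u v : R) : be <= 1 + u -> `|al - 1| <= 1 + v -> al + be <= 3 + (u + v).
Proof. by have := ler_norm (al - 1); lra. Qed.

Lemma far_dist (x y : pt) : `|x| <= 7 -> 8 < `|y| -> 1 <= `|x - y|.
Proof. by have := ler_normB x (x - y); rewrite subKr; lra. Qed.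

Lemma kern_Ce (e : R) : 0 < e -> kern (Ce e : pt -> R[i]) (Ce1 e) (Ce2 e) (3 / e + 6 / e ^+ 2).
Proof.
move=> e0; split; first exact: C11_Ce.
have a0 : 0 <= 3 / e by rewrite divr_ge0// ltW.
have b0 : 0 <= 6 / e ^+ 2 by rewrite divr_ge0// sqr_ge0.
move=> z; have [c _] := Ce_bd z e0; have [c1 c2] := Ce_grad_bd z e0; split.
- by apply: (le_trans c); rewrite lerDl.
- by apply: (le_trans c1); rewrite lerDr.
- by apply: (le_trans c2); rewrite lerDr.
Qed.

Lemma kern_re (e : R) : 0 < e -> kern (re e : pt -> R[i]) (re1 e) (re2 e) (6 / e ^+ 2 + 24 / e ^+ 3).
Proof.
move=> e0; split; first exact: C11_re.
have b0 : 0 <= 24 / e ^+ 3 by rewrite divr_ge0// exprn_ge0// ltW.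
have a0 : 0 <= 6 / e ^+ 2 by rewrite divr_ge0// sqr_ge0.
move=> z; have c := re_bd e z; have [c1 c2] := re_grad_bd z e0; split.
- by apply: (le_trans c); rewrite lerDl.
- by apply: (le_trans c1); rewrite lerDr.
- by apply: (le_trans c2); rewrite lerDr.
Qed.

Lemma kern_sub f f1 f2 g g1 g2 (M N : R) : kern f f1 f2 M -> kern g g1 g2 N ->
 kern (fun z => f z - g z) (fun z => f1 z - g1 z) (fun z => f2 z - g2 z) (M + N).
Proof.
move=> [Cf hf] [Cg hg]; split.
 by apply: C11_eq (C11_D Cf (C11_Z (-1) Cg)) => z; rewrite mulN1r.
move=> z; have [a0 a1 a2] := hf z; have [b0 b1 b2] := hg z.
by split; apply: le_nmD => //; rewrite nmN.
Qed.

Lemma Ce1_sym (e : R) (x y : pt) : Ce1 e (x - y) = - -1 * Ce1 e (y - x) /\ Ce2 e (x - y) = - -1 * Ce2 e (y - x).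
Proof. by rewrite !Ce1E !Ce2E (re_sym e x) (Se_sym e x) opprK !mul1r. Qed.

Lemma cnv_re_bd (e : R) psi x : 0 < e -> cL1 psi -> bdd psi 1 -> nm (cnv (re e) psi x) <= c0.
Proof.
move=> e0 Lp p1; have Lr := L1_rr e0; have Lx := (I2_reflect x Lr).1.
have Lc := cL1_conv_in x (re_meas e) (re_bd e) Lp.
apply: (le_trans (cI_abs Lc)); rewrite -(I2_rr e0) -(I2_reflect x Lr).2.
apply: I2_le => //; first exact: L1_nm.
move=> y; have /andP[r0 _] := rr_bd e (x - y).
by rewrite reE nm_pR// ler_piMr.
Qed.

Lemma cnv_Ce_bd (e : R) psi (B t : R) x : 0 < e -> 0 < t -> cL1 psi -> bdd psi B ->
 nm (cnv (Ce e) psi x) <= 16 * B * t + I2 (fun x => nm (psi x)) / t.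
Proof.
move=> e0 t0 Lp pB; have := Ce_sup x e0 t0 Lp pB.
rewrite (_ : cI _ = - cnv (Ce e) psi x) ?nmN//.
have Lc := cL1_conv_in x (Ce_meas0 e) (fun z => (Ce_bd z e0).1) Lp.
by rewrite /cnv -cIN//; apply: cI_eq => y; rewrite Ce_sym mulNr.
Qed.

(** [Ce] is Dbar of [Ke], which is bounded by 1 at all scales: after the integration by parts the
    sup of the convolution is bounded by the L1 norm of Dbar psi. *)
Lemma cnv_by_parts (e r : R) psi psi1 psi2 x : 0 < e -> 0 <= r -> TF r psi psi1 psi2 ->
 cnv (Ce e) psi x = cnv (Ke e) (fun z => psi1 z + iC * psi2 z) x.
Proof.
move=> e0 r0 Tp; have TT := TF_M Tp (C11_reflect x (C11_Ke e)).
have I1 := cI_d1 r0 TT; have I2' := cI_d2 r0 TT; have [_ L1' L2'] := TF_cL1 TT.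
have [Lp Lp1 Lp2] := TF_cL1 Tp.
have Lc := cL1_conv_in x (Ce_meas0 e) (fun z => (Ce_bd z e0).1) Lp.
have Lk := cL1_conv_in x (Ke_meas e) (Ke_bd e) (cL1D Lp1 (cL1Z iC Lp2)).
apply/eqP; rewrite -subr_eq0 -oppr_eq0 opprB; apply/eqP.
transitivity (cI (fun y => psi1 y * Ke e (x - y) + psi y * - Ke1 e (x - y)) +
  iC * cI (fun y => psi2 y * Ke e (x - y) + psi y * - Ke2 e (x - y))); last by rewrite I1 I2' mulr0 addr0.
rewrite /cnv -cIB// -cIZ// -cID//; last exact: cL1Z.
by apply: cI_eq => y; rewrite -DbarKe; ring.
Qed.

Lemma cnv_add k1 k2 g (M1 M2 : R) x : cmeas k1 -> bdd k1 M1 ->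
 cmeas k2 -> bdd k2 M2 -> cL1 g ->
 cnv k1 g x + iC * cnv k2 g x = cnv (fun z => k1 z + iC * k2 z) g x /\
 cnv k1 g x - cnv k2 g x = cnv (fun z => k1 z - k2 z) g x.
Proof.
move=> m1' b1 m2 b2 Lg; have L1' := cL1_conv_in x m1' b1 Lg; have L2' := cL1_conv_in x m2 b2 Lg.
split; first by rewrite /cnv -cIZ// -cID//; [apply: cI_eq => y; ring|exact: cL1Z].
by rewrite /cnv -cIB//; apply: cI_eq => y; ring.
Qed.

Lemma Mk_sub (a b : pt -> R[i]) (chi chi1 chi2 : pt -> R) (r G M N : R) f f1 f2 g g1 g2 x :
 cL1 a -> cL1 b -> TF r (fun z => (chi z)%:C) (fun z => (chi1 z)%:C) (fun z => (chi2 z)%:C) ->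
 (forall z, 0 <= chi z <= 1) -> (forall z, `|chi1 z| <= G /\ `|chi2 z| <= G) ->
 kern f f1 f2 M -> kern g g1 g2 N ->
 Mk a b chi chi1 chi2 f f1 f2 x - Mk a b chi chi1 chi2 g g1 g2 x =
 Mk a b chi chi1 chi2 (fun z => f z - g z) (fun z => f1 z - g1 z) (fun z => f2 z - g2 z) x.
Proof.
move=> La Lb Tchi chi01 chiG Hf Hg.
have Lk := kk_L1 La Lb Tchi chiG; have Lac := ax_L1 La Tchi chi01; have Lbc := bx_L1 Lb Tchi chi01.
have [Cf kf] := Hf; have [Cg kg] := Hg; have [mf _ _] := C11_cmeas Cf; have [mg _ _] := C11_cmeas Cg.
have [ma mb hab hbb] := kern_meas Hf; have [ma' mb' hab' hbb'] := kern_meas Hg.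
have hf z : nm (f z) <= M by case: (kf z).
have hg z : nm (g z) <= N by case: (kg z).
rewrite /Mk -(cnv_add x mf hf mg hg Lk).2.
have -> : (fun z => f1 z - g1 z + iC * (f2 z - g2 z)) = (fun z => (f1 z + iC * f2 z) - (g1 z + iC * g2 z)).
 by apply/funext => z; ring.
have -> : (fun z => f1 z - g1 z - iC * (f2 z - g2 z)) = (fun z => (f1 z - iC * f2 z) - (g1 z - iC * g2 z)).
 by apply/funext => z; ring.
rewrite -(cnv_add x ma hab ma' hab' Lac).2 -(cnv_add x mb hbb mb' hbb' Lbc).2; ring.
Qed.

Lemma tr_scale (c t : R) : 1 <= c -> 0 <= t -> tr (c * t) <= c * tr t.
Proof.
move=> c1 t0; rewrite /tr; case: (leP 1 t) => h; rewrite ?mulr1.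
 by rewrite ge_min c1.
by rewrite ge_min lexx orbT.
Qed.

Lemma near_cplx (F r S M a : R[i]) (c : R) : 1 <= c -> F = r - S + M ->
 tr `|nm F - c| <= nm (r - c%:C * a) + tr (nm S) + nm M + c * tr `|nm a - 1|.
Proof.
move=> c1 FE; have c0' : 0 <= c by lra.
have h : `|nm F - c| <= nm (r - c%:C * a - S + M) + c * `|nm a - 1|.
 have h1 := nm_sub F (c%:C * a); rewrite nm_pR// in h1.
 have -> : nm F - c = (nm F - c * nm a) + c * (nm a - 1) by ring.
 apply: (le_trans (ler_normD _ _)); rewrite normrM (ger0_norm c0') lerD2r.
 by apply: (le_trans h1); rewrite FE; apply: eq_ler; congr nm; ring.
apply: (le_trans (tr_mono h)).
apply: (le_trans (trD (nm_ge0 _) (mulr_ge0 c0' (normr_ge0 _)))).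
apply: lerD; last exact: tr_scale.
apply: (le_trans (tr_nmD _ _)); apply: lerD; last exact: tr_le.
apply: (le_trans (tr_nmD _ _)); rewrite nmN; apply: lerD => //; exact: tr_le.
Qed.

Lemma le_tr_scale (B X : R) : 1 <= B -> 0 <= X -> X <= B -> X <= B * tr X.
Proof.
move=> B1 X0 XB; rewrite /tr; case: (leP 1 X) => h; first by rewrite mulr1.
by rewrite ler_peMl.
Qed.

Lemma N_split (c r S Md Me0 F0 u w : R[i]) : F0 = r - S + Me0 ->
 c * (u - w) + Md = - (r - c * u) + S + - (Me0 - Md) + (F0 - c * w).
Proof. by move=> ->; ring. Qed.

Lemma Dbar_split (i u1 u2 v1 v2 w1 w2 U V W : R[i]) : u1 + i * u2 = U -> v1 + i * v2 = V -> w1 + i * w2 = W ->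
 (u1 - v1 + w1) + i * (u2 - v2 + w2) = U - V + W.
Proof. by move=> <- <- <-; ring. Qed.

Lemma sqr_nm_Re (w : R[i]) : nm w ^+ 2 = 2 * Re w ^+ 2 - Re (w ^+ 2).
Proof. by rewrite sqr_nm (expr2 w) !reim; ring. Qed.

Lemma Dbar_prod (i t t1 t2 m n1 n2 n : R[i]) : n1 + i * n2 = n ->
 (t1 * m + t * n1) + i * (t2 * m + t * n2) = (t1 + i * t2) * m + t * n.
Proof. by move=> <-; ring. Qed.

(* Absorption: Young's inequality with weight [36 d] turns the cubic term into half of [Z]. *)
Lemma absorb (d Z N m q c3 o CN c CQ : R) : 0 < d ->
 Z <= 24 * N + 24 * c * m + 18 * c3 + (-1) * q + 0 * o -> N <= CN * d ^+ 2 -> m <= d ^+ 2 -> 0 <= c ->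
 c3 <= d * (16 * 9 * (36 * d) + Z / (36 * d)) -> - q <= CQ * d ^+ 2 ->
 Z <= 2 * (24 * CN + 24 * c + CQ + 18 * (16 * 9 * 36)) * d ^+ 2.
Proof.
rewrite mul0r => d0 hZ hN hm hc h3 hq; have e : d * (Z / (36 * d)) = Z / 36 by field; rewrite gt_eqF.
rewrite mulrDr e in h3; have hm' := ler_wpM2l hc hm.
move: h3; rewrite (_ : d * (16 * 9 * (36 * d)) = 16 * 9 * 36 * d ^+ 2); last by ring.
by move: (d ^+ 2) hN hm hq hm' => D; lra.
Qed.

Lemma tr_unshift (c : R) (u w m : R[i]) : 1 <= c ->
 tr (nm (u - w)) ^+ 2 <= 2 * tr (nm (c%:C * (u - w) + m)) ^+ 2 + 4 * nm m ^+ 2.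
Proof.
move=> c1; set v := u - w.
have h1 := tr_nmD (c%:C * v + m) (- m); rewrite addrK nmN in h1.
have h2 : tr (nm v) <= tr (nm (c%:C * v)).
 by apply: tr_mono; rewrite nm_pR ?ler_peMl ?nm_ge0//; lra.
have h3 := tr_le (nm m); have t0 := tr_ge0 (nm_ge0 v); have p0 := tr_ge0 (nm_ge0 (c%:C * v + m)).
have m0 := nm_ge0 m.
move: (tr (nm v)) (tr (nm (c%:C * v))) (tr (nm (c%:C * v + m))) (tr (nm m)) (nm m) h1 h2 h3 t0 p0 m0.
move=> x y z s q h1 h2 h3 x0 z0 q0.
have h : x ^+ 2 <= (z + q) ^+ 2 by rewrite ler_pXn2r ?nnegrE//; lra.
by have := sqr_ge0 (z - q); have := sqr_ge0 q; clear h1 h2 h3; lra.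
Qed.

Lemma I2_le5 (c1 c2 c3 c4 c5 : R) (X u1 u2 u3 u4 u5 : pt -> R) :
 mfun X -> (forall x, 0 <= X x) -> L1 u1 -> L1 u2 -> L1 u3 -> L1 u4 -> L1 u5 ->
 (forall x, X x <= c1 * u1 x + c2 * u2 x + c3 * u3 x + c4 * u4 x + c5 * u5 x) ->
 I2 X <= c1 * I2 u1 + c2 * I2 u2 + c3 * I2 u3 + c4 * I2 u4 + c5 * I2 u5.
Proof.
move=> mX X0 L1' L2' L3' L4' L5' h.
rewrite -!I2Z// -!I2D; try by do ?[exact: L1Z|apply: L1D].
by apply: I2_le0 => //; [do ?[exact: L1Z|apply: L1D]|move=> x; rewrite X0 h].
Qed.

(* The modulus of [c + (n - w)/c0] is [1 + Re (n - w)/c0] up to quadratic terms. *)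
Lemma Re_sq_bound (n w al : R[i]) (c : R) : 1 <= c -> c%:C * al = c%:C + n - w -> nm w <= 3 ->
 Re w ^+ 2 <= 12 * tr (nm n) ^+ 2 + 12 * c ^+ 2 * tr `|nm al - 1| ^+ 2 + 9 * nm w ^+ 3.
Proof.
move=> c1 E w3; pose s : R := `|nm al - 1|; rewrite -/s.
have s0 : 0 <= s by exact: normr_ge0.
have w0 := nm_ge0 w; have n0 := nm_ge0 n.
have w30 : 0 <= nm w ^+ 3 by rewrite exprn_ge0.
have Rw2 : Re w ^+ 2 <= nm w ^+ 2 by rewrite sqr_nm lerDl sqr_ge0.
have ww : nm w ^+ 2 <= 9.
 by rewrite (_ : 9 = 3 ^+ 2); [rewrite ler_pXn2r ?nnegrE|rewrite -natrX].
have tn0 := sqr_ge0 (tr (nm n)); have ts0 := sqr_ge0 (tr s).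
have cc : 1 <= c ^+ 2 by rewrite exprn_ege1.
have cs : tr s ^+ 2 <= c ^+ 2 * tr s ^+ 2 by rewrite ler_peMl.
(* If [n] or [s] is at least 1, its truncated term alone exceeds [9], which bounds [(Re w)^2]. *)
have [n1|n1] := leP 1 (nm n).
 have -> : tr (nm n) = 1 by rewrite /tr; case: leP n1 => // h; lra.
 by rewrite expr1n -mulrA; lra.
have [s1|s1] := leP 1 s.
 have t1 : tr s = 1 by rewrite /tr; case: leP s1 => // h; lra.
 by rewrite t1 expr1n in cs *; lra.
have tn : tr (nm n) = nm n by rewrite /tr; case: leP n1 => // h; lra.
have ts : tr s = s by rewrite /tr; case: leP s1 => // h; lra.
rewrite tn ts.
have k1 : 2 * c * Re w = 2 * c * Re n + nm (n - w) ^+ 2 - c ^+ 2 * (nm al ^+ 2 - 1).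
 have : nm (c%:C * al) ^+ 2 = nm (c%:C + n - w) ^+ 2 by rewrite E.
 rewrite nmM exprMn nmR real_normK ?num_real// => h.
 by rewrite mulrBr h !sqr_nm !reim; ring.
have k2 : nm (n - w) ^+ 2 <= 2 * nm n ^+ 2 + 2 * nm w ^+ 2.
 have h := nmB n w; have : nm (n - w) ^+ 2 <= (nm n + nm w) ^+ 2.
  by rewrite ler_pXn2r ?nnegrE ?nm_ge0// addr_ge0.
 by have := sqr_ge0 (nm n - nm w); lra.
have a2 : nm al <= 2 by have := ler_norm (nm al - 1); rewrite -/s; lra.
have k3 : `|nm al ^+ 2 - 1| <= 3 * s.
 rewrite (_ : nm al ^+ 2 - 1 = (nm al - 1) * (nm al + 1)); last by ring.
 by rewrite normrM -/s mulrC ler_wpM2r// ger0_norm ?addr_ge0 ?nm_ge0//; lra.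
have nn : nm n ^+ 2 <= nm n by rewrite expr2 ler_piMl// ltW.
have kk : `|Re w| <= 2 * nm n + nm w ^+ 2 + 3 / 2 * c * s.
 have c0' : 0 < 2 * c by lra.
 have : `|2 * c * Re w| <= 2 * c * (2 * nm n + nm w ^+ 2 + 3 / 2 * c * s); last first.
  by rewrite normrM (gtr0_norm c0') ler_pM2l.
 rewrite k1; apply: (le_trans (ler_normB _ _)).
 have b1 : `|2 * c * Re n + nm (n - w) ^+ 2| <= 2 * c * nm n + (2 * nm n + 2 * nm w ^+ 2).
  apply: (le_trans (ler_normD _ _)); apply: lerD.
   by rewrite normrM (gtr0_norm c0') ler_pM2l// nm_Re.
  by rewrite ger0_norm ?sqr_ge0//; lra.
 have b2 : `|c ^+ 2 * (nm al ^+ 2 - 1)| <= c ^+ 2 * (3 * s).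
  by rewrite normrM ger0_norm ?sqr_ge0// ler_wpM2l// sqr_ge0.
 have d1 : 2 * nm n + 2 * nm w ^+ 2 <= c * (2 * nm n + 2 * nm w ^+ 2).
  by rewrite ler_peMl// addr_ge0// mulr_ge0// sqr_ge0.
 by apply: (le_trans (lerD b1 b2)); rewrite expr2; lra.
have w4 : (nm w ^+ 2) ^+ 2 <= 3 * nm w ^+ 3.
 by rewrite (_ : (nm w ^+ 2) ^+ 2 = nm w * nm w ^+ 3) ?ler_wpM2r//; ring.
have sq : Re w ^+ 2 <= (2 * nm n + nm w ^+ 2 + 3 / 2 * c * s) ^+ 2.
 rewrite -[X in X <= _]real_normK ?num_real// ler_pXn2r ?nnegrE//.
 exact: le_trans (normr_ge0 _) kk.
apply: (le_trans sq); move: w4; set p := nm w ^+ 2; set x := c * s.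
have -> : 12 * c ^+ 2 * s ^+ 2 = 12 * x ^+ 2 by rewrite /x; ring.
have -> : 3 / 2 * c * s = 3 / 2 * x by rewrite /x mulrA.
move=> w4.
have e1 := sqr_ge0 (2 * nm n - p); have e2 := sqr_ge0 (2 * nm n - 3 / 2 * x).
have e3 := sqr_ge0 (p - 3 / 2 * x); have e4 := sqr_ge0 x.
move: (nm n) x p (nm w ^+ 3) e1 e2 e3 e4 w4 => u v q y *; lra.
Qed.

Lemma core_pt (th m2 m3 r2 q p mm trs c2 : R) : 0 <= th -> th <= 1 -> m2 = 2 * r2 - q ->
 r2 <= 12 * p + 12 * c2 * trs + 9 * m3 -> 12 * c2 * trs <= 12 * c2 * mm -> 0 <= p -> 0 <= c2 * mm ->
 th * m2 <= 24 * p + 24 * c2 * mm + 18 * (th * m3) + (-1) * (th * q).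
Proof.
move=> t0 t1 -> h1 h2 p0 c0'.
have h := ler_wpM2l t0 (le_trans h1 (lerD (lerD (lexx _) h2) (lexx _))).
have k1 : th * p <= p by rewrite ler_piMl.
have k2 : th * (c2 * mm) <= c2 * mm by rewrite ler_piMl.
lra.
Qed.

Section Data.
Variables (chi chi1 chi2 th th1 th2 : pt -> R) (G A K : R).
Hypotheses (Tchi : TF 9 (fun z => (chi z)%:C) (fun z => (chi1 z)%:C) (fun z => (chi2 z)%:C))
 (chi01 : forall z, 0 <= chi z <= 1)
 (chiin : forall z : pt, `|z| <= 8 -> [/\ chi z = 1, chi1 z = 0 & chi2 z = 0])
 (G0 : 0 <= G) (chiG : forall z, `|chi1 z| <= G /\ `|chi2 z| <= G)
 (Tth : TF 2 (fun z => (th z)%:C) (fun z => (th1 z)%:C) (fun z => (th2 z)%:C))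
 (th01 : forall z, 0 <= th z <= 1)
 (thin : forall z : pt, `|z| <= 1 -> [/\ th z = 1, th1 z = 0 & th2 z = 0])
 (thG : forall z, `|th1 z| <= G /\ `|th2 z| <= G)
 (hA : forall e : R, 0 < e <= 1 -> forall b (d : R), cL1 b -> supp 9 b -> 0 < d <= 1 ->
  I2 (fun x => m1 (nm (b x))) <= d ^+ 2 ->
  I2 (fun x => tr (nm (cnv (Se e) b x)) ^+ 2 * \1_(ball 0 7) x) <= A * d ^+ 2).

(** A bound for the sup of [F]: 3 for the Cauchy kernel at scale 1, [2 * G] for the cutoff
    derivatives, the last factor for the mass of [|a| + |b|] on the ball of radius 9. *)
Definition core_B : R := 3 * (2 * G * (3 * (2 * 9) ^+ 2 + 1)).
Definition core_D : R := (core_B + c0) *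
 (2^-1 * ((2 * 7) ^+ 2 + A) + (16 + (2 * 7) ^+ 2) + c0 * (2^-1 * ((2 * 7) ^+ 2 + 1))) + 1.
Hypothesis
 (hK : forall (F F1 F2 : pt -> R[i]) (d : R), C11 F F1 F2 ->
 (forall x : pt, `|x| <= 7 -> F1 x + iC * F2 x = 0) ->
 0 < d <= 1 -> (forall x : pt, `|x| <= 7 -> nm (F x) <= core_B) ->
 I2 (fun x => `|nm (F x) - c0| * \1_(ball 0 7) x) <= core_D * d ->
 exists c : R[i], nm c = 1 /\ forall x : pt, `|x| <= 2 -> nm (F x - c0%:C * c) <= K * d).

Variables (a b : pt -> R[i]) (d : R).
Hypotheses (La : cL1 a) (Lb : cL1 b) (d0 : 0 < d) (d1 : d <= 1) (HL : Lbd 9 a b d)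
 (HI : I2 (fun x => (m1 (nm (b x)) + m1 `|nm (a x) - 1|) * \1_(ball 0 9) x) <= d ^+ 2).

Local Notation k := (kk a b chi1 chi2).
Local Notation ac := (ax a chi).
Local Notation bc := (bx b chi).
Local Notation M := (Mk a b chi chi1 chi2).
(** [kk] lives where the cutoff varies, between radii 8 and 9, so for [|x| <= 7] the kernel is
    evaluated at distances at least 1 only: there it is exactly [1 / z] at every scale up to 1, and
    [F] is holomorphic. *)
Let F := cnv (Ce 1) k.
Let Me e := M (Ce e) (Ce1 e) (Ce2 e).

Let d01 : 0 < d <= 1. Proof. by rewrite d0 d1. Qed.
Let dw : 0 <= d. Proof. exact: ltW. Qed.
Let c1 : 1 <= (c0 : R). Proof. by case/andP: (@c0_bd R). Qed.
Let cc0 : 0 <= (c0 : R). Proof. exact: le_trans c1. Qed.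

Let Lk : cL1 k. Proof. exact: (kk_L1 La Lb Tchi chiG). Qed.
Let Lac : cL1 ac. Proof. exact: (ax_L1 La Tchi chi01). Qed.
Let Lbc : cL1 bc. Proof. exact: (bx_L1 Lb Tchi chi01). Qed.

Lemma chi_out (z : pt) : 9 <= `|z| -> [/\ chi z = 0, chi1 z = 0 & chi2 z = 0].
Proof. by case: Tchi => _ s0 s1 s2 z9; split; apply: (@complexI R); rewrite ?s0 ?s1 ?s2. Qed.

Lemma supp_k : supp 9 k.
Proof. by move=> z z9; have [_ h1 h2] := chi_out z9; rewrite /kk h1 h2 !(mulr0, addr0, subr0). Qed.

Lemma k_in (z : pt) : `|z| <= 8 -> k z = 0.
Proof. by move=> z8; have [_ h1 h2] := chiin z8; rewrite /kk h1 h2 !(mulr0, addr0, subr0). Qed.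

Lemma supp_bc : supp 9 bc.
Proof. by move=> z z9; have [h _ _] := chi_out z9; rewrite /bx h mulr0. Qed.

Let maa : mfun (fun x : pt => `|nm (a x) - 1|).
Proof. by apply: measurableT_comp => //; apply: measurable_funB => //; exact: meas_nm (cL1_meas La). Qed.

Let mab : mfun (fun x : pt => nm (b x)).
Proof. exact: meas_nm (cL1_meas Lb). Qed.

Lemma L1_H : L1 (fun x => (m1 (nm (b x)) + m1 `|nm (a x) - 1|) * \1_(ball 0 9) x).
Proof.
apply: (@L1_dom _ _ (fun x => nm (b x) + (nm (a x) + \1_(ball 0 9) x))).
- apply: measurable_funM; last exact: meas_ball.
 apply: measurable_funD; exact: meas_m1.
- by apply: L1D; [exact: L1_nm|apply: L1D; [exact: L1_nm|exact: L1_ball]].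
- move=> x; have b0 := nm_ge0 (b x); have a0 := nm_ge0 (a x).
 rewrite ger0_norm; last by rewrite mulr_ge0// addr_ge0 ?m1_ge0.
 have [xb|xb] := pselect (ball 0 9 x); last by rewrite (ind_out xb) mulr0 addr0 addr_ge0.
 rewrite (ind_in xb) mulr1 lerD ?m1_le//; apply: (le_trans (m1_le _)).
 by apply: (le_trans (ler_normB _ _)); rewrite normr1 ger0_norm.
Qed.

Lemma Ib : I2 (fun x => m1 (nm (bc x))) <= d ^+ 2.
Proof.
apply: le_trans HI; apply: I2_le0; [by apply: meas_m1; apply: meas_nm; exact: cL1_meas|exact: L1_H|].
move=> x; rewrite m1_ge0 ?nm_ge0//=.
have [xb|xb] := pselect (ball 0 9 x); last first.
 rewrite (ind_out xb) mulr0 supp_bc ?nm0 /m1 ?minxx ?expr0n ?minxx//.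
 exact: nball0.
rewrite (ind_in xb) mulr1 -[leLHS]addr0 lerD ?m1_ge0// m1_mono ?nm_ge0//.
by rewrite /bx nmM nmR; have /andP[h0 h1] := chi01 x; rewrite ger0_norm// ler_piMr ?nm_ge0.
Qed.

Lemma Ia (s : R) : s <= 9 -> I2 (fun x => m1 `|nm (a x) - 1| * \1_(ball 0 s) x) <= d ^+ 2.
Proof.
move=> s9; apply: le_trans HI; apply: I2_le0; [|exact: L1_H|].
 apply: measurable_funM; last exact: meas_ball.
 exact: meas_m1.
move=> x; have h := m1_ge0 (normr_ge0 (nm (a x) - 1)); have h' := m1_ge0 (nm_ge0 (b x)).
have [xb|xb] := pselect (ball 0 s x); last by rewrite (ind_out xb) mulr0 lexx mulr_ge0// addr_ge0.
rewrite (ind_in xb) ind_in ?mulr1 ?h ?lerDr//.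
by apply/ball0E; apply: lt_le_trans s9; exact/ball0E.
Qed.

Lemma core_B_ge0 : 0 <= core_B.
Proof. by rewrite /core_B !mulr_ge0// addr_ge0// mulr_ge0// sqr_ge0. Qed.

Lemma F_bd x : nm (F x) <= core_B.
Proof.
have Cb z : nm (Ce 1 z : R[i]) <= 3 by have [+ _] := Ce_bd z (@ltr01 R); rewrite divr1.
apply: (le_trans (cnv_bd (Ce_meas0 1) Cb Lk x)); rewrite /core_B ler_wpM2l//.
have L9 := L1_ball (0 : pt) 9.
apply: (@le_trans _ _ (I2 (fun x => 2 * G * (3 * \1_(ball 0 9) x + (m1 (nm (b x)) + m1 `|nm (a x) - 1|) * \1_(ball 0 9) x)))).
 apply: I2_le; [exact: L1_nm|by apply: L1Z; apply: L1D; [exact: L1Z|exact: L1_H]|].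
 move=> z; have [zb|zb] := pselect (ball 0 9 z); last first.
  rewrite (ind_out zb) supp_k ?nm0 ?mulr0 ?addr0 ?mulr0//.
  exact: nball0.
 rewrite (ind_in zb) !mulr1; apply: (le_trans (kk_bd a b chiG z)).
 rewrite ler_wpM2l ?mulr_ge0//.
 have h1 := le_1m1 (nm_ge0 (b z)); have h2 := le_1m1 (normr_ge0 (nm (a z) - 1)).
 exact: growth_bd h1 h2.
rewrite I2Z; last by apply: L1D; [exact: L1Z|exact: L1_H].
rewrite ler_wpM2l ?mulr_ge0// I2D; [|exact: L1Z|exact: L1_H].
rewrite I2Z// I2_ball// lerD2l; apply: (le_trans HI).
by rewrite exprn_ile1.
Qed.

Lemma Ce_far (e : R) (x : pt) : 0 < e <= 1 -> `|x| <= 7 -> cnv (Ce e) k x = F x.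
Proof.
move=> /andP[e0 e1] x7; apply: cI_eq => y.
have [y8|y8] := leP `|y| 8; first by rewrite k_in// !mulr0.
have h := far_dist x7 y8.
rewrite (@Ce_same _ e 1)//; exact: le_trans h.
Qed.

Lemma MeE e x : Me e x = cnv (Ce e) k x - cnv (re e) ac x + cnv (Se e) bc x.
Proof.
have E1 : (fun z => Ce1 e z + iC * Ce2 e z) = re e by apply/funext => z; exact: DbarCe.
have E2 : (fun z => Ce1 e z - iC * Ce2 e z) = Se e by apply/funext => z; exact: DCe.
by rewrite /Me /Mk E1 E2.
Qed.

(** The Cauchy-Pompeiu formula for the cut-off field: [Me] is the contribution of the curl, and [F],
    which does not depend on [e], that of the cutoff. *)
Lemma star (e : R) (x : pt) : 0 < e <= 1 -> `|x| <= 7 ->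
 F x = cnv (re e) ac x - cnv (Se e) bc x + Me e x.
Proof. by move=> e01 x7; rewrite MeE Ce_far//; ring. Qed.

Let Ce_dual (e : R) (s : R) psi x : 0 < e -> 0 <= s -> cL1 psi -> bdd psi 1 -> supp s psi ->
 nm (cnv (Ce e) psi x) <= 16 + (2 * s) ^+ 2.
Proof.
move=> e0 s0 Lp p1 sp; apply: (le_trans (cnv_Ce_bd x e0 ltr01 Lp p1)).
rewrite !mulr1 divr1 lerD2l.
have -> : I2 (fun x => nm (psi x)) = I2 (fun x => `|nm (psi x)|).
 by apply: I2_eq => y; rewrite ger0_norm// nm_ge0.
apply: (le_trans (@I2_box_le _ 1 s _ s0 _ _ _)); rewrite ?mul1r//.
- exact: meas_nm (cL1_meas Lp).
- by move=> y; rewrite ger0_norm ?nm_ge0.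
- by move=> y /(supp_ball sp) ->; rewrite nm0.
Qed.

(** Duality with [psi] bounded by 1: splitting the Cauchy kernel at distance 1 bounds its
    convolution with [psi] by [16 + (2 * s) ^+ 2], whatever the scale. *)
Lemma Me_L1 (e s : R) : 0 < e -> 0 <= s ->
 I2 (fun x => nm (Me e x) * \1_(ball 0 s) x) <= d * (16 + (2 * s) ^+ 2).
Proof.
move=> e0 s0.
apply: (@Mk_L1 _ a b chi chi1 chi2 9 d G La Lb Tchi chi01 chiG HL _ _ _ _ _ s (-1) (kern_Ce e0)).
- by move=> x y; rewrite Ce_sym mulN1r.
- by move=> x y; case: (Ce1_sym e x y).
- by move=> x y; case: (Ce1_sym e x y).
- by rewrite nmN nm1.
- move=> psi Lp p1 sp x; exact: Ce_dual.
Qed.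

Lemma Mre_L1 (e s : R) : 0 < e -> 0 <= s ->
 I2 (fun x => nm (M (re e) (re1 e) (re2 e) x) * \1_(ball 0 s) x) <= d * c0.
Proof.
move=> e0 s0.
apply: (@Mk_L1 _ a b chi chi1 chi2 9 d G La Lb Tchi chi01 chiG HL _ _ _ _ _ s 1 (kern_re e0)).
- by move=> x y; rewrite re_sym mul1r.
- by move=> x y; rewrite mulN1r; case: (re1N e x y).
- by move=> x y; rewrite mulN1r; case: (re1N e x y).
- by rewrite nm1.
- move=> psi Lp p1 sp x; exact: cnv_re_bd.
Qed.

(** The difference of the Cauchy kernels has L1 norm at most [32 * d], so replacing the scale [e] by
    [d] costs only order [d^2]. This permits working with the regular function [Me d], which is
    bounded by 3. *)
Lemma Me_diff (e s : R) : 0 < e <= d -> 0 <= s ->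
 I2 (fun x => nm (Me e x - Me d x) * \1_(ball 0 s) x) <= d * (32 * d).
Proof.
move=> /andP[e0 ed] s0; have Hk := kern_sub (kern_Ce e0) (kern_Ce d0).
have := @Mk_L1 _ a b chi chi1 chi2 9 d G La Lb Tchi chi01 chiG HL _ _ _ _ (32 * d) s (-1) Hk.
rewrite (_ : (fun x => nm (Me e x - Me d x) * _) = (fun x => nm (M (fun z => Ce e z - Ce d z)
 (fun z => Ce1 e z - Ce1 d z) (fun z => Ce2 e z - Ce2 d z) x) * \1_(ball 0 s) x)); last first.
 apply/funext => x; congr (nm _ * _).
 rewrite /Me; exact: (Mk_sub x La Lb Tchi chi01 chiG (kern_Ce e0) (kern_Ce d0)).
apply.
- by move=> x y; rewrite !(Ce_sym _ x); ring.
- by move=> x y; rewrite (Ce1_sym e x y).1 (Ce1_sym d x y).1; ring.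
- by move=> x y; rewrite (Ce1_sym e x y).2 (Ce1_sym d x y).2; ring.
- by rewrite nmN nm1.
- move=> psi Lp p1 sp x; have [Lkd Ikd kb] := I2_Ce_diff e0 d0.
 have Lc := cL1_conv_in x (cL1_meas Lkd) kb Lp.
 apply: (le_trans (cI_abs Lc)).
 apply: (@le_trans _ _ (I2 (fun z => nm (Ce e z - Ce d z)))); last first.
  by apply: (le_trans Ikd); rewrite (max_r ed).
 have [Lr Ir] := I2_reflect x (L1_nm Lkd); rewrite -Ir.
 apply: I2_le => //; first exact: L1_nm.
 by move=> y; rewrite nmM ler_piMr ?nm_ge0.
Qed.

(* The kernels [Ce e] with [e] small compare [F] to [c0 * a]: up to the
  mollification error, [F - c0 a] is [M - S * b]. *)
Let mF : cmeas F.
Proof. exact: (cmeas_cnv (Ce_meas0 1) (fun z => (Ce_bd z ltr01).1) Lk). Qed.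

Let mMe (e : R) : 0 < e -> cmeas (Me e).
Proof. by move=> e0; exact: (Mk_cmeas La Lb Tchi chi01 chiG (kern_Ce e0)). Qed.

Let mS (e : R) : 0 < e -> cmeas (cnv (Se e) bc).
Proof. by move=> e0; exact: (cmeas_cnv (Se_meas e) (fun z => Se_bd z e0) Lbc). Qed.

Let mr (e : R) : cmeas (cnv (re e) ac).
Proof. exact: (cmeas_cnv (re_meas e) (re_bd e) Lac). Qed.

Let ac_in (x : pt) : `|x| <= 7 -> ac x = a x.
Proof.
move=> x7; have x8 : `|x| <= 8 by apply: (le_trans x7); rewrite ler_nat.
by have [h _ _] := chiin x8; rewrite /ax h mulr1.
Qed.

Let ac_supp (x : pt) : ~ ball 0 9 x -> ac x = 0.
Proof.
move=> xb; have [h _ _] : [/\ chi x = 0, chi1 x = 0 & chi2 x = 0]; last by rewrite /ax h mulr0.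
apply: chi_out; exact: nball0.
Qed.

Lemma mollify_ac (s eta : R) : 0 < eta -> exists e : R, 0 < e <= d /\
 I2 (fun x => nm (cnv (re e) ac x - c0%:C * ac x) * \1_(ball 0 s) x) <= eta.
Proof.
move=> eta0; have [e0 [e00 h]] := mollify_L1 s (ltr0n R 9) Lac ac_supp eta0.
exists (Num.min e0 d); split; first by rewrite lt_min e00 d0 ge_min lexx orbT.
by apply: h; rewrite lt_min e00 d0 ge_min lexx.
Qed.

Let L1cm f (s B : R) : cmeas f -> (forall x : pt, `|x| < s -> nm (f x) <= B) -> L1 (fun x => nm (f x) * \1_(ball 0 s) x).
Proof.
move=> mf fB; apply: (@L1_ind_bd _ _ _ B s) => //; [exact: meas_nm|exact: mball2|].
by move=> z /ball0E zs; rewrite ger0_norm ?nm_ge0// fB.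
Qed.

Let Me_bd (e : R) x : 0 < e -> nm (Me e x) <= d * (3 / e).
Proof.
by move=> e0; apply: (Mk_bd La Lb Tchi chi01 chiG HL x (kern_Ce e0)) => z; case: (Ce_bd z e0).
Qed.

Let L1Me (e s : R) : 0 < e -> L1 (fun x => nm (Me e x) * \1_(ball 0 s) x).
Proof. by move=> e0; apply: (L1cm (mMe e0)) => x _; exact: Me_bd. Qed.

Let L1rho (e s : R) : L1 (fun x => nm (cnv (re e) ac x - c0%:C * ac x) * \1_(ball 0 s) x).
Proof.
have Lc : cL1 (fun x => c0%:C * ac x) by exact: cL1Z.
have Lr : L1 (fun x => nm (cnv (re e) ac x) * \1_(ball 0 s) x).
 apply: (L1cm (mr e)) => x _; exact: (cnv_bd (re_meas e) (re_bd e) Lac).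
apply: (@L1_dom _ _ (fun x => nm (cnv (re e) ac x) * \1_(ball 0 s) x + nm (c0%:C * ac x))).
- apply: measurable_funM; last exact: meas_ball.
 apply: meas_nm; apply: cmeasB => //; exact: cL1_meas.
- apply: L1D => //; exact: L1_nm.
- move=> x; have /andP[i0 i1] := ind_itv (ball 0 s) x.
 rewrite ger0_norm ?mulr_ge0 ?nm_ge0//; apply: (le_trans (ler_wpM2r i0 (nmB _ _))).
 by rewrite mulrDl lerD2l ler_piMr ?nm_ge0.
Qed.

(** The squared terms are of order [d^2]; [tr_half] with weight [d] turns them into L1 bounds of
    order [d], which is what the rigidity statement asks for. Since [F] is bounded, removing the
    truncation costs only the factor [B]. *)
Lemma F_near : I2 (fun x => `|nm (F x) - c0| * \1_(ball 0 7) x) <= core_D * d.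
Proof.
have B0 := core_B_ge0; pose B := core_B + c0.
have B1 : 1 <= B by rewrite /B; apply: (le_trans c1); rewrite lerDr.
have Bp : 0 < B by exact: lt_le_trans B1.
have dB : 0 < d / B by rewrite divr_gt0.
have [e [/andP[e0 ed] he]] := mollify_ac 7 dB.
have e01 : 0 < e <= 1 by rewrite e0 (le_trans ed d1).
have hS := hA e01 Lbc supp_bc d01 Ib.
have hM := Me_L1 e0 (ler0n R 7).
have s79 : 7 <= 9 :> R by rewrite ler_nat.
have ha := Ia s79.
have mX : mfun (fun x : pt => `|nm (F x) - c0| * \1_(ball 0 7) x).
 apply: measurable_funM; last exact: meas_ball.
 apply: measurableT_comp => //; apply: measurable_funB => //; exact: meas_nm.
have La7 : L1 (fun x => m1 `|nm (a x) - 1| * \1_(ball 0 7) x).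
 apply: (@L1_dom _ _ _ _ L1_H).
  by apply: measurable_funM; [exact: meas_m1|exact: meas_ball].
 move=> x; have h := m1_ge0 (normr_ge0 (nm (a x) - 1)); have h' := m1_ge0 (nm_ge0 (b x)).
 have [xb|xb] := pselect (ball 0 7 x); last by rewrite (ind_out xb) mulr0 normr0 mulr_ge0 ?addr_ge0//; case/andP: (ind_itv (ball 0 9) x).
 have xb9 : ball 0 9 x by apply/ball0E; apply: (lt_trans ((ball0E 7 x).1 xb)); rewrite ltr_nat.
 by rewrite (ind_in xb) (ind_in xb9) !mulr1 (ger0_norm h) lerDr.
have := @I2_le5 B (B / (2 * d)) B (B * c0 / (2 * d)) (B * (d / 2) * (1 + c0)) _ _ _ _ _ _ mX _
 (L1rho e 7) (L1_trsq 7 (mS e0)) (L1Me 7 e0) La7 (L1_ball 0 7).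
move=> H; apply: (le_trans (H _ _)).
- by move=> x; rewrite mulr_ge0.
- move=> x; have [xb|xb] := pselect (ball 0 7 x); last by rewrite (ind_out xb) !mulr0 !addr0.
 have x7 : `|x| <= 7 by apply: ltW; exact/ball0E.
 rewrite (ind_in xb) !mulr1.
 have h1 := near_cplx (a x) c1 (star e01 x7).
 have h2 : `|nm (F x) - c0| <= B.
  by apply: (le_trans (ler_normB _ _)); rewrite !ger0_norm ?nm_ge0// lerD2r F_bd.
 have h3 := le_tr_scale B1 (normr_ge0 _) h2.
 have h4 := tr_half d0 (nm_ge0 (cnv (Se e) bc x)).
 have h5 := tr_half d0 (normr_ge0 (nm (a x) - 1)).
 have h6 := tr_sq_m1 (normr_ge0 (nm (a x) - 1)).
 rewrite ac_in//; apply: (le_trans h3).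
 rewrite (_ : _ + _ = B * (nm (cnv (re e) ac x - c0%:C * a x) + 2^-1 * (d + tr (nm (cnv (Se e) bc x)) ^+ 2 / d)
   + nm (Me e x) + c0 * (2^-1 * (d + m1 `|nm (a x) - 1| / d)))); last by field; rewrite gt_eqF.
 rewrite ler_wpM2l ?(ltW Bp)//; apply: (le_trans h1); apply: lerD.
  by rewrite lerD2r lerD2l.
 rewrite ler_wpM2l//; apply: (le_trans h5); rewrite ler_wpM2l ?invr_ge0// lerD2l.
 by rewrite ler_wpM2r// invr_ge0.
rewrite I2_ball// /core_D -/B.
have g1 := ler_wpM2l (ltW Bp) he; rewrite mulrCA divff ?mulr1 ?gt_eqF// in g1.
have q1 : 0 <= B / (2 * d) by rewrite divr_ge0 ?(ltW Bp)// mulr_ge0.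
have g2 := ler_wpM2l q1 hS.
have g3 := ler_wpM2l (ltW Bp) hM.
have q4 : 0 <= B * c0 / (2 * d) by rewrite divr_ge0 ?mulr_ge0// ltW.
have g4 := ler_wpM2l q4 ha.
have e2 : B / (2 * d) * (A * d ^+ 2) = B * 2^-1 * A * d by field; rewrite gt_eqF.
have e4 : B * c0 / (2 * d) * d ^+ 2 = B * c0 * 2^-1 * d by field; rewrite gt_eqF.
rewrite e2 in g2; rewrite e4 in g4.
apply: (le_trans (lerD (lerD (lerD (lerD g1 g2) g3) g4) (lexx _))).
by apply: eq_ler; field.
Qed.

Let F1 := cnv (Ce1 1) k.
Let F2 := cnv (Ce2 1) k.

Let Cconv (kp kp1 kp2 : pt -> R[i]) (m : R) g : kern kp kp1 kp2 m -> cL1 g -> supp 9 g ->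
 C11 (cnv kp g) (cnv kp1 g) (cnv kp2 g).
Proof.
move=> [Ck kM] Lg sg; have h0 z : nm (kp z) <= m by case: (kM z).
have h1 z : nm (kp1 z) <= m by case: (kM z).
have h2 z : nm (kp2 z) <= m by case: (kM z).
exact: (C11_cnv Ck h0 h1 h2 Lg sg).
Qed.

Let C11_F : C11 F F1 F2.
Proof. exact: (Cconv (kern_Ce ltr01) Lk supp_k). Qed.

Let hol_F (x : pt) : `|x| <= 7 -> F1 x + iC * F2 x = 0.
Proof.
move=> x7; have [_ m1' m2'] := Ce_meas (R := R) 1.
have b1 z := (Ce_grad_bd z (@ltr01 R)).1; have b2 z := (Ce_grad_bd z (@ltr01 R)).2.
rewrite /F1 /F2 (cnv_add x m1' b1 m2' b2 Lk).1 -(@cI0 R); apply: cI_eq => y.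
rewrite DbarCe; have [y8|y8] := leP `|y| 8; first by rewrite k_in// mulr0.
by have [-> _ _] := re_out ltr01 (far_dist x7 y8); rewrite mul0r.
Qed.

Definition core_N : R := 4 * (1 + A + 32 + K ^+ 2 * (2 * 2) ^+ 2).

(** For the [c] of the rigidity statement, [c0 (a - c) + Me d] consists of the mollification error,
    the Beurling term, a change of scale and [F - c0 c], each contributing order [d^2]. It remains
    to bound [Me d] itself. *)
Lemma N_small : exists c : R[i], nm c = 1 /\
 I2 (fun x => tr (nm (c0%:C * (a x - c) + Me d x)) ^+ 2 * \1_(ball 0 2) x) <= core_N * d ^+ 2.
Proof.
have [c [cc1 hc]] := hK C11_F hol_F d01 (fun x _ => F_bd x) F_near; exists c; split => //.
have d20 : 0 < d ^+ 2 by rewrite exprn_gt0.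
have [e [ed he]] := mollify_ac 2 d20; have /andP[e0 ed'] := ed.
have e01 : 0 < e <= 1 by rewrite e0 (le_trans ed' d1).
have hS := hA e01 Lbc supp_bc d01 Ib.
have hM := Me_diff ed (ler0n R 2).
have mdif : cmeas (fun x => Me e x - Me d x) by apply: cmeasB; exact: mMe.
have LD : L1 (fun x => nm (Me e x - Me d x) * \1_(ball 0 2) x).
 apply: (L1cm (B := d * (3 / e) + d * (3 / d)) mdif) => x _; apply: (le_trans (nmB _ _)); apply: lerD; exact: Me_bd.
have mN : cmeas (fun x => c0%:C * (a x - c) + Me d x).
 apply: cmeasD; last exact: mMe.
 by apply: cmeasM; [exact: cmeas_cst|apply: cmeasB; [exact: cL1_meas|exact: cmeas_cst]].
have mX : mfun (fun x : pt => tr (nm (c0%:C * (a x - c) + Me d x)) ^+ 2 * \1_(ball 0 2) x).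
 apply: measurable_funM; last exact: meas_ball.
 apply: measurable_funX; apply: meas_tr; exact: meas_nm.
have H := @I2_le5 4 4 4 (4 * (K ^+ 2 * d ^+ 2)) 0 _ _ _ _ _ _ mX _
 (L1rho e 2) (L1_trsq 2 (mS e0)) LD (L1_ball 0 2) L1_0; apply: (le_trans (H _ _)).
- by move=> x; rewrite mulr_ge0 ?sqr_ge0.
- move=> x; have [xb|xb] := pselect (ball 0 2 x); last by rewrite (ind_out xb) !mulr0 !addr0.
 have x2 : `|x| <= 2 by apply: ltW; exact/ball0E.
 have x7 : `|x| <= 7 by apply: (le_trans x2); rewrite ler_nat.
 rewrite (ind_in xb) !mulr1 mulr0 addr0 ac_in//.
 have E : c0%:C * (a x - c) + Me d x = - (cnv (re e) ac x - c0%:C * a x) + cnv (Se e) bc x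
   + - (Me e x - Me d x) + (F x - c0%:C * c) by apply: N_split; exact: (star e01 x7).
 rewrite E; apply: (le_trans (tr_sq4 _ _ _ _)); rewrite !nmN lerD2l ler_wpM2l// -exprMn.
 have hcx := hc x x2; rewrite ler_pXn2r ?nnegrE ?nm_ge0//; exact: le_trans (nm_ge0 _) hcx.
have hS' : I2 (fun x => tr (nm (cnv (Se e) bc x)) ^+ 2 * \1_(ball 0 2) x) <= A * d ^+ 2.
 apply: le_trans hS; apply: I2_le; [exact: L1_trsq (mS e0)|exact: L1_trsq (mS e0)|].
 move=> x; rewrite ler_wpM2l ?sqr_ge0//.
 have [xb|xb] := pselect (ball 0 2 x); last by rewrite (ind_out xb); case/andP: (ind_itv (ball 0 7) x).
 rewrite (ind_in xb) ind_in//; apply/ball0E; apply: (lt_trans ((ball0E 2 x).1 xb)); by rewrite ltr_nat.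
rewrite I2_ball// mul0r addr0.
have g1 := ler_wpM2l (ler0n R 4) he; have g2 := ler_wpM2l (ler0n R 4) hS'.
have g3 := ler_wpM2l (ler0n R 4) hM.
apply: (le_trans (lerD (lerD (lerD g1 g2) g3) (lexx _))).
by apply: eq_ler; rewrite /core_N; ring.
Qed.

Let M1 x := cnv (Ce1 d) k x - cnv (re1 d) ac x + cnv (Se1 d) bc x.
Let M2 x := cnv (Ce2 d) k x - cnv (re2 d) ac x + cnv (Se2 d) bc x.

Let kern_Se : kern (Se d : pt -> R[i]) (Se1 d) (Se2 d) (6 / d ^+ 2 + 30 / d ^+ 3).
Proof.
split; first exact: C11_Se.
have q0 : 0 <= 30 / d ^+ 3 by rewrite divr_ge0// exprn_ge0.
have p0 : 0 <= 6 / d ^+ 2 by rewrite divr_ge0// sqr_ge0.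
move=> z; have [s1 s2 _ _] := Se_grad_bd z d0; split.
- by apply: (le_trans (Se_bd z d0)); rewrite lerDl.
- by apply: (le_trans s1); rewrite lerDr.
- by apply: (le_trans s2); rewrite lerDr.
Qed.

Let supp_ac : supp 9 ac.
Proof. by move=> z z9; have [h _ _] := chi_out z9; rewrite /ax h mulr0. Qed.

Let C11_Md : C11 (Me d) M1 M2.
Proof.
have H := C11_D (C11_D (Cconv (kern_Ce d0) Lk supp_k) (C11_Z (-1) (Cconv (kern_re d0) Lac supp_ac)))
 (Cconv kern_Se Lbc supp_bc).
by apply: C11_eq H => x; rewrite ?MeE mulN1r.
Qed.

(** Dbar commutes with the construction: by [DbarCe] and [DbarSe], the kernel triple of [Ce d]
    becomes that of [re d]. *)
Let Dbar_Md x : M1 x + iC * M2 x = M (re d) (re1 d) (re2 d) x.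
Proof.
have km (kp kp1 kp2 : pt -> R[i]) (m : R) : kern kp kp1 kp2 m ->
  [/\ cmeas kp1, cmeas kp2, forall z, nm (kp1 z) <= m & forall z, nm (kp2 z) <= m].
 by move=> [/C11_cmeas[_ u v] w]; split => // z; case: (w z).
have [u1 u2 u3 u4] := km _ _ _ _ (kern_Ce d0); have [v1 v2 v3 v4] := km _ _ _ _ (kern_re d0).
have [w1 w2 w3 w4] := km _ _ _ _ kern_Se.
have EC : (fun z => Ce1 d z + iC * Ce2 d z) = re d by apply/funext => z; exact: DbarCe.
have ES : (fun z => Se1 d z + iC * Se2 d z) = (fun z => re1 d z - iC * re2 d z) by apply/funext => z; exact: DbarSe.
have e1 := (cnv_add x u1 u3 u2 u4 Lk).1; have e2 := (cnv_add x v1 v3 v2 v4 Lac).1.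
have e3 := (cnv_add x w1 w3 w2 w4 Lbc).1; rewrite EC in e1; rewrite ES in e3.
exact: (Dbar_split e1 e2 e3).
Qed.

Let t z : R[i] := (th z)%:C.

Let sgC : [/\ forall x y : pt, Ce d (x - y) = -1 * Ce d (y - x) :> R[i],
 forall x y : pt, Ce1 d (x - y) = - -1 * Ce1 d (y - x) :> R[i] &
 forall x y : pt, Ce2 d (x - y) = - -1 * Ce2 d (y - x) :> R[i]].
Proof.
split=> x y; first by rewrite Ce_sym mulN1r.
 by case: (Ce1_sym d x y).
by case: (Ce1_sym d x y).
Qed.

Let dualM psi (B : R) : cL1 psi -> supp 2 psi -> (forall x, nm (cnv (Ce d) psi x) <= B) ->
 nm (cI (fun x => Me d x * psi x)) <= d * B.
Proof.
move=> Lp sp hB; have [s1 s2 s3] := sgC.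
have sg1 : nm (-1 : R[i]) <= 1 by rewrite nmN nm1.
exact: (Mk_dual La Lb Tchi chi01 chiG HL (kern_Ce d0) s1 s2 s3 sg1 Lp sp hB).
Qed.

Definition core_Q : R := 2 * G * (16 + (2 * 2) ^+ 2) + c0.

(** Pairing [Me d] with [th * Me d] tests [Lf] at [chi] times a Cauchy transform. By [cnv_by_parts]
    the sup of the latter is at most the L1 norm of Dbar of [th * Me d], of order [d] because Dbar
    of [Me d] is the same functional for the kernel [re d]; [Lf] supplies the second factor [d]. *)
Lemma square_small : nm (cI (fun x => t x * (Me d x) ^+ 2)) <= core_Q * d ^+ 2.
Proof.
have TM := TF_M Tth C11_Md; have [Lp Lp1 Lp2] := TF_cL1 TM.
have sp : supp 2 (fun z => t z * Me d z) by case: TM.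
pose psi1 z : R[i] := (th1 z)%:C * Me d z + t z * M1 z.
pose psi2 z : R[i] := (th2 z)%:C * Me d z + t z * M2 z.
have {}Lp1 : cL1 psi1 by exact: Lp1.
have {}Lp2 : cL1 psi2 by exact: Lp2.
have LD : cL1 (fun z => psi1 z + iC * psi2 z) by apply: cL1D => //; exact: cL1Z.
have L2M := L1Me 2 d0.
have mre : cmeas (M (re d) (re1 d) (re2 d)) := Mk_cmeas La Lb Tchi chi01 chiG (kern_re d0).
have L2r : L1 (fun x => nm (M (re d) (re1 d) (re2 d) x) * \1_(ball 0 2) x).
 apply: (L1cm mre) => x _; exact: (Mk_bd La Lb Tchi chi01 chiG HL x (kern_re d0) (re_bd d)).
have ID : I2 (fun z => nm (psi1 z + iC * psi2 z)) <= core_Q * d.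
 apply: (@le_trans _ _ (I2 (fun x => 2 * G * (nm (Me d x) * \1_(ball 0 2) x) + nm (M (re d) (re1 d) (re2 d) x) * \1_(ball 0 2) x))).
  apply: I2_le; [exact: (L1_nm LD)|exact: (L1D (L1Z _ L2M) L2r)|].
  move=> z; have E : psi1 z + iC * psi2 z = ((th1 z)%:C + iC * (th2 z)%:C) * Me d z + t z * M (re d) (re1 d) (re2 d) z.
   exact: (Dbar_prod _ _ _ _ (Dbar_Md z)).
  have [zb|zb] := pselect (ball 0 2 z); last first.
   have z2 : 2 <= `|z| by exact: nball0.
   by rewrite (ind_out zb) !mulr0 addr0 E /t; case: Tth => _ -> // -> // -> //; rewrite !(mul0r, mulr0, addr0) nm0.
  rewrite (ind_in zb) !mulr1 E; apply: le_nmD.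
   by rewrite nmM ler_wpM2r ?nm_ge0//; case: (chi_grad thG z).
  by rewrite nmM nmR ger0_norm ?ler_piMl ?nm_ge0//; case/andP: (th01 z).
 rewrite (I2D (L1Z _ L2M) L2r) (I2Z _ L2M); have h1 := Me_L1 d0 (ler0n R 2); have h2 := Mre_L1 d0 (ler0n R 2).
 have h3 := ler_wpM2l (mulr_ge0 (ler0n R 2) G0) h1.
 by apply: (le_trans (lerD h3 h2)); rewrite /core_Q; apply: eq_ler; ring.
have := dualM Lp sp (B := core_Q * d); rewrite (_ : (fun x => Me d x * _) = (fun x => t x * Me d x ^+ 2)); last first.
 by apply/funext => x; ring.
move=> H; apply: (le_trans (H _)); last by apply: eq_ler; ring.
move=> x; rewrite (cnv_by_parts x d0 (ler0n R 2) TM).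
by apply: (le_trans (cnv_bd (Ke_meas d) (Ke_bd d) LD x)); rewrite mul1r.
Qed.

Let Z := I2 (fun x => th x * nm (Me d x) ^+ 2).

Let Me3 x : nm (Me d x) <= 3.
Proof. by apply: (le_trans (Me_bd x d0)); rewrite mulrCA divff ?mulr1// gt_eqF. Qed.

Let mth : mfun th.
Proof. by case: Tth => /C11_cmeas[[h _] _ _]. Qed.

Let th_out (x : pt) : ~ ball 0 2 x -> th x = 0.
Proof.
move=> xb; have x2 : 2 <= `|x| by exact: nball0.
case: Tth => _ h _ _; apply: (@complexI R); exact: h.
Qed.

Let Lth (n : nat) : L1 (fun x => th x * nm (Me d x) ^+ n).
Proof.
apply: (@L1_box _ (3 ^+ n) 2).
- apply: measurable_funM => //; apply: measurable_funX; apply: meas_nm; exact: mMe.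
- move=> x; have /andP[h0 h1] := th01 x; rewrite normrM (ger0_norm h0) ger0_norm ?exprn_ge0 ?nm_ge0//.
 rewrite -[leRHS]mul1r; apply: ler_pM => //; first by rewrite exprn_ge0// nm_ge0.
 by case: n => [|n]; rewrite ?expr0// ler_pXn2r ?nnegrE ?nm_ge0.
- by move=> x xb; rewrite th_out// mul0r.
Qed.

(** Duality with [psi = th |M| conj M], bounded by 9 and of mass [Z]; the Cauchy kernel is split at
    distance [s], a parameter left free for the absorption. *)
Lemma cubic_small (s : R) : 0 < s -> I2 (fun x => th x * nm (Me d x) ^+ 3) <= d * (16 * 9 * s + Z / s).
Proof.
move=> s0; pose psi x := (th x * nm (Me d x))%:C * cj (Me d x).
have mM := mMe d0.
have apsi x : nm (psi x) = th x * nm (Me d x) ^+ 2.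
 have /andP[h0 h1] := th01 x.
 by rewrite /psi nm_pR ?mulr_ge0 ?nm_ge0// nmcj -mulrA expr2.
have pb x : nm (psi x) <= 9.
 have /andP[h0 h1] := th01 x; rewrite apsi -[leRHS]mul1r.
 apply: ler_pM => //; first by rewrite sqr_ge0.
 rewrite (_ : 9 = 3 ^+ 2); last by rewrite -natrX.
 by rewrite ler_pXn2r ?nnegrE ?nm_ge0.
have pout x : ~ ball 0 2 x -> psi x = 0 by move=> xb; rewrite /psi th_out// mul0r rmorph0 mul0r.
have mpsi : cmeas psi.
 apply: cmeasM; last exact: cmeas_cj.
 apply: cmeasR; apply: measurable_funM => //; exact: meas_nm.
have Lp : cL1 psi by exact: cL1_box mpsi pb pout.
have sp : supp 2 psi by move=> x x2; apply: pout => /ball0E; rewrite ltNge x2.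
have := dualM Lp sp (B := 16 * 9 * s + Z / s).
rewrite (_ : (fun x => Me d x * psi x) = (fun x => (th x * nm (Me d x) ^+ 3)%:C)); last first.
 apply/funext => x; rewrite /psi mulrCA mulrC [Me d x * _]mulrC mulcjE -rmorphM; congr (_%:C); ring.
rewrite cIR nmR => H; apply: (le_trans (ler_norm _)); apply: H => x.
apply: (le_trans (cnv_Ce_bd x d0 s0 Lp pb)); rewrite lerD2l ler_wpM2r ?invr_ge0 ?(ltW s0)//.
by apply: eq_ler; apply: I2_eq => y; rewrite apsi.
Qed.

Definition core_Z : R := 24 * core_N + 24 * c0 ^+ 2 + core_Q + 18 * (16 * 9 * 36).

Lemma core_rigidity : exists c : R[i], nm c = 1 /\
 I2 (fun x => tr (nm (a x - c)) ^+ 2 * \1_(ball 0 1) x) <= (2 * core_N + 8 * core_Z) * d ^+ 2.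
Proof.
have [c [cc1 hN]] := N_small; exists c; split => //.
pose N x := c0%:C * (a x - c) + Me d x.
have mN : cmeas N.
 apply: cmeasD; last exact: mMe.
 by apply: cmeasM; [exact: cmeas_cst|apply: cmeasB; [exact: cL1_meas|exact: cmeas_cst]].
have LN2 := L1_trsq 2 mN.
have La2 : L1 (fun x => m1 `|nm (a x) - 1| * \1_(ball 0 2) x).
 apply: (@L1_dom _ _ _ _ L1_H).
  by apply: measurable_funM; [exact: meas_m1|exact: meas_ball].
 move=> x; have h := m1_ge0 (normr_ge0 (nm (a x) - 1)); have h' := m1_ge0 (nm_ge0 (b x)).
 have [xb|xb] := pselect (ball 0 2 x); last by rewrite (ind_out xb) mulr0 normr0 mulr_ge0 ?addr_ge0//; case/andP: (ind_itv (ball 0 9) x).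
 have xb9 : ball 0 9 x by apply/ball0E; apply: (lt_trans ((ball0E 2 x).1 xb)); rewrite ltr_nat.
 by rewrite (ind_in xb) (ind_in xb9) !mulr1 (ger0_norm h) lerDr.
have s29 : 2 <= 9 :> R by rewrite ler_nat.
have ha := Ia s29; have h3 := cubic_small (_ : 0 < 36 * d).
have cj1 z : nm (cj c * z) = nm z by rewrite nmM nmcj cc1 mul1r.
have Lsq : cL1 (fun x => t x * Me d x ^+ 2).
 apply: (@cL1_dom _ _ (fun x => th x * nm (Me d x) ^+ 2)) => //.
  by apply: cmeasM; [exact: cmeasR|rewrite (_ : (fun x => _) = (fun x => Me d x * Me d x))//; apply: cmeasM; exact: mMe].
 by move=> x; rewrite /t expr2 !nmM nmR ger0_norm ?expr2//; case/andP: (th01 x).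
have LRe : L1 (fun x => Re (cj c ^+ 2 * (t x * Me d x ^+ 2))) by case: (cL1Z (cj c ^+ 2) Lsq).
(* The constant [(conj c)^2] leaves the integral, so the bound for the square without modulus
   applies. *)
have hRe : - I2 (fun x => Re (cj c ^+ 2 * (t x * Me d x ^+ 2))) <= core_Q * d ^+ 2.
 rewrite -[X in - X]/(Re (cI (fun x => cj c ^+ 2 * (t x * Me d x ^+ 2)))) cIZ//.
 apply: (le_trans (ler_norm _)); rewrite normrN; apply: (le_trans (nm_Re _)).
 rewrite expr2 -mulrA !cj1; exact: square_small.
have key x : th x * nm (Me d x) ^+ 2 <= 24 * (tr (nm (N x)) ^+ 2 * \1_(ball 0 2) x)
  + 24 * c0 ^+ 2 * (m1 `|nm (a x) - 1| * \1_(ball 0 2) x) + 18 * (th x * nm (Me d x) ^+ 3)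
  + (-1) * Re (cj c ^+ 2 * (t x * Me d x ^+ 2)) + 0 * 0.
 rewrite mul0r addr0.
 have [xb|xb] := pselect (ball 0 2 x); last by rewrite /t (ind_out xb) (th_out xb) rmorph0 !(mul0r, mulr0, addr0).
 rewrite (ind_in xb) !mulr1; have /andP[t0 t1] := th01 x.
 (* Multiplication by conj c moves the reference constant to 1, the form that [Re_sq_bound] takes,
    with [n = conj c N] and [w = conj c M]. *)
 have E : c0%:C * (cj c * a x) = c0%:C + cj c * N x - cj c * Me d x.
  have cjc : cj c * c = 1 by rewrite mulcjE cc1 expr1n.
  transitivity (c0%:C * (cj c * a x) + c0%:C * (1 - cj c * c)); first by rewrite cjc subrr mulr0 addr0.
  by rewrite /N; ring.
 have w3 : nm (cj c * Me d x) <= 3 by rewrite cj1.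
 have := Re_sq_bound c1 E w3; rewrite !cj1.
 have m1t := tr_sq_m1 (normr_ge0 (nm (a x) - 1)).
 have m1t' : 12 * c0 ^+ 2 * tr `|nm (a x) - 1| ^+ 2 <= 12 * c0 ^+ 2 * m1 `|nm (a x) - 1|.
  by rewrite ler_wpM2l// mulr_ge0// sqr_ge0.
 have sqE : nm (Me d x) ^+ 2 = 2 * Re (cj c * Me d x) ^+ 2 - Re (cj c ^+ 2 * Me d x ^+ 2).
  rewrite -(cj1 (Me d x)) -exprMn; exact: sqr_nm_Re.
 have tE : Re (cj c ^+ 2 * (t x * Me d x ^+ 2)) = th x * Re (cj c ^+ 2 * Me d x ^+ 2).
  by rewrite mulrCA /t; move: (cj c ^+ 2 * _) => w; rewrite !reim; ring.
 rewrite tE => h; have q0 : 0 <= m1 `|nm (a x) - 1| by exact: m1_ge0.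
 have p0 := sqr_ge0 (tr (nm (N x))).
 have cq0 : 0 <= c0 ^+ 2 * m1 `|nm (a x) - 1| by rewrite mulr_ge0// sqr_ge0.
 exact: core_pt t0 t1 sqE h m1t' p0 cq0.
have mX2 : mfun (fun x : pt => th x * nm (Me d x) ^+ 2) by exact: (L1_meas (Lth 2)).
have Z0 x : 0 <= th x * nm (Me d x) ^+ 2 by rewrite mulr_ge0 ?sqr_ge0//; case/andP: (th01 x).
have Zle := I2_le5 mX2 Z0 LN2 La2 (Lth 3) LRe L1_0 key.
have Z2 : Z <= 2 * core_Z * d ^+ 2.
 have d36 : 0 < 36 * d by rewrite mulr_gt0.
 exact: (absorb d0 Zle hN ha (sqr_ge0 _) (h3 d36) hRe).
have LZ := Lth 2.
have H := @I2_le5 2 4 0 0 0 _ _ _ _ _ _ _ _ LN2 LZ L1_0 L1_0 L1_0.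
apply: (le_trans (H _ _ _ _)).
- apply: measurable_funM; last exact: meas_ball.
 apply: measurable_funX; apply: meas_tr; apply: meas_nm; apply: cmeasB; [exact: cL1_meas|exact: cmeas_cst].
- by move=> x; rewrite mulr_ge0 ?sqr_ge0.
- move=> x; rewrite !mul0r !addr0.
 have [xb|xb] := pselect (ball 0 1 x); last first.
  rewrite (ind_out xb) mulr0 addr_ge0// mulr_ge0// mulr_ge0 ?sqr_ge0//.
 have x1 : `|x| <= 1 by apply: ltW; exact/ball0E.
 have xb2 : ball 0 2 x by apply/ball0E; apply: (le_lt_trans x1); exact: ltr1n.
 rewrite (ind_in xb) (ind_in xb2) !mulr1; have [-> _ _] := thin x1; rewrite mul1r.
 exact: (tr_unshift (a x) c (Me d x) c1).
rewrite !mul0r !addr0; have h := ler_wpM2l (ler0n R 2) hN; have h' := ler_wpM2l (ler0n R 4) Z2.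
apply: (le_trans (lerD h h')).
by apply: eq_ler; ring.
Qed.
End Data.

Lemma interior_core : exists C : R, 0 <= C /\ forall (a b : pt -> R[i]) (d : R),
 cL1 a -> cL1 b -> 0 < d -> d <= 1 -> Lbd 9 a b d ->
 I2 (fun x => (m1 (nm (b x)) + m1 `|nm (a x) - 1|) * \1_(ball 0 9) x) <= d ^+ 2 ->
 exists c : R[i], nm c = 1 /\ I2 (fun x => tr (nm (a x - c)) ^+ 2 * \1_(ball 0 1) x) <= C * d ^+ 2.
Proof.
have [chi [chi1 [chi2 [Tchi chi01 chiin [G [G0 chiG]]]]]] := @cutoff_exists R 8 (ler0n R 8).
have [th [th1 [th2 [Tth th01 thin [G' [G'0 thG]]]]]] := @cutoff_exists R 1 ler01.
rewrite (_ : 8 + 1 = 9 :> R) in Tchi; last by ring.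
rewrite (_ : 1 + 1 = 2 :> R) in Tth; last by ring.
pose Gm := Num.max G G'.
have Gm0 : 0 <= Gm by rewrite /Gm le_max G0.
have chiGm z : `|chi1 z| <= Gm /\ `|chi2 z| <= Gm by have [u v] := chiG z; rewrite /Gm !le_max u v.
have thGm z : `|th1 z| <= Gm /\ `|th2 z| <= Gm by have [u v] := thG z; rewrite /Gm !le_max u v !orbT.
have [A [A0 hA]] := @Se_weak R 7 9 (ltr0n R 7) (ler1n R 9).
have D0 : 0 < core_D Gm A.
 have c00 : 0 <= c0 :> R by have /andP[h _] := @c0_bd R; exact: le_trans ler01 h.
 have s7 : 0 <= (2 * 7 : R) ^+ 2 by exact: sqr_ge0.
 have B0 := core_B_ge0 Gm0.
 rewrite /core_D; apply: ltr_wpDl => //; apply: mulr_ge0; first exact: addr_ge0.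
 apply: addr_ge0; first apply: addr_ge0.
 - by apply: mulr_ge0; [rewrite invr_ge0|exact: addr_ge0].
 - exact: addr_ge0.
 - by apply: mulr_ge0 => //; apply: mulr_ge0; rewrite ?invr_ge0// addr_ge0.
have [K [K0 hK]] := holomorphic_rigidity (core_B_ge0 Gm0) D0.
(* The absolute value makes the constant visibly nonnegative. *)
exists `|2 * core_N A K + 8 * core_Z Gm A K|; split=> // a b d La Lb d0 d1 HL HI.
have [c [cc hc]] := core_rigidity Tchi chi01 chiin Gm0 chiGm Tth th01 thin thGm hA hK La Lb d0 d1 HL HI.
by exists c; split => //; apply: (le_trans hc); rewrite ler_wpM2r ?sqr_ge0 ?ler_norm.
Qed.
End IntCore.

(** * Smooth test functions *)

Section Bump.
Context {R : realType}.
Local Notation pt := (R * R)%type.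

(** The powers of [t^-1] make the family stable under differentiation: the derivative of [ee j] is
    [ee' j], a combination of other members. All of them are bounded and flat at [0]. *)
Definition ee (j : nat) (t : R) : R := if 0 < t then t^-1 ^+ j * expR (- t^-1) else 0.
Definition ee' (j : nat) (t : R) : R := ee j.+2 t - j%:R * ee j.+1 t.

Lemma ee_bd j t : 0 <= ee j t <= j`!%:R.
Proof.
rewrite /ee; case: ltP => t0; last by rewrite lexx ler0n.
have s0 : 0 <= t^-1 by rewrite invr_ge0 ltW.
rewrite mulr_ge0 ?expR_ge0 ?exprn_ge0//= expRN ler_pdivrMr ?expR_gt0//.
case: j => [|j]; first by rewrite expr0 fact0 mul1r -expR0 ler_expR.
have := expR_ge1Dxn j s0; rewrite -ler_pdivrMl ?ltr0n ?fact_gt0// mulrC => h.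
by apply: le_trans h; rewrite lerDr.
Qed.

Lemma ee_out j t : t <= 0 -> ee j t = 0.
Proof. by rewrite /ee; case: ltP. Qed.

Lemma ee_shift n j t : 0 <= t -> ee j t <= (j + n)`!%:R * t ^+ n.
Proof.
move=> t0; have [t1|t1] := ltP 0 t; last by rewrite ee_out// mulr_ge0// exprn_ge0.
have /andP[_ h] := ee_bd (j + n) t; apply: (le_trans _ (ler_wpM2r (exprn_ge0 n t0) h)).
rewrite /ee t1 exprD mulrAC -mulrA -!mulrA (mulrCA (t^-1 ^+ n)) ler_wpM2l ?exprn_ge0 ?invr_ge0//.
by rewrite mulrCA mulrA -exprMn mulVf ?gt_eqF// expr1n mul1r.
Qed.

Lemma ee'_bd j t : `|ee' j t| <= j.+2`!%:R + j%:R * j.+1`!%:R.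
Proof.
rewrite /ee'; apply: (le_trans (ler_normB _ _)).
have /andP[a0 a] := ee_bd j.+2 t; have /andP[b0 b] := ee_bd j.+1 t.
by rewrite normrM !ger0_norm//; apply: lerD => //; apply: ler_wpM2l.
Qed.

Lemma ee_is_derive j (t : R) : 0 < t -> is_derive t 1 (ee j) (ee' j t).
Proof.
move=> t0; apply: (@near_eq_is_derive _ _ _ (fun s : R => s^-1 ^+ j * expR (- s^-1))).
 near=> s; rewrite /ee ifT//; near: s; exact: lt_nbhsr.
have tN : t != 0 by rewrite gt_eqF.
have dV : is_derive t 1 (fun s : R => s^-1) (- t ^- 2).
 by apply: is_derive_eq; [exact: (@is_deriveV R id t 1 1 tN)|rewrite -[_ *: _]/(_ * _) mulr1].
have dX := @is_deriveX _ _ (fun s : R => s^-1) j t 1 _ dV.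
have dE := @is_derive1_comp _ expR (fun s : R => - s^-1) t _ _ (is_derive_expR (- t^-1)) (is_deriveN dV).
have -> : (fun s : R => s^-1 ^+ j * expR (- s^-1)) = (fun s : R => s^-1) ^+ j * (expR \o (fun s : R => - s^-1)).
 by apply/funext => s; rewrite !fctE.
have dM := is_deriveM dX dE; apply: (is_derive_eq dM) => {dM dX dE dV}.
have -> : ((fun s : R => s^-1) ^+ j) t = t^-1 ^+ j by rewrite fctE.
rewrite /ee' /ee t0 -![_ *: _]/(_ * _) -exprVn /comp.
by case: j => [|j]; rewrite ?exprS /=; ring.
Unshelve. all: by end_near. Qed.

Lemma ee_continuous j (t : R) : 0 < t -> {for t, continuous (ee j)}.
Proof. by move=> /(ee_is_derive j)[d _]; apply: differentiable_continuous; exact/derivable1_diffP. Qed.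

Lemma ee_MVT j (t u : R) : 0 < t -> 0 < u -> exists c : R,
 [/\ ee j u - ee j t = ee' j c * (u - t), `|c - t| <= `|u - t| & 0 < c].
Proof.
move=> t0 u0.
have main (x y : R) : 0 < x -> x < y -> exists2 c, c \in `]x, y[%R & ee j y - ee j x = ee' j c * (y - x).
 move=> x0 xy; apply: (@MVT _ (ee j) (ee' j) x y xy).
  move=> z; rewrite in_itv /= => /andP[xz _]; apply: ee_is_derive; exact: lt_trans xz.
 apply: continuous_in_subspaceT => z; rewrite inE /= in_itv /= => /andP[xz _].
 apply: ee_continuous; exact: lt_le_trans xz.
have [tu|ut|->] := ltgtP t u; last by exists u; rewrite !subrr mulr0.
- have [c + e] := main t u t0 tu; rewrite in_itv /= => /andP[tc cu]; exists c; split => //; last exact: lt_trans tc.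
 by rewrite !ger0_norm ?subr_ge0 ?(ltW tc) ?(ltW tu)// lerD2r ltW.
- have [c + e] := main u t u0 ut; rewrite in_itv /= => /andP[uc ct]; exists c; split => //; last exact: lt_trans uc.
  by rewrite -opprB e -mulrN opprB.
 by rewrite !ler0_norm ?subr_le0 ?(ltW ct) ?(ltW ut)// !opprB lerD2l lerN2 ltW.
Qed.

(** On the positive side the mean value theorem applies. Across [0], [ee j] is of order [t^2] and
    [ee' j] of order [t], because [ee_shift] trades an inverse power for a factorial, and both
    distances to [0] are at most [|u - t|]. *)
Lemma ee_C11R j : C11R (ee j) (ee' j).
Proof.
pose B i : R := i.+2`!%:R + i%:R * i.+1`!%:R.
have B0 i : 0 <= B i by rewrite addr_ge0// mulr_ge0.
pose D : R := B j.+2 + j%:R * B j.+1; have D0 : 0 <= D by rewrite addr_ge0// mulr_ge0.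
have lip (t u : R) : 0 < t -> 0 < u -> `|ee' j u - ee' j t| <= D * `|u - t|.
 move=> t0 u0; rewrite /ee' (_ : _ - _ = (ee j.+2 u - ee j.+2 t) - j%:R * (ee j.+1 u - ee j.+1 t)); last by ring.
 have [c [-> _ _]] := ee_MVT j.+2 t0 u0; have [c' [-> _ _]] := ee_MVT j.+1 t0 u0.
 rewrite mulrA -mulrBl normrM ler_wpM2r//; apply: (le_trans (ler_normB _ _)); apply: lerD; first exact: ee'_bd.
 by rewrite normrM ger0_norm// ler_wpM2l// ee'_bd.
pose E : R := (j.+2 + 1)`!%:R + j%:R * (j.+1 + 1)`!%:R.
have E0 : 0 <= E by rewrite addr_ge0// mulr_ge0.
have e'le (u : R) : 0 <= u -> `|ee' j u| <= E * u.
 move=> u0; apply: (le_trans (ler_normB _ _)).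
 have /andP[a0 _] := ee_bd j.+2 u; have /andP[b0 _] := ee_bd j.+1 u.
 rewrite normrM !ger0_norm// mulrDl; apply: lerD; first exact: (ee_shift 1).
 rewrite -mulrA ler_wpM2l//; exact: (ee_shift 1).
pose H : R := (j + 2)`!%:R; have H0 : 0 <= H by [].
have ele (u : R) : 0 <= u -> `|ee j u| <= H * u ^+ 2.
 move=> u0; have /andP[a0 _] := ee_bd j u; rewrite ger0_norm//; exact: ee_shift.
have e'0 (u : R) : u <= 0 -> ee' j u = 0 by move=> u0; rewrite /ee' !ee_out// mulr0 subr0.
clearbody D E H; move=> r; exists (D + E + H); split => [|t u _ _]; first by rewrite !addr_ge0.
have n0 := normr_ge0 (u - t); have s0 := sqr_ge0 (u - t).
have Dn : 0 <= D * `|u - t| by exact: mulr_ge0.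
have En : 0 <= E * `|u - t| by exact: mulr_ge0.
have Hn : 0 <= H * `|u - t| by exact: mulr_ge0.
have Ds : 0 <= D * (u - t) ^+ 2 by exact: mulr_ge0.
have Es : 0 <= E * (u - t) ^+ 2 by exact: mulr_ge0.
have Hs : 0 <= H * (u - t) ^+ 2 by exact: mulr_ge0.
rewrite ![(D + E + H) * _]mulrDl ![(D + E) * _]mulrDl; have [t0|t0] := ltP 0 t; have [u0|u0] := ltP 0 u.
- split; last by apply: (le_trans (lip _ _ t0 u0)); rewrite -addrA lerDl addr_ge0.
 have [c [-> ct c0]] := ee_MVT j t0 u0; rewrite -mulrBl normrM.
 apply: (@le_trans _ _ (D * (u - t) ^+ 2)); last by rewrite -addrA lerDl addr_ge0.
 rewrite -[(u - t) ^+ 2]real_normK ?num_real// expr2 mulrA ler_wpM2r//.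
 by apply: (le_trans (lip _ _ t0 c0)); rewrite ler_wpM2l.
- have tut : t <= `|u - t| by rewrite ler0_norm; lra.
 have t00 := ltW t0; rewrite (ee_out j u0) (e'0 u)// !sub0r !normrN; split; last first.
  apply: (le_trans (e'le _ t00)); apply: (@le_trans _ _ (E * `|u - t|)); first by rewrite ler_wpM2l.
  by rewrite -addrA addrCA lerDl addr_ge0.
 rewrite -opprD normrN; apply: (le_trans (ler_normD _ _)).
 apply: (@le_trans _ _ (H * (u - t) ^+ 2 + E * (u - t) ^+ 2)); last by rewrite [leRHS]addrC lerD2l lerDr.
 have t2 : t ^+ 2 <= (u - t) ^+ 2 by rewrite -[leRHS]real_normK ?num_real// ler_pXn2r ?nnegrE.
 apply: lerD; first by apply: (le_trans (ele _ t00)); rewrite ler_wpM2l.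
 rewrite normrM -[(u - t) ^+ 2]real_normK ?num_real// expr2 mulrA ler_wpM2r//.
 by apply: (le_trans (e'le _ t00)); rewrite ler_wpM2l.
- have uut : u <= `|u - t| by rewrite ger0_norm; lra.
 have u00 := ltW u0; rewrite (ee_out j t0) (e'0 t)// !subr0 mul0r subr0; split.
  apply: (le_trans (ele _ u00)); apply: (@le_trans _ _ (H * (u - t) ^+ 2)); last by rewrite lerDr addr_ge0.
  by rewrite ler_wpM2l// -[leRHS]real_normK ?num_real// ler_pXn2r ?nnegrE.
 apply: (le_trans (e'le _ u00)); apply: (@le_trans _ _ (E * `|u - t|)); first by rewrite ler_wpM2l.
 by rewrite -addrA addrCA lerDl addr_ge0.
- by rewrite !ee_out// !e'0// !subrr mul0r subr0 normr0; split; rewrite !addr_ge0.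
Qed.

(* A class of functions of the plane containing a bump, globally bounded and closed under
  partial derivatives; the last closure property only serves [Sm_d]. *)
Inductive Sm : (pt -> R) -> Prop :=
| Sm_ee j (p q r : R) : Sm (fun z => ee j (p * z.1 + q * z.2 + r))
| Sm_M f g : Sm f -> Sm g -> Sm (fun z => f z * g z)
| Sm_D f g : Sm f -> Sm g -> Sm (fun z => f z + g z)
| Sm_Z c f : Sm f -> Sm (fun z => c * f z).

Lemma C11_lin (p q r : R) : C11r (fun z : pt => p * z.1 + q * z.2 + r) (fun _ => p) (fun _ => q).
Proof.
have H := C11_D (C11_D (C11_Z p%:C (@C11_x R)) (C11_Z q%:C (@C11_y R))) (C11_cst r%:C).
by apply: C11_eq H => z; cplx_ring.
Qed.

Lemma Sm_d f : Sm f -> exists f1 f2 (M : R),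
 [/\ Sm f1, Sm f2, C11r f f1 f2 & forall z, `|f z| <= M].
Proof.
elim=> [j p q r|u v Su [u1 [u2 [M [S1 S2 Cu uM]]]] Sv [v1 [v2 [N [T1 T2 Cv vN]]]]|u v Su [u1 [u2 [M [S1 S2 Cu uM]]]] Sv [v1 [v2 [N [T1 T2 Cv vN]]]]|c u Su [u1 [u2 [M [S1 S2 Cu uM]]]]].
- exists (fun z => p * (ee j.+2 (p * z.1 + q * z.2 + r) + - j%:R * ee j.+1 (p * z.1 + q * z.2 + r))).
 exists (fun z => q * (ee j.+2 (p * z.1 + q * z.2 + r) + - j%:R * ee j.+1 (p * z.1 + q * z.2 + r))), j`!%:R; split.
 + by do ?constructor.
 + by do ?constructor.
 + by apply: C11_eq (C11_comp (ee_C11R j) (C11_lin p q r)) => z //; rewrite /ee' mulNr mulrC.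
 + by move=> z; have /andP[h0 h1] := ee_bd j (p * z.1 + q * z.2 + r); rewrite ger0_norm.
- exists (fun z => u1 z * v z + u z * v1 z), (fun z => u2 z * v z + u z * v2 z), (M * N); split; try by do ?constructor.
 + by apply: C11_eq (C11_M Cu Cv) => z; rewrite ?rmorphD ?rmorphM.
 + by move=> z; rewrite normrM; exact: ler_pM.
- exists (fun z => u1 z + v1 z), (fun z => u2 z + v2 z), (M + N); split; try exact: Sm_D.
 + by apply: C11_eq (C11_D Cu Cv) => z; rewrite rmorphD.
 + by move=> z; apply: (le_trans (ler_normD _ _)); exact: lerD.
- exists (fun z => c * u1 z), (fun z => c * u2 z), (`|c| * M); split; try exact: Sm_Z.
 + by apply: C11_eq (C11_Z c%:C Cu) => z; rewrite rmorphM.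
 + by move=> z; rewrite normrM ler_wpM2l.
Qed.
End Bump.

(** Packaged as a linear map, so that uniqueness of the differential can identify it in
    [C11r_diff]. *)
Definition lin2 {R : realType} (p q : R) (h : R * R) : R := p * h.1 + q * h.2.
Lemma lin2_is_linear {R : realType} (p q : R) : linear (lin2 p q).
Proof. by move=> k u v; rewrite /lin2 /= -![_ *: _]/(_ * _); ring. Qed.
HB.instance Definition _ {R : realType} (p q : R) :=
 GRing.isLinear.Build R (R * R)%type R _ (lin2 p q) (lin2_is_linear p q).

(** * Smoothing of test functions and the curl functional *)

Section Mollify.
Context {R : realType}.
Local Notation pt := (R * R)%type.

(** The bridge from [C11], where derivatives are data, to the differential calculus in which the
    curl is defined. *)
Lemma C11r_diff (f f1 f2 : pt -> R) (x : pt) : C11r f f1 f2 ->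
 differentiable f x /\ forall v : pt, derive f x v = f1 x * v.1 + f2 x * v.2.
Proof.
move=> Cf; have [C [C0 hC]] := Cf (`|x| + 1).
have lc : continuous (lin2 (f1 x) (f2 x)).
 apply: lip_continuous => r; exists (`|f1 x| + `|f2 x|); split; first exact: addr_ge0.
 move=> z h _ _; rewrite (_ : _ - _ = f1 x * h.1 + f2 x * h.2); last by rewrite /lin2 /=; ring.
 apply: (le_trans (ler_normD _ _)); rewrite !normrM mulrDl; apply: lerD; apply: ler_wpM2l => //.
  exact: norm_fst.
 exact: norm_snd.
have E : f \o shift x = cst (f x) + lin2 (f1 x) (f2 x) +o_ (0 : pt) id.
 apply/eqaddoP => e e0; have d0 : 0 < Num.min 1 (e / (C + 1)) by rewrite lt_min ltr01 divr_gt0// ltr_wpDl.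
 have := nbhsx_ballx (0 : pt) _ d0; apply: filterS => h /ball0E; rewrite lt_min => /andP[h1 h2].
 have xh : `|x + h| <= `|x| + 1 by apply: (le_trans (ler_normD _ _)); rewrite lerD2l ltW.
 have x1 : `|x| <= `|x| + 1 by rewrite lerDl.
 have [+ _ _] := hC x h x1 xh; rewrite !fctE /= -!(rmorphM, rmorphD, rmorphB) nmR => hh.
 rewrite opprD addrA [h + x]addrC; apply: (le_trans hh).
 rewrite expr2 mulrA ler_wpM2r//; apply: (@le_trans _ _ ((C + 1) * `|h|)); first by rewrite ler_wpM2r// lerDl.
 by rewrite ltW// mulrC -ltr_pdivlMr// ltr_wpDl.
have U := diff_unique lc E.
have D : differentiable f x by apply/diff_locallyP; rewrite U; split.
by split=> // v; rewrite (deriveE v D) U.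
Qed.

Definition sconv (k : pt -> R) (g : pt -> R[i]) (x : pt) : R := Re (cnv (fun z => (k z)%:C) g x).

Lemma sconv_d (k : pt -> R) (g : pt -> R[i]) (r0 : R) : Sm k -> cL1 g -> supp r0 g ->
 (forall x, differentiable (sconv k g) x) /\
 forall v : pt, exists2 k', Sm k' & (fun x => derive (sconv k g) x v) = sconv k' g.
Proof.
move=> Sk Lg sg; have [k1 [k2 [M [S1 S2 Ck kM]]]] := Sm_d Sk.
have [k11 [k12 [M1 [_ _ _ kM1]]]] := Sm_d S1; have [k21 [k22 [M2 [_ _ _ kM2]]]] := Sm_d S2.
pose N := Num.max M (Num.max M1 M2).
have b0 z : nm (k z)%:C <= N by rewrite nmR /N !le_max kM.
have b1 z : nm (k1 z)%:C <= N by rewrite nmR /N !le_max kM1 !orbT.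
have b2 z : nm (k2 z)%:C <= N by rewrite nmR /N !le_max kM2 !orbT.
have [m0 m1 m2] := C11_cmeas Ck.
have CC := C11_Re (C11_cnv Ck b0 b1 b2 Lg sg).
split=> [x|v]; first by case: (C11r_diff x CC).
exists (fun z => v.1 * k1 z + v.2 * k2 z); first by apply: Sm_D; exact: Sm_Z.
apply/funext => x; have [_ ->] := C11r_diff x CC.
have L1' := cL1_conv_in x m1 b1 Lg; have L2' := cL1_conv_in x m2 b2 Lg.
rewrite /sconv; transitivity (Re (v.1%:C * cnv (fun z => (k1 z)%:C) g x + v.2%:C * cnv (fun z => (k2 z)%:C) g x)).
 by rewrite !reim; ring.
rewrite /cnv -!cIZ// -cID; [|exact: cL1Z|exact: cL1Z].
by congr (Re _); apply: cI_eq => y; rewrite rmorphD !rmorphM; ring.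
Qed.

Lemma sconv_smooth2 (k : pt -> R) (g : pt -> R[i]) (r0 : R) : Sm k -> cL1 g -> supp r0 g ->
 smooth2 (sconv k g).
Proof.
move=> Sk Lg sg vs; have [k' Sk' E] : exists2 k', Sm k' & Defs.iterD vs (sconv k g) = sconv k' g.
 elim: vs => [|v vs [k' Sk' E]] /=; first by exists k.
 by have [_ /(_ v)[k'' Sk'' E']] := sconv_d Sk' Lg sg; exists k''; rewrite // E.
by rewrite E => x; case: (sconv_d Sk' Lg sg).
Qed.

Lemma bump_exists (e : R) : 0 < e -> exists k : pt -> R,
 [/\ Sm k, forall z, 0 <= k z, forall z : pt, e <= `|z| -> k z = 0, L1 k & I2 k = 1].
Proof.
move=> e0.
(* A product of two bumps in one variable, each of the form [ee 0 (1 - t / e) * ee 0 (1 + t / e)],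
   which vanishes unless [|t| < e]. *)
pose w (z : pt) := ee 0 (- e^-1 * z.1 + 0 * z.2 + 1) * ee 0 (e^-1 * z.1 + 0 * z.2 + 1) *
 (ee 0 (0 * z.1 + - e^-1 * z.2 + 1) * ee 0 (0 * z.1 + e^-1 * z.2 + 1)).
have Sw : Sm w by do ?constructor.
have p0 (t : R) : 0 <= ee 0 t by case/andP: (ee_bd 0 t).
have w0 z : 0 <= w z by rewrite /w !mulr_ge0.
have wout (z : pt) : e <= `|z| -> w z = 0.
 have out (t : R) : e <= `|t| -> ee 0 (- e^-1 * t + 1) = 0 \/ ee 0 (e^-1 * t + 1) = 0.
  rewrite ler_normr => /orP[] h; [left|right]; apply: ee_out.
   by rewrite mulNr addrC subr_le0 -ler_pdivrMl ?invr_gt0// invrK mulr1.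
  have : e^-1 * e <= e^-1 * - t by rewrite ler_wpM2l// invr_ge0 ltW.
  by rewrite mulVf ?gt_eqF// mulrN; lra.
 rewrite prod_normE le_max /w !mul0r !addr0 !add0r => /orP[] /out[] -> //; by rewrite !(mul0r, mulr0).
have [w1 [w2 [M [_ _ Cw wM]]]] := Sm_d Sw.
have mw : mfun w by case: (C11_cmeas Cw) => -[].
have Lw : L1 w.
 apply: (@L1_box _ M e) => // x xe; apply: wout; exact: nball0.
have low (z : pt) : (expR (-2)) ^+ 4 * \1_(ball 0 (e / 2)) z <= w z.
 have [zb|zb] := pselect (ball 0 (e / 2) z); last by rewrite (ind_out zb) mulr0.
 rewrite (ind_in zb) mulr1; have /norm_pt_ltP[z1 z2] := (ball0E _ _).1 zb.
 have lo (t : R) : 2^-1 <= t -> expR (-2) <= ee 0 t.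
  move=> t2; have t0 : 0 < t by apply: lt_le_trans t2; rewrite invr_gt0.
  by rewrite /ee t0 expr0 mul1r ler_expR lerN2 -[leRHS]invrK lef_pV2 ?posrE ?invr_gt0.
 have ab (s : R) : `|s| < e / 2 -> 2^-1 <= - e^-1 * s + 1 /\ 2^-1 <= e^-1 * s + 1.
  move=> h; have : `|e^-1 * s| <= 2^-1.
   by rewrite normrM gtr0_norm ?invr_gt0// -ler_pdivlMl ?invr_gt0// invrK ltW.
  by rewrite mulNr ler_norml => /andP[]; lra.
 have [a1 a2] := ab _ z1; have [a3 a4] := ab _ z2; have q := expR_ge0 (-2 : R).
 rewrite /w !mul0r !addr0 !add0r (_ : expR (-2) ^+ 4 = expR (-2) * expR (-2) * (expR (-2) * expR (-2))); last by ring.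
 apply: ler_pM; rewrite ?mulr_ge0//; apply: ler_pM => //; exact: lo.
have I0 : 0 < I2 w.
 apply: (@lt_le_trans _ _ (I2 (fun z : pt => (expR (-2)) ^+ 4 * \1_(ball 0 (e / 2)) z))); last first.
  apply: I2_le low => //; apply: L1Z; exact: L1_ball.
 rewrite I2Z; last exact: L1_ball.
 by rewrite I2_ball ?divr_ge0 ?(ltW e0)// mulr_gt0// exprn_gt0 ?expR_gt0// mulr_gt0// divr_gt0.
exists (fun z => (I2 w)^-1 * w z); split.
- exact: Sm_Z.
- by move=> z; rewrite mulr_ge0// invr_ge0 ltW.
- by move=> z /wout ->; rewrite mulr0.
- exact: L1Z.
- by rewrite I2Z// mulVf// gt_eqF.
Qed.

Lemma cnvC (f g : pt -> R[i]) (M : R) x : cmeas f -> bdd f M -> cL1 g ->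
 cnv f g x = cnv g f x.
Proof.
move=> mf fM Lg; have L := cL1_conv_in x mf fM Lg.
have N1 : -1 != 0 :> R by rewrite oppr_eq0 oner_eq0.
have := cI_affine x N1 L; rewrite sqrrN expr1n invr1 mul1r => H.
rewrite /cnv -[LHS]H; apply: cI_eq => y; rewrite scaleN1r mulrC; congr (_ * f _).
by rewrite opprB addrCA subrr addr0.
Qed.

Lemma cnv_near (f : pt -> R[i]) (k : pt -> R) (e L M : R) x : cmeas f -> bdd f M ->
 (forall z, 0 <= k z) -> (forall z : pt, e <= `|z| -> k z = 0) -> L1 k -> I2 k = 1 ->
 (forall h : pt, `|h| <= e -> nm (f (x - h) - f x) <= L) ->
 nm (cnv f (fun z => (k z)%:C) x - f x) <= L /\ nm (cnv f (fun z => (k z)%:C) x) <= M.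
Proof.
move=> mf fM k0 kout Lk Ik hL; have Lkc := cL1R Lk; have Lc := cL1_conv_in x mf fM Lkc.
have Lf' : cL1 (fun y => f x * (k y)%:C) by exact: cL1Z.
split; last first.
 apply: (le_trans (cI_abs Lc)); rewrite -[leRHS]mulr1 -Ik -I2Z//.
 apply: I2_le; [exact: L1_nm|exact: L1Z|].
 by move=> y; rewrite nmM nmR (ger0_norm (k0 y)) ler_wpM2r.
have -> : cnv f (fun z => (k z)%:C) x - f x = cI (fun y => (f (x - y) - f x) * (k y)%:C).
 transitivity (cI (fun y => f (x - y) * (k y)%:C - f x * (k y)%:C)); last by apply: cI_eq => y; rewrite mulrBl.
 by rewrite cIB// cIZ// cIR Ik mulr1.
have LD : cL1 (fun y => (f (x - y) - f x) * (k y)%:C).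
 by rewrite (_ : (fun y => _) = (fun y => f (x - y) * (k y)%:C - f x * (k y)%:C)); [exact: cL1B|apply/funext => y; rewrite mulrBl].
apply: (le_trans (cI_abs LD)); rewrite -[leRHS]mulr1 -Ik -I2Z//.
apply: I2_le; [exact: L1_nm|exact: L1Z|].
move=> y; rewrite nmM nmR (ger0_norm (k0 y)); have [ye|ye] := leP e `|y|; first by rewrite kout// !mulr0.
by rewrite ler_wpM2r// hL// ltW.
Qed.

(** [K] contains the neighbourhood of width [e0] of the set where [f] is nonzero, so mollification
    at scales up to [e0] keeps the support in a compact subset of [O]. *)
Definition spt_in (O : set pt) (f : pt -> R[i]) := exists K (e0 : R),
 [/\ compact K, K `<=` O, 0 < e0 & forall x y : pt, `|x - y| <= e0 -> f y <> 0 -> K x].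

Definition Lbd_on (O : set pt) (a b : pt -> R[i]) (T : R) := forall (r : R) f f1 f2 (M : R),
 0 <= r -> TF r f f1 f2 -> spt_in O f -> bdd f M -> nm (Lf a b f1 f2) <= T * M.

Lemma Lf_L1 (a b f1 f2 : pt -> R[i]) (M : R) : cL1 a -> cL1 b -> cmeas f1 -> cmeas f2 ->
 bdd f1 M -> bdd f2 M ->
 cL1 (fun x => a x * (f1 x + iC * f2 x) - b x * (f1 x - iC * f2 x)) /\
 nm (Lf a b f1 f2) <= 2 * M * (I2 (fun x => nm (a x)) + I2 (fun x => nm (b x))).
Proof.
move=> La Lb m1 m2 b1 b2.
have mi : cmeas (fun z => iC * f2 z) by apply: cmeasM => //; exact: cmeas_cst.
have ib z : nm (iC * f2 z) <= M by rewrite nm_mul_i.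
have p1 z : nm (f1 z + iC * f2 z) <= M + M by exact: le_nmD.
have p2 z : nm (f1 z - iC * f2 z) <= M + M by apply: le_nmD; rewrite ?nmN.
have A1 : cL1 (fun x => a x * (f1 x + iC * f2 x)).
 rewrite (_ : (fun x => _) = (fun x => (f1 x + iC * f2 x) * a x)); last by apply/funext => x; rewrite mulrC.
 apply: (cL1_bdM _ p1 La); exact: cmeasD.
have B1 : cL1 (fun x => b x * (f1 x - iC * f2 x)).
 rewrite (_ : (fun x => _) = (fun x => (f1 x - iC * f2 x) * b x)); last by apply/funext => x; rewrite mulrC.
 apply: (cL1_bdM _ p2 Lb); exact: cmeasB.
have L := cL1B A1 B1; split=> //; apply: (le_trans (cI_abs L)).
rewrite -(I2D (L1_nm La) (L1_nm Lb)) -(I2Z _ (L1D (L1_nm La) (L1_nm Lb))).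
apply: I2_le; [exact: L1_nm|exact: (L1Z _ (L1D (L1_nm La) (L1_nm Lb)))|].
move=> x; apply: (le_trans (nmB _ _)); rewrite [leRHS]mulrDr (_ : 2 * M = M + M); last by rewrite mulr2n mulrDl mul1r.
by apply: lerD; rewrite nmM mulrC ler_wpM2r// nm_ge0.
Qed.

Lemma TF_glip r f f1 f2 : 0 <= r -> TF r f f1 f2 -> exists L : R, 0 <= L /\ forall x h : pt, `|h| <= 1 ->
 [/\ nm (f1 x) <= L, nm (f2 x) <= L, nm (f x) <= L,
   nm (f1 (x - h) - f1 x) <= L * `|h| & nm (f2 (x - h) - f2 x) <= L * `|h|].
Proof.
move=> r0 [Cf s s1 s2]; have [C [C0 hC]] := Cf (r + 2); have [M [M0 hM]] := C11_bound (r + 2) Cf.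
exists (C + M); split=> [|x h h1]; first exact: addr_ge0.
have CM : C <= C + M by rewrite lerDl.
have MC : M <= C + M by rewrite lerDr.
have LM0 : 0 <= C + M by exact: addr_ge0.
have [xr|xr] := ltP `|x| (r + 1); last first.
 have rx : r <= `|x| by lra.
 have rxh : r <= `|x - h| by have := ler_normB (x - h) (- h); rewrite opprK subrK normrN; lra.
 rewrite (s x)// (s1 x)// (s1 (x - h))// (s2 x)// (s2 (x - h))// !subrr nm0.
 by split=> //; rewrite mulr_ge0.
have xr2 : `|x| <= r + 2 by lra.
have xh : `|x + - h| <= r + 2 by apply: (le_trans (ler_normD _ _)); rewrite normrN; lra.
have [_ h1' h2'] := hC x (- h) xr2 xh; have [m0 m1 m2] := hM x xr2; rewrite normrN in h1' h2'.
by split; [exact: le_trans MC|exact: le_trans MC|exact: le_trans MC|apply: (le_trans h1')|apply: (le_trans h2')]; rewrite ler_wpM2r.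
Qed.

(** The variation of the curl is tested with smooth functions, while the kernels of the interior
    estimate produce C^{1,1} ones. Mollification keeps the sup bound and a compact support in [O],
    and moves the Lipschitz derivatives by [O(e)], hence [Lf] as well since [a] and [b] are
    integrable. *)
Lemma Lbd_on_of_smooth (O : set pt) (a b : pt -> R[i]) (T : R) : cL1 a -> cL1 b ->
 (forall F F1 F2, C11 F F1 F2 -> (forall w, test_fun O (fun x => Re (w * F x))) ->
  bdd F 1 -> (exists B, forall x, nm (F1 x) <= B /\ nm (F2 x) <= B) ->
  Re (Lf a b F1 F2) <= T) ->
 Lbd_on O a b T.
Proof.
move=> La Lb HT.
have key (r : R) f f1 f2 : 0 <= r -> TF r f f1 f2 -> spt_in O f -> bdd f 1 -> Re (Lf a b f1 f2) <= T.
 move=> r0 Tf [K [e0 [cK KO e00 hK]]] f1'; have [L [L0 hL]] := TF_glip r0 Tf.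
 have [Cf sf _ _] := Tf; have [mf m1 m2] := C11_cmeas Cf.
 have [Lfi _ _] := TF_cL1 Tf.
 have n1 : `|0 : pt| <= 1 by rewrite normr0.
 have hf x : nm (f x) <= L by case: (hL x _ n1).
 have hf1 x : nm (f1 x) <= L by case: (hL x _ n1).
 have hf2 x : nm (f2 x) <= L by case: (hL x _ n1).
 pose Q := 2 * L * (I2 (fun x => nm (a x)) + I2 (fun x => nm (b x))).
 apply/ler_addgt0Pr => t t0.
 pose e := Num.min (Num.min e0 1) (t / (`|Q| + 1)).
 have Q1 : 0 < `|Q| + 1 by rewrite ltr_wpDl.
 have ep : 0 < e by rewrite /e !lt_min e00 ltr01 divr_gt0.
 have ee0 : e <= e0 by rewrite /e !ge_min lexx.
 have e1 : e <= 1 by rewrite /e !ge_min lexx orbT.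
 have eQ : e * `|Q| <= t.
  apply: (@le_trans _ _ (e * (`|Q| + 1))); first by rewrite ler_wpM2l ?(ltW ep)// lerDl.
  by rewrite -ler_pdivlMr// /e ge_min lexx orbT.
 have [k [Sk k0 kout Lk Ik]] := bump_exists ep.
 pose kc z : R[i] := (k z)%:C.
 have Lkc : cL1 kc by exact: cL1R.
 have skc : supp e kc by move=> z /kout; rewrite /kc => ->.
 have CF := C11_cnv Cf hf hf1 hf2 Lkc skc.
 have le1 (g : pt -> R[i]) x : cmeas g -> bdd g L ->
   (forall x h : pt, `|h| <= 1 -> nm (g (x - h) - g x) <= L * `|h|) -> nm (cnv g kc x - g x) <= L * e.
  move=> mg gL gl; apply: (proj1 (cnv_near (L := L * e) mg gL k0 kout Lk Ik _)) => h he.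
  by apply: (le_trans (gl x h (le_trans he e1))); rewrite ler_wpM2l.
 have F1' x : nm (cnv f kc x) <= 1.
  apply: (proj2 (cnv_near (x := x) (L := L + L) mf f1' k0 kout Lk Ik _)) => h _.
  by apply: le_nmD; rewrite ?nmN.
 have Fsm (w : R[i]) : test_fun O (fun x => Re (w * cnv f kc x)).
  have Lw := cL1Z w Lfi; have sw : supp r (fun z => w * f z) by move=> z /sf ->; rewrite mulr0.
  have E : (fun x => Re (w * cnv f kc x)) = sconv k (fun z => w * f z).
   apply/funext => x; rewrite /sconv (cnvC x mf hf Lkc) -/kc /cnv -cIZ; first by congr Re; apply: cI_eq => y; ring.
   by have := cL1_conv_in x mf hf Lkc => _; case: (Sm_d Sk) => k1 [k2 [M [_ _ Ck kM]]];
    apply: (cL1_conv_in (M := M) x _ _ Lfi); [case: (C11_cmeas Ck)|move=> z; rewrite /kc nmR].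
  split; first by rewrite E; exact: (sconv_smooth2 Sk Lw sw).
  exists K; split=> //; split=> // x Kx; rewrite (_ : cnv f kc x = 0) ?mulr0//.
  rewrite /cnv -(@cI0 R); apply: cI_eq => y; have [ye|ye] := leP e `|y|; first by rewrite skc// mulr0.
  have [->|/eqP fn] := eqVneq (f (x - y)) 0; first by rewrite mul0r.
  case: Kx; apply: (hK x (x - y)) => //; rewrite subKr; apply: le_trans ee0; exact: ltW.
 have [mF mF1 mF2] := C11_cmeas CF.
 have d1' x : nm (f1 x - cnv f1 kc x) <= L * e.
  by rewrite nm_distC; apply: le1 => // y h h1; case: (hL y h h1).
 have d2' x : nm (f2 x - cnv f2 kc x) <= L * e.
  by rewrite nm_distC; apply: le1 => // y h h1; case: (hL y h h1).
 have [LL1 _] := Lf_L1 La Lb m1 m2 hf1 hf2.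
 have G1 x : nm (cnv f1 kc x) <= L + L * e.
  by rewrite (_ : cnv f1 kc x = f1 x - (f1 x - cnv f1 kc x)); [apply: le_nmD; rewrite ?nmN|ring].
 have G2 x : nm (cnv f2 kc x) <= L + L * e.
  by rewrite (_ : cnv f2 kc x = f2 x - (f2 x - cnv f2 kc x)); [apply: le_nmD; rewrite ?nmN|ring].
 have hT := HT _ _ _ CF Fsm F1' (ex_intro (fun B => forall x, nm (cnv f1 kc x) <= B /\ nm (cnv f2 kc x) <= B) (L + L * e) (fun x => conj (G1 x) (G2 x))).
 have [LL2 _] := Lf_L1 La Lb mF1 mF2 G1 G2.
 have [_ D] := Lf_L1 La Lb (cmeasB m1 mF1) (cmeasB m2 mF2) d1' d2'.
 have E : Lf a b f1 f2 = Lf a b (cnv f1 kc) (cnv f2 kc) +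
   Lf a b (fun x => f1 x - cnv f1 kc x) (fun x => f2 x - cnv f2 kc x).
  apply/eqP; rewrite -subr_eq0 opprD addrA /Lf -cIB// subr_eq0; apply/eqP.
  by apply: cI_eq => x; move: (cnv f1 kc x) (cnv f2 kc x) => u v; ring.
 rewrite E ReD; apply: lerD => //; apply: (le_trans (Re_le_nm _)); apply: (le_trans D).
 apply: le_trans eQ; rewrite (_ : 2 * (L * e) * _ = e * Q); last by rewrite /Q; ring.
 by rewrite ler_wpM2l ?ler_norm// ltW.
move=> r f f1 f2 M r0 Tf sf fM; apply/ler_addgt0Pr => t t0.
have M0 : 0 <= M by apply: le_trans (fM 0); exact: nm_ge0.
have T0 : 0 <= T.
 have := key r (fun _ => 0) (fun _ => 0) (fun _ => 0) r0; rewrite /Lf (@cI_eq _ _ (fun _ => 0)) ?cI0; last by move=> x; ring.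
 apply; [split=> //; exact: C11_cst| |by move=> x; rewrite nm0].
 exists set0, 1; split=> //; exact: compact0.
(* Slightly more than [M], to allow division even if [M = 0]; the phase [w] makes the real part
   equal to the modulus. *)
pose N := M + t / (T + 1); have T1 : 0 < T + 1 by rewrite ltr_wpDl.
have N0 : 0 < N by rewrite /N ltr_wpDl// divr_gt0.
have [w [w1 we wr]] := nm_phase (Lf a b f1 f2).
have [Cf s s1 s2] := Tf; pose c : R[i] := w * (N^-1)%:C.
have nmc : nm c <= N^-1.
 rewrite /c nmM nmR (ger0_norm (ltW _)) ?invr_gt0//.
 by rewrite ler_piMl// invr_ge0 ltW.
have Tc : TF r (fun z => c * f z) (fun z => c * f1 z) (fun z => c * f2 z).
 by split; [exact: C11_Z|exact: suppMr|exact: suppMr|exact: suppMr].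
have sc : spt_in O (fun z => c * f z).
 have [K [e0 [cK KO e00 hK]]] := sf; exists K, e0; split=> // x y xy fy; apply: (hK x y xy) => fy0.
 by apply: fy; rewrite fy0 mulr0.
have bc x : nm (c * f x) <= 1.
 rewrite nmM; apply: (@le_trans _ _ (N^-1 * N)); last by rewrite mulVf// gt_eqF.
 apply: ler_pM => //; try exact: nm_ge0.
 by apply: (le_trans (fM x)); rewrite lerDl divr_ge0// ltW.
have := key r _ _ _ r0 Tc sc bc.
have [L [L0 hL]] := TF_glip r0 Tf; have n1 : `|0 : pt| <= 1 by rewrite normr0.
have [_ m1 m2] := C11_cmeas Cf.
have [LI _] := Lf_L1 La Lb m1 m2 (fun x => let: And5 h _ _ _ _ := hL x 0 n1 in h) (fun x => let: And5 _ h _ _ _ := hL x 0 n1 in h).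
have -> : Lf a b (fun z => c * f1 z) (fun z => c * f2 z) = c * Lf a b f1 f2.
 by rewrite /Lf -(cIZ c LI); apply: cI_eq => x; ring.
have -> : Re (c * Lf a b f1 f2) = N^-1 * nm (Lf a b f1 f2).
 by rewrite /c mulrAC we -rmorphM ReC mulrC.
rewrite ler_pdivrMl// mulrC => h; apply: (le_trans h); rewrite /N mulrDr lerD2l.
rewrite mulrCA -[leRHS]mulr1 ler_wpM2l ?(ltW t0)//.
by rewrite ler_pdivrMr// mul1r lerDl.
Qed.
End Mollify.

(** * The interior estimate on balls of any radius *)

Section Local.
Context {R : realType}.
Local Notation pt := (R * R)%type.
Implicit Types (a b : pt -> R[i]).

Definition HH a b (x : pt) : R := m1 (nm (b x)) + m1 `|nm (a x) - 1|.

Lemma HH_ge0 a b x : 0 <= HH a b x.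
Proof. by apply: addr_ge0; apply: m1_ge0; rewrite ?nm_ge0. Qed.

Lemma HH_meas a b : cL1 a -> cL1 b -> mfun (HH a b).
Proof.
move=> La Lb; apply: measurable_funD; apply: meas_m1; first exact: meas_nm (cL1_meas Lb).
apply: measurableT_comp => //; apply: measurable_funB => //; exact: meas_nm (cL1_meas La).
Qed.

Lemma HH_L1 a b (A : set pt) : cL1 a -> cL1 b -> measurable A -> L1 (\1_A) -> L1 (fun x => HH a b x * \1_A x).
Proof.
move=> La Lb mA LA.
apply: (@L1_dom _ _ (fun x => nm (b x) + (nm (a x) + \1_A x))).
- by apply: measurable_funM; [exact: HH_meas|exact: mindic].
- by apply: L1D; [exact: L1_nm|apply: L1D => //; exact: L1_nm].
- move=> x; have b0 := nm_ge0 (b x); have a0 := nm_ge0 (a x).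
 have /andP[i0 i1] := ind_itv A x.
 rewrite ger0_norm; last by rewrite mulr_ge0// HH_ge0.
 have [xb|xb] := pselect (A x); last by rewrite (ind_out xb) mulr0 addr0 addr_ge0.
 rewrite (ind_in xb) mulr1 lerD ?m1_le//; apply: (le_trans (m1_le _)).
 by apply: (le_trans (ler_normB _ _)); rewrite normr1 ger0_norm.
Qed.

Definition dev a (c : R[i]) (x : pt) : R := tr (nm (a x - c)) ^+ 2.

Lemma dev_ge0 a c x : 0 <= dev a c x. Proof. exact: sqr_ge0. Qed.
Lemma dev_le1 a c x : dev a c x <= 1.
Proof. by rewrite exprn_ile1 ?tr_le1// tr_ge0// nm_ge0. Qed.

Lemma dev_meas a c : cmeas a -> mfun (dev a c).
Proof.
move=> ma; apply: measurable_funX; apply: meas_tr; apply: meas_nm; apply: cmeasB => //; exact: cmeas_cst.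
Qed.

Lemma dev_L1 a c (A : set pt) : cmeas a -> measurable A -> L1 (\1_A) -> L1 (fun x => dev a c x * \1_A x).
Proof.
move=> ma mA LA; apply: (@L1_dom _ _ (\1_A)) => //.
 by apply: measurable_funM; [exact: dev_meas|exact: mindic].
move=> x; have /andP[i0 i1] := ind_itv A x.
have dx0 := dev_ge0 a c x; rewrite (ger0_norm (mulr_ge0 dx0 i0)); exact: ler_piMl i0 (dev_le1 a c x).
Qed.

Lemma dev_le_area a c (A : set pt) : cmeas a -> measurable A -> L1 (\1_A) ->
 I2 (fun x => dev a c x * \1_A x) <= I2 (\1_A).
Proof.
move=> ma mA LA; apply: I2_le => //; first exact: dev_L1.
by move=> x; have i0 := ind_ge0 A x; rewrite ler_piMl// dev_le1.
Qed.

Definition Tball (x0 : pt) (r : R) a b (T : R) := forall f f1 f2 (M : R), C11 f f1 f2 ->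
 (forall z, r <= `|z - x0| -> [/\ f z = 0, f1 z = 0 & f2 z = 0]) ->
 bdd f M -> nm (Lf a b f1 f2) <= T * M.

Lemma ball_affine (x0 y : pt) (r s : R) : 0 < r -> ball x0 (r * s) (x0 + r *: y) <-> ball 0 s y.
Proof.
move=> r0; rewrite ball0E -ball_normE /ball_ /= opprD addrA subrr sub0r normrN normrZ gtr0_norm//.
by rewrite ltr_pM2l.
Qed.

Lemma ind_affine (x0 y : pt) (r s : R) : 0 < r -> \1_(ball x0 (r * s)) (x0 + r *: y) = \1_(ball 0 s) y :> R.
Proof. by move=> r0; rewrite !indE; congr (if _ then _ else _); apply/idP/idP; rewrite !inE => /ball_affine; apply. Qed.

(** The change of variables gives [r^-2] and the derivatives of the rescaled test function give back
    [r]. The curl bound scales by [1 / r], and its square matches the scaling of the bulk term. *)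
Lemma Lbd_scale (x0 : pt) (r s T : R) a b : 0 < r -> cL1 a -> cL1 b -> Tball x0 (r * s) a b T ->
 Lbd s (fun y => a (x0 + r *: y)) (fun y => b (x0 + r *: y)) (T / r).
Proof.
move=> r0 La Lb HT f f1 f2 M Tf fM; have [Cf sf s1 s2] := Tf; have [m0 mf1 mf2] := C11_cmeas Cf.
have rN : r != 0 by rewrite gt_eqF.
have rV : 0 < r^-1 by rewrite invr_gt0.
pose p : pt := - (r^-1 *: x0); have C := C11_affine p r^-1 Cf.
have pz z : p + r^-1 *: z = r^-1 *: (z - x0) by rewrite /p scalerBr addrC.
have sz z : r * s <= `|z - x0| -> s <= `|p + r^-1 *: z|.
 by rewrite pz normrZ gtr0_norm// -ler_pdivrMl ?invr_gt0// invrK.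
have H := HT _ _ _ M C _ (fun z => fM _).
have {}H := H (fun z h => And3 (sf _ (sz z h)) (etrans (congr1 _ (s1 _ (sz z h))) (mulr0 _)) (etrans (congr1 _ (s2 _ (sz z h))) (mulr0 _))).
have [B [B0 hB]] : exists B : R, 0 <= B /\ forall z, nm (f1 z) <= B /\ nm (f2 z) <= B.
 have [B [B0 hB]] := C11_bound s Cf; exists B; split=> // z.
 have [zs|zs] := leP `|z| s; first by have [_ h1 h2] := hB z zs.
 by rewrite s1 ?s2 ?(ltW zs)// nm0.
have [ma mb mc] := C11_cmeas C.
have rc : nm (r^-1)%:C = r^-1 :> R by rewrite nmR gtr0_norm.
have q1 z : nm ((r^-1)%:C * f1 (p + r^-1 *: z)) <= r^-1 * B.
 by rewrite nmM rc ler_pM2l//; case: (hB (p + r^-1 *: z)).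
have q2 z : nm ((r^-1)%:C * f2 (p + r^-1 *: z)) <= r^-1 * B.
 by rewrite nmM rc ler_pM2l//; case: (hB (p + r^-1 *: z)).
have [LI _] := Lf_L1 La Lb mb mc q1 q2.
have E : Lf (fun y => a (x0 + r *: y)) (fun y => b (x0 + r *: y)) f1 f2 =
  (r^-1)%:C * Lf a b (fun z => (r^-1)%:C * f1 (p + r^-1 *: z)) (fun z => (r^-1)%:C * f2 (p + r^-1 *: z)).
 have rE : (r^-1)%:C = r%:C * (r ^- 2)%:C :> R[i] by rewrite -rmorphM; congr (_%:C); field.
 rewrite [X in _ = X * _]rE -mulrA -(cI_affine x0 rN LI) -cIZ; last exact: (cL1_affine x0 rN LI).
 apply: cI_eq => y; rewrite pz (addrC x0) addrK scalerA mulVf// scale1r.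
 have : r%:C * (r^-1)%:C = 1 :> R[i] by rewrite -rmorphM divff.
 move: (r%:C) (r^-1)%:C (a _) (b _) (f1 y) (f2 y) => u v w x y1 y2 uv.
 by transitivity ((u * v) * (w * (y1 + iC * y2) - x * (y1 - iC * y2))); [rewrite uv mul1r|ring].
rewrite E nmM rc (mulrC T) -mulrA ler_pM2l//; exact: H.
Qed.

(** Rescaling to radius 1 with [d ^+ 2 = D / r ^+ 2]. When [D] exceeds [r ^+ 2], the area [4 r^2] of
    the ball is already a sufficient bound for the truncated deviation. *)
Lemma local_est : exists C : R, 0 <= C /\ forall a b (x0 : pt) (r T D : R),
 cL1 a -> cL1 b -> 0 < r -> 0 <= T -> Tball x0 (r * 9) a b T -> 0 < D ->
 I2 (fun x => HH a b x * \1_(ball x0 (r * 9)) x) + T ^+ 2 <= D ->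
 exists c : R[i], nm c = 1 /\ I2 (fun x => dev a c x * \1_(ball x0 r) x) <= C * D.
Proof.
have [C [C0 hC]] := @interior_core R; exists (C + 4); split; first exact: addr_ge0.
move=> a b x0 r T D La Lb r0 T0 HT D0 hD; have rN : r != 0 by rewrite gt_eqF.
have rr0 : 0 < r ^+ 2 by rewrite exprn_gt0.
have [Dr|Dr] := leP D (r ^+ 2); last first.
 exists 1; split; first exact: nm1.
 apply: (le_trans (dev_le_area 1 (cL1_meas La) (mball2 x0 r) (L1_ball x0 r))).
 rewrite I2_ball ?(ltW r0)// exprMn mulrDl (_ : 2 ^+ 2 = 4 :> R); last by rewrite -natrX.
 apply: (@le_trans _ _ (4 * D)); first by rewrite ler_pM2l// ltW.
 by rewrite lerDr mulr_ge0// ltW.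
pose d := Num.sqrt D / r.
have d0 : 0 < d by rewrite /d divr_gt0// sqrtr_gt0.
have dd : d ^+ 2 = r ^- 2 * D by rewrite /d exprMn sqr_sqrtr ?(ltW D0)// exprVn mulrC.
have d1 : d <= 1.
 by rewrite -(@ler_pXn2r _ 2) ?nnegrE ?(ltW d0)// dd expr1n mulrC ler_pdivrMr// mul1r.
have Td : T / r <= d.
 rewrite /d ler_pM2r ?invr_gt0// -(@ler_pXn2r _ 2) ?nnegrE ?sqrtr_ge0// sqr_sqrtr ?(ltW D0)//.
 by apply: le_trans hD; rewrite lerDr; apply: I2_ge0 => x; rewrite mulr_ge0 ?HH_ge0//; case/andP: (ind_itv (ball x0 (r * 9)) x).
have LG := HH_L1 La Lb (mball2 x0 (r * 9)) (L1_ball x0 (r * 9)).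
have HL : Lbd 9 (fun y => a (x0 + r *: y)) (fun y => b (x0 + r *: y)) d.
 move=> f f1 f2 M Tf fM; apply: (le_trans (Lbd_scale r0 La Lb HT Tf fM)).
 apply: ler_wpM2r => //; exact: le_trans (nm_ge0 (f 0)) (fM 0).
have HI : I2 (fun x : pt => (m1 (nm (b (x0 + r *: x))) + m1 `|nm (a (x0 + r *: x)) - 1|) * \1_(ball 0 9) x) <= d ^+ 2.
 have := I2_affine x0 rN LG; rewrite (_ : (fun x : pt => _) = (fun x : pt => HH a b (x0 + r *: x) * \1_(ball 0 9) x)).
  move=> ->; rewrite dd ler_pM2l ?invr_gt0//; apply: le_trans hD; by rewrite lerDl sqr_ge0.
 by apply/funext => x; rewrite ind_affine.
have [c [cc hc]] := hC _ _ _ (cL1_affine x0 rN La) (cL1_affine x0 rN Lb) d0 d1 HL HI.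
exists c; split=> //.
have LD := dev_L1 c (cL1_meas La) (mball2 x0 r) (L1_ball x0 r).
have := I2_affine x0 rN LD; rewrite (_ : (fun x : pt => _) = (fun x : pt => tr (nm (a (x0 + r *: x) - c)) ^+ 2 * \1_(ball 0 1) x)); last first.
 by apply/funext => x; rewrite -[X in ball x0 X](mulr1 r) ind_affine.
move=> E; rewrite E dd mulrCA ler_pM2l ?invr_gt0// in hc.
by apply: (le_trans hc); rewrite ler_wpM2r ?(ltW D0)// lerDl.
Qed.
End Local.

(** * Families of balls and gluing *)

Section Packing.
Context {R : realType}.
Local Notation pt := (R * R)%type.
Implicit Types (a b : pt -> R[i]).

Lemma cball_compact (x : pt) (r : R) : compact [set z : pt | `|z - x| <= r].
Proof.
have -> : [set z : pt | `|z - x| <= r] = `[x.1 - r, x.1 + r]%classic `*` `[x.2 - r, x.2 + r]%classic.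
 apply/seteqP; split=> z /=; rewrite !in_itv /=.
  by move=> /norm_ptP[/= h1 h2]; split; rewrite -ler_distl.
 by rewrite -!ler_distl => -[h1 h2]; apply/norm_ptP.
apply: compact_setX; exact: segment_compact.
Qed.

Lemma le_homog (X T M : R) : 0 <= T -> (forall N, M < N -> X <= T * N) -> X <= T * M.
Proof.
move=> T0 h; apply/ler_addgt0Pr => t t0; have T1 : 0 < T + 1 by rewrite ltr_wpDl.
have := h (M + t / (T + 1)); rewrite ltrDl divr_gt0// => /(_ isT) h'; apply: (le_trans h').
rewrite mulrDr lerD2l mulrCA -[leRHS]mulr1 ler_wpM2l ?(ltW t0)//.
by rewrite ler_pdivrMr// mul1r lerDl.
Qed.

Definition tball (x0 : pt) (r : R) (f f1 f2 : pt -> R[i]) := C11 f f1 f2 /\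
 forall z : pt, r <= `|z - x0| -> [/\ f z = 0, f1 z = 0 & f2 z = 0].

Lemma tball_TF x0 r f f1 f2 : tball x0 r f f1 f2 -> TF (`|x0| + r) f f1 f2.
Proof.
move=> [C h]; have k z : `|x0| + r <= `|z| -> r <= `|z - x0|.
 by have := ler_normD (z - x0) x0; rewrite subrK; lra.
by split=> // z /k /h[].
Qed.

Lemma tball_Z x0 r f f1 f2 (c : R[i]) : tball x0 r f f1 f2 ->
 tball x0 r (fun z => c * f z) (fun z => c * f1 z) (fun z => c * f2 z).
Proof. by move=> [C h]; split=> [|z /h[-> -> ->]]; [exact: C11_Z|rewrite !mulr0]. Qed.

Lemma tball_spt (O : set pt) (x0 : pt) (r s : R) f f1 f2 : r < s -> ball x0 s `<=` O ->
 tball x0 r f f1 f2 -> spt_in O f.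
Proof.
move=> rs BO [_ h]; exists [set z : pt | `|z - x0| <= (r + s) / 2], ((s - r) / 2); split.
- exact: cball_compact.
- move=> z /= hz; apply: BO; rewrite -ball_normE /ball_ /= distrC; lra.
- lra.
- move=> x y xy fy /=; have yr : `|y - x0| < r by rewrite ltNge; apply/negP => /h[].
 by have := ler_normD (x - y) (y - x0); rewrite addrA subrK; lra.
Qed.

Lemma TF_Lf_L1 r a b f f1 f2 : 0 <= r -> cL1 a -> cL1 b -> TF r f f1 f2 ->
 cL1 (fun x => a x * (f1 x + iC * f2 x) - b x * (f1 x - iC * f2 x)).
Proof.
move=> r0 La Lb Tf; have [L [L0 hL]] := TF_glip r0 Tf; have n1 : `|0 : pt| <= 1 by rewrite normr0.
have [Cf _ _ _] := Tf; have [_ m1 m2] := C11_cmeas Cf.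
have h1 x : nm (f1 x) <= L by case: (hL x 0 n1).
have h2 x : nm (f2 x) <= L by case: (hL x 0 n1).
exact: (proj1 (Lf_L1 La Lb m1 m2 h1 h2)).
Qed.

Lemma Lf_lin r a b f f1 f2 g g1 g2 (w : R[i]) : 0 <= r -> cL1 a -> cL1 b -> TF r f f1 f2 -> TF r g g1 g2 ->
 Lf a b (fun z => w * f1 z + g1 z) (fun z => w * f2 z + g2 z) = w * Lf a b f1 f2 + Lf a b g1 g2.
Proof.
move=> r0 La Lb Tf Tg; have L1' := TF_Lf_L1 r0 La Lb Tf; have L2' := TF_Lf_L1 r0 La Lb Tg.
rewrite /Lf -(cIZ w L1') -(cID (cL1Z w L1') L2'); apply: cI_eq => x; ring.
Qed.

Lemma Lf_scale r a b f f1 f2 (w : R[i]) : 0 <= r -> cL1 a -> cL1 b -> TF r f f1 f2 ->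
 Lf a b (fun z => w * f1 z) (fun z => w * f2 z) = w * Lf a b f1 f2.
Proof.
move=> r0 La Lb Tf; rewrite /Lf -(cIZ w (TF_Lf_L1 r0 La Lb Tf)); apply: cI_eq => x; ring.
Qed.

Section Data.
Variables (O : set pt) (a b : pt -> R[i]) (T : R).
Hypotheses (La : cL1 a) (Lb : cL1 b) (T0 : 0 <= T) (HT : Lbd_on O a b T).

(** The supremum of these values plays the role of the variation of the curl on the ball. *)
Definition Tset (x0 : pt) (r : R) : set R := [set t : R | exists f f1 f2, tball x0 r f f1 f2 /\
 bdd f 1 /\ t = nm (Lf a b f1 f2)].
Definition Tsup (x0 : pt) (r : R) : R := sup (Tset x0 r).

Lemma Tset0 x0 r : Tset x0 r 0.
Proof.
exists (fun _ => 0), (fun _ => 0), (fun _ => 0); split; last split.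
- split=> //; exact: C11_cst.
- by move=> z; rewrite nm0.
- by rewrite /Lf (@cI_eq _ _ (fun _ => 0)) ?cI0 ?nm0// => x; ring.
Qed.

Lemma Tset_ub (x0 : pt) (r s : R) : 0 < r -> r < s -> ball x0 s `<=` O -> ubound (Tset x0 r) T.
Proof.
move=> r0 rs BO t [f [f1 [f2 [tf [h1 ->]]]]]; rewrite -[leRHS]mulr1.
apply: (HT _ (tball_TF tf) (tball_spt rs BO tf) h1); by rewrite addr_ge0// ltW.
Qed.

Lemma Tsup_itv (x0 : pt) (r s : R) : 0 < r -> r < s -> ball x0 s `<=` O -> 0 <= Tsup x0 r <= T.
Proof.
move=> r0 rs BO; have U := Tset_ub r0 rs BO; apply/andP; split.
 by apply: ub_le_sup (Tset0 x0 r); exists T.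
apply: ge_sup U; exists 0; exact: Tset0.
Qed.

Lemma Tsup_Tball (x0 : pt) (r s : R) : 0 < r -> r < s -> ball x0 s `<=` O -> Tball x0 r a b (Tsup x0 r).
Proof.
move=> r0 rs BO f f1 f2 M Cf sf fM; have U := Tset_ub r0 rs BO.
have /andP[S0 _] := Tsup_itv r0 rs BO; apply: le_homog => // N MN.
have M0 : 0 <= M by apply: le_trans (fM 0); exact: nm_ge0.
have N0 : 0 < N by exact: le_lt_trans MN.
have tf : tball x0 r f f1 f2 by [].
have R0 : 0 <= `|x0| + r by rewrite addr_ge0// ltW.
rewrite mulrC -ler_pdivrMl//; apply: ub_le_sup; first by exists T.
exists (fun z => (N^-1)%:C * f z), (fun z => (N^-1)%:C * f1 z), (fun z => (N^-1)%:C * f2 z); split; last split.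
- exact: tball_Z.
- move=> z; rewrite nmM nmR gtr0_norm ?invr_gt0// ler_pdivrMl// mulr1; exact: le_trans (fM z) (ltW MN).
- by rewrite (Lf_scale _ R0 La Lb (tball_TF tf)) nmM nmR gtr0_norm ?invr_gt0.
Qed.

Lemma spt_add f g (w : R[i]) : spt_in O f -> spt_in O g -> spt_in O (fun z => w * f z + g z).
Proof.
move=> [K [e [cK KO e0 hK]]] [K' [e' [cK' KO' e0' hK']]].
exists (K `|` K'), (Num.min e e'); split.
- exact: compactU.
- by move=> z [/KO|/KO'].
- by rewrite lt_min e0.
- move=> x y; rewrite le_min => /andP[h h'] n.
 have [f0|/eqP f0] := eqVneq (f y) 0; last by left; exact: hK h f0.
 have [g0|/eqP g0] := eqVneq (g y) 0; last by right; exact: hK' h' g0.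
 by case: n; rewrite f0 g0 mulr0 addr0.
Qed.

(** Factor 10 against the 9 of the local test functions: the margin gives their supports a
    neighbourhood inside [O], as [spt_in] demands. *)
Definition qb (q : pt * R) := ball q.1 (q.2 * 10).

(* Near-optimal test functions on the balls, rotated so that their pairings are nonnegative, are added. *)
Lemma Tsup_sum_test (s : seq (pt * R)) (eta : R) : 0 < eta -> (forall q, q \in s -> 0 < q.2 /\ qb q `<=` O) ->
 exists r F F1 F2 (x : R), [/\ 0 <= r, TF r F F1 F2 &
  [/\ spt_in O F, forall y, nm (F y) <= \sum_(q <- s) \1_(qb q) y &
  Lf a b F1 F2 = x%:C /\ \sum_(q <- s) Tsup q.1 (q.2 * 9) <= x + eta * (size s)%:R]].
Proof.
move=> eta0; elim: s => [|q s ih] hs.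
 exists 0, (fun _ => 0), (fun _ => 0), (fun _ => 0), 0; split => //.
  split=> //; exact: C11_cst.
 split.
 - exists set0, 1; split=> //; exact: compact0.
 - by move=> y; rewrite big_nil nm0.
 - split; last by rewrite big_nil mulr0 addr0.
  by rewrite /Lf (@cI_eq _ _ (fun _ => 0)) ?cI0 => // x; ring.
have [q0 qO] := hs q (mem_head q s).
have [r [F [F1 [F2 [x [r0 TFF [sF bF [EF hx]]]]]]]] := ih (fun p ps => hs p (mem_behead (s := q :: s) ps)).
have q9 : 0 < q.2 * 9 by rewrite mulr_gt0.
have q910 : q.2 * 9 < q.2 * 10 by rewrite ltr_pM2l// ltr_nat.
have U := Tset_ub q9 q910 qO.
have hsup : has_sup (Tset q.1 (q.2 * 9)) by split; [exists 0; exact: Tset0|exists T].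
have [_ [f [f1 [f2 [tf [fb ->]]]]] hf] := sup_adherent eta0 hsup.
have [w [w1 we _]] := nm_phase (Lf a b f1 f2).
have R0 : 0 <= `|q.1| + q.2 * 9 by rewrite addr_ge0// ltW.
pose r' := Num.max r (`|q.1| + q.2 * 9).
have r'0 : 0 <= r' by rewrite le_max r0.
have Tf' : TF r' f f1 f2 by apply: TF_W (tball_TF tf); rewrite le_max lexx orbT.
have TF' : TF r' F F1 F2 by apply: TF_W TFF; rewrite le_max lexx.
exists r', (fun z => w * f z + F z), (fun z => w * f1 z + F1 z), (fun z => w * f2 z + F2 z).
exists (nm (Lf a b f1 f2) + x); split=> //.
 have [C s0 s1 s2] := Tf'; have [C' s0' s1' s2'] := TF'.
 by split; [exact: C11_D (C11_Z w C) C'|apply: suppD => //; exact: suppMr..].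
split.
- exact: spt_add (tball_spt q910 qO tf) sF.
- move=> y; rewrite big_cons; apply: le_nmD => //; rewrite nmM.
 have [yb|yb] := pselect (qb q y); first by rewrite ind_in// mulr_ile1 ?nm_ge0.
 rewrite ind_out//; have [_ tf2] := tf; have [|-> _ _] := tf2 y; last by rewrite nm0 mulr0.
 rewrite leNgt; apply/negP => h; apply: yb; rewrite /qb -ball_normE /ball_ /= distrC; exact: lt_trans q910.
- rewrite (Lf_lin _ r'0 La Lb Tf' TF') we EF -rmorphD; split=> //.
 have hf' : Tsup q.1 (q.2 * 9) - eta < nm (Lf a b f1 f2) := hf.
 rewrite big_cons -[size _]/((size s).+1) -[(size s).+1%:R]natr1 [eta * _]mulrDr mulr1.
 move: (\sum_(_ <- s) _) (Tsup _ _) (nm _) (eta * _) hf' hx => u v y z; lra.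
Qed.

Lemma Tsup_sum (s : seq (pt * R)) (N : R) : (forall q, q \in s -> 0 < q.2 /\ qb q `<=` O) ->
 (forall y, \sum_(q <- s) \1_(qb q) y <= N) -> \sum_(q <- s) Tsup q.1 (q.2 * 9) <= T * N.
Proof.
move=> hs hN; apply/ler_addgt0Pr => t t0; pose eta := t / ((size s)%:R + 1).
have s1 : 0 < (size s)%:R + 1 :> R by rewrite ltr_wpDl.
have eta0 : 0 < eta by rewrite divr_gt0.
have et : eta * (size s)%:R <= t.
 rewrite /eta mulrAC ler_pdivrMr// ler_pM2l// lerDl; exact: ler01.
have [r [F [F1 [F2 [x [r0 TFF [sF bF [EF hx]]]]]]]] := Tsup_sum_test eta0 hs.
rewrite (@le_trans _ _ (x + eta * (size s)%:R))//; apply: lerD => //.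
have := HT r0 TFF sF (fun y => le_trans (bF y) (hN y)).
rewrite EF nmR; exact: le_trans (ler_norm _).
Qed.
End Data.

Definition data (O : set pt) (a b : pt -> R[i]) (D : R) := [/\ cL1 a, cL1 b, 0 < D &
 exists T : R, [/\ 0 <= T, Lbd_on O a b T & I2 (fun x => HH a b x * \1_O x) + T ^+ 2 <= D]].

(** Local variations add up under bounded overlap, and [sum Tsup^2 <= T * sum Tsup <= N * T^2], so
    the squared curl terms of the local estimates add up too, with a constant independent of the
    number of balls. *)
Lemma packing (N : nat) : exists C : R, 0 <= C /\ forall (O : set pt) a b (D : R),
 measurable O -> L1 (\1_O) -> data O a b D -> forall s : seq (pt * R),
 (forall q, q \in s -> 0 < q.2 /\ qb q `<=` O) -> (forall y, \sum_(q <- s) \1_(qb q) y <= N%:R :> R) ->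
 exists c : pt * R -> R[i], (forall q, q \in s -> nm (c q) = 1) /\
  \sum_(q <- s) I2 (fun x => dev a (c q) x * \1_(ball q.1 q.2) x) <= C * D.
Proof.
have [C [C0 hC]] := @local_est R; exists (C * (N%:R + 1)); split; first by rewrite mulr_ge0.
move=> O a b D mO LO [La Lb D0 [T [T0 HT hD]]] s hs hN.
(* A small slack per ball: [local_est] asks for a positive right-hand side, and both local terms may
   vanish. *)
pose sl := D / ((size s)%:R + 1).
have s1 : 0 < (size s)%:R + 1 :> R by rewrite ltr_wpDl.
have sl0 : 0 < sl by rewrite divr_gt0.
have slD : sl * (size s)%:R <= D by rewrite /sl mulrAC ler_pdivrMr// ler_pM2l// lerDl; exact: ler01.
pose E (q : pt * R) : R := I2 (fun x => HH a b x * \1_(ball q.1 (q.2 * 9)) x) + Tsup a b q.1 (q.2 * 9) ^+ 2 + sl.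
have q910 (q : pt * R) : 0 < q.2 -> 0 < q.2 * 9 /\ q.2 * 9 < q.2 * 10.
 by move=> q0; rewrite mulr_gt0//; split=> //; rewrite ltr_pM2l// ltr_nat.
have ex q : exists c : R[i], q \in s -> nm c = 1 /\ I2 (fun x => dev a c x * \1_(ball q.1 q.2) x) <= C * E q.
 have [qs|qs] := boolP (q \in s); last by exists 0.
 have [q0 qO] := hs q qs; have [q9 q99] := q910 q q0.
 have /andP[S0 _] := Tsup_itv HT q9 q99 qO.
 have E0 : 0 < E q.
  rewrite /E ltr_wpDl// addr_ge0 ?sqr_ge0//; apply: I2_ge0 => x.
  by rewrite mulr_ge0 ?HH_ge0//; case/andP: (ind_itv (ball q.1 (q.2 * 9)) x).
 have [|c hc] := hC a b q.1 q.2 _ (E q) La Lb q0 S0 (Tsup_Tball La Lb HT q9 q99 qO) E0; last by exists c.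
 by rewrite /E lerDl ltW.
have [c hc] := choice ex; exists c; split=> [q qs|]; first by case: (hc q qs).
apply: (@le_trans _ _ (\sum_(q <- s) C * E q)).
 by rewrite big_seq [leRHS]big_seq; apply: ler_sum => q qs; case: (hc q qs).
rewrite -mulr_sumr -mulrA ler_wpM2l// /E !big_split /=.
have L9 (q : pt * R) : L1 (fun x => HH a b x * \1_(ball q.1 (q.2 * 9)) x) by apply: HH_L1 => //; [exact: mball2|exact: L1_ball].
have LHO := HH_L1 La Lb mO LO.
have h1 : \sum_(q <- s) I2 (fun x => HH a b x * \1_(ball q.1 (q.2 * 9)) x) <= N%:R * I2 (fun x => HH a b x * \1_O x).
 rewrite -(I2_sum s L9) -I2Z//; apply: I2_le; [exact: L1_sum|exact: L1Z|].
 move=> x; have H0 := HH_ge0 a b x.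
 have [xO|xO] := pselect (O x).
  rewrite (ind_in xO) mulr1 -mulr_sumr mulrC ler_wpM2r//; apply: le_trans (hN x).
  apply: ler_sum => q _; have [xb|xb] := pselect (ball q.1 (q.2 * 9) x); last first.
   by rewrite (ind_out xb); case/andP: (ind_itv (qb q) x).
  have [q0|q0] := ltP 0 q.2; last first.
   move: xb; rewrite -ball_normE /ball_ /= => h; have := le_lt_trans (normr_ge0 _) h; rewrite pmulr_lgt0//.
   by rewrite ltNge q0.
  rewrite (ind_in xb) ind_in// /qb; move: xb; rewrite -!ball_normE /ball_ /= => h; apply: (lt_trans h).
  by case: (q910 q q0).
 rewrite (ind_out xO) !mulr0 big_seq big1// => q qs; have [q0 qO] := hs q qs.
 rewrite ind_out ?mulr0// => xb; apply: xO; apply: qO; rewrite /qb; move: xb; rewrite -!ball_normE /ball_ /= => h.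
 by apply: (lt_trans h); case: (q910 q q0).
have h2 : \sum_(q <- s) Tsup a b q.1 (q.2 * 9) ^+ 2 <= N%:R * T ^+ 2.
 apply: (@le_trans _ _ (\sum_(q <- s) T * Tsup a b q.1 (q.2 * 9))).
  rewrite big_seq [leRHS]big_seq; apply: ler_sum => q qs; have [q0 qO] := hs q qs; have [q9 q99] := q910 q q0.
  by have /andP[S0 S1] := Tsup_itv HT q9 q99 qO; rewrite expr2 ler_wpM2r.
 rewrite -mulr_sumr (_ : N%:R * T ^+ 2 = T * (T * N%:R)); last by ring.
 have TS := @Tsup_sum _ _ _ _ La Lb HT s (N%:R) hs hN.
 exact: ler_wpM2l.
have h3 : \sum_(q <- s) sl = sl * (size s)%:R by rewrite big_const_seq count_predT iter_addr_0 mulr_natr.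
have h4 := ler_wpM2l (ler0n R N) hD.
rewrite h3; move: h1 h2 h4 slD; move: (\sum_(_ <- s) _) (\sum_(_ <- s) _) (I2 _) (T ^+ 2) (sl * _) (N%:R) => u v i t z n h1 h2 h4 h5.
lra.
Qed.
End Packing.

(* The join of pointed and topological structures on products, needed by [compact_cover]. *)
HB.saturate prod.

(** * Sets carrying the estimate: gluing, paths and compactness *)

Section Good.
Context {R : realType}.
Local Notation pt := (R * R)%type.
Implicit Types (a b : pt -> R[i]).

Lemma sq_addw (t x y z : R) : 0 < t -> 0 <= x -> x <= y + z -> x ^+ 2 <= (1 + t) * y ^+ 2 + (1 + t^-1) * z ^+ 2.
Proof.
move=> t0 x0 xyz; have h : x ^+ 2 <= (y + z) ^+ 2 by rewrite ler_pXn2r ?nnegrE//; lra.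
apply: (le_trans h); rewrite -subr_ge0.
have -> : (1 + t) * y ^+ 2 + (1 + t^-1) * z ^+ 2 - (y + z) ^+ 2 = (t * y - z) ^+ 2 / t by field; rewrite gt_eqF.
by rewrite divr_ge0 ?sqr_ge0// ltW.
Qed.

Lemma tr_sqw (t : R) (u v : R[i]) : 0 < t ->
 tr (nm (u + v)) ^+ 2 <= (1 + t) * tr (nm u) ^+ 2 + (1 + t^-1) * tr (nm v) ^+ 2.
Proof. by move=> t0; apply: sq_addw => //; [exact: tr_ge0 (nm_ge0 _)|exact: tr_nmD]. Qed.

Lemma tr_sq2 (u v : R[i]) : tr (nm (u + v)) ^+ 2 <= 2 * tr (nm u) ^+ 2 + 2 * tr (nm v) ^+ 2.
Proof. by have := tr_sqw u v (@ltr01 R); rewrite invr1. Qed.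

Lemma dev_cst a (c c' : R[i]) x : tr (nm (c - c')) ^+ 2 <= 2 * dev a c x + 2 * dev a c' x.
Proof.
rewrite (_ : c - c' = - (a x - c) + (a x - c')); last by ring.
by apply: (le_trans (tr_sq2 _ _)); rewrite nmN.
Qed.

Lemma dev_change a (c c' : R[i]) x : dev a c x <= 2 * dev a c' x + 2 * tr (nm (c - c')) ^+ 2.
Proof.
rewrite /dev (_ : a x - c = (a x - c') + - (c - c')); last by ring.
by apply: (le_trans (tr_sq2 _ _)); rewrite nmN.
Qed.

Section Domain.
Variable O : set pt.
Hypotheses (oO : open O) (LO : L1 (\1_O)).

Lemma sub_L1 (A : set pt) : measurable A -> A `<=` O -> L1 (\1_A).
Proof.
move=> mA AO; apply: (L1_dom _ LO); first exact: mindic.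
move=> x; have [xA|xA] := pselect (A x); first by rewrite (ind_in xA) (ind_in (AO _ xA)) normr1.
by rewrite (ind_out xA) normr0; case/andP: (ind_itv O x).
Qed.

Definition est (W : set pt) (C : R) := forall a b (D : R), data O a b D -> exists c : R[i], nm c = 1 /\
 I2 (fun x => dev a c x * \1_W x) <= C * D.

Definition good (W : set pt) := [/\ open W, W `<=` O & exists C : R, 0 <= C /\ est W C].

Lemma good_sub (V W : set pt) : open V -> V `<=` W -> good W -> good V.
Proof.
move=> oV VW [oW WO [C [C0 hC]]]; split=> //; first exact: subset_trans WO.
exists C; split=> // a b D dD; have [c [cc hc]] := hC a b D dD; exists c; split=> //; apply: le_trans hc.
have [La _ _ _] := dD.
apply: I2_le0.
- by apply: measurable_funM; [exact: dev_meas (cL1_meas La)|apply: mindic; exact: open2_meas].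
- by apply: dev_L1; [exact: cL1_meas|exact: open2_meas|apply: sub_L1 => //; exact: open2_meas].
- move=> x; have d0 := dev_ge0 a c x; have [xV|xV] := pselect (V x).
  by rewrite (ind_in xV) (ind_in (VW _ xV)) mulr1 d0 lexx.
 by rewrite (ind_out xV) mulr0 lexx mulr_ge0//; case/andP: (ind_itv W x).
Qed.

Lemma good_ball (x : pt) (r : R) : 0 < r -> ball x (r * 10) `<=` O -> good (ball x r).
Proof.
move=> r0 BO; have r10 : r <= r * 10 by rewrite ler_peMr ?(ltW r0)// (ler_nat _ 1 10).
split; [exact: ball_open| |].
 move=> z; rewrite -ball_normE /= => h; apply: BO; rewrite -ball_normE /ball_ /=; exact: lt_le_trans r10.
have [C [C0 hC]] := @packing R 1; exists C; split=> // a b D dD.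
have := hC O a b D (open2_meas oO) LO dD [:: (x, r)].
case=> [q|y|c [c1 hc]]; first by rewrite inE => /eqP ->.
 by rewrite big_seq1; case/andP: (ind_itv (qb (x, r)) y).
by exists (c (x, r)); split; [apply: c1; rewrite inE|rewrite big_seq1 in hc].
Qed.

Lemma open_ball_in (W : set pt) (x : pt) : open W -> W x -> exists r : R, 0 < r /\ ball x r `<=` W.
Proof.
move=> oW Wx; have : nbhs x W by apply: open_nbhs_nbhs; split.
by move=> /nbhs_ballP[r r0 h]; exists r; split.
Qed.

(** The two constants are compared on a ball inside the intersection, where their truncated squared
    distance is bounded by both deviations. The area of that ball enters the new constant, so gluing
    can only be done finitely often. *)
Lemma good_glue (V W : set pt) : good V -> good W -> V `&` W !=set0 -> good (V `|` W).
Proof.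
move=> [oV VO [C [C0 hC]]] [oW WO [C' [C'0 hC']]] [x [Vx Wx]].
have [r [r0 rB]] := open_ball_in (openI oV oW) (conj Vx Wx).
have mV := open2_meas oV; have mW := open2_meas oW.
have LV := sub_L1 mV VO; have LW := sub_L1 mW WO.
split; [exact: openU|by move=> z [/VO|/WO]|].
pose S := (2 * r) ^+ 2; have S0 : 0 < S by rewrite exprn_gt0// mulr_gt0.
pose w : R := I2 (\1_W); have w0 : 0 <= w by apply: I2_ge0 => z; case/andP: (ind_itv W z).
exists (C + (2 * C' + 2 * (w * (2 * C + 2 * C') / S))); split.
 by rewrite !(addr_ge0, mulr_ge0)// ?invr_ge0 ?(ltW S0)// addr_ge0 ?mulr_ge0.
move=> a b D dD; have [c [cc hc]] := hC a b D dD; have [c' [cc' hc']] := hC' a b D dD.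
have [/cL1_meas ma _ D0 _] := dD.
exists c; split=> //; set Q := tr (nm (c - c')) ^+ 2.
have LVc := dev_L1 c ma mV LV; have LWc := dev_L1 c ma mW LW; have LWc' := dev_L1 c' ma mW LW.
have hQ : Q * S <= (2 * C + 2 * C') * D.
 rewrite /S -(I2_ball x (ltW r0)) -(I2Z Q (L1_ball x r)).
 apply: (@le_trans _ _ (I2 (fun z => 2 * (dev a c z * \1_V z) + 2 * (dev a c' z * \1_W z)))).
  apply: I2_le; [exact: L1Z (L1_ball x r)|exact: L1D (L1Z _ LVc) (L1Z _ LWc')|].
  move=> z; have [zb|zb] := pselect (ball x r z).
   have [zV zW] := rB z zb; rewrite (ind_in zb) (ind_in zV) (ind_in zW) !mulr1; exact: dev_cst.
  have v0 := ind_ge0 V z; have /andP[w0' _] := ind_itv W z.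
  by rewrite (ind_out zb) mulr0 addr_ge0// mulr_ge0// mulr_ge0// dev_ge0.
 rewrite (I2D (L1Z _ LVc) (L1Z _ LWc')) (I2Z _ LVc) (I2Z _ LWc').
 rewrite (_ : (2 * C + 2 * C') * D = 2 * (C * D) + 2 * (C' * D)); last by ring.
 by apply: lerD; apply: ler_wpM2l.
have hW : I2 (fun z => dev a c z * \1_W z) <= 2 * (C' * D) + 2 * (w * Q).
 apply: (@le_trans _ _ (I2 (fun z => 2 * (dev a c' z * \1_W z) + 2 * Q * \1_W z))).
  apply: I2_le; [exact: LWc|exact: L1D (L1Z _ LWc') (L1Z _ LW)|].
  move=> z; have /andP[w0' _] := ind_itv W z.
  rewrite mulrA -mulrDl ler_wpM2r//; exact: dev_change.
 rewrite (I2D (L1Z _ LWc') (L1Z _ LW)) (I2Z _ LWc') (I2Z _ LW) -/w -mulrA (mulrC Q w) lerD2r.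
 exact: ler_wpM2l.
have hU : I2 (fun z => dev a c z * \1_(V `|` W) z) <= C * D + I2 (fun z => dev a c z * \1_W z).
 apply: (@le_trans _ _ (I2 (fun z => dev a c z * \1_V z + dev a c z * \1_W z))).
  apply: I2_le0; [|exact: L1D|].
   by apply: measurable_funM; [exact: dev_meas|apply: mindic; exact: measurableU].
  move=> z; have d0 := dev_ge0 a c z; have v0 := ind_ge0 V z; have /andP[w0' _] := ind_itv W z.
  have /andP[u0 u1] := ind_itv (V `|` W) z; rewrite mulr_ge0//= -mulrDr ler_wpM2l//.
  have [[zV|zW]|zU] := pselect ((V `|` W) z); last by rewrite (ind_out zU) addr_ge0.
   by apply: (le_trans u1); rewrite (ind_in zV) lerDl.
  by apply: (le_trans u1); rewrite (ind_in zW) lerDr.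
 by rewrite I2D// lerD2r.
have -> : (C + (2 * C' + 2 * (w * (2 * C + 2 * C') / S))) * D =
 C * D + (2 * (C' * D) + 2 * (w * ((2 * C + 2 * C') * D / S))) by ring.
apply: (le_trans hU); rewrite lerD2l; apply: (le_trans hW); rewrite lerD2l ler_pM2l// ler_wpM2l//.
by rewrite ler_pdivlMr.
Qed.

Lemma good_point (x : pt) : O x -> exists r : R, 0 < r /\ good (ball x r).
Proof.
move=> Ox; have [r [r0 h]] := open_ball_in oO Ox; exists (r / 10); split; first by rewrite divr_gt0.
by apply: good_ball; [rewrite divr_gt0|rewrite divfK].
Qed.

Lemma path_near (g : R -> pt) (t e : R) : {within unit_interval, continuous g} -> unit_interval t -> 0 < e ->
 exists d : R, 0 < d /\ forall s, unit_interval s -> `|s - t| < d -> ball (g t) e (g s).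
Proof.
move=> /subspace_continuousP cg ut e0.
have := cg t ut _ (nbhsx_ballx (g t) e e0); rewrite /= /nbhs /= /within /= => /nbhs_ballP[d /= d0 hd].
by exists d; split=> // s us st; apply: hd => //; rewrite /ball /= distrC.
Qed.

(** The parameters whose point shares a good set with [x] have supremum 1, and it is attained: a
    good ball around the point at the supremum extends the chain past it. *)
Lemma good_path (x y : pt) : path_connected2 O -> O x -> O y -> exists W, [/\ good W, W x & W y].
Proof.
move=> pO Ox Oy; have [g [cg [g0 [g1 gO]]]] := pO x y Ox Oy.
pose A : set R := [set t | unit_interval t /\ exists W, [/\ good W, W x & W (g t)]].
have u0 : unit_interval (0 : R) by rewrite /unit_interval /= lexx ler01.
have u1 : unit_interval (1 : R) by rewrite /unit_interval /= ler01 lexx.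
have Og t : unit_interval t -> O (g t) by move=> ut; apply: gO; exists t.
have A0 : A 0.
 split=> //; have [r [r0 gr]] := good_point Ox; exists (ball x r).
 rewrite g0; split=> //; exact: ballxx.
have Aub : has_ubound A by exists 1 => t [/andP[_ ->]].
have supA : has_sup A by split; [exists 0|].
pose t := sup A.
have ut : unit_interval t.
 apply/andP; split; first exact: ub_le_sup.
 by apply: ge_sup; [exists 0|move=> s [/andP[_ ->]]].
have [r [r0 gr]] := good_point (Og t ut).
have [d [d0 hd]] := path_near cg ut r0.
have [s As ts] := sup_adherent d0 supA; have [us [W [gW Wx Ws]]] := As.
have st : s <= t by exact: ub_le_sup.
have Bs : ball (g t) r (g s) by apply: hd => //; rewrite ler0_norm; move: ts; rewrite -/t; lra.
have gU : good (ball (g t) r `|` W) by apply: good_glue => //; exists (g s).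
have ext v : unit_interval v -> `|v - t| < d -> A v.
 move=> uv vt; split=> //; exists (ball (g t) r `|` W); split=> //; first by right.
 left; exact: hd.
have t1 : t = 1.
 apply/eqP; move: ut => /andP[t0 t1]; rewrite eq_le t1 /= leNgt; apply/negP => tl.
 pose v := Num.min 1 (t + d / 2); have tv : t < v by rewrite /v lt_min tl ltrDl divr_gt0.
 have v1 : v <= 1 by rewrite /v ge_min lexx.
 have vd : v <= t + d / 2 by rewrite /v ge_min lexx orbT.
 have Av : A v.
  by apply: ext; [rewrite /unit_interval /= v1 andbT; lra|rewrite gtr0_norm ?subr_gt0//; lra].
 by have := ub_le_sup Aub Av; rewrite leNgt tv.
have [_ [W' [gW' W'x]]] : A 1 by apply: ext => //; rewrite t1 subrr normr0.
by rewrite g1 => W'y; exists W'.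
Qed.

(** Points of [K] may lie on the boundary, so local sets are taken after intersection with [O].
    Along a finite subcover, each new set is tied to the base point [x0] by a good set following a
    path. *)
Lemma good_compact (K : set pt) : path_connected2 O -> O !=set0 -> compact K -> K `<=` closure O ->
 (forall x, K x -> exists V, [/\ open V, V x & good (V `&` O)]) -> exists W, good W /\ K `&` O `<=` W.
Proof.
move=> pO [x0 Ox0] cK KO hK.
have H x : exists V : set pt, K x -> [/\ open V, V x & good (V `&` O)].
 have [Kx|nK] := pselect (K x); last by exists set0.
 by have [V hV] := hK x Kx; exists V.
have [V hV] := choice H.
have cov : K `<=` cover K V by move=> x Kx; exists x => //; case: (hV x Kx).
have := cK; rewrite compact_cover => /(_ pt K V (fun x Kx => let: And3 h _ _ := hV x Kx in h) cov) [s sK Ks].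
suff [W [gW hW]] : exists W, good W /\ (W x0 /\ forall x, x \in (finmap.enum_fset s) -> V x `&` O `<=` W).
 exists W; split=> // z [Kz Oz]; have [x /= xs Vz] := Ks z Kz.
 apply: (proj2 hW x) => //; exact: xs.
have sK' x : x \in (finmap.enum_fset s) -> K x by move=> xs; have := sK x xs; rewrite inE.
elim: (finmap.enum_fset s) sK' => [|x l ih] lK.
 by have [r [r0 gr]] := good_point Ox0; exists (ball x0 r); split=> //; split=> //; exact: ballxx.
have [W [gW [Wx0 hW]]] := ih (fun y yl => lK y (mem_behead (s := x :: l) yl)).
have Kx := lK x (mem_head x l); have [oV Vx gV] := hV x Kx.
have [z [Oz Vz]] : O `&` V x !=set0 by apply: (KO x Kx); apply: open_nbhs_nbhs; split.
have [P [gP Px0 Pz]] := good_path pO Ox0 Oz.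
have g1 : good (W `|` P) by apply: good_glue => //; exists x0.
have g2 : good ((W `|` P) `|` (V x `&` O)) by apply: good_glue => //; exists z; split=> //; right.
exists ((W `|` P) `|` (V x `&` O)); split=> //; split; first by left; left.
by move=> y; rewrite inE => /orP[/eqP -> w|yl w /(hW y yl)]; [right|left; left].
Qed.
End Domain.
End Good.

(** * Boundary layers *)

Section Layers.
Context {R : realType}.
Local Notation pt := (R * R)%type.
Implicit Types (a b : pt -> R[i]).

(** All solutions lie within [w] of a given one, hence in a window of [2 * w + 1] integers. *)
Lemma count_near (P : nat -> bool) (n w : nat) : (forall i j, P i -> P j -> (i <= j + w)%N) ->
 (size [seq i <- iota 0 n | P i] <= 2 * w + 1)%N.
Proof.
move=> h; case E : [seq i <- iota 0 n | P i] => [|i0 l]; first by rewrite leq0n.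
rewrite -E; have Pi0 : P i0 by have : i0 \in [seq i <- iota 0 n | P i]; [rewrite E mem_head|rewrite mem_filter => /andP[]].
rewrite -(size_iota (i0 - w) (2 * w + 1)); apply: uniq_leq_size; first exact/filter_uniq/iota_uniq.
move=> i; rewrite mem_filter !mem_iota => /andP[Pi _]; have := h _ _ Pi0 Pi; have := h _ _ Pi Pi0; lia.
Qed.

Lemma L1_shift (v : pt) (f : pt -> R) : L1 f -> L1 (fun x => f (x + v)) /\ I2 (fun x => f (x + v)) = I2 f.
Proof.
move=> Lf; have E : (fun x : pt => f (x + v)) = (fun x : pt => f (v + 1 *: x)).
 by apply/funext => x; rewrite scale1r addrC.
rewrite E; split; first by apply: L1_affine => //; exact: oner_neq0.
by rewrite I2_affine ?oner_neq0// expr1n invr1 mul1r.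
Qed.

Lemma sq_sum_le (n : nat) (u : nat -> R) : (\sum_(0 <= m < n) u m) ^+ 2 <= n%:R * \sum_(0 <= m < n) u m ^+ 2.
Proof.
elim: n => [|n ih]; first by rewrite big_geq// expr0n mul0r.
rewrite !big_nat_recr//= -natr1; set s := \sum_(0 <= m < n) u m in ih *; set q := \sum_(0 <= m < n) _ ^+ 2 in ih *.
have [n0|n0] := eqVneq n 0%N.
 by rewrite /s /q n0 !big_geq// !add0r mul1r.
have np : 0 < n%:R :> R by rewrite ltr0n lt0n.
have h : 2 * s * u n <= q + n%:R * u n ^+ 2.
 rewrite -(ler_pM2l np); have := sqr_ge0 (s - n%:R * u n).
 have -> : n%:R * (2 * s * u n) = s ^+ 2 + (n%:R * u n) ^+ 2 - (s - n%:R * u n) ^+ 2 by ring.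
 have -> : n%:R * (q + n%:R * u n ^+ 2) = n%:R * q + (n%:R * u n) ^+ 2 by ring.
 by move: ((s - _) ^+ 2) ((_ * u n) ^+ 2) => x y; lra.
have -> : (s + u n) ^+ 2 = s ^+ 2 + 2 * s * u n + u n ^+ 2 by ring.
have -> : (n%:R + 1) * (q + u n ^+ 2) = n%:R * q + q + n%:R * u n ^+ 2 + u n ^+ 2 by ring.
by move: (2 * s * u n) h => x h; lra.
Qed.

Lemma step_arith (m e u v p q : R) : u + v <= q -> 2 * p <= 3 / 2 * (u + v) + 12 * m * (2 * m * e) ->
 p <= 3 / 4 * q + 12 * m ^+ 2 * e.
Proof.
rewrite (_ : 12 * m * (2 * m * e) = 24 * (m ^+ 2 * e)); last by ring.
by rewrite -(mulrA 12); move: (m ^+ 2 * e) => z; lra.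
Qed.

Lemma tr_chain (z : nat -> R[i]) (n : nat) :
 tr (nm (z 0%N - z n)) ^+ 2 <= n%:R * \sum_(0 <= m < n) tr (nm (z m - z m.+1)) ^+ 2.
Proof.
apply: le_trans (sq_sum_le n (fun m => tr (nm (z m - z m.+1)))).
rewrite ler_pXn2r ?nnegrE ?tr_ge0 ?nm_ge0//; last by apply: sumr_ge0 => i _; rewrite tr_ge0 ?nm_ge0.
elim: n => [|n ih]; first by rewrite big_geq// subrr nm0 /tr min_r.
rewrite big_nat_recr//= (_ : z 0%N - z n.+1 = (z 0%N - z n) + (z n - z n.+1)); last by ring.
by apply: (le_trans (tr_nmD _ _)); rewrite lerD2r.
Qed.

Section Data.
(** A boundary chart in abstract form: [Sg] is the tangential coordinate, [Hg] the height above the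
    graph and [n] the vertical direction, so that translation along [n] raises the height and leaves
    [Sg] unchanged. *)
Variables (O : set pt) (Sg Hg : pt -> R) (n : pt) (h La B0 : R).
Hypotheses (oO : open O) (LO : L1 (\1_O)) (pO : path_connected2 O) (O0 : O !=set0)
 (h0 : 0 < h) (La0 : 0 <= La)
 (Sn : forall x t, Sg (x + t *: n) = Sg x) (Hn : forall x t, Hg (x + t *: n) = Hg x + t) (n1 : `|n| <= 1)
 (Slip : forall x y, `|Sg x - Sg y| <= 2 * `|x - y|) (Hlip : forall x y, `|Hg x - Hg y| <= La * `|x - y|)
 (inO : forall x, `|Sg x| <= 2 * h -> 0 < Hg x <= 8 * h -> O x)
 (bd : forall x, `|Sg x| <= 2 * h -> 0 < Hg x <= 8 * h -> `|x| <= B0).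

Lemma lip_cont (f : pt -> R) (l : R) : 0 <= l -> (forall x y, `|f x - f y| <= l * `|x - y|) -> continuous f.
Proof.
move=> l0 hf; apply: lip_continuous => r; exists l; split=> // z k _ _.
by apply: (le_trans (hf _ _)); rewrite addrAC subrr add0r.
Qed.

Let cS : continuous Sg. Proof. exact: (lip_cont (ler0n R 2) Slip). Qed.
Let cH : continuous Hg. Proof. exact: (lip_cont La0 Hlip). Qed.

Let h2h (x : R) : x <= h -> x <= 2 * h. Proof. by move=> xh; apply: (le_trans xh); rewrite ler_peMl ?ler1n// ltW. Qed.
Let h28 (x : R) : x <= 2 * h -> x <= 8 * h. Proof. by move=> xh; apply: (le_trans xh); rewrite ler_pM2r// ler_nat. Qed.

Definition lay (u v : R) : set pt := [set x | `|Sg x| < h /\ u < Hg x <= v].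

Lemma lay_meas u v : measurable (lay u v).
Proof.
have -> : lay u v = (setT `&` Sg @^-1` `]-h, h[) `&` (setT `&` Hg @^-1` `]u, v]).
 apply/seteqP; split=> x; rewrite /lay /= !in_itv /=.
  by move=> [sx hx]; rewrite -ltr_norml; split.
 by rewrite -ltr_norml => -[[_ sx] [_ hx]].
by apply: measurableI; [apply: (continuous2_measurable cS)|apply: (continuous2_measurable cH)].
Qed.

Lemma lay_O u v : 0 <= u -> v <= 8 * h -> lay u v `<=` O.
Proof.
by move=> u0 v8 x [/ltW sx /andP[hx1 hx2]]; apply: inO; [rewrite (h2h sx)|rewrite (le_lt_trans u0 hx1) (le_trans hx2)].
Qed.

Lemma lay_L1 u v : 0 <= u -> v <= 8 * h -> L1 (\1_(lay u v)).
Proof. by move=> u0 v8; apply: (sub_L1 LO); [exact: lay_meas|exact: lay_O]. Qed.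

Lemma core_layer : exists W, good O W /\ lay h (2 * h) `<=` W.
Proof.
pose K : set pt := [set x | `|Sg x| <= h /\ h <= Hg x <= 2 * h].
have KO : K `<=` O.
 move=> x [sx /andP[hx1 hx2]]; apply: inO; first by rewrite (h2h sx).
 by rewrite (lt_le_trans h0 hx1) (h28 hx2).
have cK : compact K.
 apply: (@subclosed_compact _ _ [set z : pt | `|z - 0| <= B0]); last 2 first.
 - exact: cball_compact.
 - move=> x [sx /andP[hx1 hx2]] /=; rewrite subr0; apply: bd; first by rewrite (h2h sx).
  by rewrite (lt_le_trans h0 hx1) (h28 hx2).
 have -> : K = (Sg @^-1` `[-h, h]) `&` (Hg @^-1` `[h, 2 * h]).
  by apply/seteqP; split=> x; rewrite /K /= !in_itv /= -ler_norml.
 apply: closedI; apply: preimage_closed => //; exact: interval_closed.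
have [|x Kx|W [gW KW]] := good_compact oO LO pO O0 cK.
- move=> x /KO; exact: subset_closure.
- have [r [r0 gr]] := good_point oO LO (KO x Kx); exists (ball x r); split; [exact: ball_open|exact: ballxx|].
 apply: (good_sub LO _ _ gr); last by move=> z [].
 apply: openI => //; exact: ball_open.
exists W; split=> // x [sx /andP[hx1 hx2]]; apply: KW; split; last by apply: KO; split; rewrite ?hx2 ltW.
by split; rewrite ?hx2 ltW.
Qed.

Definition tau (k : nat) : R := h / 2 ^+ k.
Lemma tau0 k : 0 < tau k. Proof. by rewrite divr_gt0// exprn_gt0. Qed.
Lemma tauS k : tau k = 2 * tau k.+1.
Proof. by rewrite /tau exprS; field; rewrite expf_neq0. Qed.
Lemma tau_le k : tau k <= h.
Proof. by rewrite /tau ler_pdivrMr ?exprn_gt0// ler_peMr ?(ltW h0)// exprn_ege1// ler1n. Qed.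

(** Small enough that moving by [11 * rho k] from height above [tau k] changes the height by less
    than [tau k / 2] and the tangential coordinate by less than [h]: the changes are at most
    [11 / 42] and [22 / 42] of [tau k]. *)
Definition theta : R := (42 * (La + 1))^-1.
Lemma theta0 : 0 < theta. Proof. by rewrite invr_gt0 mulr_gt0// ltr_wpDl. Qed.
Lemma theta_h : 42 * theta <= 1.
Proof.
rewrite /theta invfM mulrA divff// mul1r invf_le1 ?lerDr//; exact: ltr_wpDl.
Qed.
Lemma theta_La : 42 * (La * theta) <= 1.
Proof.
have L1p : 0 < La + 1 by rewrite ltr_wpDl.
rewrite (_ : 42 * (La * theta) = La / (La + 1)); last by rewrite /theta; field; rewrite gt_eqF.
by rewrite ler_pdivrMr// mul1r lerDl.
Qed.

Definition rho k : R := theta * tau k.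
Lemma rho0 k : 0 < rho k. Proof. exact: mulr_gt0 theta0 (tau0 k). Qed.

Lemma near_lay k (y z : pt) : lay (tau k) (4 * tau k) y -> `|z - y| <= 11 * rho k -> (0 < k)%N ->
 [/\ O z, tau k / 2 < Hg z & Hg z < 5 * tau k].
Proof.
move=> [sy /andP[hy1 hy2]] zy k0; have t0 := tau0 k; have th := tau_le k.
have th2 : 2 * tau k <= h by case: k k0 {sy hy1 hy2 zy t0 th} => // k _; rewrite -tauS; exact: tau_le.
have tt := theta_h; have tL := theta_La; have r0 := rho0 k.
have h1 : 42 * rho k <= tau k by rewrite /rho mulrA ler_piMl// ltW.
have h2 : 42 * (La * rho k) <= tau k by rewrite /rho (mulrA La) mulrA ler_piMl// ltW.
have dS : `|Sg z - Sg y| <= 2 * (11 * rho k) by apply: (le_trans (Slip _ _)); rewrite ler_wpM2l.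
have dH : `|Hg z - Hg y| <= 11 * (La * rho k).
 by apply: (le_trans (Hlip _ _)); rewrite mulrCA ler_wpM2l.
move: dS dH; rewrite !ler_norml => /andP[dS1 dS2] /andP[dH1 dH2].
have q0 : 0 <= La * rho k by rewrite mulr_ge0// ltW.
move: sy; rewrite ltr_norml => /andP[sy1 sy2].
split; try lra.
apply: inO; first by rewrite ler_norml; apply/andP; split; lra.
by apply/andP; split; lra.
Qed.

(** A translation by [tau k] is cut into [Mn] steps, a number independent of [k]. Each is shorter
    than [rho k / 2], so both ends of a step lie in a common ball of the grid. *)
Definition Mn : nat := (Num.trunc (2 / theta)).+1.
Definition sig k : R := tau k / Mn%:R.
Lemma Mn0 : 0 < Mn%:R :> R. Proof. by rewrite ltr0n. Qed.
Lemma sig0 k : 0 < sig k. Proof. by rewrite divr_gt0 ?tau0// Mn0. Qed.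
Lemma sig_rho k : sig k < rho k / 2.
Proof.
have t0 := theta0; have := @truncnS_gt R (2 / theta); rewrite -/Mn => hM.
have tk := tau0 k; have h2 : 2 < Mn%:R * theta by rewrite -ltr_pdivrMr.
rewrite /sig ltr_pdivrMr ?Mn0// (_ : rho k / 2 * Mn%:R = Mn%:R * theta / 2 * tau k); last by rewrite /rho; ring.
by rewrite ltr_pMl// ltr_pdivlMr// mul1r.
Qed.

(** A lattice of mesh [rho k / 2], cut to [B] steps on either side of the origin; centres far from
    the layer are discarded, so that the enlarged balls stay in [O]. *)
Definition grid (B k : nat) : seq (pt * R) :=
 [seq q <- [seq (((rho k / 2) * (i%:R - B%:R), (rho k / 2) * (j%:R - B%:R)) : pt, rho k) | i <- iota 0 (2 * B).+1, j <- iota 0 (2 * B).+1] |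
  `[< exists y, lay (tau k) (4 * tau k) y /\ `|y - q.1| <= rho k >]].

Lemma grid_in B k q : (0 < k)%N -> q \in grid B k -> 0 < q.2 /\ qb q `<=` O.
Proof.
move=> k0; rewrite mem_filter => /andP[/asboolP[y [ly yq]] /allpairsP[[i j] /= [_ _ E]]].
rewrite E /= in yq *; split=> [|z]; first exact: rho0.
rewrite /qb -ball_normE /ball_ /= distrC => zq.
have [] // := near_lay ly (_ : `|z - y| <= 11 * rho k) k0.
move: zq yq; set c : pt := (_, _) => zq yq; have := ler_normD (z - c) (c - y); rewrite addrA subrK (distrC c); lra.
Qed.

Lemma grid_height B k q z : (0 < k)%N -> q \in grid B k -> qb q z -> tau k / 2 < Hg z /\ Hg z < 5 * tau k.
Proof.
move=> k0; rewrite mem_filter => /andP[/asboolP[y [ly yq]] /allpairsP[[i j] /= [_ _ E]]].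
rewrite E /= in yq *; rewrite /qb -ball_normE /ball_ /= distrC => zq.
have [] // := near_lay ly (_ : `|z - y| <= 11 * rho k) k0.
move: zq yq; set c : pt := (_, _) => zq yq; have := ler_normD (z - c) (c - y); rewrite addrA subrK (distrC c); lra.
Qed.

Lemma grid1 (e t : R) (B : nat) : 0 < e -> `|t| <= e * B%:R ->
 exists2 i, i \in iota 0 (2 * B).+1 & `|t - e * (i%:R - B%:R)| <= e.
Proof.
move=> e0 tB; pose u := t / e + B%:R.
move: tB; rewrite ler_norml => /andP[t1 t2].
have u0 : 0 <= u by rewrite /u -lerBlDr sub0r ler_pdivlMr// mulNr mulrC.
have u2 : u <= (2 * B)%:R by rewrite /u natrM mulr_natl mulr2n lerD2r ler_pdivrMr// mulrC.
have /andP[i1 i2] := truncn_itv u0; set i := Num.trunc u in i1 i2; exists i.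
 by rewrite mem_iota leq0n add0n ltnS -(ler_nat R) (le_trans i1 u2).
have -> : t - e * (i%:R - B%:R) = e * (u - i%:R) by rewrite /u; field; rewrite gt_eqF.
rewrite normrM (gtr0_norm e0) ler_piMr ?(ltW e0)// ger0_norm ?subr_ge0//.
by move: i2; rewrite -natr1 => i2; rewrite lerBlDl ltW.
Qed.

Lemma grid_cover B k y : B0 <= rho k / 2 * B%:R -> lay (tau k) (4 * tau k) y ->
 4 * tau k <= 8 * h -> exists2 q, q \in grid B k & q.2 = rho k /\ `|y - q.1| <= rho k / 2.
Proof.
move=> hB ly t8; have r20 : 0 < rho k / 2 by rewrite divr_gt0 ?rho0.
have yB : `|y| <= B0.
 move: ly => [/ltW sy /andP[hy1 hy2]]; apply: bd; first exact: h2h.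
 by rewrite (lt_trans (tau0 k) hy1) (le_trans hy2).
have [i iI hi] := grid1 r20 (le_trans (norm_fst y) (le_trans yB hB)).
have [j jI hj] := grid1 r20 (le_trans (norm_snd y) (le_trans yB hB)).
set q : pt * R := (((rho k / 2) * (i%:R - B%:R), (rho k / 2) * (j%:R - B%:R)), rho k).
have yq : `|y - q.1| <= rho k / 2 by apply/norm_ptP.
exists q => //; rewrite mem_filter; apply/andP; split; last by apply/allpairsP; exists (i, j).
apply/asboolP; exists y; split=> //; apply: (le_trans yq).
by rewrite ler_pdivrMr// ler_peMr ?ler1n// ltW// rho0.
Qed.

Lemma sum_count (I : Type) (s : seq I) (P : I -> bool) : \sum_(i <- s) (P i)%:R = (size [seq i <- s | P i])%:R :> R.
Proof. elim: s => [|i s ih]; first by rewrite big_nil.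
by rewrite big_cons ih /=; case: (P i) => /=; [rewrite [RHS]mulrS|rewrite add0r]. Qed.

(** Coordinates within [10 * rho k] of [t] differ by less than [20 * rho k], that is by at most 40
    steps of mesh [rho k / 2]. *)
Lemma grid_axis_count (k B m : nat) (t : R) :
 \sum_(i <- iota 0 m) (`|(rho k / 2) * (i%:R - B%:R) - t| < rho k * 10)%R%:R <= (2 * 40 + 1)%:R :> R.
Proof.
rewrite sum_count ler_nat; apply: count_near => i j hi hj.
have e0 : 0 < rho k / 2 by rewrite divr_gt0 ?rho0.
have d : rho k / 2 * (i%:R - j%:R) <= rho k / 2 * 40%:R.
 rewrite (_ : rho k / 2 * (i%:R - j%:R) = ((rho k / 2) * (i%:R - B%:R) - t) - ((rho k / 2) * (j%:R - B%:R) - t)); last by ring.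
 rewrite (_ : rho k / 2 * 40%:R = rho k * 10 + rho k * 10); last by field.
 apply: (le_trans (ler_norm _)); apply: (le_trans (ler_normB _ _)); apply: lerD; exact: ltW.
by move: d; rewrite ler_pM2l// lerBlDl -natrD ler_nat addnC.
Qed.

Lemma tauD j d : tau j = 2 ^+ d * tau (j + d).
Proof. by elim: d => [|d ih]; rewrite ?addn0 ?mul1r// ih addnS tauS exprS; ring. Qed.

(** The enlarged balls of level [k] stay at heights between [tau k / 2] and [5 * tau k]. This ratio
    of 10 is below [2 ^ 4], so levels meeting at one height differ by less than 4. *)
Lemma level_count (m : nat) (t : R) :
 \sum_(k <- iota 1 m) ((tau k / 2 < t) && (t < 5 * tau k))%R%:R <= (2 * 4 + 1)%:R :> R.
Proof.
have -> : iota 1 m = [seq k.+1 | k <- iota 0 m] by rewrite -(iotaDl 1).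
rewrite big_map (sum_count _ (fun k => (tau k.+1 / 2 < t) && (t < 5 * tau k.+1))) ler_nat.
apply: count_near => i j /andP[_ hi] /andP[hj _]; rewrite leqNgt; apply/negP => ij.
have lt : tau j.+1 < 10 * tau i.+1 by move: (lt_trans hj hi); rewrite ltr_pdivrMr// => h'; apply: (lt_le_trans h'); rewrite mulrAC -natrM.
have E : tau j.+1 = 2 ^+ (i - j) * tau i.+1 by rewrite (tauD j.+1 (i - j)) addSn subnKC//; lia.
move: lt; rewrite E ltr_pM2r ?tau0// -natrX ltr_nat => lt.
have : (2 ^ 4 <= 2 ^ (i - j))%N by rewrite leq_exp2l//; lia.
by move=> h16; have := leq_ltn_trans h16 lt.
Qed.

Definition grids (B m : nat) : seq (pt * R) := flatten [seq grid B k | k <- iota 1 m].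

Lemma big_grids B m (F : pt * R -> R) : \sum_(q <- grids B m) F q = \sum_(k <- iota 1 m) \sum_(q <- grid B k) F q.
Proof. by rewrite /grids big_flatten big_map. Qed.

Lemma grids_in B m q : q \in grids B m -> 0 < q.2 /\ qb q `<=` O.
Proof.
move=> /flatten_mapP[k]; rewrite mem_iota => /andP[k0 _]; exact: grid_in.
Qed.

Lemma overlap : exists N : nat, forall B m z, \sum_(q <- grids B m) \1_(qb q) z <= N%:R :> R.
Proof.
pose w := (2 * 40 + 1)%N; pose v := (2 * 4 + 1)%N; exists (v * (w * w))%N => B m z.
have lev k : (0 < k)%N -> \sum_(q <- grid B k) \1_(qb q) z <=
  ((tau k / 2 < Hg z) && (Hg z < 5 * tau k))%R%:R * (w * w)%:R :> R.
 move=> k0; case: andP => [_|hk]; last first.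
  rewrite mul0r big_seq big1// => q qg; rewrite ind_out// => qz; apply: hk.
  exact: grid_height k0 qg qz.
 pose A (c : R) (i : nat) : R := (`|(rho k / 2) * (i%:R - B%:R) - c| < rho k * 10)%R%:R.
 rewrite mul1r natrM /grid big_filter.
 apply: (@le_trans _ _ (\sum_(i <- iota 0 (2 * B).+1) \sum_(j <- iota 0 (2 * B).+1) A z.1 i * A z.2 j)); last first.
  under eq_bigr do rewrite -mulr_sumr; rewrite -mulr_suml.
  by apply: ler_pM; rewrite ?grid_axis_count//; apply: sumr_ge0.
 set l := [seq _ | i <- _, j <- _].
 apply: (@le_trans _ _ (\sum_(q <- l) \1_(qb q) z)).
  rewrite [leRHS](bigID (fun q => `[< exists y, lay (tau k) (4 * tau k) y /\ `|y - q.1| <= rho k >])) /= lerDl.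
  by apply: sumr_ge0 => q _; case/andP: (ind_itv (qb q) z).
 rewrite /l big_allpairs_dep; apply: ler_sum => i _; apply: ler_sum => j _.
 have [zb|zb] := pselect (qb ((rho k / 2 * (i%:R - B%:R), rho k / 2 * (j%:R - B%:R)), rho k) z); last first.
  by rewrite ind_out// mulr_ge0.
 rewrite ind_in//; move: zb; rewrite /qb -ball_normE /ball_ /= => /norm_pt_ltP[/= z1 z2].
 by rewrite /A z1 z2 mulr1.
rewrite big_grids (@le_trans _ _ (\sum_(k <- iota 1 m) ((tau k / 2 < Hg z) && (Hg z < 5 * tau k))%R%:R * (w * w)%:R))//.
 rewrite big_seq [leRHS]big_seq; apply: ler_sum => k; rewrite mem_iota => /andP[k0 _]; exact: lev.
rewrite -mulr_suml (natrM _ v (w * w)%N); apply: ler_wpM2r; first exact: ler0n.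
exact: level_count.
Qed.

Definition jump a (k : nat) (y : pt) : R := tr (nm (a y - a (y + sig k *: n))) ^+ 2.
Definition lmass a c (k : nat) : R := I2 (fun x => dev a c x * \1_(lay (tau k) (2 * tau k)) x).

Lemma tau_8h k (c : nat) : (c <= 8)%N -> c%:R * tau k <= 8 * h.
Proof.
move=> c8; apply: (@le_trans _ _ (8 * tau k)); first by rewrite ler_pM2r ?tau0// ler_nat.
by rewrite ler_pM2l// tau_le.
Qed.

Lemma cL1_shift a (v : pt) : cL1 a -> cL1 (fun x => a (x + v)).
Proof. by move=> [L1a L2a]; split; [exact: (L1_shift v L1a).1|exact: (L1_shift v L2a).1]. Qed.

Lemma jump_meas a k : cL1 a -> mfun (jump a k).
Proof.
move=> La0'; apply: measurable_funX; apply: meas_tr; apply: meas_nm; apply: cmeasB; apply: cL1_meas => //.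
exact: cL1_shift.
Qed.

Lemma jump_itv a k y : 0 <= jump a k y <= 1.
Proof. by rewrite /jump sqr_ge0 exprn_ile1 ?tr_le1// tr_ge0// nm_ge0. Qed.

Lemma jump_L1 a k : cL1 a -> L1 (fun y => jump a k y * \1_(lay (tau k) (4 * tau k)) y).
Proof.
move=> La0'; have L := lay_L1 (ltW (tau0 k)) (@tau_8h k 4 isT).
apply: (L1_dom _ L); first by apply: measurable_funM; [exact: jump_meas|apply: mindic; exact: lay_meas].
move=> y; have /andP[j0 j1] := jump_itv a k y; have i0 := ind_ge0 (lay (tau k) (4 * tau k)) y.
rewrite (ger0_norm (mulr_ge0 j0 i0)); exact: ler_piMl.
Qed.

Lemma mass_L1 a c u v : cL1 a -> 0 <= u -> v <= 8 * h -> L1 (fun x => dev a c x * \1_(lay u v) x).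
Proof.
by move=> La0' u0 v8; apply: dev_L1; [exact: cL1_meas|exact: lay_meas|exact: lay_L1].
Qed.

Lemma nu_small k : `|sig k *: n| < rho k / 2.
Proof.
by rewrite normrZ (gtr0_norm (sig0 k)); apply: le_lt_trans (sig_rho k); rewrite ler_piMr// ltW// sig0.
Qed.

(** Some ball of the grid contains both [y] and its translate, so the jump is bounded by the two
    deviations from the constant of that ball; the constant itself drops out of the left-hand
    side. *)
Lemma jump_le a (c : pt * R -> R[i]) B k : cL1 a -> B0 <= rho k / 2 * B%:R ->
 I2 (fun y => jump a k y * \1_(lay (tau k) (4 * tau k)) y) <=
 4 * \sum_(q <- grid B k) I2 (fun x => dev a (c q) x * \1_(ball q.1 q.2) x).
Proof.
move=> La0' hB; pose v := sig k *: n.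
pose F (q : pt * R) x := dev a (c q) x * \1_(ball q.1 q.2) x.
have LF q : L1 (F q) by apply: dev_L1; [exact: cL1_meas|exact: mball2|exact: L1_ball].
have LFv q : L1 (fun x => F q (x + v)) by exact: (L1_shift v (LF q)).1.
have F0 q x : 0 <= F q x by rewrite mulr_ge0 ?dev_ge0//; case/andP: (ind_itv (ball q.1 q.2) x).
have LG q : L1 (fun x => 2 * F q x + 2 * F q (x + v)) by apply: L1D; exact: L1Z.
have -> : 4 * \sum_(q <- grid B k) I2 (F q) = I2 (fun x => \sum_(q <- grid B k) (2 * F q x + 2 * F q (x + v))).
 rewrite (I2_sum _ LG) mulr_sumr; apply: eq_bigr => q _.
 rewrite (I2D (L1Z 2 (LF q)) (L1Z 2 (LFv q))) (I2Z 2 (LF q)) (I2Z 2 (LFv q)) (L1_shift v (LF q)).2; ring.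
apply: I2_le; [exact: jump_L1|exact: L1_sum|].
move=> y; have [yl|yl] := pselect (lay (tau k) (4 * tau k) y); last first.
 by rewrite ind_out// mulr0; apply: sumr_ge0 => q _; rewrite addr_ge0// mulr_ge0.
rewrite ind_in// mulr1; have [q qg [q2 yq]] := grid_cover hB yl (@tau_8h k 4 isT).
rewrite (big_rem q)//= -[leLHS]addr0; apply: lerD; last by apply: sumr_ge0 => p _; rewrite addr_ge0// mulr_ge0.
have r0 := rho0 k; have nv := nu_small k; rewrite -/v in nv.
have r2 : rho k / 2 < rho k by rewrite ltr_pdivrMr// ltr_pMr// ltr1n.
have yb : ball q.1 q.2 y by rewrite q2 -ball_normE /ball_ /= distrC; exact: le_lt_trans r2.
have yvb : ball q.1 q.2 (y + v).
 rewrite q2 -ball_normE /ball_ /= distrC addrAC; apply: (le_lt_trans (ler_normD _ _)).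
 rewrite [ltRHS](splitr (rho k)); exact: ler_ltD.
rewrite /F (ind_in yb) (ind_in yvb) !mulr1 /jump /dev -/v.
have -> : a y - a (y + v) = (a y - c q) + - (a (y + v) - c q) by ring.
by apply: (le_trans (tr_sq2 _ _)); rewrite nmN.
Qed.

(* Translating upward by [tau] and by [2 tau] maps a layer into the two halves of the next one,
  which gains the factor 1/2 needed to sum over the layers. *)
Lemma mass_step a c k : cL1 a -> lmass a c k.+1 <= 3 / 4 * lmass a c k +
 12 * Mn%:R ^+ 2 * I2 (fun y => jump a k.+1 y * \1_(lay (tau k.+1) (4 * tau k.+1)) y).
Proof.
move=> La0'; set t := tau k.+1; have tk : tau k = 2 * t by exact: tauS.
have t0 : 0 < t by exact: tau0.
have t8 (m : nat) : (m <= 8)%N -> m%:R * t <= 8 * h by exact: tau_8h.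
pose s := sig k.+1; have s0 : 0 < s by exact: sig0.
have st : Mn%:R * s = t by rewrite /s /sig mulrC divfK// gt_eqF// Mn0.
pose J y := jump a k.+1 y * \1_(lay t (4 * t)) y.
have LJ : L1 J by exact: jump_L1.
have J0 y : 0 <= J y.
 by have /andP[j0 _] := jump_itv a k.+1 y; have i0 := ind_ge0 (lay t (4 * t)) y; exact: mulr_ge0.
pose U1 y := dev a c y * \1_(lay (2 * t) (3 * t)) y.
pose U2 y := dev a c y * \1_(lay (3 * t) (4 * t)) y.
have t00 (m : nat) : 0 <= m%:R * t by rewrite mulr_ge0// ltW.
have LU1 : L1 U1 := mass_L1 c La0' (t00 2) (t8 3 isT).
have LU2 : L1 U2 := mass_L1 c La0' (t00 3) (t8 4 isT).
have LL : L1 (fun x => dev a c x * \1_(lay t (2 * t)) x) by exact: (mass_L1 c La0' (ltW t0) (t8 2 isT)).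
have LLk : L1 (fun x => dev a c x * \1_(lay (2 * t) (4 * t)) x) by exact: (mass_L1 c La0' (t00 2) (t8 4 isT)).
pose X x := \sum_(m <- iota 0 (2 * Mn)) J (x + (m%:R * s) *: n).
have LX : L1 X by apply: L1_sum => m; exact: (L1_shift _ LJ).1.
have IX : I2 X = (2 * Mn)%:R * I2 J.
 rewrite (I2_sum _ (fun m => (L1_shift ((m%:R * s) *: n) LJ).1)).
 under eq_bigr do rewrite (L1_shift _ LJ).2.
 by rewrite big_const_seq count_predT size_iota iter_addr_0 mulr_natl.
have X0 x : 0 <= X x by apply: sumr_ge0.
(* A walk of at most [2 * Mn] steps from the layer stays at heights between [t] and [4 * t]. [X]
   sums all the jumps such a walk can meet, and its integral is known by translation invariance. *)
have chain x (j : nat) : lay t (2 * t) x -> (j <= 2 * Mn)%N ->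
  tr (nm (a x - a (x + (j%:R * s) *: n))) ^+ 2 <= (2 * Mn)%:R * X x.
 move=> xl jM; have := tr_chain (fun m => a (x + (m%:R * s) *: n)) j.
 rewrite mul0r scale0r addr0 => hc; apply: (le_trans hc); apply: ler_pM => //; first by apply: sumr_ge0 => i _; exact: sqr_ge0.
  by rewrite ler_nat.
 rewrite /X -(subnKC jM) iotaD big_cat /= -[leLHS]addr0; apply: lerD; last by apply: sumr_ge0.
 rewrite /index_iota subn0 big_seq [leRHS]big_seq; apply: ler_sum => m; rewrite mem_iota add0n => /andP[_ mj].
 rewrite /J ind_in; last first.
  have [sx /andP[hx1 hx2]] := xl; split; first by rewrite Sn.
  rewrite Hn; apply/andP; split; first by apply: (lt_le_trans hx1); rewrite lerDl mulr_ge0// ltW.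
  have : m%:R * s <= 2 * t.
   rewrite -st mulrA -natrM ler_pM2r// ler_nat; apply: leq_trans jM; exact: ltnW.
  by move: (m%:R * s) => u; lra.
 rewrite mulr1 /jump -/s; rewrite (_ : x + (m%:R * s) *: n + s *: n = x + (m.+1%:R * s) *: n)//.
 by rewrite -addrA -scalerDl -natr1 mulrDl mul1r.
have E1 : t = Mn%:R * s by [].
have E2 : 2 * t = (2 * Mn)%:R * s by rewrite natrM -mulrA st.
have key x : 2 * (dev a c x * \1_(lay t (2 * t)) x) <=
  3 / 2 * (U1 (x + t *: n) + U2 (x + (2 * t) *: n)) + 12 * Mn%:R * X x.
 have d0 y : 0 <= U1 y by rewrite mulr_ge0 ?dev_ge0//; case/andP: (ind_itv (lay (2 * t) (3 * t)) y).
 have d0' y : 0 <= U2 y by rewrite mulr_ge0 ?dev_ge0//; case/andP: (ind_itv (lay (3 * t) (4 * t)) y).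
 have [xl|xl] := pselect (lay t (2 * t) x); last first.
  rewrite ind_out// mulr0 mulr0 addr_ge0//; first by rewrite mulr_ge0// addr_ge0.
  by rewrite mulr_ge0// mulr_ge0.
 have [sx /andP[hx1 hx2]] := xl; rewrite ind_in// mulr1.
 have l1 : lay (2 * t) (3 * t) (x + t *: n) by rewrite /lay /= Sn Hn; split=> //; apply/andP; split; lra.
 have l2 : lay (3 * t) (4 * t) (x + (2 * t) *: n) by rewrite /lay /= Sn Hn; split=> //; apply/andP; split; lra.
 rewrite /U1 /U2 (ind_in l1) (ind_in l2) !mulr1.
 have b1 : tr (nm (a x - a (x + t *: n))) ^+ 2 <= (2 * Mn)%:R * X x.
  by rewrite E1; apply: chain => //; rewrite leq_pmull.
 have b2 : tr (nm (a x - a (x + (2 * t) *: n))) ^+ 2 <= (2 * Mn)%:R * X x.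
  by rewrite E2; apply: chain.
 (* The weight [1/2] yields the coefficient [3/2]. The two translated layers together cover the
    layer above just once, so twice the mass is bounded by [3/2] of the mass above plus jumps: the
    ratio is [3/4 < 1]. *)
 have tri y : dev a c x <= 3 / 2 * dev a c y + 3 * tr (nm (a x - a y)) ^+ 2.
  have h2 : 0 < 2^-1 :> R by rewrite invr_gt0.
  rewrite /dev (_ : a x - c = (a y - c) + (a x - a y)); last by ring.
  apply: (le_trans (tr_sqw _ _ h2)); rewrite invrK le_eqVlt; apply/orP; left; by apply/eqP; field.
 have c1 := tri (x + t *: n); have c2 := tri (x + (2 * t) *: n).
 rewrite natrM -mulrA in b1; rewrite natrM -mulrA in b2; rewrite -(mulrA 12).
 move: (dev a c x) (dev a c _) (dev a c _) (tr _ ^+ 2) (tr _ ^+ 2) (Mn%:R * X x) b1 b2 c1 c2 => *; lra.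
have LU1' := (L1_shift (t *: n) LU1).1; have LU2' := (L1_shift ((2 * t) *: n) LU2).1.
have := I2_le (L1Z 2 LL) (L1D (L1Z (3 / 2) (L1D LU1' LU2')) (L1Z (12 * Mn%:R) LX)) key.
rewrite (I2Z _ LL) (I2D (L1Z (3 / 2) (L1D LU1' LU2')) (L1Z (12 * Mn%:R) LX)) (I2Z _ (L1D LU1' LU2')) (I2Z _ LX).
rewrite (I2D LU1' LU2') (L1_shift (t *: n) LU1).2 (L1_shift ((2 * t) *: n) LU2).2 IX.
have hU : I2 U1 + I2 U2 <= lmass a c k.
 rewrite -(I2D LU1 LU2) /lmass tk (_ : 2 * (2 * t) = 4 * t); last by ring.
 apply: I2_le; [exact: L1D|exact: LLk|].
 move=> y; rewrite /U1 /U2 -mulrDr ler_wpM2l ?dev_ge0//.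
 have [y1|y1] := pselect (lay (2 * t) (3 * t) y); have [y2|y2] := pselect (lay (3 * t) (4 * t) y).
 - by case: y1 y2 => [_ /andP[_ u1]] [_ /andP[u2 _]]; have := lt_le_trans u2 u1; rewrite ltxx.
 - rewrite (ind_in y1) (ind_out y2) addr0 ind_in//; case: y1 => [ys /andP[u1 u2]]; split=> //; rewrite u1 /=; lra.
 - rewrite (ind_in y2) (ind_out y1) add0r ind_in//; case: y2 => [ys /andP[u1 u2]]; split=> //; rewrite u2 andbT; lra.
 - by rewrite (ind_out y1) (ind_out y2) addr0; case/andP: (ind_itv (lay (2 * t) (4 * t)) y).
rewrite natrM; exact: (@step_arith Mn%:R _ _ _ _ _ hU).
Qed.

Definition Jmass a (k : nat) : R := I2 (fun y => jump a k y * \1_(lay (tau k) (4 * tau k)) y).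

(** The recursion with ratio [3/4] summed up: 4 is [1 / (1 - 3/4)], and the extra [3 * lmass a c m]
    closes the induction. *)
Lemma mass_sum a c (m : nat) : cL1 a ->
 \sum_(0 <= k < m.+1) lmass a c k + 3 * lmass a c m <=
 4 * lmass a c 0 + 48 * Mn%:R ^+ 2 * \sum_(1 <= k < m.+1) Jmass a k.
Proof.
move=> La0'; elim: m => [|m ih].
 by rewrite big_nat1 big_geq// mulr0 addr0; move: (lmass a c 0) => u; lra.
rewrite big_nat_recr//= [\sum_(1 <= k < m.+2) _]big_nat_recr//= mulrDr.
have st := mass_step c m La0'; rewrite -/(Jmass a m.+1) in st.
have -> : 48 * Mn%:R ^+ 2 * Jmass a m.+1 = 4 * (12 * Mn%:R ^+ 2 * Jmass a m.+1) by ring.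
move: ih st; move: (12 * _ * _) (48 * _ * _) (\sum_(0 <= k < m.+1) _) (lmass a c 0) (lmass a c m) (lmass a c m.+1) => *; lra.
Qed.

Lemma union_mass a c (m : nat) : cL1 a ->
 I2 (fun x => dev a c x * \1_(lay (tau m) (2 * h)) x) <= \sum_(0 <= k < m.+1) lmass a c k.
Proof.
move=> La0'; have h28' : 2 * h <= 8 * h by exact: h28.
elim: m => [|m ih]; first by rewrite big_nat1 /lmass /tau expr0 divr1.
rewrite big_nat_recr//=.
have L1' := mass_L1 c La0' (ltW (tau0 m)) h28'.
have L2' := mass_L1 c La0' (ltW (tau0 m.+1)) (tau_8h m.+1 (isT : (2 <= 8)%N)).
have L3' := mass_L1 c La0' (ltW (tau0 m.+1)) h28'.
apply: (le_trans _ (lerD ih (lexx (lmass a c m.+1)))); rewrite /lmass -(I2D L1' L2').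
apply: I2_le; [exact: L3'|exact: L1D|].
move=> x; rewrite -mulrDr ler_wpM2l ?dev_ge0//.
have i0 := ind_ge0 (lay (tau m) (2 * h)) x; have j0 := ind_ge0 (lay (tau m.+1) (2 * tau m.+1)) x.
have [xl|xl] := pselect (lay (tau m.+1) (2 * h) x); last by rewrite (ind_out xl) addr_ge0.
have [xs /andP[u1 u2]] := xl; rewrite (ind_in xl); have [u3|u3] := leP (Hg x) (tau m).
 have l1 : lay (tau m.+1) (2 * tau m.+1) x by split=> //; rewrite u1 -tauS u3.
 by rewrite (ind_in l1) lerDr.
have l1 : lay (tau m) (2 * h) x by split=> //; rewrite u3 u2.
by rewrite (ind_in l1) lerDl.
Qed.

Lemma lay_vanish (V : set pt) : measurable V -> V `<=` lay 0 (2 * h) ->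
 I2 (fun x => \1_(V `&` [set z | Hg z <= tau m]) x) @[m --> \oo] --> (0 : R).
Proof.
move=> mV VL; pose Bm m := V `&` [set z | Hg z <= tau m].
have mB m : measurable (Bm m).
 apply: measurableI => //; rewrite (_ : [set z | _] = setT `&` Hg @^-1` `]-oo, (tau m)]).
  exact: (continuous2_measurable cH).
 by apply/seteqP; split=> z; rewrite /= !in_itv /= => //; case.
have VO : V `<=` O by apply: (subset_trans VL); apply: lay_O => //; exact: h28.
have LB m : L1 (\1_(Bm m)) by apply: (sub_L1 LO) => // z [/VO].
have E m : leb2 (Bm m) = (I2 (\1_(Bm m)))%:E.
 have := integral_indic leb2 measurableT (mB m); rewrite setIT => <-; exact: (I2E (LB m)).
have cap : \bigcap_m Bm m = set0.
 apply/seteqP; split=> // x Bx; have [Vx _] := Bx 0%N I; have [_ /andP[hx _]] := VL x Vx.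
 pose N := (Num.trunc (h / Hg x)).+1; have [_ /=] := Bx N I; rewrite leNgt => /negP; apply.
 rewrite /tau ltr_pdivrMr ?exprn_gt0// mulrC -ltr_pdivrMr//; apply: (lt_trans (truncnS_gt _)).
 by rewrite -/N -natrX ltr_nat ltn_expl.
have := @nonincreasing_cvg_mu _ _ _ (@leb2 R) Bm.
rewrite cap measure0 => H1.
rewrite (_ : (fun m => I2 _) = fine \o (leb2 \o Bm)); last by apply/funext => m; rewrite /= E.
apply: fine_cvg; apply: H1 => //.
- by have hE := ltry (I2 (\1_(Bm 0%N))); rewrite -E in hE; exact: hE.
- apply/nonincreasing_seqP => m; apply/subsetPset => x [Vx hx]; split=> //; apply: (le_trans hx).
 by rewrite (tauS m) ler_peMl ?ler1n// ltW// tau0.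
Qed.

(** The bound for heights above [tau m] is uniform in [m]; below, [dev <= 1] and the area tends to
    [0], so [m] can go to infinity for each field separately. *)
Lemma layers_est (V : set pt) : measurable V -> V `<=` lay 0 (2 * h) -> exists C : R, 0 <= C /\ est O V C.
Proof.
move=> mV VL; have [W [[oW WO [C1 [C10 hC1]]] LW]] := core_layer.
have [N hN] := overlap; have [C2 [C20 hC2]] := @packing R N.
exists (4 * C1 + 192 * Mn%:R ^+ 2 * C2); split; first exact: addr_ge0 (mulr_ge0 (ler0n _ 4) C10) (mulr_ge0 (mulr_ge0 (ler0n _ 192) (sqr_ge0 _)) C20).
move=> a b D dD; have [c [cc hc]] := hC1 a b D dD; exists c; split=> //.
have [La0' _ D0 _] := dD; have ma := cL1_meas La0'.
have VO : V `<=` O by apply: (subset_trans VL); apply: lay_O => //; exact: h28.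
have LV := dev_L1 c ma mV (sub_L1 LO mV VO).
have h28' : 2 * h <= 8 * h by exact: h28.
have m0 : lmass a c 0 <= C1 * D.
 apply: le_trans hc; rewrite /lmass /tau expr0 divr1; apply: I2_le.
 - exact: (mass_L1 c La0' (ltW h0) h28').
 - apply: (dev_L1 c ma (open2_meas oW)); apply: (sub_L1 LO) => //; exact: open2_meas.
 - move=> x; rewrite ler_wpM2l ?dev_ge0//; have [xl|xl] := pselect (lay h (2 * h) x).
   by rewrite (ind_in xl) (ind_in (LW _ xl)).
  by rewrite (ind_out xl); case/andP: (ind_itv W x).
have key m : I2 (fun x => dev a c x * \1_(lay (tau m) (2 * h)) x) <= (4 * C1 + 192 * Mn%:R ^+ 2 * C2) * D.
 apply: (le_trans (union_mass c m La0')).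
 (* One lattice width serves all levels up to [m], since [rho k] is smallest at [k = m]. *)
 have [B hB] : exists B : nat, forall k, k \in iota 1 m -> B0 <= rho k / 2 * B%:R.
  pose B := (Num.trunc (`|B0| / (rho m / 2))).+1; exists B => k; rewrite mem_iota => /andP[_ km].
  have rm : 0 < rho m / 2 by rewrite divr_gt0 ?rho0.
  apply: (@le_trans _ _ (rho m / 2 * B%:R)).
   have := ltW (truncnS_gt (`|B0| / (rho m / 2))); rewrite -/B ler_pdivrMr// mulrC.
   exact: le_trans (ler_norm _).
  rewrite ler_pM2r ?ltr0n// ler_pM2r ?invr_gt0// /rho ler_pM2l ?theta0//.
  have km' : (k <= m)%N by rewrite -ltnS -add1n.
  by rewrite (tauD k (m - k)) subnKC// ler_peMl ?(ltW (tau0 m))// exprn_ege1// ler1n.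
 have [cq [_ hq]] := hC2 O a b D (open2_meas oO) LO dD (grids B m) (@grids_in B m) (hN B m).
 have sJ : \sum_(1 <= k < m.+1) Jmass a k <= 4 * (C2 * D).
  apply: (@le_trans _ _ (4 * \sum_(q <- grids B m) I2 (fun x => dev a (cq q) x * \1_(ball q.1 q.2) x))); last first.
   by rewrite ler_pM2l.
  rewrite big_grids mulr_sumr /index_iota subn1 /= big_seq [leRHS]big_seq; apply: ler_sum => k ki.
  exact: (jump_le cq La0' (hB k ki)).
 have ms := mass_sum c m La0'.
 have mm0 : 0 <= lmass a c m by apply: I2_ge0 => x; rewrite mulr_ge0 ?dev_ge0//; case/andP: (ind_itv (lay (tau m) (2 * tau m)) x).
 have M0 : 0 <= 48 * Mn%:R ^+ 2 :> R by rewrite mulr_ge0// sqr_ge0.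
 have sJ' := ler_wpM2l M0 sJ.
 have -> : (4 * C1 + 192 * Mn%:R ^+ 2 * C2) * D = 4 * (C1 * D) + 48 * Mn%:R ^+ 2 * (4 * (C2 * D)) by ring.
 move: ms sJ' m0 mm0; move: (48 * _ * _) (48 * _ * _) (\sum_(0 <= k < m.+1) _) (lmass a c 0) (lmass a c m) (C1 * D) => *; lra.
set Q := (_ * D) in key *; have van := lay_vanish mV VL.
have step m : I2 (fun x => dev a c x * \1_V x) - Q <= I2 (fun x => \1_(V `&` [set z | Hg z <= tau m]) x).
 rewrite lerBlDl; apply: (le_trans _ (lerD (key m) (lexx _))).
 have mB : measurable (V `&` [set z | Hg z <= tau m]).
  apply: measurableI => //; rewrite (_ : [set z | _] = setT `&` Hg @^-1` `]-oo, (tau m)]).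
   exact: (continuous2_measurable cH).
  by apply/seteqP; split=> z; rewrite /= !in_itv /= => //; case.
 have LB : L1 (\1_(V `&` [set z | Hg z <= tau m])) by apply: (sub_L1 LO) => // z [/VO].
 have Lm := mass_L1 c La0' (ltW (tau0 m)) h28'.
 rewrite -(I2D Lm LB); apply: I2_le; [exact: LV|exact: L1D|].
 move=> x; have d0 := dev_ge0 a c x.
 have i0 := ind_ge0 (lay (tau m) (2 * h)) x; have j0 := ind_ge0 (V `&` [set z | Hg z <= tau m]) x.
 have [xV|xV] := pselect (V x); last by rewrite (ind_out xV) mulr0 addr_ge0// mulr_ge0.
 rewrite (ind_in xV) mulr1; have [u3|u3] := leP (Hg x) (tau m).
  have l1 : (V `&` [set z | Hg z <= tau m]) x by [].
  by rewrite (ind_in l1); apply: (le_trans (dev_le1 a c x)); rewrite lerDr mulr_ge0.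
 have [xs /andP[_ u2]] := VL x xV; have l1 : lay (tau m) (2 * h) x by split=> //; rewrite u3 u2.
 by rewrite (ind_in l1) mulr1 lerDl.
rewrite -subr_le0; apply: (cvgr_to_ge van); exact: nearW.
Qed.
End Data.
End Layers.

(** * Lipschitz charts and the estimate on the whole domain *)

Section Chart.
Context {R : realType}.
Local Notation pt := (R * R)%type.

Lemma enorm2_le (u v : R) : enorm2 (u, v) <= `|u| + `|v|.
Proof.
rewrite /enorm2 /= -(@ler_pXn2r _ 2) ?nnegrE ?sqrtr_ge0 ?addr_ge0// sqr_sqrtr ?addr_ge0 ?sqr_ge0//.
rewrite (_ : (`|u| + `|v|) ^+ 2 = `|u| ^+ 2 + `|v| ^+ 2 + 2 * `|u| * `|v|); last by ring.
by rewrite !real_normK ?num_real// lerDl mulr_ge0// mulr_ge0.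
Qed.

Lemma le_enorm2 (u v : R) : `|u| <= enorm2 (u, v) /\ `|v| <= enorm2 (u, v).
Proof. by split; rewrite /enorm2 /= -sqrtr_sqr ler_wsqrtr// ?lerDl ?lerDr sqr_ge0. Qed.

Lemma rot_lip (al be u v w : R) : al ^+ 2 + be ^+ 2 = 1 -> `|u| <= w -> `|v| <= w ->
 `|al * u - be * v| <= 2 * w /\ `|be * u + al * v| <= 2 * w.
Proof.
move=> ab uw vw; have a1 : `|al| <= 1.
 by rewrite -(@ler_pXn2r _ 2) ?nnegrE// expr1n real_normK ?num_real// -ab lerDl sqr_ge0.
have b1 : `|be| <= 1.
 by rewrite -(@ler_pXn2r _ 2) ?nnegrE// expr1n real_normK ?num_real// -ab lerDr sqr_ge0.
have m (s t : R) : `|s| <= 1 -> `|t| <= w -> `|s * t| <= w.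
 by move=> s1 tw; rewrite normrM; apply: le_trans tw; rewrite ler_piMl.
rewrite mulr2n mulrDl mul1r; split.
 apply: (le_trans (ler_normB _ _)); apply: lerD; exact: m.
apply: (le_trans (ler_normD _ _)); apply: lerD; exact: m.
Qed.

Lemma chart_good (O : set pt) (x0 : pt) (r al be : R) (g : R -> R) (L : R) :
 open O -> L1 (\1_O : pt -> R) -> path_connected2 O -> closure O x0 -> ~ O x0 -> 0 < r ->
 al ^+ 2 + be ^+ 2 = 1 -> 0 <= L -> (forall s t, `|g s - g t| <= L * `|s - t|) ->
 (forall x : pt, enorm2 (x.1 - x0.1, x.2 - x0.2) < r ->
  (O x <-> g (al * (x.1 - x0.1) - be * (x.2 - x0.2)) < be * (x.1 - x0.1) + al * (x.2 - x0.2))) ->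
 exists V, [/\ open V, V x0 & good O (V `&` O)].
Proof.
move=> oO LO pO cx0 nx0 r0 ab L0 gL hO.
pose S (x : pt) := al * (x.1 - x0.1) - be * (x.2 - x0.2).
pose T (x : pt) := be * (x.1 - x0.1) + al * (x.2 - x0.2).
pose H x := T x - g (S x); pose nu : pt := (be, al).
have OH (x : pt) : enorm2 (x.1 - x0.1, x.2 - x0.2) < r -> (O x <-> 0 < H x) by move=> /hO; rewrite /H subr_gt0.
have Slip x y : `|S x - S y| <= 2 * `|x - y|.
 rewrite (_ : S x - S y = al * (x - y).1 - be * (x - y).2); last by rewrite /S /=; ring.
 by case: (rot_lip ab (norm_fst (x - y)) (norm_snd (x - y))).
have Tlip x y : `|T x - T y| <= 2 * `|x - y|.
 rewrite (_ : T x - T y = be * (x - y).1 + al * (x - y).2); last by rewrite /T /=; ring.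
 by case: (rot_lip ab (norm_fst (x - y)) (norm_snd (x - y))).
pose La := 2 * (1 + L); have La0 : 0 <= La by rewrite mulr_ge0// addr_ge0.
have Hlip x y : `|H x - H y| <= La * `|x - y|.
 rewrite (_ : H x - H y = (T x - T y) - (g (S x) - g (S y))); last by rewrite /H; ring.
 apply: (le_trans (ler_normB _ _)); rewrite /La mulrDr mulr1 mulrDl; apply: lerD => //.
 apply: (le_trans (gL _ _)); rewrite (mulrC 2) -mulrA; exact: ler_wpM2l.
have Snu x t : S (x + t *: nu) = S x by rewrite /S /nu /= -![_ *: _]/(_ * _); ring.
have Hnu x t : H (x + t *: nu) = H x + t.
 rewrite /H Snu; have -> : T (x + t *: nu) = T x + t * (al ^+ 2 + be ^+ 2) by rewrite /T /nu /= -![_ *: _]/(_ * _); ring.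
 by rewrite ab mulr1 addrAC.
have nu1 : `|nu| <= 1.
 by apply/norm_ptP; rewrite /nu /=; have := le_enorm2 be al; rewrite /enorm2 /= addrC ab sqrtr1.
have S0 : S x0 = 0 by rewrite /S !subrr !mulr0 subr0.
have T0 : T x0 = 0 by rewrite /T !subrr !mulr0 addr0.
have en (x : pt) : enorm2 (x.1 - x0.1, x.2 - x0.2) <= 2 * `|x - x0|.
 apply: (le_trans (enorm2_le _ _)); rewrite mulr2n mulrDl mul1r; apply: lerD.
  exact: (norm_fst (x - x0)).
 exact: (norm_snd (x - x0)).
(* A boundary point lies on the graph: below it, nearby points would miss [O], and above it, the
   point would belong to [O]. *)
have g0 : g 0 = 0.
 apply/eqP; rewrite eq_le; apply/andP; split; last first.
  rewrite leNgt; apply/negP => g0; apply: nx0; apply/OH; last by rewrite /H S0 T0 sub0r oppr_gt0.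
  by apply: (le_lt_trans (en x0)); rewrite subrr normr0 mulr0.
 rewrite leNgt; apply/negP => g0; pose e := Num.min (r / 2) (g 0 / (La + 1)).
 have La1 : 0 < La + 1 by rewrite ltr_wpDl.
 have e0 : 0 < e by rewrite lt_min !divr_gt0.
 have [y [Oy yb]] := cx0 _ (nbhsx_ballx x0 e e0).
 have yd : `|y - x0| < e by move: yb; rewrite -ball_normE /ball_ /= distrC.
 have yr : enorm2 (y.1 - x0.1, y.2 - x0.2) < r.
  apply: (le_lt_trans (en y)); rewrite mulrC -ltr_pdivlMr//; apply: (lt_le_trans yd).
  by rewrite /e ge_min lexx.
 have /(OH y yr) Hy := Oy; have := Hlip y x0; rewrite {2}/H S0 T0 sub0r opprK.
 have le : La * `|y - x0| <= g 0.
  apply: (@le_trans _ _ ((La + 1) * e)); first by apply: ler_pM => //; [rewrite lerDl|exact: ltW].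
  by rewrite mulrC -ler_pdivlMr// /e ge_min lexx orbT.
 by move=> h; have := le_trans (ler_norm _) (le_trans h le); rewrite gerDr leNgt Hy.
(* With [|S| <= 2 * h] and height at most [8 * h], the two rotated coordinates add up to at most
   [(10 + 2 * L) * h = r / 2], so the point is within the radius of the chart. *)
pose h := r / (2 * (10 + 2 * L)).
have q0 : 0 < 10 + 2 * L by rewrite ltr_wpDr// mulr_ge0.
have h0 : 0 < h by rewrite divr_gt0// mulr_gt0.
have hr : (10 + 2 * L) * h = r / 2 by rewrite /h; field; rewrite gt_eqF.
have near (x : pt) : `|S x| <= 2 * h -> 0 < H x <= 8 * h -> enorm2 (x.1 - x0.1, x.2 - x0.2) < r.
 move=> sx /andP[hx1 hx2].
 have gs : `|g (S x)| <= L * (2 * h).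
  have := gL (S x) 0; rewrite g0 !subr0 => hg; apply: (le_trans hg); exact: ler_wpM2l.
 have tx : `|T x| <= 8 * h + L * (2 * h).
  rewrite (_ : T x = H x + g (S x)); last by rewrite /H subrK.
  apply: (le_trans (ler_normD _ _)); rewrite gtr0_norm//; exact: lerD.
 have E : enorm2 (x.1 - x0.1, x.2 - x0.2) = enorm2 (S x, T x).
  rewrite /enorm2 /=; congr Num.sqrt; rewrite -[LHS]mul1r -ab /S /T; ring.
 rewrite E; apply: (le_lt_trans (enorm2_le _ _)); apply: (le_lt_trans (lerD sx tx)).
 rewrite (_ : 2 * h + (8 * h + L * (2 * h)) = (10 + 2 * L) * h); last by ring.
 by rewrite hr ltr_pdivrMr// ltr_pMr// ltr1n.
have inO (x : pt) : `|S x| <= 2 * h -> 0 < H x <= 8 * h -> O x.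
 by move=> sx hx; apply/(OH x (near x sx hx)); case/andP: hx.
have bd (x : pt) : `|S x| <= 2 * h -> 0 < H x <= 8 * h -> `|x| <= `|x0| + r.
 move=> sx hx; have nx := near x sx hx; have [n1 n2] := le_enorm2 (x.1 - x0.1) (x.2 - x0.2).
 have d : `|x - x0| <= r by apply/norm_ptP; split; apply: ltW; [exact: le_lt_trans n1 nx|exact: le_lt_trans n2 nx].
 by have := ler_normD x0 (x - x0); rewrite addrC subrK; lra.
have O0 : O !=set0 by have [y [Oy _]] := cx0 _ (nbhsx_ballx x0 1 ltr01); exists y.
pose e := h / (2 * (1 + L)); have L1' : 0 < 1 + L by rewrite ltr_wpDr.
have e0 : 0 < e by rewrite divr_gt0// mulr_gt0.
have eL : La * e = h by rewrite /La /e; field; rewrite gt_eqF.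
have e2 : 2 * e <= h by rewrite -eL ler_pM2r// /La ler_peMr// lerDl.
have VL : ball x0 e `&` O `<=` lay S H h 0 (2 * h).
 move=> y [yb Oy]; have yd : `|y - x0| < e by move: yb; rewrite -ball_normE /ball_ /= distrC.
 have yr : enorm2 (y.1 - x0.1, y.2 - x0.2) < r.
  apply: (le_lt_trans (en y)); apply: (@lt_le_trans _ _ (2 * e)); first by rewrite ltr_pM2l.
  apply: (le_trans e2); rewrite /h ler_pdivrMr ?mulr_gt0//.
  by rewrite ler_peMr ?(ltW r0)//; lra.
 have /(OH y yr) Hy := Oy; split.
  have := Slip y x0; rewrite S0 subr0 => s1; apply: (le_lt_trans s1); apply: lt_le_trans e2.
  by rewrite ltr_pM2l.
 rewrite Hy /=; have := Hlip y x0; rewrite {2}/H S0 T0 g0 !subr0 => h1.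
 apply: (le_trans (ler_norm _)); apply: (le_trans h1); apply: (@le_trans _ _ (La * e)).
  by rewrite ler_wpM2l// ltW.
 by rewrite eL ler_peMl ?(ltW h0)// ler1n.
have oV : open (ball x0 e `&` O) by apply: openI => //; exact: ball_open.
exists (ball x0 e); split; [exact: ball_open|exact: ballxx|split=> //].
exact: (layers_est oO LO pO O0 h0 La0 Snu Hnu nu1 Slip Hlip inO bd (open2_meas oV) VL).
Qed.

(** The closure is compact; interior points are covered by good balls and boundary points by charts,
    so one good set exhausts the domain. *)
Lemma domain_good (O : set pt) : open O -> L1 (\1_O : pt -> R) -> path_connected2 O -> O !=set0 -> bounded2 O ->
 lipschitz_boundary O -> exists C : R, 0 <= C /\ est O O C.
Proof.
move=> oO LO pO O0 [M hM] lb.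
have cK : compact (closure O).
 apply: (@subclosed_compact _ _ [set z : pt | `|z - 0| <= M]); [exact: closed_closure|exact: cball_compact|].
 rewrite closureE; apply: smallest_sub; last first.
  move=> z /hM h; rewrite /= subr0; have [n1 n2] := le_enorm2 z.1 z.2.
  by apply/norm_ptP; split; apply: le_trans h; [exact: n1|exact: n2].
 rewrite (_ : [set z : pt | _] = closed_ball_ Num.norm (0 : pt) M); last by apply/seteqP; split=> z; rewrite /closed_ball_ /= subr0 sub0r normrN.
 exact: closed_closed_ball_.
have [|x cx|W [[oW WO [C [C0 hC]]] KW]] := good_compact oO LO pO O0 cK.
- by [].
- have [Ox|nOx] := pselect (O x).
  have [r [r0 gr]] := good_point oO LO Ox; exists (ball x r); split; [exact: ball_open|exact: ballxx|].
  by apply: (good_sub LO _ _ gr); [apply: openI => //; exact: ball_open|move=> z []].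
 have [r [r0 [al [be [ab [g [[L gL] hO]]]]]]] := lb x (conj cx nOx).
 apply: (chart_good oO LO pO cx nOx r0 ab (L := Num.max L 0) _ _ hO); first by rewrite le_max lexx orbT.
 by move=> s t; apply: (le_trans (gL s t)); rewrite ler_wpM2r// le_max lexx.
have OW : O = W by apply/seteqP; split=> // z Oz; apply: KW; split=> //; exact: subset_closure.
by exists C; split=> //; rewrite {2}OW.
Qed.
End Chart.

(** * Matrices as pairs of complex numbers *)

Section Matrices.
Context {R : realType}.
Local Notation pt := (R * R)%type.
Implicit Types (A Q : 'M[R]_2).

(* The conformal and anticonformal parts: [A] acts on the plane as [z |-> ca A * z + cb A * cj z]. *)
Definition ca A : R[i] := ((A i1 i1 + A i2 i2) / 2) +i* ((A i2 i1 - A i1 i2) / 2).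
Definition cb A : R[i] := ((A i1 i1 - A i2 i2) / 2) +i* ((A i2 i1 + A i1 i2) / 2).
Definition rot (c : R[i]) : 'M[R]_2 := \matrix_(i, j)
 (if i == j then Re c else if i == i1 then - Im c else Im c).

Lemma big2 (F : 'I_2 -> R) : \sum_i F i = F i1 + F i2.
Proof.
rewrite big_ord_recl big_ord1; congr (_ + F _).
exact: val_inj.
Qed.

Lemma Re_ca A : Re (ca A) = (A i1 i1 + A i2 i2) / 2. Proof. by []. Qed.
Lemma Im_ca A : Im (ca A) = (A i2 i1 - A i1 i2) / 2. Proof. by []. Qed.
Lemma Re_cb A : Re (cb A) = (A i1 i1 - A i2 i2) / 2. Proof. by []. Qed.
Lemma Im_cb A : Im (cb A) = (A i2 i1 + A i1 i2) / 2. Proof. by []. Qed.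
Definition reca := (Re_ca, Im_ca, Re_cb, Im_cb).

Lemma caB A Q : ca (A - Q) = ca A - ca Q.
Proof.
apply: cplx_eq; [transitivity (Re (ca A) - Re (ca Q))|transitivity (Im (ca A) - Im (ca Q))] => //;
by rewrite !reca !mxE; field.
Qed.
Lemma cbB A Q : cb (A - Q) = cb A - cb Q.
Proof.
apply: cplx_eq; [transitivity (Re (cb A) - Re (cb Q))|transitivity (Im (cb A) - Im (cb Q))] => //;
by rewrite !reca !mxE; field.
Qed.

Lemma fnorm_sq A : fnorm A ^+ 2 = 2 * (nm (ca A) ^+ 2 + nm (cb A) ^+ 2).
Proof.
rewrite /fnorm sqr_sqrtr; last by apply: sumr_ge0 => i _; apply: sumr_ge0 => j _; exact: sqr_ge0.
by rewrite !big2 !sqr_nm !reca; field.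
Qed.

Lemma fnorm_ge0 A : 0 <= fnorm A. Proof. exact: sqrtr_ge0. Qed.

(** [4 |cb Q|^2 = |Q|^2 - 2 det Q] and [4 |ca Q|^2 = |Q|^2 + 2 det Q], with [|Q|^2 = 2] and
    [det Q = 1] for a rotation; conversely [cb Q = 0] is the Cauchy-Riemann form of the matrix. *)
Lemma SO2P Q : SO2 Q <-> cb Q = 0 /\ nm (ca Q) = 1.
Proof.
rewrite /SO2 /=; have det_mx22 : \det Q = Q 0 0 * Q 1 1 - Q 0 1 * Q 1 0.
 rewrite (expand_det_row _ 0) !big_ord_recl big_ord0 addr0 /cofactor !det_mx11 !mxE /= expr0 expr1 mul1r mulN1r mulrN.
 congr (_ * Q _ _ - Q _ _ * Q _ _); exact: val_inj.
rewrite det_mx22.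
have tE i j : (Q^T *m Q) i j = Q i1 i * Q i1 j + Q i2 i * Q i2 j by rewrite mxE big2 !mxE.
have -> : Q 0 0 = Q i1 i1 by []. have -> : Q 0 1 = Q i1 i2 by congr (Q _ _); exact: val_inj.
have -> : Q 1 0 = Q i2 i1 by congr (Q _ _); exact: val_inj.
have -> : Q 1 1 = Q i2 i2 by congr (Q _ _); exact: val_inj.
have i12 : i1 != i2 :> 'I_2 by []. have i21 : i2 != i1 :> 'I_2 by [].
split=> [[E D]|[cb0 ca1]].
 have e11 : Q i1 i1 * Q i1 i1 + Q i2 i1 * Q i2 i1 = 1 by rewrite -tE E mxE eqxx.
 have e22 : Q i1 i2 * Q i1 i2 + Q i2 i2 * Q i2 i2 = 1 by rewrite -tE E mxE eqxx.
 have b0 : nm (cb Q) ^+ 2 = 0.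
  rewrite sqr_nm !reca; transitivity (4^-1 * ((Q i1 i1 * Q i1 i1 + Q i2 i1 * Q i2 i1) +
   (Q i1 i2 * Q i1 i2 + Q i2 i2 * Q i2 i2) - 2 * (Q i1 i1 * Q i2 i2 - Q i1 i2 * Q i2 i1))); first by field.
  by rewrite e11 e22 D; field.
 have a1 : nm (ca Q) ^+ 2 = 1.
  rewrite sqr_nm !reca; transitivity (4^-1 * ((Q i1 i1 * Q i1 i1 + Q i2 i1 * Q i2 i1) +
   (Q i1 i2 * Q i1 i2 + Q i2 i2 * Q i2 i2) + 2 * (Q i1 i1 * Q i2 i2 - Q i1 i2 * Q i2 i1))); first by field.
  by rewrite e11 e22 D; field.
 split; first by apply: nm_eq0; apply/eqP; rewrite -(sqrf_eq0 (nm _)) b0.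
 by apply/eqP; rewrite -(@eqrXn2 _ 2 (nm _) 1) ?nm_ge0// expr1n a1.
have h1 : Q i1 i1 = Q i2 i2.
 by have := congr1 (@complex.Re R) cb0; rewrite Re0 reca => /eqP; rewrite mulf_eq0 invr_eq0 pnatr_eq0 orbF subr_eq0 => /eqP.
have h2 : Q i2 i1 = - Q i1 i2.
 by have := congr1 (@complex.Im R) cb0; rewrite Im0 reca => /eqP; rewrite mulf_eq0 invr_eq0 pnatr_eq0 orbF addr_eq0 => /eqP.
have n1 : Q i2 i2 ^+ 2 + Q i1 i2 ^+ 2 = 1.
 have := congr1 (fun t : R => t ^+ 2) ca1; rewrite sqr_nm !reca h1 h2 expr1n => <-; by field.
split; last by rewrite h1 h2 -n1; ring.
apply/matrixP => i j; rewrite tE mxE.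
have c2 k : k = i1 \/ k = i2 by case: k => -[|[|//]] hk; [left|right]; exact: val_inj.
case: (c2 i) => ->; case: (c2 j) => ->; rewrite ?eqxx ?(negbTE i12) ?(negbTE i21) ?h1 ?h2 ?mulr1n ?mulr0n -?n1; ring.
Qed.

Lemma ca_rot c : ca (rot c) = c.
Proof. by apply: cplx_eq; rewrite reca !mxE /=; move: (Re c) (Im c) => x y; field. Qed.
Lemma cb_rot c : cb (rot c) = 0.
Proof. by apply: cplx_eq; rewrite ?Re0 ?Im0 reca !mxE /=; move: (Re c) (Im c) => x y; field. Qed.

Lemma rot_SO2 c : nm c = 1 -> SO2 (rot c).
Proof. by move=> c1; apply/SO2P; rewrite ca_rot cb_rot. Qed.

Definition s2 : R := Num.sqrt 2.
Lemma s2_ge0 : 0 <= s2. Proof. exact: sqrtr_ge0. Qed.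
Lemma s2_sq : s2 ^+ 2 = 2. Proof. by rewrite sqr_sqrtr. Qed.

(** The two moduli are packed into one complex number, so that the measurability and the component
    bounds of [nm] can be reused. *)
Lemma fnormE A : fnorm A = s2 * nm ((nm (ca A)) +i* (nm (cb A))).
Proof.
apply/eqP; rewrite -(@eqrXn2 _ 2) ?fnorm_ge0 ?mulr_ge0 ?s2_ge0 ?nm_ge0//.
by rewrite fnorm_sq exprMn s2_sq; move: (nm (ca A)) (nm (cb A)) => x y; rewrite sqr_nm.
Qed.

(** Subtracting a rotation leaves the anticonformal part alone, and the unit constant closest to
    [ca A] is its phase, or any unit when [ca A] vanishes. *)
Lemma distE A : distSO2 A = s2 * nm ((nm (ca A) - 1) +i* (nm (cb A))).
Proof.
set v := s2 * _; have v0 : 0 <= v by rewrite mulr_ge0 ?s2_ge0 ?nm_ge0.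
have vsq : v ^+ 2 = 2 * ((nm (ca A) - 1) ^+ 2 + nm (cb A) ^+ 2) by rewrite exprMn s2_sq [nm (_ +i* _) ^+ 2]sqr_nm.
have lb : lbound [set fnorm (A - Q) | Q in SO2] v.
 move=> _ [Q /SO2P[b0 a1] <-]; rewrite -(@ler_pXn2r _ 2) ?nnegrE ?fnorm_ge0//.
 rewrite vsq fnorm_sq ler_pM2l// caB cbB b0 subr0 lerD2r.
 rewrite -(real_normK (num_real (nm (ca A) - 1))) ler_pXn2r ?nnegrE ?nm_ge0// -a1.
 exact: nm_sub.
apply/eqP; rewrite eq_le; apply/andP; split; last first.
 apply: lb_le_inf => //; exists (fnorm (A - rot 1)), (rot 1) => //; apply: rot_SO2; exact: nm1.
apply: ge_inf; first by exists v.
have [c [c1 hc]] : exists c : R[i], nm c = 1 /\ nm (ca A - c) = `|nm (ca A) - 1|.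
 have [z0|z0] := eqVneq (nm (ca A)) 0.
  by exists 1; rewrite z0 (nm_eq0 z0) !sub0r nmN nm1 normrN normr1.
 exists ((nm (ca A))^-1%:C * ca A); rewrite nmM nmR ger0_norm ?invr_ge0 ?nm_ge0// mulVf//; split=> //.
 have -> : ca A - (nm (ca A))^-1%:C * ca A = (1 - (nm (ca A))^-1)%:C * ca A by rewrite rmorphB rmorph1 mulrBl mul1r.
 rewrite nmM nmR -[in X in _ * X](ger0_norm (nm_ge0 (ca A))) -normrM mulrBl mul1r mulVf//.
exists (rot c); first exact: rot_SO2.
apply/eqP; rewrite -(@eqrXn2 _ 2) ?fnorm_ge0// vsq fnorm_sq caB cbB ca_rot cb_rot subr0 hc.
by rewrite real_normK ?num_real.
Qed.

Lemma dist_ge A : 0 <= distSO2 A /\ nm (cb A) <= distSO2 A /\ `|nm (ca A) - 1| <= distSO2 A.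
Proof.
rewrite distE; set w := (_ +i* _); have s1 : 1 <= s2 by rewrite -(@ler_pXn2r _ 2) ?nnegrE ?s2_ge0// expr1n s2_sq ler1n.
have w0 := nm_ge0 w; have ws : nm w <= s2 * nm w by rewrite ler_peMl.
split; first exact: le_trans ws; split; apply: le_trans ws.
 by apply: le_trans (nm_Im w); rewrite /w /= ler_norm.
exact: (nm_Re w).
Qed.

Section Mixed.
Variable p : R.
Hypothesis p12 : 1 < p < 2.

Let p1 : 1 <= p. Proof. by case/andP: p12 => /ltW. Qed.
Let p2 : p <= 2. Proof. by case/andP: p12 => _ /ltW. Qed.
Let p0 : 0 <= p. Proof. exact: le_trans p1. Qed.

Lemma mixed_ge0 t : 0 <= mixed t p.
Proof. by rewrite /mixed le_min sqr_ge0 powR_ge0. Qed.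

Lemma mixed_mono s t : 0 <= s -> s <= t -> mixed s p <= mixed t p.
Proof.
move=> s0 st; have t0 : 0 <= t := le_trans s0 st.
have h1 : s ^+ 2 <= t ^+ 2 by rewrite ler_pXn2r ?nnegrE.
have h2 : s `^ p <= t `^ p by apply: ge0_ler_powR; rewrite ?nnegrE.
by rewrite /mixed le_min !ge_min h1 h2 orbT.
Qed.

(** Above 1 the power dominates [t] because [1 <= p]; below 1 it dominates [t ^+ 2] because
    [p <= 2]. *)
Lemma m1_le_mixed t : 0 <= t -> m1 t <= mixed t p.
Proof.
move=> t0; rewrite /mixed le_min /m1 !ge_min lexx orbT /=.
have [t1|t1] := leP 1 t; first by rewrite le1r_powR.
have [->|tn] := eqVneq t 0; first by rewrite powR_ge0.
have tp : 0 < t by rewrite lt_neqAle eq_sym tn.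
by rewrite -(powR_mulrn 2 t0) ger_powR ?orbT// tp ltW.
Qed.

Lemma mixed_double t : 0 <= t -> mixed (2 * t) p <= 4 * mixed t p.
Proof.
move=> t0; rewrite /mixed minr_pMr// le_min !ge_min; apply/andP; split.
 by rewrite exprMn -natrX lexx.
rewrite powRM// ler_wpM2r ?powR_ge0 ?orbT//.
by apply: (le_trans (ler_powR _ p2)); rewrite ?ler1n// (powR_mulrn 2)// -natrX.
Qed.

Lemma mixedD s t : 0 <= s -> 0 <= t -> mixed (s + t) p <= 4 * (mixed s p + mixed t p).
Proof.
have main x y : 0 <= x -> x <= y -> mixed (x + y) p <= 4 * (mixed x p + mixed y p).
 move=> x0 xy; have y0 := le_trans x0 xy.
 apply: (@le_trans _ _ (mixed (2 * y) p)); first by apply: mixed_mono; rewrite ?addr_ge0// mulr2n mulrDl mul1r lerD2r.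
 by apply: (le_trans (mixed_double y0)); rewrite ler_pM2l// lerDr mixed_ge0.
move=> s0 t0; have [st|ts] := leP s t; first exact: main.
rewrite addrC [X in 4 * X]addrC; apply: main => //; exact: ltW.
Qed.

(** The truncation can be removed: if [|ca A - c| > 1], then [|ca A - c| <= d + 2] for [d] the
    distance to the rotations, and the constant [mixed 2 p <= 4] is absorbed by [tr = 1]. *)
Lemma mixed_rot A c : nm c = 1 ->
 mixed (fnorm (A - rot c)) p <= 256 * (tr (nm (ca A - c)) ^+ 2 + mixed (distSO2 A) p).
Proof.
move=> c1; have [d0 [db da]] := dist_ge A; set u := nm (ca A - c); set d := distSO2 A in d0 db da *.
have u0 : 0 <= u by exact: nm_ge0.
have h1 : fnorm (A - rot c) <= 2 * u + 2 * d.
 rewrite -(@ler_pXn2r _ 2) ?nnegrE ?fnorm_ge0 ?addr_ge0 ?mulr_ge0// fnorm_sq caB cbB ca_rot cb_rot subr0 -/u.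
 have b0 := nm_ge0 (cb A); have bd : nm (cb A) ^+ 2 <= d ^+ 2 by rewrite ler_pXn2r ?nnegrE.
 have ud : 0 <= u * d by exact: mulr_ge0.
 rewrite (_ : (2 * u + 2 * d) ^+ 2 = 4 * u ^+ 2 + 8 * (u * d) + 4 * d ^+ 2); last by ring.
 have := sqr_ge0 u; have := sqr_ge0 d; move: bd ud; move: (u ^+ 2) (d ^+ 2) (u * d) (nm _ ^+ 2) => *; lra.
have M0 := mixed_ge0 d.
have h2 : mixed u p <= 16 * tr u ^+ 2 + 4 * mixed d p.
 have [u1|u1] := leP u 1.
  have -> : tr u = u by rewrite /tr; case: leP u1 => // h h'; apply/eqP; rewrite eq_le h h'.
  apply: (@le_trans _ _ (u ^+ 2)); first by rewrite /mixed ge_min lexx.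
  by have := sqr_ge0 u; move: (u ^+ 2) => x; lra.
 have -> : tr u = 1 by rewrite /tr; case: leP u1 => // h h'; have := lt_trans h h'; rewrite ltxx.
 have ud : u <= d + 2.
  apply: (le_trans (nmB _ _)); rewrite c1; move: da; rewrite ler_norml => /andP[_]; lra.
 apply: (le_trans (mixed_mono u0 ud)); apply: (le_trans (mixedD d0 _)) => //.
 have m2 : mixed 2 p <= 4 by rewrite /mixed ge_min -natrX lexx.
 by rewrite expr1n; lra.
apply: (le_trans (mixed_mono (fnorm_ge0 _) h1)).
have u20 : 0 <= 2 * u by rewrite mulr_ge0.
have d20 : 0 <= 2 * d by rewrite mulr_ge0.
apply: (le_trans (mixedD u20 d20)); have := mixed_double u0; have := mixed_double d0.
move: h2; move: (mixed u p) (mixed d p) (mixed (2 * u) p) (mixed (2 * d) p) (tr u ^+ 2) M0 => *; lra.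
Qed.
End Mixed.
End Matrices.

(** * Transfer to matrix fields *)

Section Final.
Context {R : realType}.
Local Notation pt := (R * R)%type.

Lemma integral_ind (O : set pt) (f F : pt -> R) : (forall x, F x = f x * \1_O x) ->
 (\int[leb2]_(x in O) (f x)%:E = \int[leb2]_x (F x)%:E)%E.
Proof.
move=> h; rewrite integral_mkcond; apply: eq_integral => x _.
by rewrite patchE h indE; case: ifP; rewrite ?mulr1 ?mulr0.
Qed.

Lemma meas_ind (O : set pt) (f : pt -> R) : measurable O -> measurable_fun O f ->
 mfun (fun x => f x * \1_O x).
Proof.
move=> mO /(measurable_restrictT _ mO); congr (measurable_fun _ _); apply/funext => x.
by rewrite patchE indE; case: ifP; rewrite ?mulr1 ?mulr0.
Qed.

Lemma mul_ind_out (O : set pt) (u : R) x : ~ O x -> u * \1_O x = 0.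
Proof. by move=> Ox; rewrite ind_out// mulr0. Qed.

Lemma bounded2_L1 (O : set pt) : open O -> bounded2 O -> L1 (\1_O : pt -> R).
Proof.
move=> oO [M hM]; apply: (@L1_box _ 1 (`|M| + 1)).
- apply: mindic; exact: open2_meas.
- exact: norm_ind.
- move=> x xb; apply: ind_out => Ox; apply: xb; apply/ball0E; have [n1 n2] := le_enorm2 x.1 x.2.
 have h := le_trans (hM x Ox) (ler_norm M).
 by apply/norm_pt_ltP; split; [apply: (le_lt_trans (le_trans n1 h))|apply: (le_lt_trans (le_trans n2 h))]; rewrite ltrDl.
Qed.

Lemma smooth2_0 : smooth2 (fun _ : pt => 0 : R).
Proof.
move=> vs; suff -> : Defs.iterD vs (fun _ : pt => 0 : R) = (fun _ => 0) by move=> x; exact: differentiable_cst.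
elim: vs => //= v vs ->; apply/funext => x; exact: derive_cst.
Qed.

Lemma curlTV_ge0 (O : set pt) (beta : pt -> 'M[R]_2) : (0 <= curlTV O beta)%E.
Proof.
apply: ereal_sup_ubound; exists (fun _ => 0), (fun _ => 0).
have t0 : test_fun O (fun _ : pt => 0 : R).
 by split; [exact: smooth2_0|exists set0; split; [exact: compact0|split]].
split=> //; split=> //; split; first by move=> x; rewrite expr0n addr0 ler01.
rewrite /curl_pair; apply/esym/integral0_eq => x _; congr (_%:E).
have d0 (v : pt) : derive (fun _ : pt => 0 : R) x v = 0 by exact: derive_cst.
by rewrite /d1 /d2 !d0 !mulr0 !subr0 addr0.
Qed.

(* If the data vanish then [a] is constant of modulus 1; the constant is its mean. *)
Lemma est_zero (O : set pt) (a b : pt -> R[i]) (C : R) : open O -> O !=set0 -> L1 (\1_O : pt -> R) -> 0 <= C -> est O O C ->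
 (forall D, 0 < D -> data O a b D) -> exists c : R[i], nm c = 1 /\ I2 (fun x => dev a c x * \1_O x) <= 0.
Proof.
move=> oO [x0 Ox0] LO C0 hC hD; have mO := open2_meas oO.
have [La Lb _ _] := hD 1 ltr01; have ma := cL1_meas La.
pose S : R := I2 (\1_O).
have [r [r0 rO]] := open_ball_in oO Ox0.
have S0 : 0 < S.
 apply: (@lt_le_trans _ _ ((2 * r) ^+ 2)); first by rewrite exprn_gt0// mulr_gt0.
 rewrite -(I2_ball x0 (ltW r0)); apply: I2_le => //; first exact: L1_ball.
 move=> x; have [xb|xb] := pselect (ball x0 r x); first by rewrite (ind_in xb) (ind_in (rO x xb)).
 by rewrite (ind_out xb); case/andP: (ind_itv O x).
have LH := HH_L1 La Lb mO LO.
have H0 : I2 (fun x => HH a b x * \1_O x) <= 0.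
 apply/ler_addgt0Pr => t t0; rewrite add0r; have [_ _ _ [T [T0 _ h]]] := hD t t0.
 by apply: le_trans h; rewrite lerDl sqr_ge0.
have LaO : cL1 (fun x => a x * (\1_O x)%:C).
 apply: (cL1_dom _ (L1_nm La)); first by apply: cmeasM => //; apply: cmeasR; exact: mindic.
 by move=> x; have /andP[i0 i1] := ind_itv O x; rewrite nmM nmR ger0_norm// ler_piMr// nm_ge0.
(* The constants obtained for [D = d^2] converge to the mean of [a]: L1 control of [a - c] follows
   from the truncated deviation and from [HH], whose integral over [O] vanishes. *)
pose m : R[i] := (S^-1)%:C * cI (fun x => a x * (\1_O x)%:C).
pose K := (3 * (2^-1 * (S + C))) / S.
have K0 : 0 <= K by rewrite divr_ge0 ?(ltW S0)// !mulr_ge0// addr_ge0// ltW.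
have pointwise c x : nm c = 1 -> nm (a x - c) <= 3 * tr (nm (a x - c)) + HH a b x.
 move=> c1; have HHa : m1 `|nm (a x) - 1| <= HH a b x by rewrite /HH lerDr m1_ge0// nm_ge0.
 have HH0 := HH_ge0 a b x.
 have [u1|u1] := leP (nm (a x - c)) 1.
  have -> : tr (nm (a x - c)) = nm (a x - c) by rewrite /tr; case: leP u1 => // h h'; apply/eqP; rewrite eq_le h h'.
  by have := nm_ge0 (a x - c); move: (nm _) HH0 => u; lra.
 have -> : tr (nm (a x - c)) = 1 by rewrite /tr; case: leP u1 => // h h'; have := lt_trans h h'; rewrite ltxx.
 have := nmB (a x) c; rewrite c1; have := le_1m1 (normr_ge0 (nm (a x) - 1)); have := ler_norm (nm (a x) - 1).
 move=> h1 h2 h3; move: h1 h2 h3 HHa {u1 HH0 c1}.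
 by move: (nm (a x - c)) (nm (a x)) `|nm (a x) - 1| (HH a b x) (m1 _) => *; lra.
have close d : 0 < d -> exists c : R[i], [/\ nm c = 1, nm (m - c) <= K * d & I2 (fun x => dev a c x * \1_O x) <= C * d ^+ 2].
 move=> d0; have d20 : 0 < d ^+ 2 by rewrite exprn_gt0.
 have [c [c1 hc]] := hC a b _ (hD _ d20); exists c; split=> //.
 have Lc : cL1 (fun x => c * (\1_O x)%:C) by apply: cL1Z; exact: cL1R.
 have E : m - c = (S^-1)%:C * cI (fun x => (a x - c) * (\1_O x)%:C).
  transitivity ((S^-1)%:C * (cI (fun x => a x * (\1_O x)%:C) - cI (fun x => c * (\1_O x)%:C))).
   rewrite mulrBr cIZ; last exact: cL1R.
   rewrite cIR -/S mulrCA -rmorphM mulVf ?gt_eqF// mulr1//.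
  by rewrite -cIB//; congr (_ * _); apply: cI_eq => x; rewrite mulrBl.
 have LD : cL1 (fun x => (a x - c) * (\1_O x)%:C).
  by rewrite (_ : (fun x => _) = (fun x => a x * (\1_O x)%:C - c * (\1_O x)%:C)); [exact: cL1B|apply/funext => x; rewrite mulrBl].
 rewrite E nmM nmR gtr0_norm ?invr_gt0// mulrC ler_pdivrMr//.
 apply: (le_trans (cI_abs LD)).
 have Ld := dev_L1 c ma mO LO.
 apply: (@le_trans _ _ (I2 (fun x => (3 * (2^-1 * d)) * \1_O x + (3 * (2^-1 / d)) * (dev a c x * \1_O x) + HH a b x * \1_O x))).
  apply: I2_le; [exact: L1_nm|exact: L1D (L1D (L1Z _ LO) (L1Z _ Ld)) LH|].
  move=> x; have /andP[i0 i1] := ind_itv O x; rewrite nmM nmR (ger0_norm i0).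
  rewrite (_ : _ + _ + _ = (3 * (2^-1 * d) + 3 * (2^-1 / d) * dev a c x + HH a b x) * \1_O x); last by ring.
  rewrite ler_wpM2r//.
  apply: (le_trans (pointwise c x c1)); rewrite lerD2r.
  have := tr_half d0 (nm_ge0 (a x - c)); rewrite -/(dev a c x) => ht.
  have -> : 3 * (2^-1 * d) + 3 * (2^-1 / d) * dev a c x = 3 * (2^-1 * (d + dev a c x / d)) by ring.
  by rewrite ler_pM2l.
 rewrite (I2D (L1D (L1Z _ LO) (L1Z _ Ld)) LH) (I2D (L1Z _ LO) (L1Z _ Ld)) (I2Z _ LO) (I2Z _ Ld) -/S.
 have -> : K * d * S = 3 * (2^-1 * d) * S + 3 * (2^-1 / d) * (C * d ^+ 2).
  by rewrite /K; field; rewrite !gt_eqF.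
 rewrite -[leRHS]addr0; apply: lerD => //; rewrite lerD2l ler_wpM2l// mulr_ge0// divr_ge0//; exact: ltW.
exists m; split.
 have h d : 0 < d <= 1 -> `|nm m - 1| <= K * d.
  move=> /andP[d0 _]; have [c [c1 hm _]] := close d d0; rewrite -c1; apply: le_trans hm; exact: nm_sub.
 by have := eq0_small (normr_ge0 (nm m - 1)) h => /eqP; rewrite normr_eq0 subr_eq0 => /eqP.
have Lm := dev_L1 m ma mO LO.
have h d : 0 < d <= 1 -> I2 (fun x => dev a m x * \1_O x) <= (2 * C + 2 * K ^+ 2 * S) * d.
 move=> /andP[d0 d1]; have [c [c1 hm hc]] := close d d0; have Ld := dev_L1 c ma mO LO.
 apply: (@le_trans _ _ (I2 (fun x => 2 * (dev a c x * \1_O x) + 2 * (K * d) ^+ 2 * \1_O x))).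
  apply: I2_le; [exact: Lm|exact: L1D (L1Z _ Ld) (L1Z _ LO)|].
  move=> x; have i0 := ind_ge0 O x; rewrite mulrA -mulrDl ler_wpM2r//.
  apply: (le_trans (dev_change a m c x)); rewrite lerD2l ler_pM2l// ler_pXn2r ?nnegrE ?tr_ge0 ?nm_ge0//.
   exact: le_trans (tr_le _) hm.
  by rewrite mulr_ge0// ltW.
 rewrite (I2D (L1Z _ Ld) (L1Z _ LO)) (I2Z _ Ld) (I2Z _ LO) -/S.
 have d2 : d ^+ 2 <= d by rewrite expr2 ler_piMl// ltW.
 apply: (@le_trans _ _ ((2 * C + 2 * K ^+ 2 * S) * d ^+ 2)).
  rewrite (_ : (2 * C + 2 * K ^+ 2 * S) * d ^+ 2 = 2 * (C * d ^+ 2) + 2 * (K * d) ^+ 2 * S); last by ring.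
  by rewrite lerD2r ler_pM2l.
 apply: ler_wpM2l => //; apply: addr_ge0; first exact: mulr_ge0 (ler0n _ 2) C0.
 exact: mulr_ge0 (mulr_ge0 (ler0n _ 2) (sqr_ge0 K)) (ltW S0).
rewrite (eq0_small _ h)//; apply: I2_ge0 => x; rewrite mulr_ge0 ?dev_ge0//; by case/andP: (ind_itv O x).
Qed.

Lemma fnorm0 : fnorm (0 : 'M[R]_2) = 0.
Proof. by rewrite /fnorm big1 ?sqrtr0// => i _; rewrite big1// => j _; rewrite mxE expr0n. Qed.

Lemma ca0 : ca (0 : 'M[R]_2) = 0.
Proof. by rewrite /ca !mxE addr0 subr0 mul0r. Qed.

Lemma cb0 : cb (0 : 'M[R]_2) = 0.
Proof. by rewrite /cb !mxE addr0 subr0 mul0r. Qed.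

(** The two rows are tested with [Re (i F)] and [Re (- F)], that is with [- Im F] and [- Re F]: a
    pair of Euclidean norm [|F|] whose real pairing is the real part of [Lf]. *)
Lemma curl_pairing (A : 'M[R]_2) (z w : R[i]) :
 A i1 i1 * Re (iC * w) - A i1 i2 * Re (iC * z) + A i2 i1 * Re (-1 * w) - A i2 i2 * Re (-1 * z) =
 Re (ca A * (z + iC * w) - cb A * (z - iC * w)).
Proof.
move: (Re_ca A) (Im_ca A) (Re_cb A) (Im_cb A); move: (ca A) (cb A) => u v h1 h2 h3 h4.
by rewrite !reim h1 h2 h3 h4; field.
Qed.

Section Field.
Variables (p : R) (O : set pt) (beta : pt -> 'M[R]_2).
Hypotheses (p12 : 1 < p < 2) (oO : open O) (LO : L1 (\1_O : pt -> R)) (Lp : Lp2 O p beta)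
 (TV : (curlTV O beta < +oo)%E).

Let mO : measurable O. Proof. exact: open2_meas. Qed.
(** Extension by zero turns the pairing over [O] into one over the plane, with [fa] and [fb]
    integrable there. *)
Definition betaO (x : pt) : 'M[R]_2 := \matrix_(i, j) (beta x i j * \1_O x).
Definition fa x := ca (betaO x).
Definition fb x := cb (betaO x).

Lemma betaO_in x : O x -> betaO x = beta x.
Proof. by move=> Ox; apply/matrixP => i j; rewrite mxE ind_in// mulr1. Qed.

Lemma betaO_out x : ~ O x -> betaO x = 0.
Proof. by move=> Ox; apply/matrixP => i j; rewrite !mxE ind_out// mulr0. Qed.

Lemma meas_betaO i j : mfun (fun x => betaO x i j).
Proof.
by under eq_fun do rewrite mxE; apply: meas_ind => //; case: Lp.
Qed.

Lemma meas_cab : cmeas fa /\ cmeas fb.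
Proof.
have m := meas_betaO.
have d (f : pt -> R) : mfun f -> mfun (fun x => f x / 2).
 by move=> mf; apply: measurable_funM.
split; split.
- apply: d; exact: measurable_funD.
- apply: d; exact: measurable_funB.
- apply: d; exact: measurable_funB.
- apply: d; exact: measurable_funD.
Qed.

Lemma meas_norms : mfun (fun x => fnorm (betaO x)) /\ mfun (fun x => distSO2 (betaO x)).
Proof.
have [ma mb] := meas_cab; have mca := meas_nm ma; have mcb := meas_nm mb.
split.
 under eq_fun do rewrite fnormE; apply: measurable_funM => //; apply: meas_nm; split; [exact: mca|exact: mcb].
under eq_fun do rewrite distE; apply: measurable_funM => //; apply: meas_nm; split; last exact: mcb.
exact: measurable_funB.
Qed.

Lemma L1_of_integral (f F : pt -> R) : (forall x, F x = f x * \1_O x) -> mfun F -> (forall x, 0 <= F x) ->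
 (\int[leb2]_(x in O) (f x)%:E < +oo)%E -> L1 F /\ (\int[leb2]_(x in O) (f x)%:E)%E = (I2 F)%:E.
Proof.
by move=> E mF F0 h; rewrite (integral_ind E) in h *; have LF := L1_ge0P mF F0 h; rewrite I2E.
Qed.

(** On a set of finite area, [t <= 1 + t^p] gives integrability from the bound in L^p. *)
Lemma cL1_ab : cL1 fa /\ cL1 fb.
Proof.
have [ma mb] := meas_cab; have [mn _] := meas_norms.
have p1 : 1 <= p by case/andP: p12 => /ltW.
have p0 : 0 < p by case/andP: p12 => h _; exact: lt_trans h.
have [LF _] : L1 (fun x => (fnorm (betaO x)) `^ p) /\ (\int[leb2]_(x in O) ((fnorm (beta x)) `^ p)%:E)%E = (I2 (fun x => (fnorm (betaO x)) `^ p))%:E.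
 apply: L1_of_integral; last by case: Lp.
 - move=> x; have [Ox|Ox] := pselect (O x); first by rewrite (ind_in Ox) betaO_in// mulr1.
  rewrite (ind_out Ox) mulr0 betaO_out// fnorm0 powR0// (gt_eqF p0)//.
 - exact: (measurableT_comp (measurable_powR p) mn).
 - move=> x; exact: powR_ge0.
have LG := L1D LO LF.
have bd x : fnorm (betaO x) <= \1_O x + (fnorm (betaO x)) `^ p.
 have [Ox|Ox] := pselect (O x); last first.
  by rewrite betaO_out// fnorm0 powR0 ?gt_eqF// addr0; case/andP: (ind_itv O x).
 rewrite (ind_in Ox); have [t1|t1] := leP 1 (fnorm (betaO x)).
  apply: (le_trans (le1r_powR t1 p1)).
  by rewrite lerDr.
 by apply: (le_trans (ltW t1)); rewrite lerDl powR_ge0.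
have n2 x := fnorm_sq (betaO x).
have ab x : nm (fa x) <= fnorm (betaO x) /\ nm (fb x) <= fnorm (betaO x).
 have a0 := sqr_ge0 (nm (fa x)); have b0 := sqr_ge0 (nm (fb x)).
 by split; rewrite -(@ler_pXn2r _ 2) ?nnegrE ?fnorm_ge0 ?nm_ge0// n2 -/(fa x) -/(fb x);
  move: a0 b0; move: (nm (fa x) ^+ 2) (nm (fb x) ^+ 2) => u v; lra.
by split; apply: (cL1_dom _ LG) => // x; apply: le_trans (bd x); case: (ab x).
Qed.

Lemma curl_Lbd : Lbd_on O fa fb (fine (curlTV O beta)) /\ 0 <= fine (curlTV O beta).
Proof.
have V0 := curlTV_ge0 O beta; have Vf : curlTV O beta = (fine (curlTV O beta))%:E.
 by rewrite fineK// ge0_fin_numE.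
split; last exact: fine_ge0.
have [La Lb] := cL1_ab; apply: Lbd_on_of_smooth => // F F1 F2 CF tF F1' [B hB].
rewrite -lee_fin -Vf; apply: ereal_sup_ubound.
exists (fun x => Re (iC * F x)), (fun x => Re (-1 * F x)); split; first exact: tF.
split; first exact: tF.
split.
 move=> x; have := F1' x; rewrite -(@ler_pXn2r _ 2) ?nnegrE ?nm_ge0// expr1n sqr_nm => h.
 by apply: le_trans h; rewrite !reim; apply: eq_ler; ring.
have D w x := C11r_diff x (C11_Re (C11_Z w CF)).
have dw w x : d1 (fun x => Re (w * F x)) x = Re (w * F1 x) /\ d2 (fun x => Re (w * F x)) x = Re (w * F2 x).
 by have [_ h] := D w x; rewrite /d1 /d2 !h /= !mulr1 !mulr0 addr0 add0r.
have [mF mF1 mF2] := C11_cmeas CF.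
rewrite /curl_pair.
pose G x := fa x * (F1 x + iC * F2 x) - fb x * (F1 x - iC * F2 x).
have LG : L1 (fun x => Re (G x)).
 by have [[]] := Lf_L1 La Lb mF1 mF2 (fun x => proj1 (hB x)) (fun x => proj2 (hB x)).
rewrite (integral_ind (F := fun x => Re (G x))); first by rewrite I2E.
move=> x; have [-> ->] := dw iC x; have [-> ->] := dw (-1) x.
have [Ox|Ox] := pselect (O x); last first.
 by rewrite (ind_out Ox) mulr0 /G /fa /fb betaO_out// ca0 cb0 !mul0r subrr.
by rewrite (ind_in Ox) mulr1 /G /fa /fb betaO_in// curl_pairing.
Qed.

Definition hd (x : pt) : R := mixed (distSO2 (betaO x)) p * \1_O x.

Lemma hd_ge0 x : 0 <= hd x.
Proof. by rewrite mulr_ge0 ?mixed_ge0//; case/andP: (ind_itv O x). Qed.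

Lemma meas_mixed (f : pt -> R) : mfun f -> mfun (fun x => mixed (f x) p).
Proof.
move=> mf; apply: measurable_minr; first exact: measurable_funX.
exact: (measurableT_comp (measurable_powR p) mf).
Qed.

Lemma meas_hd : mfun hd.
Proof.
apply: measurable_funM; last exact: mindic.
by apply: meas_mixed; case: meas_norms.
Qed.

Lemma HH_hd x : HH fa fb x * \1_O x <= 2 * hd x.
Proof.
rewrite /hd mulrA; case/andP: (ind_itv O x) => i0 _; apply: ler_wpM2r => //.
have [d0 [h1 h2]] := dist_ge (betaO x).
have m := m1_le_mixed p12 d0; rewrite /HH mulr_natl mulr2n.
by apply: lerD; (apply: le_trans m; apply: m1_mono => //); rewrite ?nm_ge0.
Qed.

Lemma field_estimate (C : R) : O !=set0 -> 0 <= C -> est O O C ->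
 (\int[leb2]_(x in O) (mixed (distSO2 (beta x)) p)%:E < +oo)%E ->
 exists Q : 'M[R]_2, SO2 Q /\
  (\int[leb2]_(x in O) (mixed (fnorm (beta x - Q)) p)%:E
   <= (256 * (2 * C + 1))%:E * (\int[leb2]_(x in O) (mixed (distSO2 (beta x)) p)%:E
      + curlTV O beta * curlTV O beta))%E.
Proof.
move=> O0 C0 hC hfin.
have hdE x : hd x = mixed (distSO2 (beta x)) p * \1_O x.
 have [Ox|Ox] := pselect (O x); first by rewrite /hd betaO_in.
 exact: etrans (mul_ind_out _ Ox) (esym (mul_ind_out _ Ox)).
have [Lh Eh] := L1_of_integral hdE meas_hd hd_ge0 hfin.
have [La Lb] := cL1_ab; have [LT T0] := curl_Lbd.
set T := fine (curlTV O beta) in LT T0 *.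
have ET : curlTV O beta = T%:E by rewrite fineK// ge0_fin_numE// curlTV_ge0.
have LH := HH_L1 La Lb mO LO.
have h0 : 0 <= I2 hd by apply: I2_ge0; exact: hd_ge0.
pose D := 2 * I2 hd + T ^+ 2.
have D0 : 0 <= D by rewrite addr_ge0 ?sqr_ge0// mulr_ge0.
have HD : I2 (fun x => HH fa fb x * \1_O x) + T ^+ 2 <= D.
 by rewrite lerD2r -(I2Z _ Lh); apply: I2_le => //; [exact: L1Z|exact: HH_hd].
have dat E : 0 < E -> D <= E -> data O fa fb E.
 move=> E0 DE; split=> //; exists T; split=> //; exact: le_trans DE.
(* [data] asks for a positive bound; vanishing data are covered by [est_zero]. *)
have [c [c1 hc]] : exists c : R[i], nm c = 1 /\ I2 (fun x => dev fa c x * \1_O x) <= C * D.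
 have [Dp|Dn] := ltP 0 D; first by apply: hC; exact: dat.
 have DE : D = 0 by apply/eqP; rewrite eq_le Dn.
 rewrite DE mulr0; apply: (est_zero oO O0 LO C0 hC) => E E0; apply: dat => //.
 by rewrite DE ltW.
exists (rot c); split; first exact: rot_SO2.
have [ma mb] := meas_cab.
pose g x := mixed (fnorm (betaO x - rot c)) p * \1_O x.
have gE x : g x = mixed (fnorm (beta x - rot c)) p * \1_O x.
 have [Ox|Ox] := pselect (O x); first by rewrite /g betaO_in.
 exact: etrans (mul_ind_out _ Ox) (esym (mul_ind_out _ Ox)).
have Ld := dev_L1 c ma mO LO.
have g0 x : 0 <= g x by rewrite mulr_ge0 ?mixed_ge0//; case/andP: (ind_itv O x).
have gle x : g x <= 256 * (dev fa c x * \1_O x + hd x).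
 rewrite /g /hd -mulrDl mulrA; case/andP: (ind_itv O x) => i0 _; apply: ler_wpM2r => //.
 exact: mixed_rot.
have mg : mfun g.
 apply: measurable_funM; last exact: mindic.
 apply: meas_mixed; under eq_fun do rewrite fnormE caB cbB ca_rot cb_rot subr0.
 apply: measurable_funM => //; apply: meas_nm; split; last exact: meas_nm mb.
 apply: meas_nm; apply: cmeasB ma _; exact: cmeas_cst.
have LS := L1Z 256 (L1D Ld Lh).
have Lg : L1 g.
 by apply: L1_dom LS _ => // x; rewrite ger0_norm.
rewrite (integral_ind gE) Eh ET (I2E Lg) -[leRHS]/(((256 * (2 * C + 1)) * (I2 hd + T * T))%:E) lee_fin.
apply: (le_trans (I2_le Lg LS gle)); rewrite (I2Z _ (L1D Ld Lh)) (I2D Ld Lh) -mulrA ler_pM2l ?ltr0n//.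
apply: (@le_trans _ _ (C * D + I2 hd)); first by rewrite lerD2r.
have -> : (2 * C + 1) * (I2 hd + T * T) = C * D + I2 hd + (C * T ^+ 2 + T * T) by rewrite /D; ring.
by rewrite lerDl addr_ge0// mulr_ge0// sqr_ge0.
Qed.
End Field.
End Final.

Theorem theorem1p4 (R : realType) (p : R) (O : set (R * R)) :
  1 < p < 2 -> open O -> simply_connected2 O -> bounded2 O ->
  lipschitz_boundary O ->
  exists C : R, 0 < C /\
    forall beta : R * R -> 'M[R]_2,
      Lp2 O p beta -> (curlTV O beta < +oo)%E ->
      exists Q : 'M[R]_2, SO2 Q /\
        (\int[leb2]_(x in O) (mixed (fnorm (beta x - Q)) p)%:E
         <= C%:E * (\int[leb2]_(x in O) (mixed (distSO2 (beta x)) p)%:E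
                    + curlTV O beta * curlTV O beta))%E.
Proof.
move=> p12 oO [pO _] bO lb; have LO := bounded2_L1 oO bO.
(* The gluing argument starts from a point of the domain, so the empty domain is set aside; there
   both integrals vanish. *)
have [C [C0 hC]] : exists C : R, 0 <= C /\ (O !=set0 -> est O O C).
 have [->|/set0P O0] := eqVneq O set0; first by exists 0; split=> // -[].
 by have [C [C0 hC]] := domain_good oO LO pO O0 bO lb; exists C.
have K0 : 0 < 256 * (2 * C + 1) by apply: mulr_gt0; rewrite ?ltr0n// ltr_wpDl ?ltr01// mulr_ge0 ?ler0n.
exists (256 * (2 * C + 1)); split=> // beta Lp TV.
have V0 := mule_ge0 (curlTV_ge0 O beta) (curlTV_ge0 O beta).
have I0 : (0 <= \int[leb2]_(x in O) (mixed (distSO2 (beta x)) p)%:E)%E.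
 by apply: integral_ge0 => x _; rewrite lee_fin mixed_ge0.
have S1 : SO2 (rot 1 : 'M[R]_2) by apply: rot_SO2; exact: nm1.
have [OE|/set0P O0] := eqVneq O set0.
 exists (rot 1); split=> //; rewrite OE !integral_set0 add0e -OE.
 by apply: mule_ge0; [rewrite lee_fin; exact: ltW|exact: V0].
have [fin|] := ltP (\int[leb2]_(x in O) (mixed (distSO2 (beta x)) p)%:E)%E +oo%E.
 exact: field_estimate (hC O0) fin.
(* If the distance integral is infinite, so is the right-hand side, the squared variation being
   nonnegative, and any rotation will do. *)
rewrite leye_eq => /eqP ->; exists (rot 1); split=> //.
by rewrite addye ?gt0_muley ?leey ?lte_fin// -ltNye; apply: lt_le_trans V0.
Qed.
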